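(* Let $\hat{\mathcal F}$ be a germ of (formal) singular foliation at a point $p$ of a complex surface and let $\hat F$ be a balanced equation of separatrices of $\hat{\mathcal F}$ at $p$. Then $\hat{\mathcal F}$ is a generalized curve foliation if and only if $$\Delta_p(\hat{\mathcal F},(\hat F)_0)=0 .$$
   Context: **Foliations and reduction.** Fix local coordinates so that $p=0\in\mathbb C^2$. A germ of formal foliation $\hat{\mathcal F}$ is defined by a formal $1$-form $\hat\omega=\hat a\,dx+\hat b\,dy$, $\hat a,\hat b\in\mathbb C[[x,y]]$ without common factor. A separatrix is a germ of formal irreducible curve $\{f=0\}$ with $f$ dividing $\hat\omega\wedge df$. If $E$ is a composition of point blow-ups, $E^*\hat{\mathcal F}$ is the strict transform foliation. A singularity is reduced if, in suitable formal coordinates, its linear part is $y\,dx-\lambda x\,dy$ with $\lambda\neq0$, $\lambda\notin\mathbb Q^+$ (non-degenerate), or $x\,dy$ (saddle-node). The minimal reduction of singularities $E:(\mathcal M,\mathcal D)\to(\mathbb C^2,0)$, $\mathcal D=E^{-1}(0)$, is the minimal composition of point blow-ups ($E$ is the identity if $0$ is regular or reduced) such that all singularities of $E^*\hat{\mathcal F}$ on $\mathcal D$ are reduced and the strict transforms of all separatrices are smooth, pairwise disjoint, transverse to $\mathcal D$ and avoid the corners of $\mathcal D$. A foliation is a generalized curve if no saddle-node appears among the singularities after its reduction. **Dicritical components and balanced equations.** An irreducible component $D\subset\mathcal D$ is dicritical if it is not invariant by $E^*\hat{\mathcal F}$; $\mathrm{Dic}(\hat{\mathcal F})$ is the set of these.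 The valence $\mathrm v(D)$ is the number of other components of $\mathcal D$ meeting $D$. $\mathrm{Curv}(D)$ is the set of separatrices whose strict transform meets the dicritical component $D$; separatrices in no $\mathrm{Curv}(D)$ are called isolated, and form the set $\mathcal I(\hat{\mathcal F})$. A balanced equation of separatrices is a formal meromorphic function $\hat F$ with divisor $$(\hat F)_0-(\hat F)_\infty=\sum_{C\in\mathcal I(\hat{\mathcal F})}(C)+\sum_{D\in\mathrm{Dic}(\hat{\mathcal F})}\ \sum_{C\in\mathrm{Curv}(D)}a_{D,C}\,(C),$$ where $a_{D,C}\in\mathbb Z$ vanish for all but finitely many $C\in \mathrm{Curv}(D)$ and $\sum_{C\in\mathrm{Curv}(D)}a_{D,C}=2-\mathrm v(D)$ for each dicritical $D$. **Polar excess.** For a formal meromorphic $1$-form $\eta=(P\,dx+Q\,dy)/H$ and an irreducible $\eta$-invariant formal curve $B\not\subset (H)_0$ with Puiseux parametrization $\gamma(t)$, the polar intersection number is $(\mathcal P^{\eta},B)_p=\mathrm{ord}_{t=0}\big(\tfrac{aP+bQ}{H}\circ\gamma\big)$ for generic $(a:b)\in\mathbb P^1_{\mathbb C}$; put $(\mathcal P^{\hat{\mathcal F}},B)_p=(\mathcal P^{\hat\omega},B)_p$. If $C=\bigcup_i C_i\subset(\hat F)_0$ is a union of irreducible components, each a simple zero of $\hat F$, the polar excess index is $$\Delta_p(\hat{\mathcal F},C)=\sum_i\big((\mathcal P^{\hat{\mathcal F}},C_i)_p-(\mathcal P^{d\hat F},C_i)_p\big),$$ with $d\hat F$ regarded as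 a formal meromorphic $1$-form. In the claim, the zeros of $\hat F$ are simple, so that $\Delta_p(\hat{\mathcal F},(\hat F)_0)$ is defined. *)

(* Defs.v *)
From HB Require Import structures.
From mathcomp Require Import all_boot all_order all_algebra finmap.
From mathcomp Require Import boolp classical_sets functions cardinality fsbigop.
From mathcomp Require Import reals complex.
Set Implicit Arguments.
Unset Strict Implicit.
Unset Printing Implicit Defensive.
Import GRing.Theory Num.Theory.
Local Open Scope classical_set_scope.
Local Open Scope ring_scope.

Record fps (A : Type) := Fps { fps_coef :> nat -> A }.

HB.instance Definition _ (A : Type) := gen_eqMixin (fps A).
HB.instance Definition _ (A : Type) := gen_choiceMixin (fps A).

Lemma fpsP (A : Type) (f g : fps A) : (forall n, f n = g n) -> f = g.
Proof. by case: f g => [f] [g] /= fg; congr Fps; apply: funext. Qed.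

Section FpsRing.
Variable A : comNzRingType.
Implicit Types f g h : fps A.

Definition fps_add f g := Fps (fun n => f n + g n).
Definition fps_opp f := Fps (fun n => - f n).
Definition fpsC (c : A) := Fps (fun n => if n is 0 then c else 0).
Definition fps_mul f g := Fps (fun n => \sum_(i < n.+1) f i * g (n - i)%N).

Lemma fps_addA : associative fps_add.
Proof. by move=> f g h; apply: fpsP => n /=; rewrite addrA. Qed.
Lemma fps_addC : commutative fps_add.
Proof. by move=> f g; apply: fpsP => n /=; rewrite addrC. Qed.
Lemma fps_add0 : left_id (fpsC 0) fps_add.
Proof. by move=> f; apply: fpsP => -[|n] /=; rewrite add0r. Qed.
Lemma fps_addN : left_inverse (fpsC 0) fps_opp fps_add.
Proof. by move=> f; apply: fpsP => -[|n] /=; rewrite addNr. Qed.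

HB.instance Definition _ :=
  GRing.isZmodule.Build (fps A) fps_addA fps_addC fps_add0 fps_addN.

Let tr n f : {poly A} := \poly_(i < n) f i.

Let trM n f g m : (m < n)%N -> fps_mul f g m = (tr n f * tr n g)`_m.
Proof.
move=> mn; rewrite coefM; apply: eq_bigr => i _; rewrite !coef_poly.
by rewrite (leq_ltn_trans _ mn) ?leq_ord// (leq_ltn_trans _ mn) ?leq_subr.
Qed.

Let fps_mulE n f g m (p q : {poly A}) : (m < n)%N ->
  (forall i, (i < n)%N -> f i = p`_i) -> (forall i, (i < n)%N -> g i = q`_i) ->
  fps_mul f g m = (p * q)`_m.
Proof.
move=> mn fp gq; rewrite coefM; apply: eq_bigr => i _.
by rewrite fp ?gq// (leq_ltn_trans _ mn) ?leq_ord ?leq_subr.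
Qed.

Let trE n f i : (i < n)%N -> f i = (tr n f)`_i.
Proof. by move=> lt_in; rewrite coef_poly lt_in. Qed.

Lemma fps_mulA : associative fps_mul.
Proof.
move=> f g h; apply: fpsP => m; pose n := m.+1.
rewrite (@fps_mulE n _ _ _ (tr n f) (tr n g * tr n h))//; first last.
- by move=> i; apply: trM.
- by move=> i; apply: trE.
rewrite (@fps_mulE n _ _ _ (tr n f * tr n g) (tr n h)) ?mulrA//.
- by move=> i; apply: trM.
- by move=> i; apply: trE.
Qed.

Lemma fps_mulC : commutative fps_mul.
Proof. by move=> f g; apply: fpsP => m; rewrite !(@trM m.+1)// mulrC. Qed.

Lemma fps_mul1 : left_id (fpsC 1) fps_mul.
Proof.
move=> f; apply: fpsP => m /=; rewrite big_ord_recl/= mul1r subn0.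
by rewrite big1 ?addr0// => i _; rewrite mul0r.
Qed.

Lemma fps_mulDl : left_distributive fps_mul fps_add.
Proof.
move=> f g h; apply: fpsP => m /=; rewrite -big_split/=.
by apply: eq_bigr => i _; rewrite mulrDl.
Qed.

Lemma fps_1neq0 : fpsC 1 != 0.
Proof.
apply/eqP => /(congr1 (fun f : fps A => f 0%N))/= /eqP.
by rewrite oner_eq0.
Qed.

HB.instance Definition _ := GRing.Zmodule_isComNzRing.Build (fps A)
  fps_mulA fps_mulC fps_mul1 fps_mulDl fps_1neq0.

Definition fpsX : fps A := Fps (fun n => (n == 1)%:R).
Definition fps_deriv f := Fps (fun n => f n.+1 *+ n.+1).

End FpsRing.

Section Divisibility.
Variable A : comNzRingType.
Implicit Types f g h : A.

Definition fdvd f g := exists h, g = f * h.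
Definition is_unit f := exists g, f * g = 1.
Definition irreducible f := [/\ f <> 0, ~ is_unit f &
  forall g h, f = g * h -> is_unit g \/ is_unit h].
Definition no_common_factor f g :=
  forall h, fdvd h f -> fdvd h g -> is_unit h.

(* Meaningful when g <> 0 and f is not a unit: the largest k with f ^ k | g. *)
Definition multiplicity f g : nat :=
  xget 0%N [set k | fdvd (f ^+ k) g /\ ~ fdvd (f ^+ k.+1) g].

End Divisibility.

(* C[[x, y]] is encoded as C[[x]][[y]]: the coefficient of x^i y^j is f j i. *)
Notation fps2 R := (fps (fps R[i])).

Section Foliations.
Variable R : realType.
Local Notation C := R[i].
Local Notation fps2 := (fps2 R).
Implicit Types (f g l : fps2) (c : C).

Definition coef2 f (i j : nat) : C := f j i.
Definition cst2 c : fps2 := fpsC (fpsC c).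
Definition X : fps2 := fpsC (fpsX C).
Definition Y : fps2 := fpsX _.
Definition at0 f : C := coef2 f 0 0.
Definition dx f : fps2 := Fps (fun j => fps_deriv (f j)).
Definition dy f : fps2 := fps_deriv f.
Definition jacobian f g := dx f * dy g - dy f * dx g.

(* Substitutions, for u and v without constant term: then x^i y^j contributes
   only to coefficients of total degree >= i + j, so that the sums are exact. *)
Definition subst f (u v : fps2) : fps2 :=
  Fps (fun n => Fps (fun m =>
    \sum_(i < (m + n).+1) \sum_(j < (m + n).+1)
      coef2 f i j * coef2 (u ^+ i * v ^+ j) m n)).
Definition subst1 f (u v : fps C) : fps C :=
  Fps (fun n => \sum_(i < n.+1) \sum_(j < n.+1)
    coef2 f i j * (u ^+ i * v ^+ j) n).

(* The pair w stands for the form w.1 dx + w.2 dy. *)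
Definition form : Type := (fps2 * fps2)%type.
Implicit Types w : form.

Definition pullback w (u v : fps2) : form :=
  (subst w.1 u v * dx u + subst w.2 u v * dx v,
   subst w.1 u v * dy u + subst w.2 u v * dy v).

Definition singular w := at0 w.1 = 0 /\ at0 w.2 = 0.

(* w /\ df = (w.1 f_y - w.2 f_x) dx /\ dy *)
Definition invariant w f := fdvd f (w.1 * dy f - w.2 * dx f).

Definition same_1jet f g :=
  forall i j, (i + j <= 1)%N -> coef2 f i j = coef2 g i j.

Definition has_linear_part w w0 :=
  exists u v e : fps2,
    [/\ at0 u = 0 /\ at0 v = 0, at0 (jacobian u v) <> 0, is_unit e,
        same_1jet (e * (pullback w u v).1) w0.1 &
        same_1jet (e * (pullback w u v).2) w0.2].

Definition nondegenerate w := exists lam : C,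
  [/\ lam <> 0, forall r : rat, 0 < r -> lam <> ratr r &
      has_linear_part w (Y, - cst2 lam * X)].
Definition saddle_node w := has_linear_part w (0, X).
Definition reduced w := nondegenerate w \/ saddle_node w.

(* A direction (point of P^1): Some c is y = c x, None is x = 0.
   An infinitely near point is the list of the directions leading to it,
   the LAST one first: [::] is the origin, and d :: q is the point of direction
   d on the exceptional divisor of the blow-up of q. *)
Definition direction : Type := option C.
Definition point : Type := seq direction.
Implicit Types (d : direction) (q s : point) (T : set point).

(* Blow-up map in coordinates centered at the point d of the exceptional
   divisor, and local equation of that divisor. *)
Definition blowup d : fps2 * fps2 :=
  if d is Some c then (X, X * (Y + cst2 c)) else (X * Y, Y).
Definition exceptional d : fps2 := if d is Some _ then X else Y.

Definition strict_form1 d w : form :=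
  xget (0, 0) [set w' | exists2 k : nat,
    pullback w (blowup d).1 (blowup d).2
      = (exceptional d ^+ k * w'.1, exceptional d ^+ k * w'.2) &
    ~ (fdvd (exceptional d) w'.1 /\ fdvd (exceptional d) w'.2)].
Definition strict_form w q : form := foldr strict_form1 w q.

Definition strict_eq1 d f : fps2 :=
  xget 0 [set f' | exists2 k : nat,
    subst f (blowup d).1 (blowup d).2 = exceptional d ^+ k * f' &
    ~ fdvd (exceptional d) f'].
Definition strict_eq f q : fps2 := foldr strict_eq1 f q.

(* The component created by the blow-up of s is named s.  In the coordinates at
   an infinitely near point, the components through it are coordinate axes:
   (axes q).1 names the one with equation x = 0 and (axes q).2 the one with
   equation y = 0 (None if the axis is not in the divisor). *)
Fixpoint axes q : option point * option point :=
  match q with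
  | [::] => (None, None)
  | Some c :: s => (Some s, if c == 0 then (axes s).2 else None)
  | None :: s => ((axes s).1, Some s)
  end.

Definition component_eq s q l :=
  ((axes q).1 = Some s /\ l = X) \/ ((axes q).2 = Some s /\ l = Y).
Definition on_component s q := exists l, component_eq s q l.
Definition corner q := (axes q).1 <> None /\ (axes q).2 <> None.

(* A composition of point blow-ups E is given by the set T of the infinitely
   near points that are blown up; final T is the fibre E^-1(0). *)
Definition blowup_tree T :=
  finite_set T /\ forall d s, T (d :: s) -> T s.
Definition final T q := ~ T q /\ (if q is _ :: s then T s else True).

(* A germ of irreducible formal curve {f = 0} is identified with the ideal (f),
   i.e. f is taken up to a unit. *)
Definition curve : Type := set fps2.
Implicit Types B : curve.
Definition curve_of f : curve := [set g | fdvd f g].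
Definition is_curve B := exists2 f, irreducible f & B = curve_of f.
Definition equation B : fps2 :=
  xget 0 [set f | irreducible f /\ B = curve_of f].

Definition separatrix w : set curve :=
  [set B | is_curve B /\ invariant w (equation B)].

Definition passes B q := at0 (strict_eq (equation B) q) = 0.
Definition smooth f := at0 (dx f) <> 0 \/ at0 (dy f) <> 0.
Definition transverse f l := at0 (jacobian f l) <> 0.

Definition resolves w T :=
  [/\ blowup_tree T,
      forall q, final T q -> singular (strict_form w q) ->
        reduced (strict_form w q),
      forall B q, separatrix w B -> final T q -> passes B q ->
        [/\ smooth (strict_eq (equation B) q), ~ corner q &
            forall s l, component_eq s q l ->
              transverse (strict_eq (equation B) q) l] &
      forall B B' q, separatrix w B -> separatrix w B' -> final T q ->
        passes B q -> passes B' q -> B = B'].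

Definition minimal_reduction w T :=
  (~ singular w \/ reduced w -> T = set0) /\
  (~ (~ singular w \/ reduced w) ->
     resolves w T /\ forall T', resolves w T' -> T `<=` T').

Definition generalized_curve w := exists2 T, minimal_reduction w T &
  forall q, final T q -> singular (strict_form w q) ->
    ~ saddle_node (strict_form w q).

Definition invariant_component w T s :=
  forall q l, final T q -> component_eq s q l -> invariant (strict_form w q) l.
Definition dicritical w T : set point :=
  [set s | T s /\ ~ invariant_component w T s].
Definition valence T s : nat :=
  #|` fset_set [set s' | [/\ T s', s' <> s &
       exists q, [/\ final T q, on_component s q & on_component s' q]]] |%fset.
Definition Curv w T s : set curve :=
  [set B | separatrix w B /\
           exists q, [/\ final T q, on_component s q & passes B q]].
Definition isolated w T : set curve :=
  [set B | separatrix w B /\ forall s, dicritical w T s -> ~ Curv w T s B].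

(* The pair F stands for the formal meromorphic function F.1 / F.2, in lowest
   terms (C[[x, y]] is factorial). *)
Definition meromorphic (F : fps2 * fps2) :=
  [/\ F.1 <> 0, F.2 <> 0 & no_common_factor F.1 F.2].
Implicit Types F : (fps2 * fps2)%type.

Definition divisor F B : int :=
  (multiplicity (equation B) F.1)%:Z - (multiplicity (equation B) F.2)%:Z.

Definition balanced_equation w F :=
  meromorphic F /\
  exists2 T, minimal_reduction w T & exists a : point -> curve -> int,
    [/\ forall D, dicritical w T D ->
          finite_set [set B | Curv w T D B /\ a D B <> 0],
        forall D, dicritical w T D ->
          \sum_(B \in Curv w T D) a D B = 2 - (valence T D)%:Z &
        forall B, is_curve B ->
          divisor F B = (B \in isolated w T)%:Z
            + \sum_(D \in dicritical w T) (B \in Curv w T D)%:Z * a D B].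

Definition zeros F : set curve :=
  [set B | is_curve B /\ 0 < divisor F B].
Definition simple_zeros F := forall B, zeros F B -> divisor F B = 1.

Definition has_order (f : fps C) (n : nat) :=
  f n <> 0 /\ forall k, (k < n)%N -> f k = 0.

(* (u, v) = (t^n, v(t)) with v(0) = 0, primitive (not a series in t^d, d > 1),
   or (0, t) for the curve x = 0. *)
Definition puiseux f (u v : fps C) :=
  subst1 f u v = 0 /\
  ((u = 0 /\ v = fpsX C) \/
   exists n : nat,
     [/\ (0 < n)%N, u = fpsX C ^+ n, v 0%N = 0 &
         forall d : nat, (d %| n)%N -> (forall k, v k <> 0 -> (d %| k)%N) ->
           d = 1%N]).

Definition homogeneous d : C * C := if d is Some c then (1, c) else (0, 1).

(* Polar intersection number with B of the meromorphic form w / h. *)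
Definition polar_intersection w h B : int :=
  xget 0 [set m | exists u v : fps C, puiseux (equation B) u v /\
    exists2 S : set direction, finite_set S & forall d, ~ S d ->
      exists k l : nat,
        [/\ has_order (subst1 (cst2 (homogeneous d).1 * w.1
                               + cst2 (homogeneous d).2 * w.2) u v) k,
            has_order (subst1 h u v) l & m = k%:Z - l%:Z]].

Definition polar_excess w F (A : set curve) : int :=
  \sum_(B \in A)
    (polar_intersection w 1 B
     - polar_intersection (F.2 * dx F.1 - F.1 * dx F.2,
                           F.2 * dy F.1 - F.1 * dy F.2) (F.2 ^+ 2) B).

End Foliations.

(* Main.v *)
(* Arcs replace curves: a separatrix is the kernel of the substitution of an arc, and
   polar intersection numbers are orders along arcs.  At an infinitely near point q let
   m be the exponent of the exceptional divisor in the pull-back of the form, nu the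
   multiplicity of F, i the number of invariant components through q and delta = 1 if the
   blow-up of q is dicritical, and put tau(q) = m - nu + 1 - i - delta.  Along a zero B of F
   the difference of the polar numbers drops by h tau(q), up to the intersection with the
   invariant components, where h is the order of the exceptional divisor along B.  On the
   other hand, tau(q) is a sum over the points of the new component of excesses of the
   tangency order of the foliation, and balancedness makes the noncorner final points of a
   dicritical component cancel its valence; the excesses are therefore nonnegative, each is
   bounded by tau at the origin, and at a final singular point it vanishes exactly when the
   component is not tangent to a saddle-node in its weak direction.  It remains to know
   that F has a zero: this is the separatrix theorem of Camacho and Sad, obtained with
   J. Cano's choice, at each blow-up, of a point whose indices are not nonnegative
   rationals (in a suitable sense at corners). *)

Require Import Defs.
From HB Require Import structures.
From mathcomp Require Import all_boot all_order all_algebra finmap.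
From mathcomp Require Import boolp classical_sets functions cardinality fsbigop.
From mathcomp Require Import cyclic separable cyclotomic.
From mathcomp Require Import reals complex.
From mathcomp Require Import ring zify lra.
Set Implicit Arguments.
Unset Strict Implicit.
Unset Printing Implicit Defensive.
Import Order.TTheory GRing.Theory Num.Theory.
Local Open Scope classical_set_scope.
Local Open Scope ring_scope.

(** All sums over a new component come from one fact: a binary form of degree N has N zeros on the
    projective line. It is applied to the initial forms of the curves and to the tangent cone, whose
    degree is one more than the multiplicity of the foliation; in the dicritical case the tangent
    cone is replaced by a form whose degree is one less than that multiplicity. This drop of two is
    the source of the 2 in 2 - v(D). One zero of F controls every point of the tree, even those
    through which no zero passes: its term in the polar excess contains a positive multiple of tau
    at the origin, which bounds all the excesses. This is why the existence of a zero has to be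
    proved. A germ that is already reduced has an empty tree and no component, so it is treated
    apart through its two branches. The polar numbers are defined by Puiseux parametrizations, but
    any primitive arc computes them, so parametrizations can be chosen at infinitely near points,
    where the curves are smooth, and pushed down. *)

Section FpsBasics.
Variable A : comNzRingType.
Implicit Types f g : fps A.

(** * Power series in one variable *)

Lemma fps_coefD f g n : (f + g) n = f n + g n. Proof. by []. Qed.
Lemma fps_coefN f n : (- f) n = - f n. Proof. by []. Qed.
Lemma fps_coefB f g n : (f - g) n = f n - g n. Proof. by []. Qed.
Lemma fps_coef0 n : (0 : fps A) n = 0. Proof. by case: n. Qed.
Lemma fps_coef1 n : (1 : fps A) n = (n == 0)%:R. Proof. by case: n. Qed.
Lemma fps_coefM f g n : (f * g) n = \sum_(i < n.+1) f i * g (n - i)%N.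
Proof. by []. Qed.
Lemma fps_coefX n : fpsX A n = (n == 1)%:R. Proof. by []. Qed.

Lemma fps_coef_deriv f n : fps_deriv f n = f n.+1 *+ n.+1.
Proof. by []. Qed.

Lemma fps_coefM0 f g : (f * g) 0 = f 0 * g 0.
Proof. by rewrite fps_coefM big_ord1 subnn. Qed.

Lemma fps_coef_sum (I : Type) (r : seq I) (P : pred I) (F : I -> fps A) n :
  (\sum_(i <- r | P i) F i) n = \sum_(i <- r | P i) F i n.
Proof.
by elim/big_rec2: _ => [|i x y _ <-]; rewrite ?fps_coef0 ?fps_coefD.
Qed.

Fact fpsC_is_additive : additive (@fpsC A).
Proof. by move=> a b; apply: fpsP => -[|n] /=; rewrite ?subr0. Qed.
HB.instance Definition _ :=
  GRing.isZmodMorphism.Build A (fps A) (@fpsC A) fpsC_is_additive.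

Lemma fps_coefCM c f n : (fpsC c * f) n = c * f n.
Proof.
by rewrite fps_coefM big_ord_recl /= subn0 big1 ?addr0// => i _; rewrite mul0r.
Qed.

Fact fpsC_is_multiplicative : multiplicative (@fpsC A).
Proof.
split=> // a b; apply: fpsP => n; rewrite fps_coefCM.
by case: n => //= n; rewrite mulr0.
Qed.
HB.instance Definition _ :=
  GRing.isMonoidMorphism.Build A (fps A) (@fpsC A)
    (fpsC_is_multiplicative.2, fpsC_is_multiplicative.1).

Definition fps_shift f : fps A := Fps (fun n => f n.+1).

Lemma fps_coefXM f n : (fpsX A * f) n = if n is m.+1 then f m else 0.
Proof.
rewrite fps_coefM big_ord_recl/= mul0r add0r.
case: n => [|n]; first by rewrite big_ord0.
rewrite big_ord_recl/= subSS subn0 mul1r big1 ?addr0// => i _.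
by rewrite mul0r.
Qed.

Lemma fps_coefXnM f k n :
  (fpsX A ^+ k * f) n = if (n < k)%N then 0 else f (n - k)%N.
Proof.
elim: k n => [|k IH] n; first by rewrite mul1r subn0.
by rewrite exprS -mulrA fps_coefXM; case: n => // n; rewrite IH subSS.
Qed.

Lemma fps_decomp f : f = fpsC (f 0%N) + fpsX A * fps_shift f.
Proof.
by apply: fpsP => -[|n]; rewrite fps_coefD fps_coefXM /= ?addr0 ?add0r.
Qed.

(** The valuation is at least n; as a predicate it needs no value for the order of the zero
    series. *)
Definition vge n f := forall k, (k < n)%N -> f k = 0.

Lemma vgeP n f : vge n f <-> exists g, f = fpsX A ^+ n * g.
Proof.
split=> [fn|[g ->] k kn]; last by rewrite fps_coefXnM kn.
exists (Fps (fun k => f (k + n)%N)); apply: fpsP => k.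
rewrite fps_coefXnM; case: ltnP => [/fn//|nk] /=.
by rewrite subnK.
Qed.

Lemma vge_le m n f : (m <= n)%N -> vge n f -> vge m f.
Proof. by move=> mn fn k km; apply: fn; apply: leq_trans mn. Qed.

Lemma vge0 f : vge 0 f. Proof. by []. Qed.
Lemma vge_0 n : vge n (0 : fps A). Proof. by move=> k _; rewrite fps_coef0. Qed.
Lemma vge1 f : f 0%N = 0 -> vge 1 f.
Proof. by move=> f0 [|k]. Qed.

Lemma vgeD n f g : vge n f -> vge n g -> vge n (f + g).
Proof. by move=> fn gn k kn; rewrite fps_coefD fn ?gn ?addr0. Qed.
Lemma vgeN n f : vge n f -> vge n (- f).
Proof. by move=> fn k kn; rewrite fps_coefN fn ?oppr0. Qed.
Lemma vgeB n f g : vge n f -> vge n g -> vge n (f - g).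
Proof. by move=> fn gn; apply/vgeD/vgeN. Qed.
Lemma vgeM m n f g : vge m f -> vge n g -> vge (m + n) (f * g).
Proof.
move=> /vgeP[f' ->] /vgeP[g' ->]; apply/vgeP; exists (f' * g').
by rewrite exprD mulrACA.
Qed.
Lemma vgeMl n f g : vge n g -> vge n (f * g).
Proof. by move=> gn; apply: (@vgeM 0 n). Qed.
Lemma vgeMr n f g : vge n f -> vge n (f * g).
Proof. by rewrite mulrC; exact: vgeMl. Qed.
Lemma vge_lead m n f g : vge m f -> vge n g -> (f * g) (m + n)%N = f m * g n.
Proof.
move=> /vgeP[f' ->] /vgeP[g' ->]; rewrite mulrACA -exprD !fps_coefXnM.
by rewrite !ltnn !subnn fps_coefM0.
Qed.

Lemma vge_eq0 f : (forall n, vge n f) -> f = 0.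
Proof. by move=> fn; apply: fpsP => n; rewrite fps_coef0 (fn n.+1). Qed.

Lemma fps_deriv_add f g : fps_deriv (f + g) = fps_deriv f + fps_deriv g.
Proof. by apply: fpsP => n; rewrite /= mulrnDl. Qed.
Lemma fps_deriv_opp f : fps_deriv (- f) = - fps_deriv f.
Proof. by apply: fpsP => n; rewrite /= mulNrn. Qed.
Lemma fps_derivC c : fps_deriv (fpsC c) = 0 :> fps A.
Proof. by apply: fpsP => -[|n]; rewrite /= ?mul0rn ?mulr0n. Qed.
Lemma fps_derivX : fps_deriv (fpsX A) = 1.
Proof. by apply: fpsP => -[|n]; rewrite /= ?mulr1n ?mul0rn. Qed.

Lemma fps_derivXM f : fps_deriv (fpsX A * f) = f + fpsX A * fps_deriv f.
Proof.
apply: fpsP => n; rewrite fps_coefD fps_coef_deriv !fps_coefXM.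
by case: n => [|n]; rewrite ?addr0// fps_coef_deriv -mulrS.
Qed.

Lemma fps_deriv_CM c f : fps_deriv (fpsC c * f) = fpsC c * fps_deriv f.
Proof. by apply: fpsP => n; rewrite fps_coef_deriv !fps_coefCM mulrnAr. Qed.

(** The defect of the Leibniz rule for f is X times its defect for the shifted series, so its order
    exceeds every n. *)
Lemma fps_derivM f g :
  fps_deriv (f * g) = fps_deriv f * g + f * fps_deriv g.
Proof.
apply/subr0_eq/vge_eq0 => n; elim: n f => // n IH f.
rewrite [f]fps_decomp; set c := fpsC _; set f1 := fps_shift f.
rewrite !mulrDl -!mulrA !fps_deriv_add fps_derivC fps_derivXM !fps_deriv_CM.
rewrite (_ : _ - _ = fpsX A * (@fps_deriv A (f1 * g)
                        - (fps_deriv f1 * g + f1 * fps_deriv g) : fps A)).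
  by apply: (@vgeM 1) => //; apply: vge1.
by rewrite fps_derivXM; ring.
Qed.

End FpsBasics.

(** Course-of-values recursion: [G n] tabulates the values at indices below n, and locality of H
    makes the tables agree where they overlap. *)
Lemma strong_rec (T : Type) (t0 : T) (H : nat -> (nat -> T) -> T) :
  (forall n g g', (forall k, (k < n)%N -> g k = g' k) -> H n g = H n g') ->
  exists g, forall n, g n = H n g.
Proof.
move=> Hloc; pose fix G n := if n is m.+1 then
  fun k => if k == m then H m (G m) else G m k else fun=> t0.
have GS n k : (k < n)%N -> G n k = G k.+1 k.
  elim: n => // n IH; rewrite ltnS leq_eqVlt => /orP[/eqP->//|kn].
  by rewrite /= (ltn_eqF kn) IH//= eqxx.
exists (fun n => G n.+1 n) => n; rewrite [LHS]/= eqxx; apply: Hloc => k.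
exact: GS.
Qed.

(** * Solving equations for a series coefficient by coefficient *)

Section Approximation.
Variable A : comUnitRingType.

Definition fps_trunc n (f : fps A) : fps A :=
  Fps (fun k => if (k < n)%N then f k else 0).

(* The coefficient of order n of Phi s determines that of s. *)
Lemma successive_approx (Phi : fps A -> fps A) (N : nat) (s0 : fps A)
    (kappa : nat -> A) :
  (forall n, (N <= n)%N -> kappa n \is a GRing.unit) ->
  (forall n s s', (N <= n)%N -> vge N (s - s0) -> vge n (s - s') ->
     Phi s n - Phi s' n = kappa n * (s n - s' n)) ->
  (forall s, vge N (s - s0) -> vge N (Phi s)) ->
  exists2 s, vge N (s - s0) & Phi s = 0.
Proof.
move=> kU Phik Phi0.
(* The truncation at n has coefficient 0 at n; Newton's correction with slope [kappa n] then
   annihilates the coefficient n of Phi. *)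
have [n g g' gg'|g gE] := @strong_rec A 0 (fun n g =>
   if (n < N)%N then s0 n else - (kappa n)^-1 * Phi (fps_trunc n (Fps g)) n).
  case: ifP => // _; congr (- _ * Phi _ _); apply: fpsP => k /=.
  by case: ifP => // /gg'.
have gN : vge N (Fps g - s0) by move=> k kN; rewrite fps_coefB /= gE kN subrr.
exists (Fps g) => //; apply: fpsP => n; rewrite fps_coef0.
have [nN|Nn] := ltnP n N; first exact: Phi0.
have tr : vge n (Fps g - fps_trunc n (Fps g)).
  by move=> k kn; rewrite fps_coefB /= kn subrr.
have := Phik n (Fps g) (fps_trunc n (Fps g)) Nn gN tr.
rewrite /= ltnn subr0 [X in kappa n * X]gE ltnNge Nn /=.
by rewrite mulrA mulrN mulrV ?kU// mulN1r => /eqP; rewrite subr_eq addrC subrr => /eqP.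
Qed.

Lemma fps_inv_exists (f : fps A) :
  f 0%N \is a GRing.unit -> exists g, f * g = 1.
Proof.
move=> f0; have [//|n s s' _ _ ss'|//|s _ /subr0_eq fs] :=
  @successive_approx (fun g => f * g - 1) 0 0 (fun=> f 0%N); last by exists s.
rewrite -!fps_coefB (_ : _ - _ = f * (s - s')); last by ring.
by rewrite -[n in LHS]add0n vge_lead.
Qed.

End Approximation.

(** * Units, integrality and the order of a series *)

Section FpsUnit.
Variable A : comUnitRingType.
Implicit Types f g : fps A.

Definition fps_unit : pred (fps A) := fun f => f 0%N \is a GRing.unit.
Definition fps_inv f : fps A :=
  if fps_unit f then xget 0 [set g | g * f = 1] else f.

Fact fps_mulVx : {in fps_unit, left_inverse 1 fps_inv *%R}.
Proof.
move=> f fu; rewrite /fps_inv (fu : fps_unit f) /=.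
case: xgetP => [g _ //|ng]; have [g fg] := fps_inv_exists fu.
by case: (ng g); rewrite /= mulrC.
Qed.
Fact fps_unitPl : forall f g, g * f = 1 -> fps_unit f.
Proof.
move=> f g /(congr1 (fun h : fps A => h 0%N)); rewrite fps_coefM0 /= => gf.
by apply/unitrPr; exists (g 0%N); rewrite mulrC.
Qed.
Fact fps_invr_out : {in [predC fps_unit], fps_inv =1 id}.
Proof. by move=> f; rewrite inE => /negPf fu; rewrite /fps_inv (fu : fps_unit f = false). Qed.

HB.instance Definition _ := GRing.ComNzRing_hasMulInverse.Build (fps A)
  fps_mulVx fps_unitPl fps_invr_out.

Lemma fps_unitE f : (f \is a GRing.unit) = (f 0%N \is a GRing.unit).
Proof. by []. Qed.

End FpsUnit.

Section FpsDomain.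
Variable A : idomainType.
Implicit Types f g : fps A.

Lemma fps_neq0 f : f != 0 -> exists2 n, vge n f & f n != 0.
Proof.
move=> f0; have exn : exists n, f n != 0.
  apply: contrapT => nf; case/eqP: f0; apply: fpsP => n; rewrite fps_coef0.
  by apply/eqP; apply: contrapT => /negP fn; apply: nf; exists n.
case: (ex_minnP exn) => m fm mmin; exists m => // k; apply: contraTeq => fk.
by rewrite -leqNgt mmin.
Qed.

Fact fps_mulf_eq0 : GRing.integral_domain_axiom (fps A).
Proof.
move=> f g fg; apply: contrapT => /negP.
rewrite negb_or => /andP[/fps_neq0[m fm f0] /fps_neq0[n gn g0]].
have := vge_lead fm gn; rewrite fg fps_coef0 => /esym/eqP.
by rewrite mulf_eq0 (negPf f0) (negPf g0).
Qed.
HB.instance Definition _ :=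
  GRing.ComUnitRing_isIntegral.Build (fps A) fps_mulf_eq0.

Lemma fpsX_neq0 : fpsX A != 0.
Proof.
by apply/eqP => /(congr1 (fun h : fps A => h 1%N))/eqP; rewrite /= oner_eq0.
Qed.

(** The zero series gets the default value 0, so statements on orders ask for nonzero series. *)
Definition ord f : nat := xget 0%N [set n | vge n f /\ f n <> 0].

Lemma ordP f : f != 0 -> vge (ord f) f /\ f (ord f) != 0.
Proof.
move=> /fps_neq0[n fn f0]; rewrite /ord; case: xgetP => [m _ [fm /eqP]//|].
by move=> /(_ n) []; split=> //; apply/eqP.
Qed.

Lemma neq0_coef f n : f n != 0 -> f != 0.
Proof. by apply: contra_neq => ->; exact: (@fps_coef0 A). Qed.

Lemma ord_eq f n : vge n f -> f n != 0 -> ord f = n.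
Proof.
move=> fn f0; have /ordP[fm fm0] := neq0_coef f0.
case: (ltngtP (ord f) n) => // lt.
  by move: fm0; rewrite (fn _ lt) eqxx.
by move: f0; rewrite (fm _ lt) eqxx.
Qed.

Lemma ordM f g : f != 0 -> g != 0 -> ord (f * g) = (ord f + ord g)%N.
Proof.
move=> /ordP[fm f0] /ordP[gn g0]; apply: ord_eq; first exact: vgeM.
by rewrite vge_lead// mulf_neq0.
Qed.

Lemma ord_unit f : f 0%N != 0 -> ord f = 0%N.
Proof. by move=> f0; apply: ord_eq. Qed.

Lemma ord_one : ord 1 = 0%N. Proof. by apply: ord_unit; exact: oner_neq0. Qed.

Lemma ord_eq0 f : f != 0 -> (ord f == 0)%N = (f 0%N != 0).
Proof.
move=> f0; apply/eqP/idP => [o|/ord_unit//].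
by have := (ordP f0).2; rewrite o.
Qed.

Lemma ord_gt0 f : f != 0 -> (0 < ord f)%N = (f 0%N == 0).
Proof. by move=> f0; rewrite lt0n ord_eq0// negbK. Qed.

Lemma ordX n f : f != 0 -> ord (f ^+ n) = (n * ord f)%N.
Proof.
move=> f0; elim: n => [|n IH]; first by rewrite expr0 ord_one.
by rewrite exprS ordM ?expf_neq0// IH mulSn.
Qed.

Lemma ord_fpsX : ord (fpsX A) = 1%N.
Proof. by apply: ord_eq; [move=> [] | exact: oner_neq0]. Qed.

End FpsDomain.


(** * Series in two variables *)

Section Coef2.
Variable R : realType.
Local Notation C := R[i].
Local Notation fps2 := (fps2 R).
Implicit Types (f g h : fps2) (c : C).

Lemma fps2P f g : (forall i j, coef2 f i j = coef2 g i j) -> f = g.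
Proof. by move=> fg; apply: fpsP => j; apply: fpsP => i; apply: fg. Qed.

Lemma coef2D f g i j : coef2 (f + g) i j = coef2 f i j + coef2 g i j.
Proof. by []. Qed.
Lemma coef2_0 i j : coef2 (0 : fps2) i j = 0.
Proof. by rewrite /coef2 !fps_coef0. Qed.
Lemma coef2_cst c i j : coef2 (cst2 c) i j = if (i + j == 0)%N then c else 0.
Proof. by case: j i => [|j] [|i]; rewrite /coef2 //= ?fps_coef0 ?addnS. Qed.

Lemma cst2_is_additive : additive (@cst2 R).
Proof. by move=> a b; rewrite /cst2 !raddfB. Qed.
Lemma cst2_is_multiplicative : multiplicative (@cst2 R).
Proof. by split=> [a b|]; rewrite /cst2 ?rmorphM ?rmorph1. Qed.
HB.instance Definition _ :=
  GRing.isZmodMorphism.Build C fps2 (@cst2 R) cst2_is_additive.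
HB.instance Definition _ :=
  GRing.isMonoidMorphism.Build C fps2 (@cst2 R)
    (cst2_is_multiplicative.2, cst2_is_multiplicative.1).

Lemma coef2_cstM c f i j : coef2 (cst2 c * f) i j = c * coef2 f i j.
Proof. by rewrite /coef2 !fps_coefCM. Qed.

Lemma coef2_XM f i j :
  coef2 (X R * f) i j = if i is k.+1 then coef2 f k j else 0.
Proof. by rewrite /coef2 fps_coefCM fps_coefXM. Qed.

Lemma coef2_YM f i j :
  coef2 (Y R * f) i j = if j is k.+1 then coef2 f i k else 0.
Proof. by rewrite /coef2 fps_coefXM; case: j => //; rewrite fps_coef0. Qed.

Lemma coef2_X i j : coef2 (X R) i j = ((i == 1%N) && (j == 0%N))%:R.
Proof.
rewrite -[X R]mulr1 coef2_XM -(rmorph1 (@cst2 R)).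
by case: i => [|i] //; rewrite coef2_cst eqSS; case: i j => [|i] [|j].
Qed.
Lemma coef2_Y i j : coef2 (Y R) i j = ((i == 0%N) && (j == 1%N))%:R.
Proof.
rewrite -[Y R]mulr1 coef2_YM -(rmorph1 (@cst2 R)).
by case: j => [|j]; rewrite ?andbF // coef2_cst eqSS; case: i j => [|i] [|j].
Qed.

Lemma coef2M f g i j : coef2 (f * g) i j =
  \sum_(b < j.+1) \sum_(a < i.+1) coef2 f a b * coef2 g (i - a) (j - b).
Proof.
by rewrite /coef2 fps_coefM fps_coef_sum; apply: eq_bigr => b _; rewrite fps_coefM.
Qed.

Lemma at0M f g : at0 (f * g) = at0 f * at0 g.
Proof. by rewrite /at0 coef2M !big_ord1. Qed.
Lemma at0D f g : at0 (f + g) = at0 f + at0 g. Proof. by []. Qed.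
Lemma at0N f : at0 (- f) = - at0 f. Proof. by []. Qed.
Lemma at0_cst c : at0 (cst2 c) = c. Proof. by rewrite /at0 coef2_cst. Qed.
Lemma at0_X : at0 (X R) = 0. Proof. by []. Qed.
Lemma at0_Y : at0 (Y R) = 0. Proof. by []. Qed.
Lemma at0_1 : at0 (1 : fps2) = 1. Proof. by rewrite -(rmorph1 (@cst2 R)) at0_cst. Qed.
Lemma at0_0 : at0 (0 : fps2) = 0. Proof. by rewrite /at0 coef2_0. Qed.

(** In f = f(0) + x [fx] + y [fy] every monomial divisible by x goes to [fx], so [fy] is a series in
    y alone. Identities about substitutions are proved by unfolding this splitting. *)
Definition fx f : fps2 := Fps (fun j => fps_shift (f j)).
Definition fy f : fps2 := Fps (fun j => fpsC (f j.+1 0%N)).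

Lemma coef2_fx f i j : coef2 (fx f) i j = coef2 f i.+1 j. Proof. by []. Qed.
Lemma coef2_fy f i j :
  coef2 (fy f) i j = if i is 0 then coef2 f 0 j.+1 else 0.
Proof. by []. Qed.

Lemma fps2_decomp f : f = cst2 (at0 f) + X R * fx f + Y R * fy f.
Proof.
apply: fps2P => i j; rewrite !coef2D coef2_XM coef2_YM coef2_cst.
by case: i => [|i]; case: j => [|j]; rewrite /= ?coef2_fx ?coef2_fy ?addr0 ?add0r.
Qed.

Definition ordge n f := forall i j, (i + j < n)%N -> coef2 f i j = 0.

Lemma ordge1 f : at0 f = 0 -> ordge 1 f.
Proof. by move=> f0 [|i] [|j]; rewrite ?addnS. Qed.
Lemma ordgeM m n f g : ordge m f -> ordge n g -> ordge (m + n) (f * g).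
Proof.
move=> fm gn i j ij; rewrite coef2M big1// => b _; rewrite big1// => a _.
have [lt|le] := ltnP (a + b) m; first by rewrite fm ?mul0r.
by rewrite gn ?mulr0//; have := ltn_ord a; have := ltn_ord b; lia.
Qed.
Lemma ordge_eq0 f : (forall n, ordge n f) -> f = 0.
Proof. by move=> fn; apply: fps2P => i j; rewrite coef2_0 (fn (i + j).+1). Qed.

Lemma dxD f g : dx (f + g) = dx f + dx g.
Proof. by apply: fpsP => j; rewrite /= fps_deriv_add. Qed.
Lemma dxM f g : dx (f * g) = dx f * g + f * dx g.
Proof.
apply: fpsP => j; rewrite fps_coefD !fps_coefM /= -big_split/= -fps_coefM.
rewrite fps_coefM (big_morph _ (@fps_deriv_add _) (id1 := 0)); last first.
  by rewrite -(raddf0 (@fpsC C)) fps_derivC.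
by apply: eq_bigr => i _; rewrite fps_derivM.
Qed.
Lemma dyD f g : dy (f + g) = dy f + dy g. Proof. exact: fps_deriv_add. Qed.
Lemma dyM f g : dy (f * g) = dy f * g + f * dy g. Proof. exact: fps_derivM. Qed.
Lemma dx_cst c : dx (cst2 c) = 0.
Proof.
by apply: fpsP => -[|j] /=; rewrite ?fps_coef0 ?fps_derivC.
Qed.
Lemma dy_cst c : dy (cst2 c) = 0. Proof. exact: fps_derivC. Qed.
Lemma dx_X : dx (X R) = 1.
Proof.
by apply: fpsP => -[|j] /=; rewrite ?fps_derivX// ?fps_derivC.
Qed.
Lemma dy_X : dy (X R) = 0. Proof. exact: fps_derivC. Qed.
Lemma dx_Y : dx (Y R) = 0.
Proof.
by apply: fpsP => -[|[|j]]; exact: fps_derivC.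
Qed.
Lemma dy_Y : dy (Y R) = 1. Proof. exact: fps_derivX. Qed.
Lemma dyN f : dy (- f) = - dy f. Proof. exact: fps_deriv_opp. Qed.
Lemma dyB f g : dy (f - g) = dy f - dy g. Proof. by rewrite dyD dyN. Qed.
Lemma dx_lin c g h : dx (cst2 c + X R * g + Y R * h) = g + X R * dx g + Y R * dx h.
Proof. by rewrite dxD dxD dx_cst (dxM (X R)) (dxM (Y R)) dx_X dx_Y; ring. Qed.
Lemma dy_lin c g h : dy (cst2 c + X R * g + Y R * h) = h + X R * dy g + Y R * dy h.
Proof. by rewrite dyD dyD dy_cst (dyM (X R)) (dyM (Y R)) dy_X dy_Y; ring. Qed.
Lemma at0_dx f : at0 (dx f) = coef2 f 1 0. Proof. by []. Qed.
Lemma at0_dy f : at0 (dy f) = coef2 f 0 1. Proof. by []. Qed.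

End Coef2.

#[global] Opaque fps_add fps_opp fps_mul fps_deriv X Y cst2 dx dy fx fy.

(** * Substitution of series without constant term, into C[[t]] and C[[x, y]] at once *)

Section FormalSubst.
Variables (R : realType) (S : comNzRingType) (I : Type) (deg : I -> nat).
Local Notation C := R[i].
Local Notation fps2 := (fps2 R).
Variables (K : I -> S -> C) (cS : {rmorphism C -> S}).
Let vS n s := forall k, (deg k < n)%N -> K k s = 0.
Hypothesis KD : forall k s t, K k (s + t) = K k s + K k t.
Hypothesis Kc : forall k c s, K k (cS c * s) = c * K k s.
Hypothesis K_inj : forall s, (forall k, K k s = 0) -> s = 0.
Hypothesis vSM : forall m n s t, vS m s -> vS n t -> vS (m + n) (s * t).
Variables (u v : S).
Hypotheses (vu : vS 1 u) (vv : vS 1 v).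

Let K0 k : K k 0 = 0.
Proof. by apply: (addrI (K k 0)); rewrite -KD !addr0. Qed.
Let KB k s t : K k (s - t) = K k s - K k t.
Proof. by apply: (addIr (K k t)); rewrite -KD !subrK. Qed.
Let K_sum k (J : Type) (r : seq J) (F : J -> S) :
  K k (\sum_(i <- r) F i) = \sum_(i <- r) K k (F i).
Proof. exact: (big_morph _ (KD k) (K0 k)). Qed.
Let vSD n s t : vS n s -> vS n t -> vS n (s + t).
Proof. by move=> sn tn k kn; rewrite KD sn ?tn ?addr0. Qed.
Let vSX n s : vS 1 s -> vS n (s ^+ n).
Proof. by move=> s1; elim: n => // n IH; rewrite exprS -add1n; apply: vSM. Qed.
Let vS_uv i j : vS (i + j) (u ^+ i * v ^+ j).
Proof. by apply: vSM; apply: vSX. Qed.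

(** Each unfolding gains one order, because u and v have order at least one, so E f has infinite
    order. Applied to the difference of two maps that unfold f in the same way. *)
Lemma subst_unique (E : fps2 -> S) :
  (forall f, E f = u * E (fx f) + v * E (fy f)) -> forall f, E f = 0.
Proof.
move=> Efe f; apply: K_inj => k.
suff: vS (deg k).+1 (E f) by apply.
elim: _.+1 f => // n IH f; rewrite Efe -add1n.
by apply: vSD; apply: vSM.
Qed.

Variable phi : fps2 -> S.
Hypothesis phiE : forall k f, K k (phi f) =
  \sum_(i < (deg k).+1) \sum_(j < (deg k).+1) coef2 f i j * K k (u ^+ i * v ^+ j).

Lemma phiD f g : phi (f + g) = phi f + phi g.
Proof.
apply/subr0_eq/K_inj => k; rewrite KB KD !phiE -big_split/= -sumrB big1// => i _.
by rewrite -big_split -sumrB big1// => j _; rewrite /= coef2D mulrDl subrr.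
Qed.

Lemma phi_cst c f : phi (cst2 c * f) = cS c * phi f.
Proof.
apply/subr0_eq/K_inj => k; rewrite KB Kc !phiE mulr_sumr -sumrB big1// => i _.
by rewrite mulr_sumr -sumrB big1// => j _; rewrite /= coef2_cstM mulrA subrr.
Qed.

(** Up to degree N a substitution is a finite sum, in which multiplication by u or v can be computed
    termwise. *)
Let approx N f : vS N.+1 (phi f -
  \sum_(i < N.+1) \sum_(j < N.+1) cS (coef2 f i j) * (u ^+ i * v ^+ j)).
Proof.
move=> k kN; rewrite KB K_sum phiE; apply/eqP; rewrite subr_eq0; apply/eqP.
(* The sum in [phiE] stops at the degree of k; the additional terms up to N vanish, as u^i v^j has
   order at least i + j. *)
have ext (F : nat -> C) : (forall i, (deg k < i)%N -> F i = 0) ->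
    \sum_(i < (deg k).+1) F i = \sum_(i < N.+1) F i.
  move=> F0; rewrite (big_ord_widen _ F kN) big_mkcond; apply: eq_bigr => i _.
  by case: ltnP => // /F0.
have := ext (fun i => \sum_(j < (deg k).+1) coef2 f i j * K k (u ^+ i * v ^+ j)).
move=> /= -> => [|i ki]; last first.
  by rewrite big1// => j _; rewrite (vS_uv (i := i)) ?mulr0//; lia.
apply: eq_bigr => i _; rewrite K_sum.
have := ext (fun j => coef2 f i j * K k (u ^+ i * v ^+ j)).
move=> /= -> => [|j kj]; first by apply: eq_bigr => j _; rewrite Kc.
by rewrite (vS_uv (i := i)) ?mulr0//; lia.
Qed.

Lemma phi_X f : phi (X R * f) = u * phi f.
Proof.
apply/subr0_eq/K_inj => k; rewrite KB; set N := deg k.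
set A := \sum_(i < N.+1) \sum_(j < N.+1) cS (coef2 f i j) * (u ^+ i * v ^+ j).
have -> : K k (u * phi f) = K k (u * A).
  apply/eqP; rewrite -subr_eq0 -KB -mulrBr; apply/eqP.
  by have := vSM vu (@approx N f); apply; rewrite -/N; lia.
rewrite phiE -/N big_ord_recl big1 ?add0r => [|j _]; last by rewrite coef2_XM mul0r.
rewrite /A mulr_sumr K_sum big_ord_recr/= [X in _ - (_ + X)](_ : _ = 0) ?addr0.
  rewrite -sumrB big1// => i _; rewrite mulr_sumr K_sum -sumrB big1// => j _.
  by rewrite coef2_XM /= mulrCA Kc exprS !mulrA subrr.
rewrite mulr_sumr K_sum big1// => j _.
by rewrite mulrCA Kc mulrA -exprS (vS_uv (i := N.+1)) ?mulr0// -/N; lia.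
Qed.

Lemma phi_Y f : phi (Y R * f) = v * phi f.
Proof.
apply/subr0_eq/K_inj => k; rewrite KB; set N := deg k.
set A := \sum_(i < N.+1) \sum_(j < N.+1) cS (coef2 f i j) * (u ^+ i * v ^+ j).
have -> : K k (v * phi f) = K k (v * A).
  apply/eqP; rewrite -subr_eq0 -KB -mulrBr; apply/eqP.
  by have := vSM vv (@approx N f); apply; rewrite -/N; lia.
rewrite phiE -/N /A mulr_sumr K_sum -sumrB big1// => i _.
rewrite big_ord_recl coef2_YM mul0r add0r.
rewrite mulr_sumr K_sum big_ord_recr/= [X in _ - (_ + X)](_ : _ = 0) ?addr0.
  rewrite -sumrB big1// => j _.
  by rewrite coef2_YM /= mulrCA Kc (mulrCA v) -exprS subrr.
by rewrite mulrCA Kc (mulrCA v) -exprS (vS_uv (i := i) (j := N.+1)) ?mulr0// -/N; lia.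
Qed.

Lemma phi_1 : phi 1 = 1.
Proof.
apply/subr0_eq/K_inj => k; rewrite KB phiE big_ord_recl big_ord_recl.
rewrite !expr0 mulr1 big1 => [|j _]; last first.
  by rewrite -(rmorph1 (@cst2 R)) coef2_cst mul0r.
rewrite big1 => [|i _]; last first.
  by rewrite big1// => j _; rewrite -(rmorph1 (@cst2 R)) coef2_cst mul0r.
by rewrite -(rmorph1 (@cst2 R)) coef2_cst mul1r !addr0 subrr.
Qed.

Lemma phi_lin c f g h :
  phi (cst2 c * f + X R * g + Y R * h) = cS c * phi f + u * phi g + v * phi h.
Proof. by rewrite phiD phiD (phi_cst c f) (phi_X g) (phi_Y h). Qed.

Lemma phi_decomp f : phi f = cS (at0 f) + u * phi (fx f) + v * phi (fy f).
Proof. by rewrite {1}(fps2_decomp f) -[cst2 _]mulr1 phi_lin phi_1 mulr1. Qed.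

(** The defect of multiplicativity, as a map of f with g fixed, satisfies the equation of
    [subst_unique]. *)
Lemma phiM f g : phi (f * g) = phi f * phi g.
Proof.
apply/subr0_eq.
have := @subst_unique (fun f => phi (f * g) - phi f * phi g); apply => {}f.
rewrite {1}(fps2_decomp f) [phi f]phi_decomp !mulrDl -!mulrA phi_lin.
move: (phi (fx f * g)) (phi (fy f * g)) (phi (fx f)) (phi (fy f)) (phi g) (cS _).
by move=> a b a' b' c d; ring.
Qed.

End FormalSubst.


(** * Arcs, charts and pull-backs *)

Section Arcs.
Variable R : realType.
Local Notation C := R[i].
Local Notation fps2 := (fps2 R).
Implicit Types (f g h : fps2) (c : C).

(** The conditions are boolean, so that an arc is determined by its two series. *)
Record parc := Arc {
  ax : fps C; ay : fps C; ax0 : ax 0%N == 0; ay0 : ay 0%N == 0 }.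
Implicit Types gam del : parc.

Record chart := Chart {
  cu : fps2; cv : fps2; cu0 : at0 cu == 0; cv0 : at0 cv == 0 }.
Implicit Types psi : chart.

Lemma parcP gam del : ax gam = ax del -> ay gam = ay del -> gam = del.
Proof.
case: gam del => [a b a0 b0] [a' b' a0' b0'] /= ea eb.
by subst a' b'; rewrite (bool_irrelevance a0 a0') (bool_irrelevance b0 b0').
Qed.

Definition pb gam f : fps C := subst1 f (ax gam) (ay gam).
Definition sb psi f : fps2 := subst f (cu psi) (cv psi).

Section PB.
Variable gam : parc.
Let KD k (s t : fps C) : (s + t) k = s k + t k. Proof. by []. Qed.
Let Kc k c (s : fps C) : (fpsC c * s) k = c * s k.
Proof. exact: fps_coefCM. Qed.
Let K_inj (s : fps C) : (forall k, s k = 0) -> s = 0.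
Proof. by move=> s0; apply: fpsP => k; rewrite s0 fps_coef0. Qed.
Let vu : vge 1 (ax gam). Proof. exact/vge1/eqP/ax0. Qed.
Let vv : vge 1 (ay gam). Proof. exact/vge1/eqP/ay0. Qed.
Let pbE k f : pb gam f k = \sum_(i < k.+1) \sum_(j < k.+1)
    coef2 f i j * (ax gam ^+ i * ay gam ^+ j) k.
Proof. by []. Qed.

Let phD := phiD KD K_inj pbE.
Let phM := phiM KD Kc K_inj (@vgeM C) vu vv pbE.
Let ph1 := phi_1 KD K_inj pbE.

Fact pb_is_additive : additive (pb gam).
Proof.
move=> f g; apply/eqP; rewrite -(inj_eq (addIr (pb gam g))) -phD.
by rewrite !subrK.
Qed.
Fact pb_is_multiplicative : multiplicative (pb gam).
Proof. by split; [exact: phM | exact: ph1]. Qed.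
HB.instance Definition _ :=
  GRing.isZmodMorphism.Build fps2 (fps C) (pb gam) pb_is_additive.
HB.instance Definition _ :=
  GRing.isMonoidMorphism.Build fps2 (fps C) (pb gam)
    (pb_is_multiplicative.2, pb_is_multiplicative.1).

Lemma pb_X : pb gam (X R) = ax gam.
Proof.
by rewrite -[X R]mulr1 (phi_X KD Kc K_inj (@vgeM C) vu vv pbE) rmorph1 mulr1.
Qed.
Lemma pb_Y : pb gam (Y R) = ay gam.
Proof.
by rewrite -[Y R]mulr1 (phi_Y KD Kc K_inj (@vgeM C) vu vv pbE) rmorph1 mulr1.
Qed.
Lemma pb_cst c : pb gam (cst2 c) = fpsC c.
Proof.
by rewrite -[cst2 _]mulr1 (phi_cst KD Kc K_inj pbE) rmorph1 mulr1.
Qed.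
Lemma pbM f g : pb gam (f * g) = pb gam f * pb gam g.
Proof. exact: rmorphM. Qed.
Lemma pbD f g : pb gam (f + g) = pb gam f + pb gam g.
Proof. exact: rmorphD. Qed.
Lemma pbB f g : pb gam (f - g) = pb gam f - pb gam g.
Proof. exact: rmorphB. Qed.
Lemma pbX f n : pb gam (f ^+ n) = pb gam f ^+ n.
Proof. exact: rmorphXn. Qed.
Lemma pb_lin f g h : pb gam (f + X R * g + Y R * h)
  = pb gam f + ax gam * pb gam g + ay gam * pb gam h.
Proof. by rewrite !rmorphD !rmorphM /= pb_X pb_Y. Qed.
Lemma pb_decomp f :
  pb gam f = fpsC (at0 f) + ax gam * pb gam (fx f) + ay gam * pb gam (fy f).
Proof. by rewrite {1}[f]fps2_decomp !rmorphD !rmorphM /= pb_X pb_Y pb_cst. Qed.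
Lemma pb_unique (E : fps2 -> fps C) :
  (forall f, E f = ax gam * E (fx f) + ay gam * E (fy f)) -> forall f, E f = 0.
Proof. by move=> Efe; apply: (subst_unique KD K_inj (@vgeM C) vu vv). Qed.

End PB.

Section SB.
Variable psi : chart.
Let deg (k : nat * nat) := (k.1 + k.2)%N.
Let K (k : nat * nat) f := coef2 f k.1 k.2.
Let KD k f g : K k (f + g) = K k f + K k g. Proof. by []. Qed.
Let Kc k c f : K k (cst2 c * f) = c * K k f. Proof. exact: coef2_cstM. Qed.
Let K_inj f : (forall k, K k f = 0) -> f = 0.
Proof. by move=> f0; apply: fps2P => i j; rewrite coef2_0; exact: (f0 (i, j)). Qed.
Let vM m n f g : (forall k, (deg k < m)%N -> K k f = 0) ->
  (forall k, (deg k < n)%N -> K k g = 0) ->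
  (forall k, (deg k < m + n)%N -> K k (f * g) = 0).
Proof.
move=> fm gn [i j]; apply: ordgeM => {i j} i j; [exact: (fm (i, j))|exact: (gn (i, j))].
Qed.
Let vu k : (deg k < 1)%N -> K k (cu psi) = 0.
Proof. by case: k => i j; apply: ordge1; apply/eqP/cu0. Qed.
Let vv k : (deg k < 1)%N -> K k (cv psi) = 0.
Proof. by case: k => i j; apply: ordge1; apply/eqP/cv0. Qed.
Let sbE k f : K k (sb psi f) = \sum_(i < (deg k).+1) \sum_(j < (deg k).+1)
    coef2 f i j * K k (cu psi ^+ i * cv psi ^+ j).
Proof. by []. Qed.

Fact sb_is_additive : additive (sb psi).
Proof.
move=> f g; apply/eqP; rewrite -(inj_eq (addIr (sb psi g))).
by rewrite -(phiD KD K_inj sbE) !subrK.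
Qed.
Fact sb_is_multiplicative : multiplicative (sb psi).
Proof.
split; [exact: (phiM KD Kc K_inj vM vu vv sbE) | exact: (phi_1 KD K_inj sbE)].
Qed.
HB.instance Definition _ :=
  GRing.isZmodMorphism.Build fps2 fps2 (sb psi) sb_is_additive.
HB.instance Definition _ :=
  GRing.isMonoidMorphism.Build fps2 fps2 (sb psi)
    (sb_is_multiplicative.2, sb_is_multiplicative.1).

Lemma sb_X : sb psi (X R) = cu psi.
Proof. by rewrite -[X R]mulr1 (phi_X KD Kc K_inj vM vu vv sbE) rmorph1 mulr1. Qed.
Lemma sb_Y : sb psi (Y R) = cv psi.
Proof. by rewrite -[Y R]mulr1 (phi_Y KD Kc K_inj vM vu vv sbE) rmorph1 mulr1. Qed.
Lemma sb_cst c : sb psi (cst2 c) = cst2 c.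
Proof. by rewrite -[cst2 _]mulr1 (phi_cst KD Kc K_inj sbE) rmorph1. Qed.
Lemma sb_decomp f :
  sb psi f = cst2 (at0 f) + cu psi * sb psi (fx f) + cv psi * sb psi (fy f).
Proof. by rewrite {1}[f]fps2_decomp !rmorphD !rmorphM /= sb_X sb_Y sb_cst. Qed.
Lemma sb_unique (E : fps2 -> fps2) :
  (forall f, E f = cu psi * E (fx f) + cv psi * E (fy f)) -> forall f, E f = 0.
Proof. by move=> Efe; apply: (subst_unique KD K_inj vM vu vv). Qed.

Lemma sb_lin f g h :
  sb psi (f + X R * g + Y R * h) = sb psi f + cu psi * sb psi g + cv psi * sb psi h.
Proof. by rewrite !rmorphD !rmorphM /= sb_X sb_Y. Qed.

Lemma sb_dx f : dx (sb psi f) = sb psi (dx f) * dx (cu psi) + sb psi (dy f) * dx (cv psi).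
Proof.
apply/subr0_eq; move: f; apply: sb_unique => f.
move: (fps2_decomp f); move: (at0 f) (fx f) (fy f) => c g h ->.
rewrite dx_lin dy_lin !sb_lin sb_cst dxD dxD dx_cst.
rewrite (dxM (cu psi)) (dxM (cv psi)).
move: (sb psi _) (sb psi _) (sb psi _) (sb psi _) (sb psi _) (sb psi _).
move=> a1 a2 a3 a4 a5 a6; move: (dx a6) (dx a5) (dx (cu psi)) (dx (cv psi)).
by move: (cu psi) (cv psi) => c1 c2 b1 b2 b3 b4; ring.
Qed.
Lemma sb_dy f : dy (sb psi f) = sb psi (dx f) * dy (cu psi) + sb psi (dy f) * dy (cv psi).
Proof.
apply/subr0_eq; move: f; apply: sb_unique => f.
move: (fps2_decomp f); move: (at0 f) (fx f) (fy f) => c g h ->.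
rewrite dx_lin dy_lin !sb_lin sb_cst dyD dyD dy_cst.
rewrite (dyM (cu psi)) (dyM (cv psi)).
move: (sb psi _) (sb psi _) (sb psi _) (sb psi _) (sb psi _) (sb psi _).
move=> a1 a2 a3 a4 a5 a6; move: (dy a6) (dy a5) (dy (cu psi)) (dy (cv psi)).
by move: (cu psi) (cv psi) => c1 c2 b1 b2 b3 b4; ring.
Qed.

End SB.

Definition pull psi (w : Defs.form R) : Defs.form R :=
  (sb psi w.1 * dx (cu psi) + sb psi w.2 * dx (cv psi),
   sb psi w.1 * dy (cu psi) + sb psi w.2 * dy (cv psi)).
Lemma pullbackE psi w : pullback w (cu psi) (cv psi) = pull psi w.
Proof. by []. Qed.
Lemma substE psi f : subst f (cu psi) (cv psi) = sb psi f. Proof. by []. Qed.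
#[local] Opaque pb sb.

Local Ltac atoms :=
  repeat match goal with
  | |- context[fps_deriv ?f] => generalize (fps_deriv f)
  | |- context[pb ?g ?f] => generalize (pb g f)
  | |- context[sb ?g ?f] => generalize (sb g f)
  | |- context[dx ?f] => generalize (dx f)
  | |- context[dy ?f] => generalize (dy f)
  | |- context[ax ?f] => generalize (ax f)
  | |- context[ay ?f] => generalize (ay f)
  | |- context[cst2 ?f] => generalize (cst2 f)
  | |- context[fpsC ?f] => generalize (fpsC f)
  end; intros.
Local Ltac aring := atoms; ring.

Lemma pb_at0 gam f : pb gam f 0%N = at0 f.
Proof.
rewrite pb_decomp !fps_coefD !fps_coefM0 /= (eqP (ax0 gam)) (eqP (ay0 gam)).
by rewrite !mul0r !addr0.
Qed.

Lemma sb_at0 psi f : at0 (sb psi f) = at0 f.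
Proof.
rewrite sb_decomp !at0D !at0M at0_cst (eqP (cu0 psi)) (eqP (cv0 psi)).
by rewrite !mul0r !addr0.
Qed.

Lemma pb_deriv gam f : fps_deriv (pb gam f) =
  pb gam (dx f) * fps_deriv (ax gam) + pb gam (dy f) * fps_deriv (ay gam).
Proof.
apply/subr0_eq; move: f; apply: (@pb_unique gam) => f.
move: (fps2_decomp f); move: (at0 f) (fx f) (fy f) => c g h ->.
rewrite dx_lin dy_lin !pb_lin pb_cst !fps_deriv_add fps_derivC.
rewrite (fps_derivM (ax gam)) (fps_derivM (ay gam)).
move: (pb gam _) (pb gam _) (pb gam _) (pb gam _) (pb gam _) (pb gam _).
move=> a1 a2 a3 a4 a5 a6.
move: (fps_deriv a6) (fps_deriv a5) (fps_deriv (ax gam)) (fps_deriv (ay gam)).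
by move: (ax gam) (ay gam) => c1 c2 b1 b2 b3 b4; ring.
Qed.

Fact push_subproof gam f : at0 f == 0 -> pb gam f 0%N == 0.
Proof. by rewrite pb_at0. Qed.
Definition push psi gam : parc :=
  Arc (push_subproof gam (cu0 psi)) (push_subproof gam (cv0 psi)).

Lemma pb_push psi gam f : pb (push psi gam) f = pb gam (sb psi f).
Proof.
apply/subr0_eq; move: f; apply: (@pb_unique (push psi gam)) => f /=.
move: (fps2_decomp f); move: (at0 f) (fx f) (fy f) => c g h ->.
rewrite pb_lin sb_lin pb_cst sb_cst !rmorphD !rmorphM /= pb_cst.
move: (pb gam _) (pb gam _) (pb gam _) (pb gam _) => b1 b2 b3 b4.
by move: (pb _ g) (pb _ h) => b5 b6; ring.
Qed.

Lemma pb_close n gam del f :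
  vge n (ax gam - ax del) -> vge n (ay gam - ay del) ->
  vge n (pb gam f - pb del f).
Proof.
move=> xn yn; suff: forall k, (k <= n)%N -> vge k (pb gam f - pb del f).
  by apply.
move=> k; elim: k f => // k IH f kn.
rewrite (_ : _ - _ = (ax gam - ax del) * pb gam (fx f)
   + (ay gam - ay del) * pb gam (fy f)
   + (ax del * (pb gam (fx f) - pb del (fx f))
      + ay del * (pb gam (fy f) - pb del (fy f)))); last first.
  by rewrite [pb gam f]pb_decomp [pb del f]pb_decomp; aring.
apply: vgeD; first by apply: vgeD; apply: vgeMr; apply: vge_le kn _.
have IH1 g := IH g (ltnW kn).
by apply: vgeD; rewrite -add1n; apply: vgeM => //; apply/vge1/eqP; rewrite ?ax0 ?ay0.
Qed.

(** The difference of the arcs enters the coefficient n only through the linear part of f, since the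
    remaining terms gain one order. This supplies slopes for [successive_approx]. *)
Lemma pb_close_coef n gam del f :
  vge n (ax gam - ax del) -> vge n (ay gam - ay del) ->
  (pb gam f - pb del f) n =
    coef2 f 1 0 * (ax gam n - ax del n) + coef2 f 0 1 * (ay gam n - ay del n).
Proof.
move=> xn yn.
rewrite (_ : pb gam f - pb del f = pb gam (fx f) * (ax gam - ax del)
   + pb gam (fy f) * (ay gam - ay del)
   + (ax del * (pb gam (fx f) - pb del (fx f))
      + ay del * (pb gam (fy f) - pb del (fy f)))); last first.
  by rewrite [pb gam f]pb_decomp [pb del f]pb_decomp; aring.
rewrite fps_coefD [X in _ + X](_ : _ = 0) ?addr0; last first.
  have cl := pb_close _ xn yn.
  suff: vge (1 + n) (ax del * (pb gam (fx f) - pb del (fx f))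
      + ay del * (pb gam (fy f) - pb del (fy f))) by apply.
  by apply: vgeD; apply: vgeM => //; apply/vge1/eqP; rewrite ?ax0 ?ay0.
rewrite fps_coefD -[in LHS](add0n n).
by rewrite (vge_lead (vge0 _) xn) (vge_lead (vge0 _) yn) !pb_at0.
Qed.

(** The coefficient of dt in the pull-back of w to the arc; it is zero exactly when the arc is an
    integral curve of w. *)
Definition tpb gam (w : Defs.form R) : fps C :=
  pb gam w.1 * fps_deriv (ax gam) + pb gam w.2 * fps_deriv (ay gam).

Lemma tpb_push psi gam w : tpb (push psi gam) w = tpb gam (pull psi w).
Proof.
rewrite /tpb /pull /= !pb_push !pb_deriv !rmorphD !rmorphM /=.
by aring.
Qed.

End Arcs.

#[global] Opaque pb sb.


(** * Implicit curves, leaves, separatrices and changes of parameter *)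

Section Solving.
Variable R : realType.
Local Notation C := R[i].
Local Notation fps2 := (fps2 R).
Local Notation t := (fpsX C).
Implicit Types (f g h : fps2) (c : C) (s u : fps C) (gam : parc R) (w : Defs.form R).

Fact t0 : t 0%N == 0. Proof. by []. Qed.
Fact z0 s : (t * s) 0%N == 0. Proof. by rewrite fps_coefM0 mul0r. Qed.

Lemma vge_shift n s s' : vge n (s - s') ->
  vge n (t * fps_shift s - t * fps_shift s').
Proof.
move=> ss' k kn; rewrite -mulrBr fps_coefXM; case: k kn => // k kn.
exact: (ss' k.+1).
Qed.

Lemma vge_deriv n s : vge n.+1 s -> vge n (fps_deriv s).
Proof. by move=> sn k kn; rewrite fps_coef_deriv sn ?mul0rn. Qed.

(** The graph of s - s(0): every series gives an arc, so the unknown s is unconstrained. *)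
Definition garc s := Arc t0 (z0 (fps_shift s)).

Lemma garc_close n s s' f : vge n (s - s') -> vge n (pb (garc s) f - pb (garc s') f).
Proof. by move=> ss'; apply: pb_close => /=; [rewrite subrr; exact: vge_0|exact: vge_shift]. Qed.

Lemma pb_coef1 gam f :
  pb gam f 1%N = coef2 f 1 0 * ax gam 1%N + coef2 f 0 1 * ay gam 1%N.
Proof.
have := congr1 (fun s : fps C => s 0%N) (pb_deriv gam f).
by rewrite fps_coefD !fps_coefM0 !pb_at0 !fps_coef_deriv !mulr1n !at0_dx !at0_dy.
Qed.

Lemma implicit_y f : at0 f = 0 -> coef2 f 0 1 != 0 ->
  exists2 gam, ax gam = t & pb gam f = 0.
Proof.
move=> f0 f1; have [|||s] := @successive_approx C (fun s => pb (garc s) f) 1 0 (fun=> coef2 f 0 1).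
- by move=> n _; rewrite unitfE.
- move=> n s s' n1 s1 ss'; rewrite -[LHS]fps_coefB pb_close_coef /=.
  + by rewrite subrr mulr0 add0r !fps_coefXM; case: n n1 {ss'}.
  + by rewrite subrr; exact: vge_0.
  + exact: vge_shift.
- by move=> s _ [|k] //; rewrite pb_at0.
by move=> _ s0; exists (garc s).
Qed.

Lemma leaf_y w : coef2 w.2 0 0 != 0 -> exists2 gam, ax gam = t & tpb gam w = 0.
Proof.
move=> w2; have [|||s] := @successive_approx C (fun s => t * tpb (garc s) w) 1 0
    (fun n => n%:R * coef2 w.2 0 0).
- by move=> [//|n] _; rewrite unitfE mulf_neq0// pnatr_eq0.
- move=> [//|n] s s' n1 s1 ss'; rewrite !fps_coefXM -[LHS]fps_coefB /tpb /=.
  set b := t * _; set b' := t * _.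
  rewrite (_ : _ - _ = (pb (garc s) w.1 - pb (garc s') w.1) * fps_deriv t
    + ((pb (garc s) w.2 - pb (garc s') w.2) * fps_deriv b
    + pb (garc s') w.2 * fps_deriv (b - b'))); last first.
    rewrite fps_deriv_add fps_deriv_opp.
    by move: (fps_deriv _) (fps_deriv _) (fps_deriv _) (pb _ _) (pb _ _) (pb _ _) (pb _ _) => *; ring.
  rewrite fps_coefD [X in X + _](vgeMr _ (garc_close _ ss')) ?add0r//.
  rewrite fps_coefD [X in X + _](vgeMr _ (garc_close _ ss')) ?add0r//.
  have bb : vge n.+1 (b - b') := vge_shift ss'.
  rewrite -[n in LHS]add0n (vge_lead (vge0 _) (vge_deriv bb)).
  rewrite pb_at0 fps_coef_deriv fps_coefB !fps_coefXM /= -mulr_natr /at0.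
  by ring.
- by move=> s _ [|k] //; rewrite fps_coefXM.
move=> _ s0; exists (garc s) => //; apply/eqP.
by have /eqP := s0; rewrite mulf_eq0 (negPf (fpsX_neq0 _)).
Qed.

(** Briot-Bouquet: along y = s(x), with s of order at least two, the unknown s_n enters the
    coefficient of order n as (a + b n) s_n, and the other terms involve only earlier coefficients
    of s. *)
Lemma separatrix_y w (a b : C) :
  at0 w.1 = 0 -> at0 w.2 = 0 -> coef2 w.1 1 0 = 0 -> coef2 w.1 0 1 = a ->
  coef2 w.2 1 0 = b -> (forall n, (2 <= n)%N -> a + b * n%:R != 0) ->
  exists2 gam, ax gam = t & vge 2 (ay gam) /\ tpb gam w = 0.
Proof.
move=> w10 w20 w1x w1y w2x ab.
have arc1 s : vge 2 s -> vge 2 (ay (garc s)).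
  by move=> s2 [|[|//]] _ /=; rewrite fps_coefXM //; exact: s2.
have [|||s] := @successive_approx C (fun s => tpb (garc s) w) 2 0 (fun n => a + b * n%:R).
- by move=> n n2; rewrite unitfE ab.
- move=> n s s' n2 s2 ss'; rewrite -[LHS]fps_coefB /tpb.
  move: s2; rewrite subr0 => s2.
  have s2' : vge 2 s'.
    by rewrite -[s'](subKr s); apply: vgeB => //; exact: vge_le ss'.
  have ay2 := arc1 _ s2.
  set b1 := ay _; set b' := ay _.
  rewrite (_ : _ - _ = (pb (garc s) w.1 - pb (garc s') w.1)
    + ((pb (garc s) w.2 - pb (garc s') w.2) * fps_deriv b1
    + pb (garc s') w.2 * fps_deriv (b1 - b'))); last first.
    rewrite fps_deriv_add fps_deriv_opp /= fps_derivX.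
    by move: (fps_deriv _) (fps_deriv _) (pb _ _) (pb _ _) (pb _ _) (pb _ _) => *; ring.
  rewrite fps_coefD pb_close_coef /=; first last.
  + exact: vge_shift.
  + by rewrite subrr; exact: vge_0.
  rewrite subrr mulr0 add0r w1y fps_coefD.
  have -> : ((pb (garc s) w.2 - pb (garc s') w.2) * fps_deriv b1) n = 0.
    have := vgeM (garc_close w.2 ss') (vge_deriv ay2).
    by apply; rewrite addn1.
  have bb : vge n (b1 - b') := vge_shift ss'.
  case: n n2 ss' bb => // n n2 ss' bb.
  rewrite -[n.+1 in X in _ + (_ + X)]add1n (vge_lead _ (vge_deriv bb)); last first.
    by move=> [|//] _; rewrite pb_at0.
  rewrite pb_coef1 w2x /= mulr1 !fps_coefXM /=.
  have -> : s' 1%N = 0 by apply: s2'.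
  rewrite mulr0 addr0 add0r fps_coef_deriv fps_coefB /b1 /b' /= !fps_coefXM /=.
  by rewrite -mulr_natr; ring.
- move=> s; rewrite subr0 => /arc1 ay2 k; rewrite /tpb fps_derivX mulr1 fps_coefD.
  have := vgeM (vge1 (f := pb (garc s) w.2) _) (vge_deriv ay2).
  rewrite pb_at0 => /(_ w20) h k2; rewrite [X in _ + X]h// addr0.
  case: k k2 => [|[|//]] _; first by rewrite pb_at0.
  by rewrite pb_coef1 w1x mul0r add0r ay2 ?mulr0.
rewrite subr0 => s2 s0; exists (garc s) => //; split => //; exact: arc1.
Qed.

Definition ofx u : fps2 := fpsC u.
HB.instance Definition _ := GRing.RMorphism.copy ofx (@fpsC (fps C)).
(** Composition of u with the first coordinate of an arc. Changes of parameter are thus also arcs,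
    read through [ax]. *)
Definition cmp gam u : fps C := pb gam (ofx u).
HB.instance Definition _ gam := GRing.RMorphism.copy (cmp gam) (pb gam \o ofx).

Lemma ofx_C c : ofx (fpsC c) = cst2 c. Proof. by []. Qed.
Lemma ofx_t : ofx t = X R. Proof. by []. Qed.

Lemma cmp_C gam c : cmp gam (fpsC c) = fpsC c.
Proof. by rewrite /cmp ofx_C pb_cst. Qed.
Lemma cmp_t gam : cmp gam t = ax gam.
Proof. by rewrite /cmp ofx_t pb_X. Qed.
Lemma cmp_decomp gam u : cmp gam u = fpsC (u 0%N) + ax gam * cmp gam (fps_shift u).
Proof. by rewrite {1}[u]fps_decomp rmorphD rmorphM /= cmp_C cmp_t. Qed.

Lemma cmp0E gam u : cmp gam u 0%N = u 0%N.
Proof. by rewrite cmp_decomp fps_coefD fps_coefM0 (eqP (ax0 gam)) mul0r addr0. Qed.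

Fact rep_subproof gam u : u 0%N == 0 -> cmp gam u 0%N == 0.
Proof. by rewrite cmp0E. Qed.
Definition rep gam p : parc R :=
  Arc (rep_subproof p (ax0 gam)) (rep_subproof p (ay0 gam)).

Lemma pb_rep gam p f : pb (rep gam p) f = cmp p (pb gam f).
Proof.
apply/subr0_eq; move: f; apply: (@pb_unique R (rep gam p)) => f /=.
move: (fps2_decomp f); move: (at0 f) (fx f) (fy f) => c g h ->.
rewrite !pb_lin !pb_cst !rmorphD !rmorphM /= cmp_C.
move: (pb _ _) (pb _ _) (pb _ _) (pb _ _) => a1 a2 a3 a4.
by move: (cmp _ a2) (cmp _ a1) (cmp _ (ax _)) (cmp _ (ay _)) (fpsC _) => *; ring.
Qed.

Lemma ord_cmp gam u : ax gam != 0 -> u != 0 ->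
  cmp gam u != 0 /\ ord (cmp gam u) = (ord u * ord (ax gam))%N.
Proof.
move=> g0 u0; have [/vgeP[u' eu] un] := ordP u0.
set n := ord u in eu un *; have u'0 : u' 0%N != 0.
  by move: un; rewrite eu fps_coefXnM ltnn subnn.
have cu' : cmp gam u' 0%N != 0 by rewrite cmp0E.
rewrite eu rmorphM rmorphXn /= cmp_t; split.
  by rewrite mulf_neq0 ?expf_neq0//; exact: neq0_coef cu'.
by rewrite ordM ?expf_neq0// ?ordX ?(ord_unit cu') ?addn0//; exact: neq0_coef cu'.
Qed.

Lemma cmp_close n gam del u :
  vge n (ax gam - ax del) -> vge n (cmp gam u - cmp del u).
Proof.
move=> gd; suff: forall k, (k <= n)%N -> vge k (cmp gam u - cmp del u) by apply.
move=> k; elim: k u => // k IH u kn; rewrite (cmp_decomp gam) (cmp_decomp del).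
rewrite (_ : _ - _ = (ax gam - ax del) * cmp gam (fps_shift u)
  + ax del * (cmp gam (fps_shift u) - cmp del (fps_shift u))); last first.
  by move: (cmp _ _) (cmp _ _) (ax _) (ax _) (fpsC _) => *; ring.
apply: vgeD; first by apply: vgeMr; exact: vge_le gd.
by rewrite -add1n; apply: vgeM; [apply/vge1/eqP; rewrite ax0|exact: IH (ltnW kn)].
Qed.

(* A series of order n is t^n after a change of parameter. *)
Lemma reparam u n : u != 0 -> ord u = n -> (0 < n)%N ->
  exists p : parc R, [/\ ord (ax p) = 1%N, ax p != 0 & cmp p u = t ^+ n].
Proof.
move=> u0 un n0; have [/vgeP[u' eu] un'] := ordP u0; rewrite un in eu un'.
have u'0 : u' 0%N != 0 by move: un'; rewrite eu fps_coefXnM ltnn subnn.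
pose c := n.-root (u' 0%N)^-1; have cn : c ^+ n = (u' 0%N)^-1 by rewrite rootCK.
have c0 : c != 0.
  by apply/eqP => c0; move: cn; rewrite c0 expr0n eqn0Ngt n0 => /esym/eqP; rewrite invr_eq0 (negPf u'0).
(* With p = t s and u = t^n u', the equation u(p) = t^n becomes s^n u'(t s) = 1; its constant term
   is solved by the root c. *)
pose P s := Arc (z0 s) t0.
have [|||s] := @successive_approx C (fun s => s ^+ n * cmp (P s) u' - 1) 1 (fpsC c)
  (fun=> n%:R * c ^+ n.-1 * u' 0%N).
- by move=> m _; rewrite unitfE !mulf_neq0 ?expf_neq0// pnatr_eq0 -lt0n.
- move=> m s s' m1 s1 ss'; rewrite -[LHS]fps_coefB.
  have sc : s 0%N = c by apply/eqP; rewrite -subr_eq0; apply/eqP/(s1 0%N).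
  have s'c : s' 0%N = c.
    by rewrite -sc; apply/esym/eqP; rewrite -subr_eq0; apply/eqP/(ss' 0%N).
  set D := \sum_(i < n) s ^+ (n.-1 - i) * s' ^+ i.
  have De : s ^+ n - s' ^+ n = (s - s') * D.
    by rewrite subrXX.
  have D0 : D 0%N = n%:R * c ^+ n.-1.
    have X0 (v : fps C) k : (v ^+ k) 0%N = v 0%N ^+ k.
      by elim: k => [|k IH]; rewrite ?expr0// !exprS fps_coefM0 IH.
    rewrite /D fps_coef_sum (eq_bigr (fun=> c ^+ n.-1)) => [|i _].
      by rewrite sumr_const card_ord mulr_natl.
    by rewrite fps_coefM0 !X0 sc s'c -exprD subnK// -ltnS prednK.
  rewrite (_ : _ - _ = (s - s') * (D * cmp (P s) u')
     + s' ^+ n * (cmp (P s) u' - cmp (P s') u')); last first.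
    by rewrite mulrA -De; move: (_ ^+ _) (_ ^+ _) (cmp _ _) (cmp _ _) => *; ring.
  rewrite fps_coefD [X in _ + X](_ : _ = 0) ?addr0.
    by rewrite -[m in LHS]addn0 (vge_lead ss' (vge0 _)) fps_coefM0 cmp0E D0 fps_coefB mulrC.
  suff: vge m.+1 (s' ^+ n * (cmp (P s) u' - cmp (P s') u')) by apply.
  apply: vgeMl; apply: cmp_close; rewrite /= -mulrBr -add1n.
  by apply: vgeM => //; apply: vge1.
- move=> s s1; apply: vge1; rewrite fps_coefB fps_coefM0 cmp0E.
  have X0 (v : fps C) k : (v ^+ k) 0%N = v 0%N ^+ k.
    by elim: k => [|k IH]; rewrite ?expr0// !exprS fps_coefM0 IH.
  have sc : s 0%N = c by apply/eqP; rewrite -subr_eq0; apply/eqP/(s1 0%N).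
  by rewrite X0 sc cn mulVf// subrr.
move=> s1 /subr0_eq sE.
have sc : s 0%N = c by apply/eqP; rewrite -subr_eq0; apply/eqP/(s1 0%N).
have s0 : s 0%N != 0 by rewrite sc.
exists (P s); have sn0 := neq0_coef s0; split=> /=.
- by rewrite ordM ?fpsX_neq0// ord_fpsX ord_unit.
- by rewrite mulf_neq0 ?fpsX_neq0.
- by rewrite eu rmorphM rmorphXn /= cmp_t /= exprMn -mulrA sE mulr1.
Qed.

End Solving.


(** * Equation of an arc as a product over its conjugates *)

Section Kernel.
Variable R : realType.
Local Notation C := R[i].
Local Notation fps2 := (fps2 R).
Local Notation t := (fpsX C).
Implicit Types (f g h : fps2) (c z : C) (s u v : fps C) (gam del p : parc R).

Lemma prod_cyclic (A : comNzRingType) n (F : nat -> A) : F n.+1 = F 0%N ->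
  \prod_(k < n.+1) F k.+1 = \prod_(k < n.+1) F k.
Proof. by move=> Fn; rewrite big_ord_recr [RHS]big_ord_recl /= Fn mulrC. Qed.

Lemma prim_root_ex n : (0 < n)%N -> exists z : C, n.-primitive_root z.
Proof.
pose q : {poly C} := 'X^n - 1; have [r Dp] := closed_field_poly_normal q.
move=> n_gt0; rewrite (monicP _) ?monicXnsubC // scale1r in Dp.
have rn1: all n.-unity_root r by apply/allP=> z; rewrite -root_prod_XsubC -Dp.
have sz_r: (n < (size r).+1)%N.
  by rewrite -(size_prod_XsubC r id) -Dp size_XnsubC.
have [|z] := hasP (has_prim_root n_gt0 rn1 _ sz_r); last by exists z.
by rewrite -separable_prod_XsubC -Dp separable_Xn_sub_1 // pnatr_eq0 -lt0n.
Qed.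

Lemma coef_expX n k : (t ^+ n) k = (k == n)%:R.
Proof.
rewrite -[t ^+ n]mulr1 fps_coefXnM fps_coef1.
by case: ltnP => kn; rewrite ?(ltn_eqF kn)// subn_eq0 eqn_leq kn andbT.
Qed.

Fact cX_subproof n c : (0 < n)%N -> (fpsC c * t ^+ n) 0%N == 0.
Proof. by move=> n0; rewrite fps_coefCM coef_expX (ltn_eqF n0) mulr0. Qed.
(* The parameter change t |-> c t^n (for n > 0; n.+1 keeps the map total). *)
Definition cX n c : parc R := Arc (cX_subproof c (ltn0Sn n)) (t0 R).

Lemma cmp_cX n c v :
  cmp (cX n c) v = Fps (fun i => if (n.+1 %| i)%N then c ^+ (i %/ n.+1) * v (i %/ n.+1)%N else 0).
Proof.
pose ex v : fps C := Fps (fun i => if (n.+1 %| i)%N then c ^+ (i %/ n.+1) * v (i %/ n.+1)%N else 0).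
have exE u : ex u = fpsC (u 0%N) + ax (cX n c) * ex (fps_shift u).
  apply: fpsP => i; rewrite fps_coefD [ax _]/= -mulrA fps_coefCM fps_coefXnM.
  case: i => [|i]; first by rewrite /= div0n expr0 mul1r mulr0 addr0.
  rewrite [fpsC _ _]/= add0r; case: ltnP => lt; first by rewrite mulr0 /= gtnNdvd.
  have := subnK lt; set k := (_ - _)%N => <-.
  rewrite /= dvdn_addl// divnDr// divnn /= addn1.
  by case: ifP; rewrite ?mulr0// exprS mulrA.
apply/subr0_eq/vge_eq0 => k; rewrite -/(ex v); elim: k v => // k IH v.
rewrite cmp_decomp exE; set a := ax _.
rewrite (_ : _ - _ = a * (cmp (cX n c) (fps_shift v) - ex (fps_shift v))); last first.
  by move: (cmp _ _) (ex _) (fpsC _) a => *; ring.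
by rewrite -add1n; apply: vgeM => //; apply/vge1/eqP/(ax0 (cX n c)).
Qed.

Fact chX_subproof (a : fps C) : a 0%N == 0 -> at0 (ofx a : fps2) == 0. Proof. by []. Qed.
Definition chX p : chart R := Chart (chX_subproof (ax0 p)) (introT eqP (at0_Y R)).

Lemma sb_chX p f : sb (chX p) f = Fps (fun j => cmp p (f j)).
Proof.
apply/subr0_eq; move: f; apply: (@sb_unique R (chX p)) => f.
pose M f : fps2 := Fps (fun j => cmp p (f j)).
have ME g : M g = cst2 (at0 g) + cu (chX p) * M (fx g) + cv (chX p) * M (fy g).
  apply: fpsP => j; rewrite !fps_coefD fps_coefXM fps_coefCM /=.
  rewrite cmp_decomp -ofx_C /=; case: j => [|j] /=; first by rewrite addr0.
  rewrite cmp_C (_ : (0 : fps C) = 0)//; rewrite [fpsC _ + _]addrC; congr (_ + _).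
  by rewrite add0r.
rewrite -!/(M _) ME sb_decomp.
by move: (sb _ _) (sb _ _) (M _) (M _) (cu _) (cv _) (cst2 _) => *; ring.
Qed.

(** The product of the Y - v(z^k x), over the roots of unity z^k, is invariant under x -> z x, hence
    equals g(x^(n+1), y) for some g. This g vanishes along (t^(n+1), v), and an arc on which it
    vanishes comes from a conjugate of v. *)
Lemma conjugates n v : v 0%N == 0 -> exists g, [/\ g != 0,
  (forall gam, ax gam = t ^+ n.+1 -> ay gam = v -> pb gam g = 0) &
  forall m gam, ax gam = t ^+ m.+1 -> pb gam g = 0 ->
    exists2 z, z ^+ n.+1 = 1 & cmp (cX n 1) (ay gam) = cmp (cX m z) v].
Proof.
move=> v0; have [z zp] := prim_root_ex (ltn0Sn n).
pose vk k := cmp (cX 0 (z ^+ k)) v.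
pose G : fps2 := \prod_(k < n.+1) (Y R - ofx (vk k)).
have GT : sb (chX (cX 0 z)) G = G.
  have sbk k : sb (chX (cX 0 z)) (Y R - ofx (vk k)) = Y R - ofx (vk k.+1).
    rewrite rmorphB /= sb_Y /=; congr (_ - _); rewrite sb_chX; apply: fpsP => -[|j] /=; last first.
      by rewrite rmorph0.
    apply: fpsP => i; rewrite /vk !cmp_cX /= !divn1 !dvd1n mulrA -exprMn.
    by rewrite exprS.
  rewrite rmorph_prod /= (eq_bigr (fun k : 'I_n.+1 => Y R - ofx (vk k.+1))) => [|k _]; last exact: sbk.
  apply: (@prod_cyclic _ n (fun k => Y R - ofx (vk k))).
  by rewrite /vk (prim_expr_order zp) expr0.
(* The substitution x -> z x multiplies the coefficient of x^i by z^i, so invariance kills it unless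
   z^i = 1. *)
have Gn j i : ~~ (n.+1 %| i)%N -> G j i = 0.
  rewrite (prim_order_dvd zp) => zi.
  have := congr1 (fun f : fps2 => f j i) GT; rewrite sb_chX /= cmp_cX /= divn1 dvd1n.
  move/eqP; rewrite -subr_eq0 -{2}[G j i]mul1r -mulrBl mulf_eq0 subr_eq0 (negPf zi).
  by move/eqP.
pose g : fps2 := Fps (fun j => Fps (fun i => G j (i * n.+1)%N)).
have gG : sb (chX (cX n 1)) g = G.
  rewrite sb_chX; apply: fpsP => j; rewrite /= cmp_cX; apply: fpsP => i /=.
  by case: ifPn => [dv|/Gn->//]; rewrite expr1n mul1r divnK.
have Gk gam : pb gam G = \prod_(k < n.+1) (ay gam - cmp gam (vk k)).
  by rewrite rmorph_prod; apply: eq_bigr => k _; rewrite rmorphB /= pb_Y.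
exists g; split.
- have: G != 0.
    apply/prodf_neq0 => k _; apply: (@neq0_coef _ _ 1); rewrite fps_coefB /=.
    by rewrite subr0 oner_neq0.
  by apply: contra_neq => g0; rewrite -gG g0 rmorph0.
- move=> gam gx gy; pose del := Arc (t0 R) v0.
  have -> : gam = push (chX (cX n 1)) del.
    apply: parcP; last by rewrite gy [RHS]pb_Y.
    rewrite gx [RHS](_ : _ = cmp del (fpsC 1 * t ^+ n.+1)) //.
    by rewrite rmorph1 mul1r rmorphXn /= cmp_t.
  rewrite pb_push gG Gk big_ord_recl /= [X in X * _](_ : _ = 0) ?mul0r//.
  apply/eqP; rewrite subr_eq0; apply/eqP; rewrite /vk expr0.
  have e1 (q : parc R) w : ax q = t -> cmp q w = w.
    move=> qt; have -> : cmp q w = cmp (cX 0 1) w.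
      apply/subr0_eq/vge_eq0 => k; apply: cmp_close; rewrite qt /=.
      by rewrite rmorph1 mul1r expr1 subrr; exact: vge_0.
    by rewrite cmp_cX; apply: fpsP => i /=; rewrite dvd1n divn1 expr1n mul1r.
  by rewrite !e1//= rmorph1 mul1r expr1.
move=> m gam gx gg.
have d0 : cmp (cX n 1) (ay gam) 0%N == 0 by rewrite cmp0E ay0.
have tm0 : (t ^+ m.+1) 0%N == 0 by rewrite coef_expX.
(* [del] is (t^(m+1), y(t^(n+1))). Its image under x -> x^(n+1) is [gam] reparametrized by t^(n+1),
   so G vanishes along [del]. *)
pose del := Arc tm0 d0.
have : pb del G = 0.
  rewrite -gG -pb_push; have -> : push (chX (cX n 1)) del = rep gam (cX n 1).
    have e1 (q : parc R) k : cmp q (fpsC 1 * t ^+ k) = ax q ^+ k.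
      by rewrite rmorph1 mul1r rmorphXn /= cmp_t.
    have e2 (q : parc R) k : cmp q (t ^+ k) = ax q ^+ k by rewrite rmorphXn /= cmp_t.
    apply: parcP; last by rewrite [LHS]pb_Y.
    rewrite [LHS](e1 del) [ax (rep _ _)]/= gx e2 [ax del]/= [ax (cX _ _)]/=.
    by rewrite rmorph1 mul1r -!exprM mulnC.
  by rewrite pb_rep gg rmorph0.
rewrite Gk => /eqP/prodf_eq0[k _]; rewrite subr_eq0 /= => /eqP e.
exists (z ^+ k); first by rewrite exprAC (prim_expr_order zp) expr1n.
rewrite e; apply: fpsP => i.
have -> : cmp del (vk k) = cmp (cX m 1) (vk k).
  apply/subr0_eq/vge_eq0 => l; apply: cmp_close => /=.
  by rewrite rmorph1 mul1r subrr; exact: vge_0.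
rewrite /vk !cmp_cX /= dvd1n divn1 expr1n mul1r.
by case: ifP.
Qed.

End Kernel.


(** * The ideal of an arc is principal and determines the arc up to parameter changes *)

Section Principal.
Variable R : realType.
Local Notation C := R[i].
Local Notation fps2 := (fps2 R).
Local Notation t := (fpsX C).
Implicit Types (f g h : fps2) (c z : C) (s u v : fps C) (gam del p q : parc R).

Lemma is_unitP f : is_unit f <-> at0 f != 0.
Proof.
have -> : (at0 f != 0) = (f \is a GRing.unit) by rewrite !fps_unitE unitfE.
by split=> /unitrPr.
Qed.

Lemma fdvd_trans f g h : fdvd f g -> fdvd g h -> fdvd f h.
Proof. by move=> [a ->] [b ->]; exists (a * b); rewrite mulrA. Qed.
Lemma cmp_eq0 p u : ax p != 0 -> cmp p u = 0 -> u = 0.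
Proof.
move=> p0 pu; apply/eqP; apply: contraT => u0.
by have [/eqP] := ord_cmp p0 u0.
Qed.

Lemma cmp_rep p q u : cmp (rep p q) u = cmp q (cmp p u).
Proof. exact: pb_rep. Qed.
Lemma rep_rep gam p q : rep (rep gam p) q = rep gam (rep p q).
Proof. by apply: parcP; rewrite /= cmp_rep. Qed.

Definition nonconst gam := (ax gam != 0) || (ay gam != 0).

Lemma ord_par_gt0 (gam : parc R) : ax gam != 0 -> (0 < ord (ax gam))%N.
Proof. by move=> a0; rewrite ord_gt0// ax0. Qed.

Lemma normalize gam : ax gam != 0 -> exists n p,
  [/\ ax p != 0, ord (ax p) = 1%N & ax (rep gam p) = t ^+ n.+1].
Proof.
move=> a0; have n0 := ord_par_gt0 a0.
have [p [p1 p0 pE]] := reparam a0 erefl n0.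
by exists (ord (ax gam)).-1, p; rewrite prednK.
Qed.

Lemma ker_neq0 gam : exists2 f, f != 0 & pb gam f = 0.
Proof.
have [gx|gx] := eqVneq (ax gam) 0.
  exists (X R); last by rewrite pb_X.
  apply/eqP => /(congr1 (fun f : fps2 => coef2 f 1 0)) /eqP.
  by rewrite coef2_0 oner_eq0.
have [n [p [p0 _ pE]]] := normalize gx.
have [g [g0 gk _]] := conjugates n (ay0 (rep gam p)); exists g => //.
by apply: (cmp_eq0 p0); rewrite -pb_rep; apply: gk.
Qed.

(** Here x is the distinguished variable: the remainder is a polynomial in x of degree less than d,
    the order of f(x, 0). The coefficient of y^n in the quotient is found from the previous ones by
    dividing the part of order at least d by the unit part of f(x, 0). *)
Lemma weierstrass_division f g : f 0%N != 0 -> exists k r : fps2, g = k * f + r /\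
  forall j i, (ord (f 0%N) <= i)%N -> r j i = 0.
Proof.
move=> f0; set d := ord _; have [/vgeP[U eU] fd] := ordP f0; rewrite -/d in eU fd.
have U0 : U \is a GRing.unit.
  by rewrite fps_unitE unitfE; move: fd; rewrite eU fps_coefXnM ltnn subnn.
pose hi u : fps C := Fps (fun i => u (i + d)%N).
pose H n (k : nat -> fps C) : fps C :=
  U^-1 * hi (g n - \sum_(i < n) k i * f (n - i)%N).
have [n k k' kk'|k kE] := strong_rec 0 (H := H).
  by rewrite /H; congr (_ * hi (_ - _)); apply: eq_bigr => i _; rewrite kk'.
exists (Fps k), (g - Fps k * f); split; first by rewrite addrC subrK.
move=> j i di; rewrite fps_coefB fps_coefM big_ord_recr /= subnn.
rewrite [k j]kE /H eU; set S := \sum_(i0 < j) _.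
have -> : U^-1 * hi (g j - S) * (t ^+ d * U) = t ^+ d * hi (g j - S).
  move: (hi _) (t ^+ d) => a b.
  by rewrite mulrCA mulrAC mulVr ?mul1r.
rewrite fps_coefD fps_coefXnM ltnNge di /= subnK//.
by rewrite fps_coefB [S i + _]addrCA subrr addr0 subrr.
Qed.

Lemma fps2_ydecomp f : f = ofx (f 0%N) + Y R * (fps_shift f : fps2).
Proof. exact: (fps_decomp f). Qed.

Lemma pb_ydecomp gam f :
  pb gam f = cmp gam (f 0%N) + ay gam * pb gam (fps_shift f).
Proof. by rewrite {1}[f]fps2_ydecomp rmorphD rmorphM /= pb_Y. Qed.

Lemma fps2_Yn f : f != 0 -> exists k g, f = Y R ^+ k * g /\ g 0%N != 0.
Proof.
move=> /ordP[/vgeP[g]]; move: (ord f) => n eg f0; exists n, g; split=> //.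
by move: f0; rewrite eg fps_coefXnM ltnn subnn.
Qed.

(** Take f in the kernel with f(x, 0) nonzero of least order. A nonzero remainder modulo f, stripped
    of its powers of y, would be in the kernel with smaller order; so f divides the whole kernel. It
    is irreducible because the kernel is prime. An arc inside y = 0 has Y as generator. *)
Lemma ker_principal gam : nonconst gam ->
  exists2 f, irreducible f & forall g, pb gam g = 0 <-> fdvd f g.
Proof.
move=> gnc.
have prime_irr f : f <> 0 -> (forall g, pb gam g = 0 <-> fdvd f g) -> irreducible f.
  move=> f0 fk; split=> //.
    have /(fk f) fg : fdvd f f by exists 1; rewrite mulr1.
    by move=> /is_unitP/eqP; rewrite -(pb_at0 gam) fg fps_coef0.
  move=> g h fgh; have : pb gam (g * h) = 0 by apply/fk; exists 1; rewrite mulr1.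
  have aux a b k : f = a * b -> a = f * k -> is_unit b.
    move=> e1 e2; exists k; apply: (@mulfI _ f); first exact/eqP.
    by rewrite mulr1 [b * k]mulrC mulrA -e2.
  move=> /eqP; rewrite rmorphM mulf_eq0 => /orP[]/eqP/fk[k kE].
    by right; apply: (aux g h k).
  by left; apply: (aux h g k) => //; rewrite mulrC.
have [gy|gy] := eqVneq (ay gam) 0.
  have gx : ax gam != 0 by move: gnc; rewrite /nonconst gy eqxx orbF.
  have kY g : pb gam g = 0 <-> fdvd (Y R) g.
    split=> [|[h ->]]; last by rewrite rmorphM /= pb_Y gy mul0r.
    rewrite pb_ydecomp gy mul0r addr0 => /(cmp_eq0 gx) g0.
    by exists (fps_shift g); rewrite {1}[g]fps2_ydecomp g0 rmorph0 add0r.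
  exists (Y R) => //; apply: prime_irr => //.
  by apply/eqP; exact: (fpsX_neq0 (fps C)).
pose P n := `[< exists f, [/\ pb gam f = 0, f 0%N != 0 & ord (f 0%N) = n] >].
have divY k g : pb gam (Y R ^+ k * g) = 0 -> pb gam g = 0.
  rewrite rmorphM rmorphXn /= pb_Y => /eqP.
  by rewrite mulf_eq0 expf_eq0 (negPf gy) andbF => /eqP.
have exP : exists n, P n.
  have [f /fps2_Yn[k [g [-> g0]]] /divY gk] := ker_neq0 gam.
  by exists (ord (g 0%N)); apply/asboolP; exists g.
case: (ex_minnP exP) => d /asboolP[f [fk f0 fd]] dmin.
have kf g : pb gam g = 0 <-> fdvd f g.
  split=> [gk|[h ->]]; last by rewrite rmorphM /= fk mul0r.
  have [k [r [gE rlt]]] := weierstrass_division g f0.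
  have rk : pb gam r = 0.
    by move: gk; rewrite gE rmorphD rmorphM /= fk mulr0 add0r.
  have [r0|/fps2_Yn[l [h [rE h0]]]] := eqVneq r 0.
    by exists k; rewrite gE r0 addr0 mulrC.
  have hk : pb gam h = 0 by apply: (divY l); rewrite -rE.
  have : P (ord (h 0%N)) by apply/asboolP; exists h.
  move=> /dmin; rewrite -fd => le; have [_ /negP[]] := ordP h0.
  by rewrite -(rlt l _ le) rE -[Y R]/(fpsX (fps C)) fps_coefXnM ltnn subnn.
exists f => //; apply: prime_irr => // fe.
by move: f0; rewrite fe fps_coef0 eqxx.
Qed.

Lemma irreducible_assoc f g : irreducible f -> irreducible g -> fdvd f g -> fdvd g f.
Proof.
move=> [_ fu _] [_ _ gi] [k kE]; have [//|[l kl]] := gi _ _ kE.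
by exists l; rewrite kE -mulrA kl mulr1.
Qed.

Lemma ker_irreducible gam f g : nonconst gam -> irreducible f -> pb gam f = 0 ->
  pb gam g = 0 <-> fdvd f g.
Proof.
move=> gnc fi fk; have [p pi pk] := ker_principal gnc.
have pf := irreducible_assoc pi fi ((pk f).1 fk).
split=> [/pk|[h ->]]; last by rewrite rmorphM /= fk mul0r.
exact: fdvd_trans.
Qed.

(** Both arcs have the ideal (f) as kernel, so the equation made of the conjugates of [gam] vanishes
    along [del]. Once the first coordinates are powers of t and the two exponents are crossed, [del]
    is a conjugate of [gam]. *)
Lemma common_rep f gam del : irreducible f -> nonconst gam -> nonconst del ->
  pb gam f = 0 -> pb del f = 0 ->
  exists p q, [/\ ax p != 0, ax q != 0 & rep gam p = rep del q].
Proof.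
move=> fi gnc dnc gf df.
have same g : pb gam g = 0 -> pb del g = 0.
  by move=> /(ker_irreducible g gnc fi gf)/(ker_irreducible g dnc fi df).
have same' g : pb del g = 0 -> pb gam g = 0.
  by move=> /(ker_irreducible g dnc fi df)/(ker_irreducible g gnc fi gf).
have cX0 n z : z != 0 -> ax (cX n z : parc R) != 0.
  by move=> z0; apply: (@neq0_coef _ _ n.+1); rewrite fps_coefCM coef_expX eqxx mulr1.
have cE (q : parc R) k z : cmp q (fpsC z * t ^+ k) = fpsC z * ax q ^+ k.
  by rewrite rmorphM rmorphXn /= cmp_C cmp_t.
have cE1 (q : parc R) k : cmp q (t ^+ k) = ax q ^+ k by rewrite rmorphXn /= cmp_t.
have [gx|gx] := eqVneq (ax gam) 0.
  have dx : ax del = 0 by rewrite -pb_X; apply: same; rewrite pb_X.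
  have gy : ay gam != 0 by move: gnc; rewrite /nonconst gx eqxx.
  have dy : ay del != 0 by move: dnc; rewrite /nonconst dx eqxx.
  have oy (g : parc R) : ay g != 0 -> (0 < ord (ay g))%N by move=> g0; rewrite ord_gt0// ay0.
  have [p [_ p0 pE]] := reparam gy erefl (oy _ gy).
  have [q [_ q0 qE]] := reparam dy erefl (oy _ dy).
  move: (oy _ gy) (oy _ dy) pE qE; case: (ord (ay gam)) (ord (ay del)) => // n [//|m] _ _ pE qE.
  exists (rep p (cX m 1)), (rep q (cX n 1)); split.
  - by have [] := ord_cmp (cX0 m 1 (oner_neq0 _)) p0.
  - by have [] := ord_cmp (cX0 n 1 (oner_neq0 _)) q0.
  apply: parcP => /=; first by rewrite gx dx !rmorph0.
  rewrite !cmp_rep pE qE !cE1 /= !rmorph1 !mul1r -!exprM.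
  by rewrite mulnC.
have dx : ax del != 0.
  apply: contra_neq gx => d0; rewrite -pb_X; apply: same'; by rewrite pb_X.
have [n [p [p0 _ pE]]] := normalize gx.
have [m [q [q0 _ qE]]] := normalize dx.
have [g [_ gk gz]] := conjugates n (ay0 (rep gam p)).
have pg : pb (rep gam p) g = 0 by apply: gk.
have dg : pb (rep del q) g = 0.
  have gk0 : pb gam g = 0 by apply: (cmp_eq0 p0); rewrite -pb_rep.
  by rewrite pb_rep (same g gk0) rmorph0.
have [z zn zE] := gz m _ qE dg.
have z0 : z != 0 by apply: contraPneq zn => ->; rewrite expr0n => /eqP; rewrite eq_sym oner_eq0.
exists (rep p (cX m z)), (rep q (cX n 1)); split.
- by have [] := ord_cmp (cX0 m z z0) p0.
- by have [] := ord_cmp (cX0 n 1 (oner_neq0 _)) q0.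
rewrite -!rep_rep; apply: parcP; last exact: (esym zE).
transitivity (cmp (cX m z) (t ^+ n.+1)); first exact: (congr1 (cmp (cX m z)) pE).
transitivity (cmp (cX n 1) (t ^+ m.+1)); last exact: (congr1 (cmp (cX n 1)) (esym qE)).
rewrite !cE1 [ax (cX m z)]/= [ax (cX n 1)]/=.
by rewrite rmorph1 mul1r exprMn -rmorphXn /= zn rmorph1 mul1r -!exprM mulnC.
Qed.

End Principal.


(** * Blow-ups and strict transforms of curves *)

Section Blowup.
Variable R : realType.
Local Notation C := R[i].
Local Notation fps2 := (fps2 R).
Local Notation t := (fpsX C).
Implicit Types (f g h : fps2) (c z : C) (s u v : fps C) (gam del p q : parc R) (d : direction R) (b : bool) (G H : {poly C}).

(** A product of two nonunits has no term of degree less than two. *)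
Lemma smooth_irreducible f : at0 f = 0 -> smooth f -> irreducible f.
Proof.
move=> f0 sf; have f1 : ~ ordge 2 f.
  by move=> o; case: sf; rewrite ?at0_dx ?at0_dy; apply; apply: o.
split.
- by move=> fe; apply: f1 => i j _; rewrite fe coef2_0.
- by move=> /is_unitP; rewrite f0 eqxx.
move=> g h fgh; rewrite !is_unitP; apply/orP; rewrite -negb_and; apply/negP => /andP[/eqP g0 /eqP h0].
by apply: f1; rewrite fgh; apply: (@ordgeM R 1 1); apply: ordge1.
Qed.

Fact zero0 : (0 : fps C) 0%N == 0. Proof. by rewrite fps_coef0. Qed.
(* Axis b: the component y = 0 if b is true, x = 0 otherwise. *)
Definition axarc b : parc R := if b then Arc (t0 R) zero0 else Arc zero0 (t0 R).
Definition axeq b : fps2 := if b then Y R else X R.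

Lemma axeq0 b : at0 (axeq b) = 0. Proof. by case: b; rewrite /= ?at0_X ?at0_Y. Qed.
Lemma smooth_axeq b : smooth (axeq b).
Proof.
by case: b; [right; rewrite dy_Y|left; rewrite dx_X]; rewrite at0_1; apply/eqP/oner_neq0.
Qed.
Lemma irreducible_axeq b : irreducible (axeq b).
Proof. by apply: smooth_irreducible; [exact: axeq0|exact: smooth_axeq]. Qed.
Lemma axeq_neq0 b : axeq b != 0.
Proof. by apply/eqP; have [] := irreducible_axeq b. Qed.
Lemma nonconst_axarc b : nonconst (axarc b).
Proof. by case: b; rewrite /nonconst /= fpsX_neq0 ?orbT. Qed.
Lemma pb_axeq b b' : pb (axarc b) (axeq b') = if b == b' then 0 else t.
Proof. by case: b; case: b'; rewrite /= ?pb_X ?pb_Y. Qed.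
Lemma fdvd_axeq b f : fdvd (axeq b) f <-> pb (axarc b) f = 0.
Proof.
apply: iff_sym; apply: ker_irreducible; first exact: nonconst_axarc.
  exact: irreducible_axeq.
by rewrite pb_axeq eqxx.
Qed.

Fact XY0 f g : at0 f == 0 -> at0 (f * g) == 0.
Proof. by rewrite at0M => /eqP ->; rewrite mul0r. Qed.
Definition bl d : chart R := match d with
  | Some c => Chart (introT eqP (at0_X R)) (XY0 (Y R + cst2 c) (introT eqP (at0_X R)))
  | None => Chart (XY0 (Y R) (introT eqP (at0_X R))) (introT eqP (at0_Y R))
  end.
(** The axis formed by the exceptional divisor at d, in the convention of [axarc]. *)
Definition eb d : bool := ~~ isSome d.
Notation exc d := (axeq (eb d)).
Notation earc d := (axarc (eb d)).

Lemma exceptionalE d : exceptional d = exc d. Proof. by case: d. Qed.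
Lemma blowup1 d : (blowup d).1 = cu (bl d). Proof. by case: d. Qed.
Lemma blowup2 d : (blowup d).2 = cv (bl d). Proof. by case: d. Qed.

(** The homogeneous part of degree n, dehomogenized at x = 1. *)
Definition lead n f : {poly C} := \poly_(j < n.+1) coef2 f (n - j) j.

Definition ptp (G : {poly C}) : fps C := Fps (fun i => G`_i).
Fact ptp_is_additive : additive ptp.
Proof. by move=> G H; apply: fpsP => i; rewrite fps_coefB /= coefB. Qed.
Fact ptp_is_multiplicative : multiplicative ptp.
Proof.
split=> [G H|]; apply: fpsP => i; first by rewrite fps_coefM /= coefM.
by rewrite fps_coef1 /= coef1.
Qed.
HB.instance Definition _ :=
  GRing.isZmodMorphism.Build {poly C} (fps C) ptp ptp_is_additive.
HB.instance Definition _ :=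
  GRing.isMonoidMorphism.Build {poly C} (fps C) ptp
    (ptp_is_multiplicative.2, ptp_is_multiplicative.1).
Lemma ptp_C c : ptp c%:P = fpsC c.
Proof. by apply: fpsP => -[|i]; rewrite /= coefC. Qed.
Lemma ptp_X : ptp 'X = t.
Proof. by apply: fpsP => i; rewrite /= coefX. Qed.

(* The germ at the point d of P^1 of the binary form of degree N with dehomogenization G. *)
Definition at_dir N (G : {poly C}) d : fps C :=
  if d is Some c then ptp (G \Po ('X + c%:P))
  else Fps (fun i => if (i <= N)%N then G`_(N - i) else 0).

Lemma at_dirD N G H d : at_dir N (G + H) d = at_dir N G d + at_dir N H d.
Proof.
case: d => [c|]; rewrite /=; first by rewrite comp_polyD rmorphD.
by apply: fpsP => i; rewrite fps_coefD /=; case: ifP; rewrite ?coefD ?addr0.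
Qed.
Lemma at_dirS N G H : (size G <= N.+1)%N ->
  at_dir N.+1 (G + 'X * H) None = t * at_dir N G None + at_dir N H None.
Proof.
move=> sG; apply: fpsP => i; rewrite fps_coefD fps_coefXM /= coefD coefXM.
case: i => [|i] /=; first by rewrite !subn0 add0r nth_default ?add0r.
rewrite !ltnS; have [iN|Ni] := leqP i N; last by rewrite ltnNge ltnW// addr0.
rewrite subSS; have [->|lt] := eqVneq i N; first by rewrite subnn ltnn eqxx.
have {lt}iN : (i < N)%N by rewrite ltn_neqAle lt.
by rewrite iN subn_eq0 leqNgt iN /= subnS.
Qed.

Lemma leadS n f : lead n.+1 (X R * fx f + Y R * fy f) = lead n (fx f) + 'X * lead n (fy f).
Proof.
apply/polyP => j; rewrite coefD coefXM !coef_poly.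
rewrite coef2D coef2_XM coef2_YM.
case: j => [|j] /=; first by rewrite !subn0 /= !addr0.
rewrite !ltnS subSS; have [jn|nj] := ltnP j n.+1; last first.
  by rewrite leqNgt nj /= ltnNge (ltnW nj) addr0.
rewrite ltnS in jn; rewrite jn; have [->|ne] := eqVneq j n; first by rewrite subnn ltnn.
have lt : (j < n)%N by rewrite ltn_neqAle ne.
by rewrite lt -(subnSK lt).
Qed.

Lemma ordge_fx n f : ordge n.+1 f -> ordge n (fx f).
Proof. by move=> o i j ij; rewrite coef2_fx o. Qed.
Lemma ordge_fy n f : ordge n.+1 f -> ordge n (fy f).
Proof. by move=> o [|i] j ij; rewrite coef2_fy ?o. Qed.

(** Induction along f = x [fx] + y [fy]: each factor x or y gives off one equation of the
    exceptional divisor, and [leadS] splits the initial form in the same way. *)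
Lemma blow_lead d n f : ordge n f -> exists2 f',
  sb (bl d) f = exc d ^+ n * f' & pb (earc d) f' = at_dir n (lead n f) d.
Proof.
elim: n f => [|n IH] f o.
  exists (sb (bl d) f); first by rewrite expr0 mul1r.
  rewrite -pb_push; have -> : lead 0 f = (at0 f)%:P.
    by apply/polyP => -[|j]; rewrite coef_poly coefC.
  have p0 : ax (push (bl d) (earc d)) = 0 /\ ay (push (bl d) (earc d)) = 0.
    case: d => [c|] /=; rewrite ?pb_X ?pb_Y ?rmorphM /= ?pb_X ?pb_Y ?mul0r ?mulr0//.
  rewrite pb_decomp p0.1 p0.2 !mul0r !addr0; case: d {p0} => [c|] /=.
    by rewrite comp_polyC ptp_C.
  by apply: fpsP => -[|i] /=; rewrite ?coefC.
have f0 : at0 f = 0 by apply: o.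
have [f1 e1 p1] := IH _ (ordge_fx o); have [f2 e2 p2] := IH _ (ordge_fy o).
have fE : f = X R * fx f + Y R * fy f.
  by rewrite {1}[f]fps2_decomp f0 rmorph0 add0r.
have sE : sb (bl d) f = cu (bl d) * (exc d ^+ n * f1) + cv (bl d) * (exc d ^+ n * f2).
  by rewrite {1}fE rmorphD !rmorphM /= sb_X sb_Y e1 e2.
have lE := leadS n f; rewrite -fE in lE; rewrite lE {fE lE IH e1 e2}.
case: d p1 p2 sE => [c|] /= p1 p2 ->.
  exists (f1 + (Y R + cst2 c) * f2).
    by rewrite exprS; move: (X R ^+ n) (Y R + cst2 c) (X R) => *; ring.
  rewrite rmorphD rmorphM /= rmorphD /= pb_Y pb_cst p1 p2 comp_polyD comp_polyM comp_polyX.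
  by rewrite rmorphD rmorphM /= rmorphD /= ptp_X ptp_C.
exists (X R * f1 + f2); first by rewrite exprS; move: (Y R ^+ n) (Y R) (X R) => *; ring.
rewrite rmorphD rmorphM /= pb_X p1 p2; apply: esym.
exact: (at_dirS (lead n (fy f)) (size_poly _ _)).
Qed.

(** A binary form of degree N has N zeros on the projective line: the roots of G, and the direction
    x = 0 with multiplicity N - deg G. Sums run over finite lists containing [ds0], so that several
    such counts can share one list. *)
Lemma sum_at_dir N G : G != 0 -> (size G <= N.+1)%N ->
  (forall d, at_dir N G d != 0) /\ exists ds0 : seq (direction R),
   (forall d, d \notin ds0 -> ord (at_dir N G d) = 0%N) /\
   forall ds : seq (direction R), uniq ds -> {subset ds0 <= ds} ->
     (\sum_(d <- ds) ord (at_dir N G d))%N = N.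
Proof.
move=> G0 sG; have [r Gr] := closed_field_poly_normal G.
have lc0 : lead_coef G != 0 by rewrite lead_coef_eq0.
have sr : size G = (size r).+1.
  by rewrite Gr size_scale ?size_prod_XsubC.
have rN : (size r <= N)%N by rewrite -ltnS -sr.
have atS c : at_dir N G (Some c) != 0 /\
    ord (at_dir N G (Some c)) = (\sum_(z <- r) (Some c == Some z :> direction R))%N.
  rewrite /= {1 2}Gr linearZ /= -mul_polyC rmorphM /= ptp_C rmorph_prod /= rmorph_prod /=.
  have lin z : ptp (('X - z%:P) \Po ('X + c%:P)) = t + fpsC (c - z).
    by rewrite comp_polyB comp_polyX comp_polyC -addrA -polyCB rmorphD /= ptp_X ptp_C.
  have lin0 z : t + fpsC (c - z) != 0.
    by apply: (@neq0_coef _ _ 1); rewrite fps_coefD /= addr0 oner_neq0.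
  have ol z : ord (t + fpsC (c - z)) = (Some c == Some z :> direction R).
    have [[->]|ne] := eqVneq (Some c) (Some z); first by rewrite subrr rmorph0 addr0 ord_fpsX.
    apply: ord_unit; rewrite fps_coefD /= add0r subr_eq0.
    by apply: contra_neq ne => ->.
  have fc : fpsC (lead_coef G) != 0 by apply: (@neq0_coef _ _ 0).
  under eq_bigr do rewrite lin.
  have pr : \prod_(z <- r) (t + fpsC (c - z)) != 0.
    by rewrite prodf_seq_neq0; apply/allP => z _; rewrite lin0.
  split; first by rewrite mulf_neq0.
  rewrite ordM// (@ord_unit _ (fpsC _)) ?add0n//.
  elim: (r) pr => [|z r' IH] pr; first by rewrite !big_nil ord_one.
  move: pr; rewrite !big_cons mulf_eq0 negb_or => /andP[a0 b0].
  by rewrite ordM// ol IH.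
have cN k : (k < N - size r)%N -> G`_(N - k) = 0.
  by move=> kl; rewrite nth_default// sr; lia.
have oN : vge (N - size r) (at_dir N G None) /\ at_dir N G None (N - size r)%N != 0.
  split=> [k kl|] /=; first by rewrite cN// if_same.
  by rewrite leq_subr subKn// -[size r]/(size r).+1.-1 -sr -lead_coefE.
split.
  by case=> [c|]; [have [] := atS c|exact: neq0_coef oN.2].
have oE d : ord (at_dir N G d) = (\sum_(z <- r) (d == Some z) + (d == None) * (N - size r))%N.
  case: d => [c|]; first by rewrite mul0n addn0; have [] := atS c.
  rewrite (ord_eq oN.1 oN.2) big1 ?mul1n//.
exists (None :: map Some r); split=> [d|ds du sub].
  rewrite inE negb_or oE => /andP[/negPf-> dr]; rewrite mul0n addn0 big_seq big1// => z zr.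
  by case: eqP dr => // ->; rewrite map_f.
under eq_bigr do rewrite oE.
have c1 (d0 : direction R) : d0 \in ds -> (\sum_(d <- ds) (d == d0))%N = 1%N.
  move=> din; transitivity (count_mem d0 ds); last by rewrite count_uniq_mem ?din.
  by rewrite -sum1_count [RHS]big_mkcond; apply: eq_bigr => d _ /=; case: (d == d0).
rewrite big_split /= exchange_big /= big_seq (eq_bigr (fun=> 1%N)) => [|z zr]; last first.
  by apply: c1; apply: sub; rewrite inE map_f ?orbT.
rewrite -big_seq sum1_size -big_distrl /= c1 ?mul1n ?subnKC//.
by apply: sub; rewrite inE eqxx.
Qed.

Definition mlt f : nat := xget 0%N [set n | ordge n f /\ ~ ordge n.+1 f].

Lemma mltP f : f != 0 -> ordge (mlt f) f /\ lead (mlt f) f != 0.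
Proof.
move=> f0; have [n fn] : exists n, `[< ~ ordge n f >].
  apply: contrapT => nn; case/eqP: f0; apply: ordge_eq0 => n.
  by apply: contrapT => fn; apply: nn; exists n; apply/asboolP.
have exn : exists n, `[< ~ ordge n f >] by exists n.
have [m [om nm]] : exists m, ordge m f /\ ~ ordge m.+1 f.
  case: (ex_minnP exn) => -[/asboolP n0|m /asboolP nm mmin]; first by case: n0.
  exists m; split=> //.
  by apply: contrapT => /asboolP/mmin; rewrite ltnn.
rewrite /mlt; case: xgetP => [k _ [ok nk]|/(_ m)]; last by case.
split=> //; apply/eqP => l0; apply: nk => i j; rewrite ltnS leq_eqVlt => /orP[/eqP ij|]; last exact: ok.
have := congr1 (fun p : {poly C} => p`_j) l0; rewrite coef_poly coef0 ltnS -ij leq_addl.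
by rewrite addnK.
Qed.

Lemma exc_factor d k l f g : exc d ^+ k * f = exc d ^+ l * g ->
  ~ fdvd (exc d) f -> ~ fdvd (exc d) g -> k = l /\ f = g.
Proof.
move=> e nf ng; have cancel m (a b : fps2) : exc d ^+ m * a = exc d ^+ m * b -> a = b.
  by apply: mulfI; rewrite expf_neq0// axeq_neq0.
case: (ltngtP k l) => [kl|lk|kl].
- case: nf; exists (exc d ^+ (l - k.+1) * g).
  by apply: (cancel k); rewrite e mulrA mulrA -exprSr -exprD subnKC.
- case: ng; exists (exc d ^+ (k - l.+1) * f).
  by apply: (cancel l); rewrite -e mulrA mulrA -exprSr -exprD subnKC.
- by split=> //; apply: (cancel k); rewrite e kl.
Qed.

(** [blow_lead] provides a candidate, whose restriction to the divisor is nonzero, and [exc_factor]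
    shows that the chosen strict transform is this candidate. *)
Lemma strict_eqP d f : f != 0 ->
  [/\ sb (bl d) f = exc d ^+ mlt f * strict_eq1 d f,
      ~ fdvd (exc d) (strict_eq1 d f) &
      pb (earc d) (strict_eq1 d f) = at_dir (mlt f) (lead (mlt f) f) d].
Proof.
move=> /mltP[o l0]; have [f' e p] := blow_lead d o.
have [at0 _] := sum_at_dir l0 (size_poly _ _).
have nf' : ~ fdvd (exc d) f' by move/fdvd_axeq; rewrite p; apply/eqP.
suff -> : strict_eq1 d f = f' by [].
rewrite /strict_eq1; case: xgetP => [g _ [k]|/(_ f') []]; last first.
  exists (mlt f); rewrite exceptionalE; last exact: nf'.
  by rewrite blowup1 blowup2 substE; exact: e.
rewrite exceptionalE blowup1 blowup2 substE e => eg ng.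
by have [] := exc_factor eg nf' ng.
Qed.

End Blowup.


(** * The order of a pair of series *)

Section Order2.
Variable A : idomainType.
Implicit Types a b k : fps A.

(** The smaller of the two orders, which is the order of a generic combination of a and b; polar
    numbers have this form. *)
Definition ord2 a b : nat :=
  xget 0%N [set n | [/\ vge n a, vge n b & a n <> 0 \/ b n <> 0]].

Lemma ord2_eq n a b : vge n a -> vge n b -> a n <> 0 \/ b n <> 0 -> ord2 a b = n.
Proof.
move=> an bn ab; rewrite /ord2; case: xgetP => [m _ [am bm ab']|/(_ n)]; last by case.
case: (ltngtP m n) => // lt; first by case: ab'; rewrite ?(an _ lt) ?(bn _ lt).
by case: ab; rewrite ?(am _ lt) ?(bm _ lt).
Qed.

Lemma ord2P a b : (a != 0) || (b != 0) ->
  [/\ vge (ord2 a b) a, vge (ord2 a b) b & a (ord2 a b) <> 0 \/ b (ord2 a b) <> 0].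
Proof.
move=> ab; suff [n [an bn nab]] : exists n, [/\ vge n a, vge n b & a n <> 0 \/ b n <> 0].
  by rewrite (ord2_eq an bn nab).
have [a0|a0] := eqVneq a 0.
  move: ab; rewrite a0 eqxx => /ordP[vb /eqP b0].
  by exists (ord b); split=> //; [exact: vge_0|right].
have [va /eqP a1] := ordP a0.
have [b0|b0] := eqVneq b 0.
  by exists (ord a); split=> //; [rewrite b0; exact: vge_0|left].
have [vb /eqP b1] := ordP b0; have [le|lt] := leqP (ord a) (ord b).
  by exists (ord a); split=> //; [exact: vge_le vb|left].
by exists (ord b); split=> //; [exact: vge_le (ltnW lt) va|right].
Qed.

Lemma ord2M k a b : k != 0 -> (a != 0) || (b != 0) ->
  ord2 (k * a) (k * b) = (ord k + ord2 a b)%N.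
Proof.
move=> k0 /ord2P[va vb ab]; have [vk /eqP k1] := ordP k0.
apply: ord2_eq; [exact: vgeM|exact: vgeM|].
rewrite !vge_lead//; case: ab => h; [left|right] => /eqP;
by rewrite mulf_eq0 => /orP[]/eqP.
Qed.

Lemma ord2_0r a : a != 0 -> ord2 a 0 = ord a.
Proof.
by move=> /ordP[va /eqP a0]; apply: ord2_eq; [|exact: vge_0|left].
Qed.
Lemma ord2_0l a : a != 0 -> ord2 0 a = ord a.
Proof.
by move=> /ordP[va /eqP a0]; apply: ord2_eq; [exact: vge_0| |right].
Qed.

Lemma ord2_propr k l a b c e : k != 0 -> l != 0 ->
  (a != 0) || (b != 0) -> (c != 0) || (e != 0) ->
  k * a = l * c -> k * b = l * e -> (ord k + ord2 a b = ord l + ord2 c e)%N.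
Proof. by move=> k0 l0 ab ce ka kb; rewrite -!ord2M// ka kb. Qed.

Lemma ord2_gt0 a b : (a != 0) || (b != 0) -> a 0%N = 0 -> b 0%N = 0 -> (0 < ord2 a b)%N.
Proof.
move=> /ord2P[va vb ab] a0 b0; case: posnP => // o.
by move: ab; rewrite o a0 b0 => -[].
Qed.

Lemma ord2_eq0 a b : a 0%N <> 0 \/ b 0%N <> 0 -> ord2 a b = 0%N.
Proof. by move=> ab; apply: ord2_eq. Qed.

Lemma ord2_1P a b : (a != 0) || (b != 0) -> a 0%N = 0 -> b 0%N = 0 ->
  ord2 a b = 1%N <-> a 1%N <> 0 \/ b 1%N <> 0.
Proof.
move=> ab a0 b0; split=> [o|ab1]; first by have [] := ord2P ab; rewrite o.
by apply: ord2_eq => //; apply: vge1.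
Qed.

End Order2.

(** * Strict transforms of forms *)

Section BlowupForm.
Variable R : realType.
Local Notation C := R[i].
Local Notation fps2 := (fps2 R).
Local Notation t := (fpsX C).
Implicit Types (f g h : fps2) (c z : C) (s u v : fps C) (gam del p q : parc R) (d : direction R) (b : bool) (G H : {poly C}) (w : Defs.form R).
Notation exc d := (axeq R (eb d)).
Notation earc d := (axarc R (eb d)).

Definition nzform w := (w.1 != 0) || (w.2 != 0).
Definition nzon gam w := (pb gam w.1 != 0) || (pb gam w.2 != 0).
(* Components of a form tangent and transverse to the axis b. *)
Definition tcomp b w : fps2 := if b then w.1 else w.2.
Definition ncomp b w : fps2 := if b then w.2 else w.1.
Definition ordon gam w : nat := ord2 (pb gam w.1) (pb gam w.2).
Definition dform f : Defs.form R := (dx f, dy f).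
Definition wedge w f : fps2 := w.1 * dy f - w.2 * dx f.

Lemma nzon_nzform gam w : nzon gam w -> nzform w.
Proof.
by move=> /orP[] h; apply/orP; [left|right]; apply: contra_neq h => ->; rewrite rmorph0.
Qed.

Lemma exc_factor2 d k l w w' :
  exc d ^+ k * w.1 = exc d ^+ l * w'.1 -> exc d ^+ k * w.2 = exc d ^+ l * w'.2 ->
  ~ (fdvd (exc d) w.1 /\ fdvd (exc d) w.2) ->
  ~ (fdvd (exc d) w'.1 /\ fdvd (exc d) w'.2) -> k = l /\ w = w'.
Proof.
case: w w' => [a b] [a' b'] /= e1 e2 nf ng.
have cancel m (x y : fps2) : exc d ^+ m * x = exc d ^+ m * y -> x = y.
  by apply: mulfI; rewrite expf_neq0// axeq_neq0.
have dv m n (x y : fps2) : (m < n)%N -> exc d ^+ m * x = exc d ^+ n * y -> fdvd (exc d) x.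
  move=> mn e; exists (exc d ^+ (n - m.+1) * y).
  by apply: (cancel m); rewrite e mulrA mulrA -exprSr -exprD subnKC.
case: (ltngtP k l) => [kl|lk|kl].
- by case: nf; split; [exact: (dv k l _ _ kl e1)|exact: (dv k l _ _ kl e2)].
- by case: ng; split; [exact: (dv l k _ _ lk (esym e1))|exact: (dv l k _ _ lk (esym e2))].
- rewrite -kl in e1 e2; by rewrite (cancel _ _ _ e1) (cancel _ _ _ e2).
Qed.

Definition mltw w : nat := xget 0%N
  [set n | [/\ ordge n w.1, ordge n w.2 & ~ (ordge n.+1 w.1 /\ ordge n.+1 w.2)]].
Definition leadP w : {poly C} := lead (mltw w) w.1.
Definition leadQ w : {poly C} := lead (mltw w) w.2.
(** The initial part of x [w.1] + y [w.2] at x = 1, that is, the tangent cone; when it vanishes the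
    blow-up is dicritical and the pull-back gains one more factor. *)
Definition tcone w : {poly C} := leadP w + 'X * leadQ w.
Definition dicb w : bool := tcone w == 0.
(* The exponent of the exceptional divisor in the pull-back of w. *)
Definition mexp w : nat := (mltw w + dicb w)%N.

Lemma lead_eq0 n f : ordge n f -> lead n f = 0 -> ordge n.+1 f.
Proof.
move=> ok l0 i j; rewrite ltnS leq_eqVlt => /orP[/eqP ij|]; last exact: ok.
have := congr1 (fun p : {poly C} => p`_j) l0; rewrite coef_poly coef0 ltnS -ij leq_addl.
by rewrite addnK.
Qed.

Lemma mltwP w : nzform w ->
  [/\ ordge (mltw w) w.1, ordge (mltw w) w.2 & (leadP w != 0) || (leadQ w != 0)].
Proof.
move=> w0; have exn : exists n, `[< ~ (ordge n w.1 /\ ordge n w.2) >].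
  apply: contrapT => nn; have o n : ordge n w.1 /\ ordge n w.2.
    by apply: contrapT => fn; apply: nn; exists n; apply/asboolP.
  have e1 : w.1 = 0 by apply: ordge_eq0 => n; have [] := o n.
  have e2 : w.2 = 0 by apply: ordge_eq0 => n; have [] := o n.
  by move: w0; rewrite /nzform e1 e2 eqxx.
have [m [o1 o2 nm]] : exists m, [/\ ordge m w.1, ordge m w.2 & ~ (ordge m.+1 w.1 /\ ordge m.+1 w.2)].
  case: (ex_minnP exn) => -[/asboolP n0|m /asboolP nm mmin]; first by case: n0.
  have [o1 o2] : ordge m w.1 /\ ordge m w.2.
    by apply: contrapT => /asboolP/mmin; rewrite ltnn.
  by exists m.
rewrite /leadP /leadQ /mltw; case: xgetP => [k _ [ok1 ok2 nk]|/(_ m)]; last by case.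
split=> //; rewrite -negb_and; apply/negP => /andP[/eqP l1 /eqP l2]; apply: nk.
by split; apply: lead_eq0.
Qed.

Lemma size_tcone w : (size (tcone w) <= (mltw w).+2)%N.
Proof.
apply: leq_trans (size_polyD _ _) _; rewrite geq_max.
rewrite (leq_trans (size_poly _ _))//= (leq_trans (size_polyMleq _ _))// size_polyX /=.
by rewrite ltnS size_poly.
Qed.

(** The vanishing of the tangent cone means [leadP] = - X [leadQ]; as [leadP] has degree at most the
    multiplicity, [leadQ] has one degree less. *)
Lemma dicb_leadQ w : nzform w -> dicb w ->
  [/\ (0 < mltw w)%N, leadQ w != 0 & (size (leadQ w) <= mltw w)%N].
Proof.
move=> /mltwP[_ _ PQ] /eqP R0; have PE : leadP w = - ('X * leadQ w).
  by apply/eqP; rewrite -addr_eq0; exact/eqP.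
have Q0 : leadQ w != 0.
  by apply: contraTneq PQ => Q0; rewrite PE Q0 mulr0 oppr0 eqxx.
have sQ : (size (leadQ w) <= mltw w)%N.
  have sP : (size (leadP w) <= (mltw w).+1)%N by exact: size_poly.
  by move: sP; rewrite PE size_polyN mulrC size_mulX // ltnS.
split=> //; apply: leq_trans sQ; by rewrite lt0n size_poly_eq0.
Qed.

Lemma at_dir_neq0 N G d : G != 0 -> (size G <= N.+1)%N -> at_dir N G d != 0.
Proof. by move=> G0 sG; have [] := sum_at_dir G0 sG. Qed.

Lemma axeq_dvd b f : pb (axarc R b) f = 0 -> exists g, f = axeq R b * g.
Proof. by move=> /fdvd_axeq. Qed.

(** [blow_lead] restricts the coefficients of the pull-back to the exceptional divisor, and
    [exc_factor2] identifies the chosen strict transform. The third nondicritical equation prepares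
    the Camacho-Sad index. *)
Lemma strict_formP d w : nzform w ->
  [/\ pull (bl d) w = (exc d ^+ mexp w * (strict_form1 d w).1,
                       exc d ^+ mexp w * (strict_form1 d w).2),
    dicb w = false -> [/\ pb (earc d) (tcomp (eb d) (strict_form1 d w)) = 0,
      pb (earc d) (ncomp (eb d) (strict_form1 d w)) = at_dir (mltw w).+1 (tcone w) d &
      pb (earc d) (if eb d then dy (strict_form1 d w).1 else dx (strict_form1 d w).2)
        = at_dir (mltw w) (if d is Some _ then leadQ w else leadP w) d] &
    dicb w -> pb (earc d) (tcomp (eb d) (strict_form1 d w))
      = (-1) ^+ (eb d) * at_dir (mltw w).-1 (leadQ w) d].
Proof.
move=> w0; have [o1 o2 PQ] := mltwP w0.
have [a ea pa] := blow_lead d o1; have [b ebb pb'] := blow_lead d o2.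
rewrite -/(leadP w) in pa; rewrite -/(leadQ w) in pb'.
set n := mltw w in ea ebb pa pb' *.
suff [w' [pw nw iw dw]] : exists w', [/\ pull (bl d) w = (exc d ^+ mexp w * w'.1, exc d ^+ mexp w * w'.2),
    ~ (fdvd (exc d) w'.1 /\ fdvd (exc d) w'.2),
    dicb w = false -> [/\ pb (earc d) (tcomp (eb d) w') = 0,
      pb (earc d) (ncomp (eb d) w') = at_dir n.+1 (tcone w) d &
      pb (earc d) (if eb d then dy w'.1 else dx w'.2)
        = at_dir n (if d is Some _ then leadQ w else leadP w) d] &
    dicb w -> pb (earc d) (tcomp (eb d) w')
      = (-1) ^+ (eb d) * at_dir n.-1 (leadQ w) d].
  suff -> : strict_form1 d w = w' by [].
  rewrite /strict_form1; case: xgetP => [w'' _ [k]|/(_ w') []]; last first.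
    exists (mexp w); rewrite exceptionalE; last exact: nw.
    by rewrite blowup1 blowup2 pullbackE; exact: pw.
  rewrite exceptionalE blowup1 blowup2 pullbackE pw => e nw''.
  have /= e1 := congr1 fst e; have /= e2 := congr1 snd e.
  by have [_ ->] := exc_factor2 e1 e2 nw nw''.
have sR := size_tcone w; rewrite -/n in sR.
have [R0|R0] := boolP (dicb w); last first.
  have Rat : at_dir n.+1 (tcone w) d != 0 by apply: at_dir_neq0.
  rewrite /mexp (negPf R0) addn0.
  case: d a b ea ebb pa pb' Rat => [c|] a b /= ea ebb pa pb' Rat.
    exists (a + (Y R + cst2 c) * b, X R * b); split=> /=.
    - rewrite /pull /= ea ebb !dxM !dyM !dxD !dyD dx_X dy_X dx_Y dy_Y dx_cst dy_cst.
      by congr (_, _); move: (Y R + cst2 c) (X R) => *; ring.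
    - move=> [/(fdvd_axeq false _).1]; rewrite /= !rmorphD !rmorphM /= !rmorphD /= pb_Y pb_cst.
      rewrite pa pb' => h _; case/eqP: Rat; rewrite -h /tcone /=.
      by rewrite comp_polyD comp_polyM comp_polyX rmorphD rmorphM rmorphD /= ptp_X ptp_C.
    - move=> _; split; first by rewrite rmorphM /= pb_X mul0r.
        rewrite !rmorphD !rmorphM /= !rmorphD /= pb_Y pb_cst pa pb' /tcone /=.
        by rewrite comp_polyX rmorphD /= ptp_X ptp_C.
      by rewrite dxM dx_X mul1r rmorphD rmorphM /= pb_X mul0r addr0.
    - by [].
  have Re : pb (axarc R true) (X R * a + b) = at_dir n.+1 (tcone w) None.
    rewrite rmorphD rmorphM /= pb_X /= pa pb'; apply: esym.
    exact: (at_dirS (leadQ w) (size_poly _ _)).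
  exists (Y R * a, X R * a + b); split=> /=.
  - rewrite /pull /= ea ebb !dxM !dyM dx_X dy_X dx_Y dy_Y.
    by congr (_, _); move: (Y R) (X R) => *; ring.
  - move=> [_ /(fdvd_axeq true _).1] /=; rewrite Re => h; case/eqP: Rat; exact: h.
  - move=> _; split; [by rewrite rmorphM /= pb_Y mul0r|exact: Re|].
    by rewrite dyM dy_Y mul1r rmorphD rmorphM /= pb_Y mul0r addr0.
  - by [].
have [n0 Q0 sQ] := dicb_leadQ w0 R0; rewrite -/n in n0 sQ.
have sQ' : (size (leadQ w) <= n.-1.+1)%N by rewrite prednK.
have Qat : at_dir n.-1 (leadQ w) d != 0 by apply: at_dir_neq0.
have PE : leadP w = - ('X * leadQ w).
  by apply/eqP; rewrite -addr_eq0; exact: R0.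
rewrite /mexp R0 /= addn1.
case: d a b ea ebb pa pb' Qat => [c|] a b /= ea ebb pa pb' Qat.
  have [a' a'E] : exists g, a + (Y R + cst2 c) * b = X R * g.
    apply: (@axeq_dvd false); rewrite rmorphD rmorphM rmorphD /= pb_Y pb_cst pa pb' /=.
    rewrite PE (raddfN (comp_poly ('X + c%:P))) (raddfN (@ptp R)) /= comp_polyM comp_polyX rmorphM rmorphD /= ptp_X ptp_C.
    by move: (ptp _) (t + _) => *; ring.
  exists (a', b); split=> /=.
  - rewrite /pull /= ea ebb !dxM !dyM !dxD !dyD dx_X dy_X dx_Y dy_Y dx_cst dy_cst.
    congr (_, _); last by rewrite exprS; move: (Y R + cst2 c) (X R) => *; ring.
    rewrite [in RHS]exprSr -[RHS]mulrA -a'E; move: (Y R + cst2 c) (X R) => *; ring.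
  - by move=> [_ /(fdvd_axeq false _).1] /=; rewrite pb' => h; case/eqP: Qat; exact: h.
  - by [].
  - by move=> _; rewrite mul1r pb'.
(* At x = 0 the tangential component comes from [leadP] = - X [leadQ]; this is the origin of the
   sign, and the factor X lowers the degree of the reversal to n - 1. *)
have aE : at_dir n (leadP w) None = - at_dir n.-1 (leadQ w) None.
  apply: fpsP => i; rewrite fps_coefN /= PE coefN coefXM.
  case: leqP => lei; last by rewrite leqNgt (leq_ltn_trans _ lei) ?leq_pred ?oppr0.
  rewrite subn_eq0; case: leqP => ni; first by rewrite leqNgt prednK// ni oppr0.
  by rewrite -ltnS prednK// ni -!subn1 -!subnDA addnC.
have [b' b'E] : exists g, X R * a + b = Y R * g.
  apply: (@axeq_dvd true); rewrite rmorphD rmorphM /= pb_X /= pa pb'.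
  have := at_dirS (leadQ w) (size_poly n.+1 (fun j => coef2 w.1 (n - j) j)).
  rewrite -/(lead n w.1) -[lead n w.1]/(leadP w) -[leadP w + _]/(tcone w) (eqP R0) => h.
  apply: etrans (esym h) _; apply: fpsP => i; rewrite fps_coef0 /= coef0.
  by case: ifP.
exists (a, b'); split=> /=.
- rewrite /pull /= ea ebb !dxM !dyM dx_X dy_X dx_Y dy_Y.
  congr (_, _); first by rewrite exprS; move: (Y R) (X R) => *; ring.
  rewrite [in RHS]exprSr -[RHS]mulrA -b'E; move: (Y R) (X R) => *; ring.
- move=> [/(fdvd_axeq true _).1 h _]; case/eqP: Qat.
  by apply/eqP; rewrite -oppr_eq0; apply/eqP; exact: etrans (esym (etrans pa aE)) h.
- by [].
- by move=> _; rewrite expr1 mulN1r; exact: etrans pa aE.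
Qed.

End BlowupForm.


(** * Lifting arcs, curves and forms through blow-ups *)

Section Transport.
Variable R : realType.
Local Notation C := R[i].
Local Notation fps2 := (fps2 R).
Local Notation t := (fpsX C).
Implicit Types (f g h : fps2) (c z : C) (s u v : fps C) (gam del p : parc R) (d : direction R) (b : bool) (w : Defs.form R) (q r : Defs.point R).
Notation exc d := (axeq R (eb d)).
Notation earc d := (axarc R (eb d)).

(** For an arc outside the exceptional divisor the quotient of the coordinates gives both the
    direction, as its value at t = 0, and the new coordinate. *)
Lemma lift_uniq d d' gam del : pb gam (exc d) != 0 -> pb del (exc d') != 0 ->
  push (bl d) gam = push (bl d') del -> d = d' /\ gam = del.
Proof.
move=> g0 d0 e.
have ex : pb gam (cu (bl d)) = pb del (cu (bl d')) := congr1 (@ax R) e.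
have ey : pb gam (cv (bl d)) = pb del (cv (bl d')) := congr1 (@ay R) e.
case: d d' g0 d0 ex ey {e} => [c|] [c'|] /=; rewrite ?pbM ?pbD ?pb_X ?pb_Y ?pb_cst => g0 d0.
- move=> ex; rewrite ex => /(mulfI d0) e.
  have ec : c = c'.
    have := congr1 (fun v : fps C => v 0%N) e.
    by rewrite !fps_coefD (eqP (ay0 gam)) (eqP (ay0 del)) !add0r.
  by split; [rewrite ec|apply: parcP => //; move: e; rewrite ec => /addIr].
- move=> ex ey; have e : 1 = ax del * (ay gam + fpsC c).
    apply: (mulfI d0); rewrite mulr1 mulrA -[_ * ax del]mulrC -ex; exact: esym ey.
  have := congr1 (fun v : fps C => v 0%N) e.
  by rewrite fps_coefM0 (eqP (ax0 del)) mul0r fps_coef1 => /eqP; rewrite oner_eq0.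
- move=> ex ey; have e : 1 = ax gam * (ay del + fpsC c').
    apply: (mulfI g0); rewrite mulr1 mulrA -[_ * ax gam]mulrC ex; exact: ey.
  have := congr1 (fun v : fps C => v 0%N) e.
  by rewrite fps_coefM0 (eqP (ax0 gam)) mul0r fps_coef1 => /eqP; rewrite oner_eq0.
- move=> ex ey; split=> //; apply: parcP => //; move: ex; rewrite ey.
  exact: mulIf.
Qed.

Lemma bl_det d : dx (cu (bl d)) * dy (cv (bl d)) - dy (cu (bl d)) * dx (cv (bl d)) = exc d.
Proof.
by case: d => [c|] /=; rewrite ?dxM ?dyM ?dxD ?dyD ?dx_cst ?dy_cst ?dx_X ?dx_Y ?dy_X ?dy_Y;
  move: (X R) (Y R) => x y; ring.
Qed.

Lemma push_nonconst d gam : pb gam (exc d) != 0 -> nonconst (push (bl d) gam).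
Proof.
by rewrite /nonconst; case: d => [c|] /= ->; rewrite ?orbT.
Qed.

Lemma push_rep (psi : chart R) gam p : push psi (rep gam p) = rep (push psi gam) p.
Proof. by apply: parcP; rewrite /= pb_rep. Qed.

(** The direction of the axis b: at [dir b :: q] the strict transform of this axis is again the axis
    b. *)
Definition dir b : direction R := if b then Some 0 else None.
Lemma eb_dir b : eb (dir b) = ~~ b. Proof. by case: b. Qed.
Lemma push_axarc b : push (bl (dir b)) (axarc R b) = axarc R b.
Proof.
by case: b; apply: parcP; rewrite /= ?pbM ?pbD ?pb_X ?pb_Y ?pb_cst /= ?raddf0 ?addr0 ?mulr0 ?mul0r.
Qed.

Lemma pb_strict d gam f : f != 0 ->
  pb (push (bl d) gam) f = pb gam (exc d) ^+ mlt f * pb gam (strict_eq1 d f).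
Proof. by move=> f0; rewrite pb_push; have [-> _ _] := strict_eqP d f0; rewrite pbM pbX. Qed.

Lemma strict_neq0 d f : f != 0 -> strict_eq1 d f != 0.
Proof.
move=> f0; have [_ nf _] := strict_eqP d f0.
by apply/eqP => e; apply: nf; exists 0; rewrite e mulr0.
Qed.

Lemma pull_strict d gam w : nzform w ->
  pb gam (pull (bl d) w).1 = pb gam (exc d) ^+ mexp w * pb gam (strict_form1 d w).1 /\
  pb gam (pull (bl d) w).2 = pb gam (exc d) ^+ mexp w * pb gam (strict_form1 d w).2.
Proof.
by move=> w0; have [e _ _] := strict_formP d w0; rewrite e /fst /snd; split; rewrite pbM pbX; reflexivity.
Qed.

Lemma tpb_blow d gam w : nzform w -> tpb (push (bl d) gam) w =
  pb gam (exc d) ^+ mexp w * tpb gam (strict_form1 d w).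
Proof.
move=> w0; rewrite tpb_push /tpb; have [-> ->] := pull_strict d gam w0.
by rewrite mulrDr !mulrA.
Qed.

Lemma pb_pull psi gam w :
  pb gam (pull psi w).1 = pb (push psi gam) w.1 * pb gam (dx (cu psi))
    + pb (push psi gam) w.2 * pb gam (dx (cv psi)) /\
  pb gam (pull psi w).2 = pb (push psi gam) w.1 * pb gam (dy (cu psi))
    + pb (push psi gam) w.2 * pb gam (dy (cv psi)).
Proof. by rewrite !pb_push /pull /= !pbD !pbM. Qed.

(** Cramer's rule: the Jacobian of the chart is the equation of the exceptional divisor, which is
    nonzero along the arc. *)
Lemma nzon_pull d gam w : pb gam (exc d) != 0 -> nzon (push (bl d) gam) w ->
  nzon gam (pull (bl d) w).
Proof.
move=> e0; have [] := pb_pull (bl d) gam w; rewrite /nzon.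
set a := pb _ w.1; set b := pb _ w.2 => -> ->.
have dt := congr1 (pb gam) (bl_det d); move: dt; rewrite pbB !pbM.
move: (pb gam (dx (cu _))) (pb gam (dx (cv _))) (pb gam (dy (cu _))) (pb gam (dy (cv _))).
move=> x1 x2 y1 y2 dt ab; apply: contraT => /norP[/negPn/eqP e1 /negPn/eqP e2].
have ea : pb gam (exc d) * a = 0.
  rewrite -dt (_ : _ * _ = (a * x1 + b * x2) * y2 - (a * y1 + b * y2) * x2); last by ring.
  by rewrite e1 e2 !mul0r subrr.
have ebb : pb gam (exc d) * b = 0.
  rewrite -dt (_ : _ * _ = (a * y1 + b * y2) * x1 - (a * x1 + b * x2) * y1); last by ring.
  by rewrite e1 e2 !mul0r subrr.
have a0 : a = 0 by apply: (mulfI e0); rewrite ea mulr0.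
have b0 : b = 0 by apply: (mulfI e0); rewrite ebb mulr0.
by move: ab; rewrite a0 b0 eqxx.
Qed.

Lemma nzon_strict d gam w : pb gam (exc d) != 0 -> nzon (push (bl d) gam) w ->
  nzon gam (strict_form1 d w).
Proof.
move=> e0 nz; have := nzon_pull e0 nz; rewrite /nzon.
have [-> ->] := pull_strict d gam (nzon_nzform nz).
by rewrite !mulf_eq0 !expf_eq0 (negPf e0) !andbF.
Qed.

Lemma pull_dform psi f : pull psi (dform f) = dform (sb psi f).
Proof. by rewrite /pull /dform /= sb_dx sb_dy. Qed.

(* Along an invariant arc, w and df are proportional, and the factor of
   proportionality is not changed by pull-back. *)
Lemma delta_blow d gam w f : f != 0 -> pb gam (exc d) != 0 ->
  nzon (push (bl d) gam) w -> nzon (push (bl d) gam) (dform f) ->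
  pb (push (bl d) gam) f = 0 -> pb (push (bl d) gam) (wedge w f) = 0 ->
  nzon gam (dform (strict_eq1 d f)) /\
  (ordon (push (bl d) gam) w + mlt f * ord (pb gam (exc d)) + ordon gam (dform (strict_eq1 d f)) =
   ordon (push (bl d) gam) (dform f) + mexp w * ord (pb gam (exc d)) + ordon gam (strict_form1 d w))%N.
Proof.
move=> f0 e0 nw nf pf pw; have nw' := nzon_strict e0 nw.
have pf' : pb gam (strict_eq1 d f) = 0.
  move: pf; rewrite (pb_strict d gam f0) => /eqP.
  by rewrite mulf_eq0 expf_eq0 (negPf e0) andbF => /eqP.
have [sE _ _] := strict_eqP d f0.
have dE (D : fps2 -> fps2) : (forall x y, D (x * y) = D x * y + x * D y) ->
    pb gam (D (sb (bl d) f)) = pb gam (exc d) ^+ mlt f * pb gam (D (strict_eq1 d f)).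
  by move=> DM; rewrite sE DM pbD !pbM pf' mulr0 add0r pbX.
have df1 := dE _ (@dxM R); have df2 := dE _ (@dyM R).
have np := nzon_pull e0 nf; rewrite pull_dform in np.
have nf' : nzon gam (dform (strict_eq1 d f)).
  by move: np; rewrite /nzon /= df1 df2 !mulf_eq0 !expf_eq0 (negPf e0) !andbF.
split=> //.
(* Two nonzero vectors with zero wedge: a coordinate that is nonzero for one is nonzero for the
   other, and these coordinates are the factors. *)
have [al [be [al0 be0 e1 e2]]] : exists al be : fps C, [/\ al != 0, be != 0,
    al * pb (push (bl d) gam) w.1 = be * pb (push (bl d) gam) (dx f) &
    al * pb (push (bl d) gam) w.2 = be * pb (push (bl d) gam) (dy f)].
  move: nw nf pw; rewrite /nzon /wedge pbB !pbM /=.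
  move: (pb _ w.1) (pb _ w.2) (pb _ (dx f)) (pb _ (dy f)) => a b fx fy ab fxy /subr0_eq e.
  have [fy0|fy0] := eqVneq fy 0.
    have fx0 : fx != 0 by move: fxy; rewrite fy0 eqxx orbF.
    exists fx, a; split=> //; [|exact: mulrC|by rewrite mulrC -e].
    apply/eqP => a0; move: e; rewrite a0 mul0r => /esym/eqP.
    by move: ab; rewrite a0 eqxx mulf_eq0 (negPf fx0) orbF => /negPf ->.
  exists fy, b; split=> //; [|by rewrite mulrC|exact: mulrC].
  apply/eqP => b0; move: e; rewrite b0 mul0r => /eqP.
  by move: ab; rewrite b0 eqxx orbF mulf_eq0 (negPf fy0) orbF => /negPf ->.
have o1 : (ord al + ordon (push (bl d) gam) w = ord be + ordon (push (bl d) gam) (dform f))%N.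
  exact: ord2_propr al0 be0 nw nf e1 e2.
have E0 k : pb gam (exc d) ^+ k != 0 by rewrite expf_neq0.
have [w1 w2] := pb_pull (bl d) gam w.
have [] := pb_pull (bl d) gam (dform f); rewrite pull_dform /= => f1 f2.
have [s1 s2] := pull_strict d gam (nzon_nzform nw).
have k1 : al * pb gam (exc d) ^+ mexp w * pb gam (strict_form1 d w).1 =
    be * pb gam (exc d) ^+ mlt f * pb gam (dx (strict_eq1 d f)).
  rewrite -mulrA -s1 w1 -mulrA -df1 f1 !mulrDr !mulrA e1 e2.
  by [].
have k2 : al * pb gam (exc d) ^+ mexp w * pb gam (strict_form1 d w).2 =
    be * pb gam (exc d) ^+ mlt f * pb gam (dy (strict_eq1 d f)).
  rewrite -mulrA -s2 w2 -mulrA -df2 f2 !mulrDr !mulrA e1 e2.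
  by [].
have o2 : (ord (al * pb gam (exc d) ^+ mexp w)%R + ordon gam (strict_form1 d w) =
    ord (be * pb gam (exc d) ^+ mlt f)%R + ordon gam (dform (strict_eq1 d f)))%N.
  exact: ord2_propr (mulf_neq0 al0 (E0 _)) (mulf_neq0 be0 (E0 _)) nw' nf' k1 k2.
have oE (a : fps C) k : a != 0 -> ord (a * pb gam (exc d) ^+ k) = (ord a + k * ord (pb gam (exc d)))%N.
  by move=> a0; rewrite (ordM a0 (E0 k)) (ordX k e0).
move: o1 o2; rewrite (oE _ _ al0) (oE _ _ be0).
move: (ordon (push (bl d) gam) w) (ordon (push (bl d) gam) (dform f)).
move: (ordon gam (strict_form1 d w)) (ordon gam (dform (strict_eq1 d f))).
move: (ord al) (ord be) (ord (pb gam (exc d))) => a1 a2 a3 a4 a5 a6 a7.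
lia.
Qed.

Fixpoint pushq q gam : parc R := if q is d :: r then pushq r (push (bl d) gam) else gam.

Lemma pushq_rep q gam p : pushq q (rep gam p) = rep (pushq q gam) p.
Proof. by elim: q gam => //= d q IH gam; rewrite push_rep IH. Qed.
Lemma pushq_cat q r gam : pushq (q ++ r) gam = pushq r (pushq q gam).
Proof. by elim: q gam => //=. Qed.

Definition axis_at q b : option (Defs.point R) := if b then (axes q).2 else (axes q).1.
(** The arc lies in no component of the divisor through q. This makes its image at the origin
    nonconstant and lets it be recovered from that image. *)
Definition offaxes q gam := forall b, axis_at q b -> pb gam (axeq R b) != 0.

Lemma axis_at_exc d q : axis_at (d :: q) (eb d) = Some q.
Proof. by case: d. Qed.
Lemma axis_at_dir b q : axis_at (dir b :: q) b = axis_at q b.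
Proof. by case: b; rewrite /= ?eqxx. Qed.
Lemma axis_at_cons d q b (s : Defs.point R) : axis_at (d :: q) b = Some s ->
  (b = eb d /\ s = q) \/ (d = dir b /\ axis_at q b = Some s).
Proof.
case: d b => [c|] [] /=; rewrite /axis_at /=.
- by case: eqP => // -> ?; right.
- by move=> [<-]; left.
- by move=> [<-]; left.
- by right.
Qed.

Lemma offaxes_exc d q gam : offaxes (d :: q) gam -> pb gam (exc d) != 0.
Proof. by apply; rewrite axis_at_exc. Qed.

Lemma offaxes_push d q gam : offaxes (d :: q) gam -> offaxes q (push (bl d) gam).
Proof.
move=> off b qb; have e0 := offaxes_exc off.
rewrite pb_push; case: d off e0 => [c|] off /= e0; case: b qb => qb /=; rewrite ?sb_X ?sb_Y //=.
- rewrite pbM mulf_neq0// pbD pb_Y pb_cst.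
  have [c0|c0] := eqVneq c 0.
    by rewrite c0 rmorph0 addr0 -pb_Y; apply: (off true); rewrite c0 /axis_at /= eqxx.
  by apply: (@neq0_coef _ _ 0); rewrite fps_coefD (eqP (ay0 gam)) add0r.
- by rewrite pbM mulf_neq0//; exact: (off false).
Qed.

Lemma offaxes_pushq q r gam : offaxes (q ++ r) gam -> offaxes r (pushq q gam).
Proof. by elim: q gam => //= d q IH gam /offaxes_push/IH. Qed.

Lemma offaxes_rep q gam p : ax p != 0 -> offaxes q gam -> offaxes q (rep gam p).
Proof.
by move=> p0 off b qb; rewrite pb_rep; apply: contra_neq (off b qb) => /(cmp_eq0 p0).
Qed.

Lemma pushq_nonconst q gam : nonconst gam -> offaxes q gam -> nonconst (pushq q gam).
Proof.
elim: q gam => //= d q IH gam _ off; apply: IH; last exact: offaxes_push off.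
exact/push_nonconst/(offaxes_exc off).
Qed.

(** The directions are read from the origin, that is, from the end of the lists; by [lift_uniq] they
    agree as long as both lists last. *)
Lemma lifts_comparable q (q' : Defs.point R) r gam del : offaxes (q ++ r) gam -> offaxes (q' ++ r) del ->
  pushq q gam = pushq q' del -> (exists s : Defs.point R, q = s ++ q') \/ (exists s : Defs.point R, q' = s ++ q).
Proof.
elim/last_ind: q q' r => [|q d IH] q' r; first by right; exists q'; rewrite cats0.
case/lastP: q' => [|q' d']; first by left; exists (rcons q d); rewrite cats0.
rewrite !cat_rcons -!cats1 !pushq_cat /= => og od e.
have [ed eg] := lift_uniq (offaxes_exc (offaxes_pushq og)) (offaxes_exc (offaxes_pushq od)) e.
rewrite -ed in od *; case: (IH q' (d :: r) og od eg) => -[s ->]; [left|right];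
by exists s; rewrite catA.
Qed.

Lemma strict_eq_neq0 f q : f != 0 -> strict_eq f q != 0.
Proof. by move=> f0; elim: q => //= d q; exact: strict_neq0. Qed.

Lemma pb_strict_eq f q gam : f != 0 -> offaxes q gam ->
  pb gam (strict_eq f q) = 0 <-> pb (pushq q gam) f = 0.
Proof.
move=> f0; elim: q gam => [|d q IH] gam off; first exact: iff_refl.
rewrite [strict_eq _ _]/= [pushq _ _]/=.
apply: iff_trans (IH _ (offaxes_push off)).
rewrite [X in _ <-> X = 0](pb_strict d gam (strict_eq_neq0 q f0)).
split=> [->|/eqP]; first exact: mulr0.
by rewrite mulf_eq0 expf_eq0 (negPf (offaxes_exc off)) andbF => /eqP.
Qed.

Lemma nz_strict_form1 w d : nzform w -> nzform (strict_form1 d w).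
Proof.
move=> w0; have [_ iw dw] := strict_formP d w0; move: iw dw; have [R0|R0] := boolP (dicb w).
  move=> _ /(_ isT) tE; have [n0 Q0 sQ] := dicb_leadQ w0 R0.
  have at0 : at_dir (mltw w).-1 (leadQ w) d != 0 by apply: at_dir_neq0; rewrite ?prednK.
  have : pb (earc d) (tcomp (eb d) (strict_form1 d w)) != 0.
    by rewrite tE mulf_neq0 ?signr_eq0.
  rewrite /tcomp /nzform; case: (eb d) => h; apply/orP; [left|right];
  by apply: contra_neq h => ->; rewrite rmorph0.
move=> /(_ erefl)[_ nE _] _.
have : pb (earc d) (ncomp (eb d) (strict_form1 d w)) != 0.
  by rewrite nE at_dir_neq0// size_tcone.
rewrite /ncomp /nzform; case: (eb d) => h; apply/orP; [right|left];
by apply: contra_neq h => ->; rewrite rmorph0.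
Qed.

Lemma nz_strict_form w q : nzform w -> nzform (strict_form w q).
Proof. by move=> w0; elim: q => //= d q; exact: nz_strict_form1. Qed.

End Transport.


(** * Reduced singularities and their two branches *)

Section ReducedSingularity.
Variable R : realType.
Local Notation C := R[i].
Local Notation fps2 := (fps2 R).
Local Notation t := (fpsX C).
Implicit Types (f g h : fps2) (c z al be : C) (s u v : fps C) (gam del p : parc R) (w : Defs.form R).

Definition smooth_arc gam := ax gam 1%N != 0 \/ ay gam 1%N != 0.
(* The linear part of w, as a symmetric-form-like map on tangent vectors. *)
Definition linw w (a b : C) : C * C :=
  (coef2 w.1 1 0 * a + coef2 w.1 0 1 * b, coef2 w.2 1 0 * a + coef2 w.2 0 1 * b).

Lemma smooth_nonconst gam : smooth_arc gam -> nonconst gam.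
Proof. by move=> [] h; apply/orP; [left|right]; exact: neq0_coef h. Qed.

Lemma pb_lin1 gam w : (pb gam w.1 1%N, pb gam w.2 1%N) = linw w (ax gam 1%N) (ay gam 1%N).
Proof. by rewrite !pb_coef1. Qed.

Lemma ordon_1P gam w : singular w -> nzon gam w ->
  ordon gam w = 1%N <-> linw w (ax gam 1%N) (ay gam 1%N) <> (0, 0).
Proof.
move=> [s1 s2] nz; rewrite -pb_lin1 /ordon.
have [h1 h2] := ord2_1P nz (etrans (pb_at0 _ _) s1) (etrans (pb_at0 _ _) s2).
split=> [/h1 h [e1 e2]|ne]; first by case: h => [[]|[]].
apply: h2; have [a0|/eqP a0] := eqVneq (pb gam w.1 1%N) 0; last by left.
by right=> b0; apply: ne; rewrite a0 b0.
Qed.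

Lemma ordon_gt0 gam w : singular w -> nzon gam w -> (0 < ordon gam w)%N.
Proof. by move=> [s1 s2] nz; apply: ord2_gt0 => //; rewrite pb_at0. Qed.

(* Reduced singularities of both kinds, with eigenvalues [- be] and [al]. *)
Definition jet_form w psi e al be := [/\ at0 (jacobian (cu psi) (cv psi)) != 0, at0 e != 0,
  same_1jet (e * (pull psi w).1) (cst2 al * Y R) &
  same_1jet (e * (pull psi w).2) (cst2 be * X R)].

Lemma linear_part_chart w w0 : has_linear_part w w0 -> exists psi e,
  [/\ at0 (jacobian (cu psi) (cv psi)) != 0, at0 e != 0,
  same_1jet (e * (pull psi w).1) w0.1 & same_1jet (e * (pull psi w).2) w0.2].
Proof.
move=> [u [v [e [[u0 v0] /eqP j0 /is_unitP e0 w1 w2]]]].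
by exists (Chart (introT eqP u0) (introT eqP v0)), e.
Qed.

Lemma saddle_node_jet w : saddle_node w -> exists psi e, jet_form w psi e 0 1.
Proof.
move=> /linear_part_chart[psi [e [j0 e0 w1 w2]]].
have w1' : same_1jet (e * (pull psi w).1) (cst2 0 * Y R).
  by rewrite (rmorph0 (@cst2 R)) mul0r; exact: w1.
have w2' : same_1jet (e * (pull psi w).2) (cst2 1 * X R).
  by rewrite (rmorph1 (@cst2 R)) mul1r; exact: w2.
by exists psi, e; exact: And4 j0 e0 w1' w2'.
Qed.

Lemma nondegenerate_jet w : Defs.nondegenerate w -> exists psi e lam,
  [/\ lam <> 0, forall r : rat, 0 < r -> lam <> ratr r & jet_form w psi e 1 (- lam)].
Proof.
move=> [lam [l0 lr /linear_part_chart[psi [e [j0 e0 w1 w2]]]]].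
have w1' : same_1jet (e * (pull psi w).1) (cst2 1 * Y R).
  by rewrite (rmorph1 (@cst2 R)) mul1r; exact: w1.
have w2' : same_1jet (e * (pull psi w).2) (cst2 (- lam) * X R).
  by rewrite (rmorphN (@cst2 R)); exact: w2.
by exists psi, e, lam; split; [exact: l0|exact: lr|exact: And4 j0 e0 w1' w2'].
Qed.

(** One nonresonance condition serves both kinds: for al = 1, be = - lam it says that lam is not
    q/p, and for al = 0, be = 1 it holds trivially. *)
Lemma reduced_jet w : reduced w -> exists psi e al be, jet_form w psi e al be /\
  forall p q : nat, (0 < p)%N -> (0 < q)%N -> al * q%:R + be * p%:R != 0.
Proof.
case=> [/nondegenerate_jet[psi [e [lam [l0 lr jf]]]]|/saddle_node_jet[psi [e jf]]].
  exists psi, e, 1, (- lam); split=> // p q p0 q0; rewrite mul1r mulNr subr_eq0.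
  apply/eqP => h; apply: (lr (q%:R / p%:R)); first by rewrite divr_gt0 ?ltr0n.
  rewrite fmorph_div !rmorph_nat; apply: (mulIf (_ : (p%:R : C) != 0)).
    by rewrite pnatr_eq0 -lt0n.
  by rewrite mulfVK ?pnatr_eq0 -?lt0n// -h.
exists psi, e, 0, 1; split=> // p q p0 q0.
by rewrite mul0r add0r mul1r pnatr_eq0 -lt0n.
Qed.

Lemma pb_quad gam (e a x b y : fps2) : pb gam (e * (a * x + b * y)) =
  pb gam e * (pb gam a * pb gam x + pb gam b * pb gam y).
Proof. by rewrite pbM pbD !pbM. Qed.

Section Jet.
Variables (w : Defs.form R) (psi : chart R) (e : fps2) (al be : C).
Hypothesis jf : jet_form w psi e al be.
Let hw : Defs.form R := (e * (pull psi w).1, e * (pull psi w).2).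
Notation ux := (coef2 (cu psi) 1 0).
Notation uy := (coef2 (cu psi) 0 1).
Notation vx := (coef2 (cv psi) 1 0).
Notation vy := (coef2 (cv psi) 0 1).

Let jac0 : ux * vy - uy * vx != 0.
Proof.
by have [j0 _ _ _] := jf; move: j0; rewrite /jacobian at0D at0N !at0M !at0_dx !at0_dy.
Qed.
Let e0 : at0 e != 0. Proof. by have [] := jf. Qed.

Let hw1 i j : (i + j <= 1)%N -> coef2 hw.1 i j = al * ((i == 0%N) && (j == 1%N))%:R.
Proof. by have [_ _ h _] := jf => /h; rewrite coef2_cstM coef2_Y. Qed.
Let hw2 i j : (i + j <= 1)%N -> coef2 hw.2 i j = be * ((i == 1%N) && (j == 0%N))%:R.
Proof. by have [_ _ _ h] := jf => /h; rewrite coef2_cstM coef2_X. Qed.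

Let solve2 (m1 m2 : C) : ux * m1 + vx * m2 = 0 -> uy * m1 + vy * m2 = 0 -> m1 = 0 /\ m2 = 0.
Proof.
move=> e1 e2.
have k1 : (ux * vy - uy * vx) * m1 = vy * (ux * m1 + vx * m2) - vx * (uy * m1 + vy * m2) by ring.
have k2 : (ux * vy - uy * vx) * m2 = ux * (uy * m1 + vy * m2) - uy * (ux * m1 + vx * m2) by ring.
move/eqP: k1; move/eqP: k2; rewrite e1 e2 !mulr0 subrr !mulf_eq0 (negPf jac0) /=.
by move=> /eqP -> /eqP ->.
Qed.

Lemma jet_singular : singular w.
Proof.
have h1 : at0 hw.1 = 0 by rewrite /at0 hw1// mulr0.
have h2 : at0 hw.2 = 0 by rewrite /at0 hw2// mulr0.
move: h1 h2; rewrite /= !at0M !at0D !at0M !sb_at0 !at0_dx !at0_dy => /eqP.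
rewrite mulf_eq0 (negPf e0) => /eqP h1 /eqP.
rewrite mulf_eq0 (negPf e0) => /eqP h2.
by apply: solve2; rewrite ![_ * at0 _]mulrC.
Qed.

(** The change of coordinates of the linear part is read off along the line (a t, b t), where only
    the coefficients of order one matter. *)
Lemma jet_lin a b :
  let m := linw w (ux * a + uy * b) (vx * a + vy * b) in
  at0 e * (ux * m.1 + vx * m.2) = al * b /\ at0 e * (uy * m.1 + vy * m.2) = be * a.
Proof.
move=> m; have [s1 s2] := jet_singular.
have c0 c : (fpsC c * t) 0%N == 0 by rewrite fps_coefCM mulr0.
pose gam := Arc (c0 a) (c0 b).
have a1 : ax gam 1%N = a by rewrite /= fps_coefCM mulr1.
have b1 : ay gam 1%N = b by rewrite /= fps_coefCM mulr1.
have <- : (pb gam (sb psi w.1) 1%N, pb gam (sb psi w.2) 1%N) = m.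
  rewrite -!pb_push; apply: etrans (pb_lin1 _ _) _; congr (linw w _ _).
    by apply: etrans (pb_coef1 _ _) _; rewrite a1 b1.
  by apply: etrans (pb_coef1 _ _) _; rewrite a1 b1.
have v1 f : at0 f = 0 -> vge 1 (pb gam (sb psi f)).
  by move=> f0; apply: vge1; rewrite pb_at0 sb_at0.
have key (D : fps2 -> fps2) : pb gam (e * (sb psi w.1 * D (cu psi) + sb psi w.2 * D (cv psi))) 1%N =
    at0 e * (at0 (D (cu psi)) * pb gam (sb psi w.1) 1%N + at0 (D (cv psi)) * pb gam (sb psi w.2) 1%N).
  rewrite pb_quad.
  have vA : vge 1 (pb gam (sb psi w.1) * pb gam (D (cu psi)) + pb gam (sb psi w.2) * pb gam (D (cv psi))).
    by apply: vgeD; apply: vgeMr; apply: v1.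
  rewrite -[1%N in LHS]add0n (vge_lead (vge0 _) vA) pb_at0 fps_coefD.
  rewrite -[1%N in LHS]addn0 (vge_lead (v1 _ s1) (vge0 _)) (vge_lead (v1 _ s2) (vge0 _)).
  by rewrite !pb_at0 ![_ * at0 (D _)]mulrC.
have k1 := key (@dx R); have k2 := key (@dy R).
have := pb_coef1 gam hw.1; rewrite k1 !hw1// a1 b1 !at0_dx => ->.
have := pb_coef1 gam hw.2; rewrite k2 !hw2// a1 b1 !at0_dy => ->.
by rewrite !mulr0 !mulr1 !mul0r add0r addr0.
Qed.

Let surj (x y : C) : exists a b, x = ux * a + uy * b /\ y = vx * a + vy * b.
Proof.
exists ((vy * x - uy * y) / (ux * vy - uy * vx)), ((ux * y - vx * x) / (ux * vy - uy * vx)).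
by split; apply: (mulIf jac0); rewrite mulrDl -!mulrA !mulVf// !mulr1; ring.
Qed.

Lemma jet_lin_inj x y : al != 0 -> be != 0 -> linw w x y = (0, 0) -> x = 0 /\ y = 0.
Proof.
move=> al0 be0; have [a [b [-> ->]]] := surj x y => h.
have := jet_lin a b; cbv zeta; rewrite h /= !mulr0 !addr0 !mulr0 => -[/esym/eqP + /esym/eqP].
by rewrite !mulf_eq0 (negPf al0) (negPf be0) => /= /eqP -> /eqP ->; rewrite !mulr0 addr0.
Qed.

(** In the coordinates of the jet a tangent (a, b) of an integral arc satisfies be a b = 0. If a = 0
    the linear part kills it; the tangents with b = 0 form one line, which cannot contain two
    independent ones. *)
Lemma jet_lin_sn x y x' y' : al = 0 -> be != 0 -> x * y' - y * x' != 0 ->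
  x * (linw w x y).1 + y * (linw w x y).2 = 0 ->
  x' * (linw w x' y').1 + y' * (linw w x' y').2 = 0 ->
  linw w x y = (0, 0) \/ linw w x' y' = (0, 0).
Proof.
move=> al0 be0; have [a [b [-> ->]]] := surj x y; have [a' [b' [-> ->]]] := surj x' y'.
have aux c d : (ux * c + uy * d) * (linw w (ux * c + uy * d) (vx * c + vy * d)).1
    + (vx * c + vy * d) * (linw w (ux * c + uy * d) (vx * c + vy * d)).2 = 0 ->
    linw w (ux * c + uy * d) (vx * c + vy * d) = (0, 0) \/ d = 0.
  have := jet_lin c d; cbv zeta; move: (linw w (ux * c + uy * d) (vx * c + vy * d)) => [m1 m2] /= [e1 e2] q.
  have : at0 e * ((ux * c + uy * d) * m1 + (vx * c + vy * d) * m2) = 0 by rewrite q mulr0.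
  rewrite (_ : _ * _ = c * (at0 e * (ux * m1 + vx * m2)) + d * (at0 e * (uy * m1 + vy * m2))); last by ring.
  rewrite e1 e2 al0 mul0r mulr0 add0r => /eqP.
  rewrite !mulf_eq0 (negPf be0) => /orP[/eqP ->|/= /eqP c0]; first by right.
  left; move: e1 e2; rewrite al0 c0 mul0r mulr0 => /eqP.
  rewrite mulf_eq0 (negPf e0) => /eqP h1 /eqP.
  rewrite mulf_eq0 (negPf e0) => /eqP h2.
  by have [-> ->] := solve2 h1 h2.
move=> ind /aux[->|b0]; first by left.
move=> /aux[->|b0']; first by right.
by case/eqP: ind; rewrite b0 b0'; ring.
Qed.

Hypothesis ab : forall p q : nat, (0 < p)%N -> (0 < q)%N -> al * q%:R + be * p%:R != 0.

Let e_arc gam : pb gam e != 0.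
Proof. by apply: (@neq0_coef _ _ 0); rewrite pb_at0. Qed.
Let tpb_hw gam : tpb gam hw = 0 -> tpb (push psi gam) w = 0.
Proof.
rewrite tpb_push /tpb /hw /= !pbM -!mulrA -mulrDr => /eqP.
by rewrite mulf_eq0 (negPf (e_arc _)) => /eqP.
Qed.

Let swp : chart R := Chart (introT eqP (at0_Y R)) (introT eqP (at0_X R)).

Let hbranches : (exists2 gam, ax gam = t & vge 2 (ay gam) /\ tpb gam hw = 0) /\
  (exists2 gam, ay gam = t & vge 2 (ax gam) /\ tpb gam hw = 0).
Proof.
have h00 : at0 hw.1 = 0 by rewrite /at0 hw1// mulr0.
have h00' : at0 hw.2 = 0 by rewrite /at0 hw2// mulr0.
split.
  apply: (@separatrix_y R hw al be) => //; rewrite ?hw1 ?hw2 ?mulr0 ?mulr1//.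
  by move=> n n2; have := ab (ltnW n2) (ltn0Sn 0); rewrite mulr1.
have sdx f : coef2 (sb swp f) 1 0 = coef2 f 0 1.
  by rewrite -at0_dx sb_dx at0D !at0M !sb_at0 /= dx_Y dx_X at0_0 at0_1 mulr0 mulr1 add0r at0_dy.
have sdy f : coef2 (sb swp f) 0 1 = coef2 f 1 0.
  by rewrite -at0_dy sb_dy at0D !at0M !sb_at0 /= dy_Y dy_X at0_0 at0_1 mulr0 mulr1 addr0 at0_dx.
have pE : pull swp hw = (sb swp hw.2, sb swp hw.1).
  by rewrite /pull [cu swp]/= [cv swp]/= dx_X dx_Y dy_X dy_Y !mulr0 !mulr1 add0r addr0.
have [||||||gam gx [gy gt]] := @separatrix_y R (pull swp hw) be al; rewrite ?pE.
- by rewrite [LHS]sb_at0.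
- by rewrite [LHS]sb_at0.
- by rewrite [LHS]sdx hw2// mulr0.
- by rewrite [LHS]sdy hw2// mulr1.
- by rewrite [LHS]sdx hw1// mulr1.
- by move=> n n2; have := ab (ltn0Sn 0) (ltnW n2); rewrite mulr1 addrC.
exists (push swp gam); first by rewrite [LHS]pb_X.
by split; [rewrite [ax _]pb_Y|rewrite tpb_push].
Qed.

Let wedge_pull f : wedge hw (sb psi f) = e * jacobian (cu psi) (cv psi) * sb psi (wedge w f).
Proof.
rewrite /wedge /hw /jacobian /= sb_dx sb_dy rmorphB !rmorphM /=.
move: (sb psi w.1) (sb psi w.2) (sb psi (dx f)) (sb psi (dy f)) (dx (cu psi)) (dx (cv psi)) (dy (cu psi)) (dy (cv psi)) (e).
by move=> a b fx fy a1 a2 a3 a4 e'; ring.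
Qed.

(** Compares leading coefficients; differentiation brings down the order of f along the arc. *)
Let order_lead gam f W (K : fps C) (m : C) : pb gam f != 0 -> at0 f = 0 -> vge 1 W -> W 1%N = m ->
  W * fps_deriv (pb gam f) = K * pb gam f -> K 0%N = m * (ord (pb gam f))%:R.
Proof.
move=> F0 f0 W1 Wm e'; have [vF Fp] := ordP F0.
have p0 : (0 < ord (pb gam f))%N by rewrite ord_gt0// pb_at0 f0.
move: vF Fp p0 e'; case: (ord _) => // p vF Fp _ e'.
have := congr1 (fun s : fps C => s p.+1) e'.
rewrite -[X in _ = _ X -> _]add0n (vge_lead (vge0 _) vF) -[p.+1 in LHS]add1n.
rewrite (vge_lead W1 (vge_deriv vF)) Wm fps_coef_deriv => h.
by apply: (mulIf Fp); rewrite -h mulr_natr mulrnAl mulrnAr.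
Qed.

(** If an invariant f vanished on neither branch, with orders o1 and o2 along them, its cofactor at
    the origin would be both - be o1 and al o2, up to the same unit, against nonresonance. *)
Lemma jet_branches : exists g1 g2 : parc R, [/\ tpb g1 w = 0, tpb g2 w = 0,
  ax g1 1%N * ay g2 1%N - ay g1 1%N * ax g2 1%N != 0 &
  forall f, at0 f = 0 -> fdvd f (wedge w f) -> pb g1 f = 0 \/ pb g2 f = 0].
Proof.
have [[g1 x1 [y1 t1]] [g2 y2 [x2 t2]]] := hbranches.
exists (push psi g1), (push psi g2); split; [exact: tpb_hw|exact: tpb_hw| |].
  have pa gam : ax (push psi gam) 1%N = ux * ax gam 1%N + uy * ay gam 1%N := pb_coef1 gam (cu psi).
  have pc gam : ay (push psi gam) 1%N = vx * ax gam 1%N + vy * ay gam 1%N := pb_coef1 gam (cv psi).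
  have a1 : ax (push psi g1) 1%N = ux.
    by apply: etrans (pa g1) _; rewrite x1 (y1 1%N isT) mulr0 addr0 mulr1.
  have c1 : ay (push psi g1) 1%N = vx.
    by apply: etrans (pc g1) _; rewrite x1 (y1 1%N isT) mulr0 addr0 mulr1.
  have a2 : ax (push psi g2) 1%N = uy.
    by apply: etrans (pa g2) _; rewrite y2 (x2 1%N isT) mulr0 add0r mulr1.
  have c2 : ay (push psi g2) 1%N = vy.
    by apply: etrans (pc g2) _; rewrite y2 (x2 1%N isT) mulr0 add0r mulr1.
  suff -> : ax (push psi g1) 1%N * ay (push psi g2) 1%N - ay (push psi g1) 1%N * ax (push psi g2) 1%N
    = ux * vy - uy * vx by [].
  by congr (_ - _); [exact: congr2 a1 c2|rewrite mulrC; exact: congr2 a2 c1].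
move=> f f0 [k kE]; rewrite !pb_push; set fh := sb psi f.
have fh0 : at0 fh = 0 by rewrite sb_at0.
have [F1|F1] := eqVneq (pb g1 fh) 0; first by left.
have [F2|F2] := eqVneq (pb g2 fh) 0; first by right.
pose K := e * jacobian (cu psi) (cv psi) * sb psi k.
have WK : wedge hw fh = K * fh.
  by rewrite wedge_pull kE (rmorphM (sb psi)) -/fh mulrCA mulrC.
have h00 : at0 hw.1 = 0 by rewrite /at0 hw1// mulr0.
have h00' : at0 hw.2 = 0 by rewrite /at0 hw2// mulr0.
have W1 gam : vge 1 (pb gam hw.1) by apply: vge1; rewrite pb_at0.
have W2 gam : vge 1 (pb gam hw.2) by apply: vge1; rewrite pb_at0.
have e1 : (- pb g1 hw.2) * fps_deriv (pb g1 fh) = pb g1 K * pb g1 fh.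
  rewrite -(pbM g1 K) -WK /wedge pbB (pbM g1 hw.1) (pbM g1 hw.2) pb_deriv x1 fps_derivX mulr1.
  move: t1; rewrite /tpb x1 fps_derivX mulr1 => /eqP; rewrite addr_eq0 => /eqP ->.
  by move: (pb g1 hw.2) (pb g1 (dx fh)) (pb g1 (dy fh)) (fps_deriv _) => *; ring.
have e2 : pb g2 hw.1 * fps_deriv (pb g2 fh) = pb g2 K * pb g2 fh.
  rewrite -(pbM g2 K) -WK /wedge pbB (pbM g2 hw.1) (pbM g2 hw.2) pb_deriv y2 fps_derivX mulr1.
  move: t2; rewrite /tpb y2 fps_derivX mulr1 => /eqP; rewrite addrC addr_eq0 => /eqP ->.
  by move: (pb g2 hw.1) (pb g2 (dx fh)) (pb g2 (dy fh)) (fps_deriv _) => *; ring.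
have c1 : (- pb g1 hw.2) 1%N = - be.
  by rewrite fps_coefN pb_coef1 !hw2// x1 /= !mulr1 mulr0 mul0r addr0.
have c2 : pb g2 hw.1 1%N = al.
  by rewrite pb_coef1 !hw1// y2 /= !mulr1 mulr0 mul0r add0r.
have k1 := etrans (esym (pb_at0 g1 K)) (order_lead F1 fh0 (vgeN (W2 g1)) c1 e1).
have k2 := etrans (esym (pb_at0 g2 K)) (order_lead F2 fh0 (W1 g2) c2 e2).
have o1 : (0 < ord (pb g1 fh))%N by rewrite (ord_gt0 F1) pb_at0 fh0 eqxx.
have o2 : (0 < ord (pb g2 fh))%N by rewrite (ord_gt0 F2) pb_at0 fh0 eqxx.
by case/eqP: (ab o1 o2); rewrite -k2 k1 mulNr addNr.
Qed.

End Jet.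

Lemma reduced_branches w : reduced w -> exists g1 g2 : parc R, [/\ tpb g1 w = 0, tpb g2 w = 0,
  ax g1 1%N * ay g2 1%N - ay g1 1%N * ax g2 1%N != 0 &
  forall f, at0 f = 0 -> fdvd f (wedge w f) -> pb g1 f = 0 \/ pb g2 f = 0].
Proof. by move=> /reduced_jet[psi [e [al [be [jf ab]]]]]; exact: jet_branches jf ab. Qed.

Lemma reduced_singular w : reduced w -> singular w.
Proof. by move=> /reduced_jet[psi [e [al [be [jf ab]]]]]; exact: jet_singular jf. Qed.

Lemma nondegenerate_ordon w gam : Defs.nondegenerate w -> smooth_arc gam -> nzon gam w ->
  ordon gam w = 1%N.
Proof.
move=> /nondegenerate_jet[psi [e [lam [l0 lr jf]]]] sg nz.
apply/ordon_1P => //; first exact: jet_singular jf.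
move/(jet_lin_inj jf); case; rewrite ?oner_neq0 ?oppr_eq0 //; first exact/eqP.
by move=> a0 b0; case: sg; rewrite ?a0 ?b0 eqxx.
Qed.

Lemma tpb_lin1 gam w : singular w -> tpb gam w = 0 ->
  ax gam 1%N * (linw w (ax gam 1%N) (ay gam 1%N)).1 + ay gam 1%N * (linw w (ax gam 1%N) (ay gam 1%N)).2 = 0.
Proof.
move=> [s1 s2] /(congr1 (fun s : fps C => s 1%N)); rewrite /tpb fps_coef0 fps_coefD.
have v f : at0 f = 0 -> vge 1 (pb gam f) by move=> f0; apply: vge1; rewrite pb_at0.
rewrite -[1%N in LHS]addn0 (vge_lead (v _ s1) (vge0 _)) (vge_lead (v _ s2) (vge0 _)).
rewrite !fps_coef_deriv !mulr1n -(pb_lin1 gam w) /= => <-.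
by rewrite ![_ * pb _ _ _]mulrC.
Qed.

(** One of the two branches is tangent to the kernel of the linear part, the weak direction, and
    there w vanishes to order at least two. *)
Lemma saddle_node_ordon w (g1 g2 : parc R) : saddle_node w -> tpb g1 w = 0 -> tpb g2 w = 0 ->
  ax g1 1%N * ay g2 1%N - ay g1 1%N * ax g2 1%N != 0 -> nzon g1 w -> nzon g2 w ->
  (1 < ordon g1 w)%N \/ (1 < ordon g2 w)%N.
Proof.
move=> /saddle_node_jet[psi [e jf]] t1 t2 ind n1 n2.
have sw := jet_singular jf.
have gt1 gam : nzon gam w -> linw w (ax gam 1%N) (ay gam 1%N) = (0, 0) -> (1 < ordon gam w)%N.
  move=> nz l0; have := ordon_gt0 sw nz; rewrite leq_eqVlt => /orP[/eqP o|//].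
  by have := (ordon_1P sw nz).1 (esym o); rewrite l0.
have [/gt1|/gt1] := jet_lin_sn jf erefl (oner_neq0 _) ind (tpb_lin1 sw t1) (tpb_lin1 sw t2).
  by move=> /(_ n1); left.
by move=> /(_ n2); right.
Qed.

Lemma regular_leaf w : ~ singular w -> exists gam, smooth_arc gam /\ tpb gam w = 0.
Proof.
move=> ns; have [w2|w2] := eqVneq (at0 w.2) 0; last first.
  have [gam gx gt] := leaf_y w2; exists gam; split=> //.
  by left; rewrite gx oner_neq0.
have w1 : at0 w.1 != 0 by apply/eqP => w1; apply: ns.
pose swp : chart R := Chart (introT eqP (at0_Y R)) (introT eqP (at0_X R)).
have pE : pull swp w = (sb swp w.2, sb swp w.1).
  by rewrite /pull [cu swp]/= [cv swp]/= dx_X dx_Y dy_X dy_Y !mulr0 !mulr1 add0r addr0.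
have [|gam gx gt] := @leaf_y R (pull swp w); first by rewrite pE [X in X != _]sb_at0.
exists (push swp gam); split; last by rewrite tpb_push.
by right; rewrite /= pb_X gx oner_neq0.
Qed.

End ReducedSingularity.


(** * Puiseux parametrizations and polar numbers *)

Section Polar.
Variable R : realType.
Local Notation C := R[i].
Local Notation fps2 := (fps2 R).
Local Notation t := (fpsX C).
Implicit Types (f g h : fps2) (c z al be : C) (s u v : fps C) (gam del p q : parc R) (w : Defs.form R) (B : curve R) (d : direction R).

Lemma cmp_cX0 z v : cmp (cX 0 z) v = Fps (fun i => z ^+ i * v i).
Proof. by rewrite cmp_cX; apply: fpsP => i /=; rewrite dvd1n divn1. Qed.

Lemma ax_cX0 z : z != 0 -> ax (cX 0 z : parc R) != 0 /\ ord (ax (cX 0 z : parc R)) = 1%N.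
Proof.
move=> z0; have e1 : ax (cX 0 z : parc R) 1%N != 0 by rewrite fps_coefCM coef_expX eqxx mulr1.
split; first exact: neq0_coef e1.
by apply: ord_eq => //; apply: vge1; exact/eqP/(ax0 (cX 0 z)).
Qed.

(* The arc is not a function of a power of its parameter. *)
Definition prim gam := forall p z, ax p != 0 -> ord (ax p) = 1%N -> z != 0 ->
  rep (rep gam p) (cX 0 z) = rep gam p -> z = 1.

Lemma smooth_prim gam : smooth_arc gam -> prim gam.
Proof.
move=> sg p z p0 p1 z0 e.
have p1' : ax p 1%N != 0 by have := (ordP p0).2; rewrite p1.
have c1 v : v 0%N = 0 -> cmp p v 1%N = v 1%N * ax p 1%N.
  move=> v0; have := pb_coef1 p (ofx v); rewrite -/(cmp p v) => ->.
  by rewrite (_ : coef2 (ofx v) 0 1 = 0) ?mul0r ?addr0.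
have aux v : v 0%N = 0 -> v 1%N != 0 -> cmp (cX 0 z) (cmp p v) = cmp p v -> z = 1.
  move=> v0 v1 /(congr1 (fun s : fps C => s 1%N)); rewrite cmp_cX0 /= expr1 (c1 v v0) => ev.
  by apply: (mulIf (mulf_neq0 v1 p1')); rewrite ev mul1r.
by case: sg => h; [apply: (aux _ (eqP (ax0 gam)) h)|apply: (aux _ (eqP (ay0 gam)) h)];
  [exact: (congr1 (@ax R) e)|exact: (congr1 (@ay R) e)].
Qed.

Lemma pushq_inj (r : Defs.point R) gam del : offaxes r gam -> offaxes r del ->
  pushq r gam = pushq r del -> gam = del.
Proof.
elim: r gam del => [|d r IH] gam del //= og od e.
by have [] := lift_uniq (offaxes_exc og) (offaxes_exc od) (IH _ _ (offaxes_push og) (offaxes_push od) e).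
Qed.

Lemma pushq_prim (r : Defs.point R) gam : offaxes r gam -> prim gam -> prim (pushq r gam).
Proof.
move=> og pg p z p0 p1 z0 e; have [x0 x1] := ax_cX0 z0; apply: (pg p z p0 p1 z0).
have o1 := offaxes_rep p0 og; have o2 := offaxes_rep x0 o1.
apply: (pushq_inj o2 o1).
by apply: etrans (etrans _ e) _; rewrite !pushq_rep.
Qed.

Lemma ord2_cmp q (a b : fps C) : ax q != 0 -> (a != 0) || (b != 0) ->
  ((cmp q a != 0) || (cmp q b != 0)) /\ ord2 (cmp q a) (cmp q b) = (ord2 a b * ord (ax q))%N.
Proof.
move=> q0 nz; have [va vb ab] := ord2P nz.
move: va vb ab; move: (ord2 a b) => n.
move=> /vgeP[a' ea] /vgeP[b' eb] ab.
have ab' : a' 0%N <> 0 \/ b' 0%N <> 0.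
  by move: ab; rewrite ea eb !fps_coefXnM ltnn subnn.
have E (x : fps C) : cmp q (t ^+ n * x) = ax q ^+ n * cmp q x.
  by rewrite (rmorphM (cmp q)) (rmorphXn (cmp q)) /= cmp_t.
have nz' : (cmp q a' != 0) || (cmp q b' != 0).
  by apply/orP; case: ab' => /eqP h; [left|right]; apply: (@neq0_coef _ _ 0); rewrite cmp0E.
have qn : ax q ^+ n != 0 by rewrite expf_neq0.
rewrite ea eb (E a') (E b'); split.
  by case/orP: nz' => h; apply/orP; [left|right]; apply: mulf_neq0.
have o0 : ord2 (cmp q a') (cmp q b') = 0%N by apply: ord2_eq0; rewrite !cmp0E.
by rewrite (ord2M qn nz') (ordX n q0) o0 addn0.
Qed.

Lemma ordon_rep gam w q : nzon gam w -> ax q != 0 ->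
  nzon (rep gam q) w /\ ordon (rep gam q) w = (ordon gam w * ord (ax q))%N.
Proof.
move=> nz q0; rewrite /nzon /ordon (pb_rep gam q w.1) (pb_rep gam q w.2).
exact: ord2_cmp.
Qed.

Lemma ord_rep gam q h : pb gam h != 0 -> ax q != 0 ->
  pb (rep gam q) h != 0 /\ ord (pb (rep gam q) h) = (ord (pb gam h) * ord (ax q))%N.
Proof. by move=> h0 q0; rewrite pb_rep; exact: ord_cmp. Qed.

Lemma puiseux_arc f u v : puiseux f u v -> exists gam, [/\ ax gam = u, ay gam = v, pb gam f = 0 & nonconst gam].
Proof.
move=> [fuv]; case=> [[u0 ve]|[n [n0 ue v0 _]]].
  exists (axarc R false); rewrite u0 ve; split; [by []|by []| |exact: nonconst_axarc].
  by apply: etrans fuv; rewrite u0 ve.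
have u0' : u 0%N == 0 by rewrite ue coef_expX (ltn_eqF n0).
exists (Arc u0' (introT eqP v0)); split; [by []|by []|exact: fuv|].
apply/orP; left => /=; rewrite ue; apply: (@neq0_coef _ _ n).
by rewrite coef_expX eqxx oner_neq0.
Qed.

(** Normalize the first coordinate to t^n. If d divides n and all exponents of the second
    coordinate, then t -> z t fixes the arc for a primitive d-th root z, so z = 1 by primitivity of
    the arc and d = 1. *)
Lemma puiseux_exists f gam : irreducible f -> nonconst gam -> pb gam f = 0 -> prim gam ->
  exists q, [/\ ax q != 0, ord (ax q) = 1%N & puiseux f (ax (rep gam q)) (ay (rep gam q))].
Proof.
move=> fi gnc gf pg; have [gx|gx] := eqVneq (ax gam) 0.
  have gy : ay gam != 0 by move: gnc; rewrite /nonconst gx eqxx.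
  have o0 : (0 < ord (ay gam))%N by rewrite (ord_gt0 gy) ay0.
  have [q [q1 q0 qE]] := reparam gy erefl o0.
  have [z zp] := @prim_root_ex R _ o0.
  have z0 : z != 0.
    by apply: contraPneq (prim_expr_order zp) => ->; rewrite expr0n (gtn_eqF o0) => /eqP; rewrite eq_sym oner_eq0.
  have n1 : ord (ay gam) = 1%N.
    have z1 : z = 1.
      apply: (pg q z q0 q1 z0); apply: parcP; first by rewrite /= gx !raddf0.
      apply: etrans (congr1 (cmp (cX 0 z)) qE) _; apply: esym; apply: etrans qE _.
      rewrite cmp_cX0; apply: fpsP => i /=; rewrite coef_expX.
      by case: eqP => [->|_]; rewrite ?mulr0// (prim_expr_order zp) mulr1.
    by have := prim_order_dvd zp 1; rewrite z1 expr1 eqxx dvdn1 => /eqP.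
  have qf : pb (rep gam q) f = 0 by rewrite pb_rep gf raddf0.
  exists q; split; [exact: q0|exact: q1|split; first exact: qf].
  by left; split; [rewrite /= gx raddf0|rewrite -(expr1 t) -n1; exact: qE].
have [n [q [q0 q1 qE]]] := normalize gx.
have qf : pb (rep gam q) f = 0 by rewrite pb_rep gf raddf0.
exists q; split; [exact: q0|exact: q1|split; first exact: qf].
right; exists n.+1; split; [by []|exact: qE|exact/eqP/(ay0 (rep gam q))|].
move=> d dn dv; have d0 : (0 < d)%N by apply: dvdn_gt0 dn.
have [z zp] := @prim_root_ex R _ d0.
have zd i : (d %| i)%N -> z ^+ i = 1 by rewrite (prim_order_dvd zp) => /eqP.
have z0 : z != 0.
  by apply: contraPneq (prim_expr_order zp) => ->; rewrite expr0n (gtn_eqF d0) => /eqP; rewrite eq_sym oner_eq0.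
have z1 : z = 1.
  apply: (pg q z q0 q1 z0); apply: parcP.
    apply: etrans (congr1 (cmp (cX 0 z)) qE) _; apply: esym; apply: etrans qE _.
    rewrite cmp_cX0; apply: fpsP => i /=; rewrite coef_expX.
    by case: eqP => [->|_]; rewrite ?mulr0// zd// mulr1.
  apply: etrans (cmp_cX0 _ _) _; apply: fpsP => i /=.
  have [->|/eqP vi] := eqVneq (ay (rep gam q) i) 0; first by rewrite mulr0.
  by rewrite zd ?mul1r//; apply: dv.
by have := prim_order_dvd zp 1; rewrite z1 expr1 eqxx dvdn1 => /eqP.
Qed.

Lemma gcd_split n m : exists e a b : nat,
  [/\ (0 < e)%N, n.+1 = (a * e)%N, m.+1 = (b * e)%N & coprime a b].
Proof.
pose e := gcdn n.+1 m.+1; have e0 : (0 < e)%N by rewrite gcdn_gt0.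
have [a ae] : exists a, n.+1 = (a * e)%N by apply/dvdnP/dvdn_gcdl.
have [b bE] : exists b, m.+1 = (b * e)%N by apply/dvdnP/dvdn_gcdr.
exists e, a, b; split=> //.
have : (gcdn (a * e) (b * e) = e)%N by rewrite -ae -bE.
by rewrite -muln_gcdl -{2}[e]mul1n => /eqP; rewrite eqn_pmul2r.
Qed.

Lemma dvd_red a b e k : (0 < e)%N -> coprime b a -> (b * e %| k * (a * e))%N -> (b %| k)%N.
Proof. by move=> e0 ba; rewrite mulnA dvdn_pmul2r// Gauss_dvdl. Qed.

(** [conjugates] relates the second coordinates after raising the parameters to the powers n.+1 and
    m.+1. Comparing the supports of the two sides, primitivity of each parametrization forces m =
    n. *)
Lemma puiseux_unique f gam del : irreducible f ->
  puiseux f (ax gam) (ay gam) -> puiseux f (ax del) (ay del) ->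
  exists2 z, z != 0 & del = rep gam (cX 0 z).
Proof.
move=> fi pg pd.
have [gam' [e1 e2 gf gnc]] := puiseux_arc pg; have ge : gam' = gam by apply: parcP.
have [del' [e3 e4 df dnc]] := puiseux_arc pd; have de : del' = del by apply: parcP.
rewrite {gam' e1 e2}ge in gf gnc; rewrite {del' e3 e4}de in df dnc.
have kf (g1 g2 : parc R) h : nonconst g1 -> nonconst g2 -> pb g1 f = 0 -> pb g2 f = 0 -> pb g1 h = 0 -> pb g2 h = 0.
  by move=> n1 n2 f1 f2 /(ker_irreducible h n1 fi f1)/(ker_irreducible h n2 fi f2).
have id1 (g : parc R) : g = rep g (cX 0 1).
  by apply: parcP; apply: esym; apply: etrans (cmp_cX0 _ _) _; apply: fpsP => i /=; rewrite expr1n mul1r.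
have nx n (g : parc R) : ax g = t ^+ n -> ax g != 0.
  by move=> ->; rewrite expf_neq0// fpsX_neq0.
case: pg => _ [[gx gy]|[n [n0 gx gy gp]]]; case: pd => _ [[dx dy]|[m [m0 dx dy dp]]].
- by exists 1; [exact: oner_neq0|rewrite -id1; apply: parcP; rewrite ?gx ?gy].
- by case/eqP: (nx _ _ dx); rewrite -pb_X; apply: (kf gam del _ gnc dnc gf df); rewrite pb_X.
- by case/eqP: (nx _ _ gx); rewrite -pb_X; apply: (kf del gam _ dnc gnc df gf); rewrite pb_X.
case: n n0 gx gp => // n _ gx gp; case: m m0 dx dp => // m _ dx dp.
have [g [_ gk gz]] := conjugates n (ay0 gam).
have [z zn zE] := gz m _ dx (kf _ _ g gnc dnc gf df (gk _ gx erefl)).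
have cE i : (if (n.+1 %| i)%N then ay del (i %/ n.+1)%N else 0)
    = (if (m.+1 %| i)%N then z ^+ (i %/ m.+1) * ay gam (i %/ m.+1)%N else 0).
  have := congr1 (fun s : fps C => s i) zE; rewrite !cmp_cX /= => <-.
  by rewrite expr1n mul1r.
have z0 : z != 0 by apply: contraPneq zn => ->; rewrite expr0n => /eqP; rewrite eq_sym oner_eq0.
(* With n.+1 = a e and m.+1 = b e, the cofactor b divides m.+1 and every exponent of [ay del], hence
   is 1; likewise a. *)
have [e [a [b [e0 ae bE ab]]]] := gcd_split n m.
have ba : coprime b a by rewrite coprime_sym.
have b1 : b = 1%N.
  apply: dp; first by rewrite bE dvdn_mulr.
  move=> k vk; have := cE (k * n.+1)%N; rewrite (dvdn_mull k (dvdnn n.+1)) (mulnK k (ltn0Sn n)).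
  case: ifP => [+ _|_ /vk]; last by case.
  by move=> h; apply: dvd_red e0 ba _; rewrite -bE -ae; exact: h.
have a1 : a = 1%N.
  apply: gp; first by rewrite ae dvdn_mulr.
  move=> k vk; have := cE (k * m.+1)%N; rewrite (dvdn_mull k (dvdnn m.+1)) (mulnK k (ltn0Sn m)).
  have zk : z ^+ k != 0 by apply: expf_neq0.
  case: ifP => [+ _|_ h]; last by case: vk; apply: (mulfI zk); rewrite -h mulr0.
  by move=> h; apply: dvd_red e0 ab _; rewrite -bE -ae; exact: h.
have mn : m = n by apply: succn_inj; rewrite ae bE a1 b1.
exists z; first exact: z0.
apply: parcP.
  rewrite dx mn; apply: esym; apply: etrans (congr1 (cmp (cX 0 z)) gx) _; rewrite cmp_cX0.
  by apply: fpsP => i /=; rewrite coef_expX; case: eqP => [->|_]; [rewrite zn mul1r|rewrite mulr0].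
apply: esym; apply: etrans (cmp_cX0 _ _) _; apply: fpsP => i /=.
by have := cE (i * n.+1)%N; rewrite mn (dvdn_mull i (dvdnn n.+1)) (mulnK i (ltn0Sn n)).
Qed.

Lemma bad_direction (a b : C) : a <> 0 \/ b <> 0 -> exists d0 : direction R,
  forall d, d <> d0 -> (homogeneous d).1 * a + (homogeneous d).2 * b != 0.
Proof.
move=> ab; have [b0|b0] := eqVneq b 0.
  exists None => -[c|] // _; rewrite b0 mulr0 addr0 mul1r.
  by case: ab => /eqP //; rewrite b0 eqxx.
exists (Some (- (a / b))) => -[c|] ne /=; rewrite ?mul0r ?add0r mul1r //.
rewrite addrC addr_eq0; apply: contra_not_neq ne => e; congr Some.
by apply: (mulIf b0); rewrite e mulNr mulfVK.
Qed.

Lemma finite_direction (S : set (direction R)) d0 : finite_set S -> exists2 d, ~ S d & d <> d0.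
Proof.
move=> fS; have fS' : finite_set (S `|` [set d0]) by rewrite finite_setU; split=> //; exact: finite_set1.
apply: contrapT => h; apply: infinite_nat.
apply: (@sub_finite_set _ _ ((fun n : nat => Some n%:R : direction R) @^-1` (S `|` [set d0]))).
  move=> n _ /=; apply: contrapT => /not_orP[nS nd]; apply: h; exists (Some n%:R) => //.
apply: finite_preimage => // n m _ _ [/eqP].
by rewrite eqr_nat => /eqP.
Qed.

(** The definition quantifies over a Puiseux parametrization and over all directions but finitely
    many. Parametrizations differ by t -> z t, which keeps orders, and only one direction makes the
    leading terms cancel, so some allowed direction is good. *)
Lemma polarE w h B gam : irreducible (equation B) -> pb gam (equation B) = 0 ->
  nonconst gam -> prim gam -> nzon gam w -> pb gam h != 0 ->
  polar_intersection w h B = (ordon gam w)%:Z - (ord (pb gam h))%:Z.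
Proof.
move=> fi gf gnc pg nz h0.
have has_ord (del : parc R) d : nzon del w ->
    (homogeneous d).1 * pb del w.1 (ordon del w) + (homogeneous d).2 * pb del w.2 (ordon del w) != 0 ->
    has_order (subst1 (cst2 (homogeneous d).1 * w.1 + cst2 (homogeneous d).2 * w.2) (ax del) (ay del)) (ordon del w).
  move=> nd ne; have [va vb _] := ord2P nd.
  have e : subst1 (cst2 (homogeneous d).1 * w.1 + cst2 (homogeneous d).2 * w.2) (ax del) (ay del)
      = fpsC (homogeneous d).1 * pb del w.1 + fpsC (homogeneous d).2 * pb del w.2.
    by apply: etrans (pbD _ _ _) _; congr (_ + _); apply: etrans (pbM _ _ _) _; rewrite pb_cst.
  rewrite e; split; first by rewrite fps_coefD !fps_coefCM; exact/eqP.
  by move=> k kn; rewrite fps_coefD !fps_coefCM (va k kn) (vb k kn) !mulr0 addr0.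
have has_ordh (del : parc R) : pb del h != 0 -> has_order (subst1 h (ax del) (ay del)) (ord (pb del h)).
  by move=> hd; have [v1 v2] := ordP hd; split; [exact/eqP|exact: v1].
have hu (x : fps C) n m : has_order x n -> has_order x m -> n = m.
  move=> [/eqP x1 v1] [/eqP x2 v2]; apply: etrans (esym (ord_eq v1 x1)) (ord_eq v2 x2).
have [q [q0 q1 qP]] := puiseux_exists fi gnc gf pg.
have [nq oq] := ordon_rep nz q0; have [hq ohq] := ord_rep h0 q0.
rewrite q1 muln1 in oq; rewrite q1 muln1 in ohq.
rewrite /polar_intersection; case: xgetP => [m _ [u [v [pu [S fS HS]]]]|/(_ ((ordon gam w)%:Z - (ord (pb gam h))%:Z)) []]; last first.
  exists (ax (rep gam q)), (ay (rep gam q)); split; first exact: qP.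
  have [_ _ ab] := ord2P nq; have [d0 dP] := bad_direction ab.
  exists [set d0]; first exact: finite_set1.
  move=> d dd; exists (ordon gam w), (ord (pb gam h)); split; [|by rewrite -ohq; exact: has_ordh hq|by []].
  by rewrite -oq; exact: has_ord nq (dP d dd).
have [del [eu ev df dnc]] := puiseux_arc pu; rewrite -eu -ev in pu HS.
have [z z0 dE] := puiseux_unique fi qP pu; have [x0 x1] := ax_cX0 z0.
have [nd od] := ordon_rep nq x0; have [hd ohd] := ord_rep hq x0.
subst del.
have od' := etrans od (etrans (congr1 (muln _) x1) (etrans (muln1 _) oq)).
have ohd' := etrans ohd (etrans (congr1 (muln _) x1) (etrans (muln1 _) ohq)).
have [_ _ ab] := ord2P nd; have [d0 dP] := bad_direction ab.
have [d nS nd0] := finite_direction d0 fS.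
have [k [l [hk hl ->]]] := HS d nS.
rewrite (hu _ _ _ hk (has_ord _ _ nd (dP d nd0))) (hu _ _ _ hl (has_ordh _ hd)).
exact: (congr2 (fun a b : nat => a%:Z - b%:Z) od' ohd').
Qed.

End Polar.


(** * Curves as ideals, and integral curves at infinitely near points *)

Section Tree.
Variable R : realType.
Local Notation C := R[i].
Local Notation fps2 := (fps2 R).
Local Notation t := (fpsX C).
Implicit Types (f g h : fps2) (c z al be : C) (s u v : fps C) (gam del p : parc R) (B : curve R) (d : direction R) (b : bool) (q : Defs.point R).
Notation exc d := (axeq R (eb d)).

Lemma curve_eqP B : is_curve B -> irreducible (equation B) /\ B = curve_of (equation B).
Proof.
move=> [f fi Bf]; rewrite /equation; case: xgetP => [g _ [gi Bg]|/(_ f) []]; split=> //.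
Qed.

Lemma curve_of_eq f g : irreducible f -> irreducible g -> fdvd f g -> curve_of f = curve_of g.
Proof.
move=> fi gi fg; have gf := irreducible_assoc fi gi fg.
by apply/seteqP; split=> h; exact: fdvd_trans.
Qed.

Lemma curve_ext B (B' : curve R) : is_curve B -> is_curve B' -> fdvd (equation B) (equation B') -> B = B'.
Proof.
move=> /curve_eqP[i e] /curve_eqP[i' e'] dv.
by rewrite e e'; exact: curve_of_eq.
Qed.

Lemma irreducible_at0 f : irreducible f -> at0 f = 0.
Proof. by move=> [_ nu _]; apply/eqP; apply: contraT => h; case: nu; apply/is_unitP. Qed.

Lemma implicit_arc f : at0 f = 0 -> smooth f -> exists gam, smooth_arc gam /\ pb gam f = 0.
Proof.
move=> f0 sf; have [fy|fy] := eqVneq (coef2 f 0 1) 0; last first.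
  have [gam gx gf] := implicit_y f0 fy; exists gam; split=> //.
  by left; rewrite gx oner_neq0.
have fx : coef2 f 1 0 != 0 by case: sf; rewrite ?at0_dx ?at0_dy ?fy // => /eqP.
pose swp : chart R := Chart (introT eqP (at0_Y R)) (introT eqP (at0_X R)).
have sdy : coef2 (sb swp f) 0 1 = coef2 f 1 0.
  by rewrite -at0_dy sb_dy at0D !at0M !sb_at0 /= dy_Y dy_X at0_0 at0_1 mulr0 mulr1 addr0 at0_dx.
have [||gam gx gf] := @implicit_y R (sb swp f); first by rewrite sb_at0.
  by rewrite sdy.
exists (push swp gam); split; last by rewrite pb_push.
by right; rewrite /= pb_X gx oner_neq0.
Qed.

Lemma deriv_neq0 u : u 0%N == 0 -> u != 0 -> fps_deriv u != 0.
Proof.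
move=> u0 un; have [_ u1] := ordP un.
have n0 : (0 < ord u)%N by rewrite (ord_gt0 un).
apply: (@neq0_coef _ _ (ord u).-1).
by rewrite fps_coef_deriv prednK// -mulr_natl mulf_neq0// pnatr_eq0 -lt0n.
Qed.

(** Along the arc w is proportional to df, and df kills the velocity because f vanishes on the
    arc. *)
Lemma tpb_wedge gam (w : Defs.form R) f : pb gam f = 0 -> nzon gam (dform f) ->
  pb gam (wedge w f) = 0 -> tpb gam w = 0.
Proof.
move=> gf nf; rewrite /wedge pbB (pbM gam w.1) (pbM gam w.2) => /subr0_eq ww.
have dg : pb gam (dx f) * fps_deriv (ax gam) + pb gam (dy f) * fps_deriv (ay gam) = 0.
  by rewrite -pb_deriv gf -(raddf0 (@fpsC C)) fps_derivC.
rewrite /tpb; move: nf ww dg; rewrite /nzon /=.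
move: (pb gam w.1) (pb gam w.2) (pb gam (dx f)) (pb gam (dy f)) (fps_deriv (ax gam)) (fps_deriv (ay gam)).
move=> a b' fx fy x y nz ww dg.
have k1 : fx * (a * x + b' * y) = a * (fx * x + fy * y) - (a * fy - b' * fx) * y by ring.
have k2 : fy * (a * x + b' * y) = b' * (fx * x + fy * y) + (a * fy - b' * fx) * x by ring.
rewrite dg ww mulr0 subrr mul0r subrr in k1; rewrite dg ww mulr0 subrr mul0r addr0 in k2.
by case/orP: nz => n; apply: (mulfI n); rewrite mulr0.
Qed.

(** Both w and df kill the nonzero velocity of the arc, so their wedge vanishes. *)
Lemma wedge_tpb gam (w : Defs.form R) f : nonconst gam -> pb gam f = 0 -> tpb gam w = 0 ->
  pb gam (wedge w f) = 0.
Proof.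
move=> nc gf; rewrite /tpb /wedge pbB (pbM gam w.1) (pbM gam w.2).
have dg : pb gam (dx f) * fps_deriv (ax gam) + pb gam (dy f) * fps_deriv (ay gam) = 0.
  by rewrite -pb_deriv gf -(raddf0 (@fpsC C)) fps_derivC.
have : (fps_deriv (ax gam) != 0) || (fps_deriv (ay gam) != 0).
  by case/orP: nc => n; apply/orP; [left|right]; apply: deriv_neq0 => //; rewrite ?ax0 ?ay0.
move: dg; move: (pb gam w.1) (pb gam w.2) (pb gam (dx f)) (pb gam (dy f)) (fps_deriv (ax gam)) (fps_deriv (ay gam)).
move=> a b' fx fy x y dg nz ww.
have k1 : x * (a * fy - b' * fx) = (a * x + b' * y) * fy - b' * (fx * x + fy * y) by ring.
have k2 : y * (a * fy - b' * fx) = a * (fx * x + fy * y) - (a * x + b' * y) * fx by ring.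
rewrite dg ww mulr0 mul0r subrr in k1; rewrite dg ww mulr0 mul0r subrr in k2.
by case/orP: nz => n; apply: (mulfI n); rewrite mulr0.
Qed.

Lemma nzon_dform_push d gam f : f != 0 -> pb gam (strict_eq1 d f) = 0 -> pb gam (exc d) != 0 ->
  nzon gam (dform (strict_eq1 d f)) -> nzon (push (bl d) gam) (dform f).
Proof.
move=> f0 gf e0 nz; apply: contraT => /norP[/negPn/eqP fx /negPn/eqP fy].
have [sE _ _] := strict_eqP d f0.
have dE (D : fps2 -> fps2) : (forall x y, D (x * y) = D x * y + x * D y) ->
    pb gam (D (sb (bl d) f)) = pb gam (exc d) ^+ mlt f * pb gam (D (strict_eq1 d f)).
  by move=> DM; rewrite sE DM pbD !pbM gf mulr0 add0r pbX.
have E0 : pb gam (exc d) ^+ mlt f != 0 by rewrite expf_neq0.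
have [] := pb_pull (bl d) gam (dform f); rewrite pull_dform.
rewrite [(dform (sb _ _)).1]/= [(dform (sb _ _)).2]/= (dE _ (@dxM R)) (dE _ (@dyM R)) fx fy !mul0r addr0.
move=> /eqP; rewrite mulf_eq0 (negPf E0) => /eqP h1 /eqP; rewrite mulf_eq0 (negPf E0) => /eqP h2.
by case/orP: nz => /=; rewrite ?h1 ?h2 eqxx.
Qed.

Lemma nzon_dform_pushq q gam f : f != 0 -> offaxes q gam -> pb gam (strict_eq f q) = 0 ->
  nzon gam (dform (strict_eq f q)) -> nzon (pushq q gam) (dform f).
Proof.
move=> f0; elim: q gam => [|d q IH] gam off gf nz; first exact: nz.
have e0 := offaxes_exc off; have sq0 := strict_eq_neq0 q f0.
apply: IH; [exact: offaxes_push off| |exact: nzon_dform_push sq0 gf e0 nz].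
rewrite (pb_strict d gam sq0); apply: etrans (mulr0 (pb gam (exc d) ^+ mlt (strict_eq f q))).
exact: congr1 gf.
Qed.

Lemma tpb_pushq q gam (w : Defs.form R) : nzform w -> offaxes q gam ->
  tpb (pushq q gam) w = 0 <-> tpb gam (strict_form w q) = 0.
Proof.
move=> w0; elim: q gam => [|d q IH] gam off; first exact: iff_refl.
apply: iff_trans (IH _ (offaxes_push off)) _.
have e0 := offaxes_exc off; rewrite (tpb_blow d gam (nz_strict_form q w0)).
split=> [/eqP|h].
  by rewrite mulf_eq0 expf_eq0 (negPf e0) andbF => /eqP.
apply: etrans (mulr0 (pb gam (exc d) ^+ mexp (strict_form w q))); exact: congr1 h.
Qed.

Lemma nzon_pushq q gam (w : Defs.form R) : offaxes q gam -> nzon (pushq q gam) w ->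
  nzon gam (strict_form w q).
Proof.
elim: q gam => [|d q IH] gam off nz; first exact: nz.
exact: nzon_strict (offaxes_exc off) (IH _ (offaxes_push off) nz).
Qed.

(** Such an arc is a reparametrization of the axis, and only the tangential component of w meets its
    velocity. *)
Lemma on_axis gam b (w : Defs.form R) : pb gam (axeq R b) = 0 -> nonconst gam -> tpb gam w = 0 ->
  pb (axarc R b) (tcomp b w) = 0.
Proof.
have d0 : fps_deriv (0 : fps C) = 0 by rewrite -(raddf0 (@fpsC C)) fps_derivC.
case: b => /=; rewrite ?pb_X ?pb_Y => g0 nc; rewrite /tpb g0 d0 mulr0 ?addr0 ?add0r => /eqP.
  have gx : ax gam != 0 by move: nc; rewrite /nonconst g0 eqxx orbF.
  rewrite mulf_eq0 (negPf (deriv_neq0 (ax0 gam) gx)) orbF => /eqP h.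
  pose p := Arc (ax0 gam) (ax0 gam).
  have ge : rep (axarc R true) p = gam.
    by apply: parcP; [exact: cmp_t|exact: etrans (raddf0 (cmp p)) (esym g0)].
  by apply: (@cmp_eq0 R p _ gx); rewrite -(pb_rep (axarc R true)) ge.
have gy : ay gam != 0 by move: nc; rewrite /nonconst g0 eqxx.
rewrite mulf_eq0 (negPf (deriv_neq0 (ay0 gam) gy)) orbF => /eqP h.
pose p := Arc (ay0 gam) (ay0 gam).
have ge : rep (axarc R false) p = gam.
  by apply: parcP; [exact: etrans (raddf0 (cmp p)) (esym g0)|exact: cmp_t].
by apply: (@cmp_eq0 R p _ gy); rewrite -(pb_rep (axarc R false)) ge.
Qed.

Lemma transverse_arc f gam b : at0 f = 0 -> smooth_arc gam -> pb gam f = 0 -> transverse f (axeq R b) ->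
  ord (pb gam (axeq R b)) = 1%N /\ (pb (axarc R b) f != 0 /\ ord (pb (axarc R b) f) = 1%N).
Proof.
move=> f0 sg gf /eqP tr.
have lin : coef2 f 1 0 * ax gam 1%N + coef2 f 0 1 * ay gam 1%N = 0.
  by rewrite -pb_coef1 gf fps_coef0.
suff [h0 h1 h2] : [/\ pb gam (axeq R b) 0%N = 0, pb gam (axeq R b) 1%N != 0 &
    pb (axarc R b) f 1%N != 0].
  split; first by apply: ord_eq h1; exact: vge1.
  split; first exact: neq0_coef h2.
  by apply: ord_eq h2; apply: vge1; rewrite pb_at0.
split; first by rewrite pb_at0 axeq0.
  move: tr; rewrite /jacobian at0D at0N !at0M !at0_dx !at0_dy.
  case: b; rewrite [axeq R _]/= ?coef2_X ?coef2_Y /= ?mulr0 ?mulr1 ?subr0 ?sub0r ?oppr_eq0 => n0.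
    rewrite pb_Y; apply: contraPneq lin => b0; rewrite b0 mulr0 addr0 => /eqP.
    by rewrite mulf_eq0 (negPf n0) /= => a0; case: sg; rewrite ?b0 ?eqxx ?a0.
  rewrite pb_X; apply: contraPneq lin => b0; rewrite b0 mulr0 add0r => /eqP.
  by rewrite mulf_eq0 (negPf n0) /= => a0; case: sg; rewrite ?b0 ?eqxx ?a0.
move: tr; rewrite /jacobian at0D at0N !at0M !at0_dx !at0_dy.
case: b; rewrite [axeq R _]/= ?coef2_X ?coef2_Y /= ?mulr0 ?mulr1 ?subr0 ?sub0r ?oppr_eq0 => n0.
  by rewrite pb_coef1 /= mulr0 addr0 mulr1.
by rewrite pb_coef1 /= mulr0 add0r mulr1.
Qed.

Lemma bool_cases b b1 b2 : b1 != b2 -> b = b1 \/ b = b2.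
Proof. by case: b b1 b2 => [] [] []; auto. Qed.

End Tree.


(** * Final points of a resolution *)

Section Resolution.
Variable R : realType.
Local Notation C := R[i].
Local Notation fps2 := (fps2 R).
Local Notation t := (fpsX C).
Implicit Types (f g h : fps2) (c z al be : C) (s u v : fps C) (gam del p : parc R) (B : curve R) (d : direction R) (b : bool) (q : Defs.point R).
Notation exc d := (axeq R (eb d)).

Section Resolved.
Variables (w : Defs.form R) (T : set (Defs.point R)).
Hypothesis wco : no_common_factor w.1 w.2.
Hypothesis RT : resolves w T.
Hypothesis T0 : T [::].
Notation lw q := (strict_form w q).
Notation feq B q := (strict_eq (equation B) q).
Notation inv q b := (pb (axarc R b) (tcomp b (lw q)) = 0).

Lemma nz_of_coprime : nzform w.
Proof.
apply: contraT => /norP[/negPn/eqP w1 /negPn/eqP w2].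
have dv f : f = 0 -> fdvd (X R) f by move=> ->; exists 0; rewrite mulr0.
have /is_unitP := wco (dv _ w1) (dv _ w2).
by rewrite at0_X eqxx.
Qed.
Let w0 := nz_of_coprime.

Lemma sep_curve B : separatrix w B -> irreducible (equation B).
Proof. by move=> [/curve_eqP[]]. Qed.

Lemma irr_neq0 f : irreducible f -> f != 0.
Proof. by move=> [/eqP]. Qed.

Lemma nzon_w gam f : irreducible f -> nonconst gam -> pb gam f = 0 -> nzon gam w.
Proof.
move=> fi nc gf; apply: contraT => /norP[/negPn/eqP e1 /negPn/eqP e2].
have k := fun g => (ker_irreducible g nc fi gf).1.
by have := wco (k _ e1) (k _ e2); case: fi => _ nu _ /nu.
Qed.

Lemma sep_wedge B gam : separatrix w B -> pb gam (equation B) = 0 -> pb gam (wedge w (equation B)) = 0.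
Proof. by move=> [_ [k kE]] gf; rewrite /wedge kE pbM gf mul0r. Qed.

Lemma Ttail (r : Defs.point R) q : T (r ++ q) -> T q.
Proof. by have [[_ Tc] _ _ _] := RT; elim: r => //= d r IH /Tc. Qed.

Lemma final_cons q : final T q -> exists d r, q = d :: r /\ T r.
Proof. by case: q => [[/(_ T0)]|d r [_ Tr]] //; exists d, r. Qed.

Lemma final_axis q : final T q -> exists b, axis_at q b.
Proof. by move=> /final_cons[d [r [-> _]]]; exists (eb d); rewrite axis_at_exc. Qed.

Lemma cornerP q : corner q <-> forall b, axis_at q b.
Proof.
rewrite /corner; split=> [[h1 h2] [] |h].
- by move: h2; rewrite /axis_at; case: (axes q).2.
- by move: h1; rewrite /axis_at; case: (axes q).1.
by have := h true; have := h false; rewrite /axis_at; case: (axes q).1; case: (axes q).2.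
Qed.

(** The separatrix is the kernel of the arc pushed down to the origin, where it is still an integral
    curve. *)
Lemma separatrix_of_arc q gam : nonconst gam -> offaxes q gam -> tpb gam (lw q) = 0 ->
  exists B, [/\ separatrix w B, pb (pushq q gam) (equation B) = 0, passes B q & pb gam (feq B q) = 0].
Proof.
move=> nc off /(tpb_pushq w0 off) tp; have nc' := pushq_nonconst nc off.
have [f fi fk] := ker_principal nc'.
have Bc : is_curve (curve_of f) by exists f.
have [ei eE] := curve_eqP Bc; set e := equation (curve_of f) in ei eE.
have fe : fdvd f e.
  have : curve_of e e by exists 1; rewrite mulr1.
  by rewrite -eE.
have pe : pb (pushq q gam) e = 0 by apply/fk.
have ke g : pb (pushq q gam) g = 0 -> fdvd e g.
  by move=> /(ker_irreducible g nc' ei pe).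
have pq : pb gam (strict_eq e q) = 0 by apply/(pb_strict_eq (irr_neq0 ei) off).
exists (curve_of f); split; [|exact: pe| |exact: pq].
  by split; [exact: Bc|apply: ke; exact: wedge_tpb nc' pe tp].
apply: etrans (esym (pb_at0 gam _)) _; apply: etrans (congr1 (fun x : fps C => x 0%N) pq) _.
exact: fps_coef0.
Qed.

Lemma component_axis (s : Defs.point R) q b : axis_at q b = Some s -> component_eq s q (axeq R b).
Proof. by case: b => h; [right|left]. Qed.

Lemma final_arc B q : separatrix w B -> final T q -> passes B q ->
  exists gam, [/\ smooth_arc gam, pb gam (feq B q) = 0, offaxes q gam,
    forall b, axis_at q b -> ord (pb gam (axeq R b)) = 1%N /\
      (pb (axarc R b) (feq B q) != 0 /\ ord (pb (axarc R b) (feq B q)) = 1%N) & nzon gam (dform (feq B q))].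
Proof.
move=> sB fq pq; have [_ _ c3 _] := RT; have [sm _ tr] := c3 B q sB fq pq.
have [gam [sg gf]] := implicit_arc pq sm.
have key b : axis_at q b -> ord (pb gam (axeq R b)) = 1%N /\
      (pb (axarc R b) (feq B q) != 0 /\ ord (pb (axarc R b) (feq B q)) = 1%N).
  case ab : (axis_at q b) => [s|]; [move=> _|by []].
  exact: transverse_arc pq sg gf (tr s _ (component_axis ab)).
exists gam; split; [exact: sg|exact: gf| |exact: key|].
  move=> b /key[h _]; apply/eqP => e; move: h; rewrite e /ord.
  by case: xgetP => // n _ [_]; rewrite fps_coef0.
by case: sm => h; apply/orP; [left|right]; apply: (@neq0_coef _ _ 0); apply/eqP => e;
  apply: h; rewrite -e; apply: esym; exact: pb_at0.
Qed.

(** Arcs of B at the two points have a common reparametrization at the origin, so one point lies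
    above the other by [lifts_comparable]; but a final point is not blown up, so nothing of the tree
    lies above it. *)
Lemma final_unique B q (q' : Defs.point R) : separatrix w B -> final T q -> final T q' ->
  passes B q -> passes B q' -> q = q'.
Proof.
move=> sB fq fq' pq pq'; have fi := sep_curve sB; have f0 := irr_neq0 fi.
have [g [sg gf og _ _]] := final_arc sB fq pq.
have [g' [sg' gf' og' _ _]] := final_arc sB fq' pq'.
have h := (pb_strict_eq f0 og).1 gf; have h' := (pb_strict_eq f0 og').1 gf'.
have nc := pushq_nonconst (smooth_nonconst sg) og.
have nc' := pushq_nonconst (smooth_nonconst sg') og'.
have [p [p' [p0 p0' e]]] := common_rep fi nc nc' h h'.
have o1 := offaxes_rep p0 og; have o2 := offaxes_rep p0' og'.
have e2 : pushq q (rep g p) = pushq q' (rep g' p').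
  by apply: etrans (pushq_rep _ _ _) (etrans e _); apply: esym; exact: pushq_rep.
rewrite -[q]cats0 in o1; rewrite -[q']cats0 in o2.
have aux (s r r' : Defs.point R) : final T r -> final T r' -> r = s ++ r' -> r = r'.
  case: s => [//|d s] fr fr' er; have [d' [x [ex Tx]]] := final_cons fr.
  move: ex; rewrite er /= => -[_ ex]; case: fr' => nT _; case: nT.
  by apply: (@Ttail s); rewrite ex.
by case: (lifts_comparable o1 o2 e2) => -[s es]; [|apply: esym]; exact: aux es.
Qed.

Lemma tree_bound : exists M, forall q, T q -> (size q < M)%N.
Proof.
have [[fT _] _ _ _] := RT.
have fI : finite_set (size @` T) by exact: finite_image.
have [s sE] := (finite_seqP (size @` T)).1 fI.
exists (\max_(k <- s) k).+1 => q Tq; rewrite ltnS.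
have qs : size q \in s.
  have : (size @` T) (size q) by exists q.
  by rewrite sE.
by rewrite (big_rem _ qs) leq_maxl.
Qed.

(** The multiplicity of B at q is positive, so its initial form has a zero among the directions. *)
Lemma passes_child B q : is_curve B -> passes B q -> exists d, passes B (d :: q).
Proof.
move=> Bc pq; have [fi _] := curve_eqP Bc; have f0 := strict_eq_neq0 q (irr_neq0 fi).
have [o l0] := mltP f0; have [at0 [ds0 [ds1 ds2]]] := sum_at_dir l0 (size_poly _ _).
have m0 : (0 < mlt (feq B q))%N.
  case: posnP => // m; move: l0; rewrite m.
  suff -> : lead 0 (feq B q) = 0 by rewrite eqxx.
  apply/polyP => j; rewrite coef_poly coef0; case: ifP => // j1.
  have -> : j = 0%N by case: j j1.
  exact: pq.
apply: contrapT => np; move: m0; rewrite -(ds2 (undup ds0) (undup_uniq _)); last first.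
  by move=> d; rewrite mem_undup.
rewrite big1// => d _; apply: ord_unit.
have [_ _ <-] := strict_eqP d f0; rewrite pb_at0; apply/eqP => h; apply: np; by exists d.
Qed.

Lemma final_exists B : is_curve B -> exists q, final T q /\ passes B q.
Proof.
move=> Bc; have [M Mb] := tree_bound; have [fi _] := curve_eqP Bc.
suff: forall n q, (M - size q <= n)%N -> T q -> passes B q -> exists r, final T r /\ passes B r.
  move/(_ M [::]); apply; [exact: leq_subr|exact: T0|exact: irreducible_at0 fi].
elim=> [|n IH] q le Tq pq; first by have := Mb _ Tq; lia.
have [d pd] := passes_child Bc pq.
have [Td|nTd] := pselect (T (d :: q)); last by exists (d :: q).
by apply: (IH (d :: q)) Td pd; have := Mb _ Tq; rewrite /=; lia.
Qed.

Lemma arc_cases q gam : nonconst gam -> tpb gam (lw q) = 0 ->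
  (exists2 b, axis_at q b & pb gam (axeq R b) = 0 /\ inv q b) \/
  (exists B, [/\ separatrix w B, passes B q, offaxes q gam & pb gam (feq B q) = 0]).
Proof.
move=> nc tp; have [off|noff] := pselect (offaxes q gam).
  by right; have [B [sB _ pB gB]] := separatrix_of_arc nc off tp; exists B; split; [exact: sB|exact: pB|exact: off|exact: gB].
left; apply: contrapT => h; apply: noff => b qb; apply/eqP => e.
apply: h; exists b; [exact: qb|split; [exact: e|exact: on_axis e nc tp]].
Qed.

(** A reduced singularity has two transverse branches, each inside the divisor or giving a
    separatrix. Two separatrices would coincide by resolution, though a smooth curve has one
    tangent. A separatrix avoids corners, so it meets a single component, which must be the other
    branch. *)
Lemma final_singular q : final T q -> singular (lw q) ->
  (forall b, axis_at q b -> inv q b) /\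
  (corner q \/ exists B, separatrix w B /\ passes B q).
Proof.
move=> fq sq; have [_ c2 c3 c4] := RT; have rq := c2 q fq sq.
have [g1 [g2 [t1 t2 ind _]]] := reduced_branches rq.
have nc1 : nonconst g1.
  apply: contraT => /norP[/negPn/eqP h1 /negPn/eqP h2].
  by case/eqP: ind; rewrite h1 h2 !fps_coef0 !mul0r subrr.
have nc2 : nonconst g2.
  apply: contraT => /norP[/negPn/eqP h1 /negPn/eqP h2].
  by case/eqP: ind; rewrite h1 h2 !fps_coef0 !mulr0 subrr.
have one b b' : axis_at q b -> axis_at q b' -> b != b' -> corner q.
  by move=> h h' ne; apply/cornerP => b''; case: b b' b'' h h' ne => [] [] [].
case: (arc_cases nc1 t1) => [[b1 ab1 [e1 i1]]|[B1 [sB1 pB1 o1 f1]]];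
  case: (arc_cases nc2 t2) => [[b2 ab2 [e2 i2]]|[B2 [sB2 pB2 o2 f2]]].
- have ne : b1 != b2.
    apply/eqP => e; case/eqP: ind; rewrite e in e1.
    case: b2 e1 e2 {ab2 i2 e} => /=; rewrite ?pb_X ?pb_Y => -> ->;
    by rewrite !fps_coef0 ?mulr0 ?mul0r subrr.
  split; last by left; exact: one ab1 ab2 ne.
  by move=> b _; case: (bool_cases b ne) => ->; [exact: i1|exact: i2].
- split; last by right; exists B2; split; [exact: sB2|exact: pB2].
  move=> b qb; have [->|ne] := eqVneq b b1; first exact: i1.
  by have [_ nc _] := c3 B2 q sB2 fq pB2; case: nc; exact: one qb ab1 ne.
- split; last by right; exists B1; split; [exact: sB1|exact: pB1].
  move=> b qb; have [->|ne] := eqVneq b b2; first exact: i2.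
  by have [_ nc _] := c3 B1 q sB1 fq pB1; case: nc; exact: one qb ab2 ne.
- have eB := c4 _ _ _ sB1 sB2 fq pB1 pB2; rewrite -eB in f2.
  have [sm _ _] := c3 B1 q sB1 fq pB1.
  have l1 : coef2 (feq B1 q) 1 0 * ax g1 1%N + coef2 (feq B1 q) 0 1 * ay g1 1%N = 0.
    by rewrite -pb_coef1 f1 fps_coef0.
  have l2 : coef2 (feq B1 q) 1 0 * ax g2 1%N + coef2 (feq B1 q) 0 1 * ay g2 1%N = 0.
    by rewrite -pb_coef1 f2 fps_coef0.
  exfalso; move: sm ind l1 l2; rewrite /smooth at0_dx at0_dy.
  move: (coef2 _ 1 0) (coef2 _ 0 1) (ax g1 1%N) (ay g1 1%N) (ax g2 1%N) (ay g2 1%N).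
  move=> x y a b a' b' sm ind l1 l2.
  have k1 : x * (a * b' - b * a') = (x * a + y * b) * b' - (x * a' + y * b') * b by ring.
  have k2 : y * (a * b' - b * a') = (x * a' + y * b') * a - (x * a + y * b) * a' by ring.
  rewrite l1 l2 !mul0r subrr in k1; rewrite l1 l2 !mul0r subrr in k2.
  have x0 : x = 0 by apply: (mulIf ind); rewrite mul0r.
  have y0 : y = 0 by apply: (mulIf ind); rewrite mul0r.
  by case: sm => [/(_ x0)|/(_ y0)].
Qed.

Lemma inv_at0 q b : inv q b -> at0 (tcomp b (lw q)) = 0.
Proof. by move=> h; rewrite -(pb_at0 (axarc R b)) h fps_coef0. Qed.

Lemma inv_both_singular q b : inv q b -> inv q (~~ b) -> singular (lw q).
Proof. by move=> /inv_at0 h1 /inv_at0 h2; case: b h1 h2. Qed.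

Lemma sep_tpb B q gam : separatrix w B -> smooth_arc gam -> offaxes q gam ->
  pb gam (feq B q) = 0 -> nzon gam (dform (feq B q)) -> tpb gam (lw q) = 0.
Proof.
move=> sB sg og gf nf; have f0 := irr_neq0 (sep_curve sB).
apply/(tpb_pushq w0 og); have h := (pb_strict_eq f0 og).1 gf.
exact: tpb_wedge h (nzon_dform_pushq f0 og gf nf) (sep_wedge sB h).
Qed.

Lemma tpb_at0 gam (W : Defs.form R) : tpb gam W = 0 -> at0 W.1 * ax gam 1%N + at0 W.2 * ay gam 1%N = 0.
Proof.
move=> /(congr1 (fun s : fps C => s 0%N)); rewrite fps_coef0 => <-.
by rewrite /tpb fps_coefD !fps_coefM0 !pb_at0 !fps_coef_deriv !mulr1n.
Qed.

Lemma ord1_axeq gam b : ord (pb gam (axeq R b)) = 1%N -> (if b then ay gam 1%N else ax gam 1%N) != 0.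
Proof.
move=> o; have n0 : pb gam (axeq R b) != 0.
  by apply/eqP => e; move: o; rewrite e /ord; case: xgetP => // n _ [_]; rewrite fps_coef0.
by have [_] := ordP n0; rewrite o; case: b {o n0} => /=; rewrite ?pb_X ?pb_Y.
Qed.

Lemma inv_passes_singular B q b : separatrix w B -> final T q -> passes B q -> axis_at q b ->
  inv q b -> singular (lw q).
Proof.
move=> sB fq pB qb iq; have [gam [sg gf og ax1 nf]] := final_arc sB fq pB.
have := tpb_at0 (sep_tpb sB sg og gf nf); have [/ord1_axeq n1 _] := ax1 b qb.
have := inv_at0 iq; case: b n1 {qb iq ax1} => /= n1 i0.
  by rewrite i0 mul0r add0r => /eqP; rewrite mulf_eq0 (negPf n1) orbF => /eqP.
by rewrite i0 mul0r addr0 => /eqP; rewrite mulf_eq0 (negPf n1) orbF => /eqP.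
Qed.

(** The point is regular, so it carries a smooth leaf: this is either the other axis, which is then
    invariant, or a separatrix, which rules out a corner and is transverse to the axis. *)
Lemma final_dicritical q b : final T q -> axis_at q b -> ~ inv q b ->
  [/\ ~ singular (lw q), at0 (tcomp b (lw q)) <> 0, corner q -> inv q (~~ b) &
      ~ corner q -> exists B, separatrix w B /\ passes B q].
Proof.
move=> fq qb ni; have ns : ~ singular (lw q) by move=> /(final_singular fq)[/(_ b qb)].
have [gam [sg tg]] := regular_leaf ns.
case: (arc_cases (smooth_nonconst sg) tg) => [[b' qb' [e i]]|[B [sB pB og gf]]].
  have ne : b != b' by apply/eqP => bb; apply: ni; rewrite bb; exact: i.
  have eb' : b' = ~~ b by case: b b' ne {ni i qb qb' e} => [] [].
  rewrite eb' in i qb'; split; [exact: ns| |by move=> _; exact: i|].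
    by have := inv_at0 i; move: ns; rewrite /singular; case: b {ne qb ni qb' eb' i} => /= ns h1 h2; apply: ns.
  by case; apply/cornerP => b''; case: b b'' qb qb' {ne ni eb' i e} => [] [].
have [_ _ c3 _] := RT; have [_ nc tr] := c3 B q sB fq pB.
split; [exact: ns| |move=> cq; case: (nc cq)|move=> _; exists B; split; [exact: sB|exact: pB]].
move=> t0; apply: ni; exfalso; apply: ns.
have [g2 [sg2 gf2 og2 ax1 nf]] := final_arc sB fq pB.
have := tpb_at0 (sep_tpb sB sg2 og2 gf2 nf); have [/ord1_axeq n1 _] := ax1 b qb.
case: b n1 t0 {qb ax1} => /= n1 i0.
  by rewrite i0 mul0r add0r => /eqP; rewrite mulf_eq0 (negPf n1) orbF => /eqP.
by rewrite i0 mul0r addr0 => /eqP; rewrite mulf_eq0 (negPf n1) orbF => /eqP.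
Qed.

End Resolved.
End Resolution.


(** * Excesses and tau at one blow-up *)

Section Index.
Variable R : realType.
Local Notation C := R[i].
Local Notation fps2 := (fps2 R).
Local Notation t := (fpsX C).
Implicit Types (f g h : fps2) (c z : C) (s u v : fps C) (gam del p : parc R) (B : curve R) (d : direction R) (b : bool) (W : Defs.form R) (q : Defs.point R).
Notation exc d := (axeq R (eb d)).
Notation earc d := (axarc R (eb d)).

(** The normal derivative of the tangential component along the axis b, the numerator of the
    Camacho-Sad index. *)
Definition trans_deriv b W : fps2 := if b then dy W.1 else dx W.2.

Lemma pb_exc_dir b : pb (axarc R b) (exc (dir R b)) = t.
Proof. by rewrite eb_dir pb_axeq; case: b. Qed.

Lemma tpb_axarc b W : tpb (axarc R b) W = pb (axarc R b) (tcomp b W).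
Proof.
have d0 : fps_deriv (0 : fps C) = 0 by rewrite -(raddf0 (@fpsC C)) fps_derivC.
have dt : fps_deriv t = 1 by exact: fps_derivX.
by case: b; rewrite /tpb [ax _]/= [ay _]/= d0 dt mulr0 mulr1 ?addr0 ?add0r.
Qed.

Lemma tcomp_dir b W : nzform W -> pb (axarc R b) (tcomp b W) =
  t ^+ mexp W * pb (axarc R b) (tcomp b (strict_form1 (dir R b) W)).
Proof.
move=> W0; have h := tpb_blow (dir R b) (axarc R b) W0.
rewrite push_axarc pb_exc_dir in h.
exact: etrans (esym (tpb_axarc b W)) (etrans h (congr1 (fun x => t ^+ mexp W * x) (tpb_axarc b _))).
Qed.

Lemma inv_dir b W : nzform W -> pb (axarc R b) (tcomp b (strict_form1 (dir R b) W)) = 0 <->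
  pb (axarc R b) (tcomp b W) = 0.
Proof.
move=> /(tcomp_dir b) e; split=> [h|h]; first by rewrite e h mulr0.
move/eqP: e; rewrite h eq_sym mulf_eq0 expf_eq0 (negPf (fpsX_neq0 C)) andbF => /eqP; exact.
Qed.

Lemma ncomp_dir b W : nzform W -> pb (axarc R b) (tcomp b W) = 0 ->
  t * pb (axarc R b) (ncomp b W) = t ^+ mexp W * pb (axarc R b) (ncomp b (strict_form1 (dir R b) W)).
Proof.
move=> W0 h; have [e1 e2] := pull_strict (dir R b) (axarc R b) W0.
have [p1 p2] := pb_pull (bl (dir R b)) (axarc R b) W.
rewrite push_axarc in p1 p2; rewrite pb_exc_dir in e1 e2.
case: b h e1 e2 p1 p2 => /= h e1 e2 p1 p2.
  rewrite -e2 p2 h mul0r add0r dyM dy_X dyD dy_Y dy_cst mul0r add0r addr0 mulr1 pb_X.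
  exact: mulrC.
by rewrite -e1 p1 h mul0r addr0 dxM dx_X dx_Y mulr0 addr0 mul1r pb_Y; exact: mulrC.
Qed.

(** Differentiates the pull-back identity across the axis. The additional term [ncomp] is what
    lowers the index by one under blow-up. *)
Lemma trans_deriv_dir b W : nzform W ->
  t * pb (axarc R b) (trans_deriv b W) + pb (axarc R b) (ncomp b W) =
  t ^+ mexp W * pb (axarc R b) (trans_deriv b (strict_form1 (dir R b) W)).
Proof.
move=> W0; have [e _ _] := strict_formP (dir R b) W0.
move: (mexp W) (strict_form1 (dir R b) W) e => m W' e.
have pbp f : pb (axarc R b) (sb (bl (dir R b)) f) = pb (axarc R b) f.
  by rewrite -pb_push push_axarc.
have c0 : cst2 (0 : C) = 0 by rewrite rmorph0.
have D1 (D : fps2 -> fps2) : (forall f g, D (f * g) = D f * g + f * D g) -> D 1 = 0.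
  by move=> DM; have := DM 1 1; rewrite !mulr1 mul1r => /(congr1 (fun x => x - D 1)); rewrite addrK subrr.
have Dn (D : fps2 -> fps2) n f : (forall f g, D (f * g) = D f * g + f * D g) -> D f = 0 -> D (f ^+ n) = 0.
  move=> DM Df; elim: n => [|n IH]; first by rewrite expr0; exact: D1.
  by rewrite exprS DM Df IH mul0r mulr0 addr0.
have e1 : (pull (bl (dir R b)) W).1 = exc (dir R b) ^+ m * W'.1 := congr1 fst e.
have e2 : (pull (bl (dir R b)) W).2 = exc (dir R b) ^+ m * W'.2 := congr1 snd e.
case: b e1 e2 pbp {e} => e1 e2 pbp.
  have {}e1 : sb (bl (dir R true)) W.1 + sb (bl (dir R true)) W.2 * Y R = X R ^+ m * W'.1.
    apply: etrans e1; rewrite /pull /= (dxM (X R)) dx_X (dxD (Y R)) dx_Y dx_cst c0 !addr0 mulr0 addr0 mulr1 mul1r.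
    exact: erefl.
  have k := congr1 (fun x => pb (axarc R true) (dy x)) e1; move: k.
  rewrite dyD (dyM _ (Y R)) (dyM (X R ^+ m)) (Dn _ _ _ (@dyM R) (dy_X R)) mul0r add0r dy_Y mulr1 sb_dy.
  rewrite [cu _]/= [cv _]/= dy_X mulr0 add0r (dyM (X R)) dy_X mul0r add0r dyD dy_Y dy_cst addr0 mulr1.
  rewrite 2!pbD (pbM _ _ (Y R)) (pbM _ _ (X R)) (pbM _ (X R ^+ m)) pbX pb_X pb_Y mulr0 add0r.
  rewrite (pbp (dy W.1)) (pbp W.2) => <-; congr (_ + _); exact: mulrC.
have {}e2 : sb (bl (dir R false)) W.1 * X R + sb (bl (dir R false)) W.2 = Y R ^+ m * W'.2.
  apply: etrans e2; rewrite /pull /= (dyM (X R)) dy_X dy_Y mul0r add0r !mulr1.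
  exact: erefl.
have k := congr1 (fun x => pb (axarc R false) (dx x)) e2; move: k.
rewrite dxD (dxM _ (X R)) (dxM (Y R ^+ m)) (Dn _ _ _ (@dxM R) (dx_Y R)) mul0r add0r dx_X mulr1 (sb_dx _ W.2).
rewrite [cu _]/= [cv _]/= dx_Y mulr0 addr0 (dxM (X R)) dx_X mul1r dx_Y mulr0 addr0.
rewrite 2!pbD (pbM _ _ (X R)) (pbM _ _ (Y R)) (pbM _ (Y R ^+ m)) pbX pb_X pb_Y mulr0 add0r.
by rewrite (pbp (dx W.2)) (pbp W.1) => <-; rewrite addrC; congr (_ + _); exact: mulrC.
Qed.

Variables (w : Defs.form R) (ss : seq (curve R)) (cf : curve R -> int).
Hypothesis w0 : nzform w.
Hypothesis ssi : forall B, B \in ss -> irreducible (equation B).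
Notation lw q := (strict_form w q).
Notation feq B q := (strict_eq (equation B) q).
Notation inv q b := (pb (axarc R b) (tcomp b (lw q)) = 0).

Definition dic q : bool := dicb (lw q).
Definition ia q b : bool := if axis_at q b is Some s then ~~ dic s else false.

Lemma ia_axis q b : ia q b -> axis_at q b.
Proof. by rewrite /ia; case: (axis_at q b). Qed.

(** Invariance passes between an axis and its strict transform, so it is decided at the blow-up that
    created the component. *)
Lemma axis_inv q b (s : Defs.point R) : axis_at q b = Some s -> inv q b <-> dic s = false.
Proof.
elim: q b => [|d q IH] b; first by case: b.
move=> /axis_at_cons[[-> ->]|[-> qb]]; last first.
  exact: iff_trans (inv_dir b (nz_strict_form q w0)) (IH b qb).
have [_ h1 h2] := strict_formP d (nz_strict_form q w0).
split=> [h|dq]; last by have [h _ _] := h1 dq; exact: h.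
apply/negbTE/negP => dq; have h' := h2 dq.
have [mu l0 ls] := dicb_leadQ (nz_strict_form q w0) dq.
have n0 : at_dir (mltw (lw q)).-1 (leadQ (lw q)) d != 0 by apply: at_dir_neq0 l0 _; rewrite prednK.
have : (-1) ^+ eb d * at_dir (mltw (lw q)).-1 (leadQ (lw q)) d == 0 :> fps C by rewrite -h'; apply/eqP; exact: h.
by rewrite mulf_eq0 (negPf n0) orbF expf_eq0 oppr_eq0 oner_eq0 andbF.
Qed.

Lemma iaP q b : axis_at q b -> reflect (inv q b) (ia q b).
Proof.
rewrite /ia; case e : (axis_at q b) => [s|] // _; have h := axis_inv e.
by apply: (iffP negPf) => /h.
Qed.

Lemma ia_dir q b : ia (dir R b :: q) b = ia q b.
Proof. by rewrite /ia axis_at_dir. Qed.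

Lemma ia_exc d q : ia (d :: q) (eb d) = ~~ dic q.
Proof. by rewrite /ia axis_at_exc. Qed.

Lemma ia_other d q : ia (d :: q) (~~ eb d) =
  (d == Some 0) && ia q true || (d == None) && ia q false.
Proof.
case: d => [c|]; rewrite /ia /axis_at /=.
  by case: (eqVneq c 0) => [->|n]; [rewrite !eqxx orbF|rewrite orbF; case: eqP => // -[e]; rewrite e eqxx in n].
by [].
Qed.

Lemma nzon_axis q b : axis_at q b -> nzon (axarc R b) (lw q).
Proof.
elim: q b => [|d q IH] b; first by case: b.
case e : (axis_at (d :: q) b) => [s|] // _.
have [[-> _]|[-> qb]] := axis_at_cons e; last first.
  have qb' : axis_at q b by rewrite qb.
  apply: nzon_strict; first by rewrite pb_exc_dir fpsX_neq0.
  by rewrite push_axarc; exact: IH qb'.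
have [_ h1 h2] := strict_formP d (nz_strict_form q w0).
suff : pb (earc d) (tcomp (eb d) (lw (d :: q))) != 0 \/ pb (earc d) (ncomp (eb d) (lw (d :: q))) != 0.
  by rewrite /nzon; case: (eb d) => /= -[] ->; rewrite ?orbT.
case dq : (dicb (lw q)).
  left; have h' := h2 dq.
  have [mu l0 ls] := dicb_leadQ (nz_strict_form q w0) dq.
  have n0 : at_dir (mltw (lw q)).-1 (leadQ (lw q)) d != 0 by apply: at_dir_neq0 l0 _; rewrite prednK.
  by rewrite h' mulf_eq0 (negPf n0) orbF expf_eq0 oppr_eq0 oner_eq0 andbF.
right; have [_ h _] := h1 dq; rewrite h; apply: at_dir_neq0 (size_tcone _).
by rewrite -/(dicb _) dq.
Qed.

Lemma ncomp_neq0 q b : ia q b -> pb (axarc R b) (ncomp b (lw q)) != 0.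
Proof.
move=> i; have := nzon_axis (ia_axis i); move/(iaP (ia_axis i)): i.
by rewrite /nzon; case: b => /= ->; rewrite eqxx ?orbF.
Qed.

Lemma tcomp_neq0 q b : axis_at q b -> ~~ ia q b -> pb (axarc R b) (tcomp b (lw q)) != 0.
Proof. by move=> qb /(iaP qb)/eqP. Qed.

Lemma ordon_axis q b : ia q b -> ordon (axarc R b) (lw q) = ord (pb (axarc R b) (ncomp b (lw q))).
Proof.
move=> i; have n0 := ncomp_neq0 i; move/(iaP (ia_axis i)): i => h.
by rewrite /ordon; case: b h n0 => /= -> n0; [exact: ord2_0l|exact: ord2_0r].
Qed.

Lemma feq_neq0 B q : B \in ss -> feq B q != 0.
Proof. by move=> /ssi /irr_neq0/strict_eq_neq0. Qed.

Lemma feq_axis f q b : f != 0 -> axis_at q b -> pb (axarc R b) (strict_eq f q) != 0.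
Proof.
move=> f0; elim: q b => [|d q IH] b; first by case: b.
case e : (axis_at (d :: q) b) => [s|] // _; have fq := strict_eq_neq0 q f0.
have [[-> _]|[-> qb]] := axis_at_cons e.
  by have [_ h _] := strict_eqP d fq; apply/eqP => z; apply: h; apply/fdvd_axeq.
have qb' : axis_at q b by rewrite qb.
have := IH b qb'; rewrite -{1}(push_axarc R b) (pb_strict (dir R b) (axarc R b) fq).
by rewrite mulf_eq0 negb_or => /andP[_].
Qed.

(** [fv] and [fl] are the multiplicity at q, and the intersection number with the axis b, of the
    strict transform of the divisor with coefficients [cf] on the curves of [ss]. *)
Definition fv q : int := \sum_(B <- ss) cf B * (mlt (feq B q))%:Z.
Definition fl q b : int := \sum_(B <- ss) cf B * (ord (pb (axarc R b) (feq B q)))%:Z.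
(** The shift by one for a noninvariant axis makes the excess vanish at a regular corner where the
    leaf is the other axis, transverse to the first. *)
Definition oo q b : int := (if ia q b then ord (pb (axarc R b) (ncomp b (lw q)))
  else (ord (pb (axarc R b) (tcomp b (lw q)))).+1)%:Z.
Definition ex q b : int := oo q b - fl q b - (ia q (~~ b))%:Z.
Definition iq q : int := (ia q true)%:Z + (ia q false)%:Z.
Definition tau q : int := (mexp (lw q))%:Z - fv q + 1 - iq q - (dic q)%:Z.

Lemma fl_dir q b : axis_at q b -> fl q b = fv q + fl (dir R b :: q) b.
Proof.
move=> qb; rewrite /fl /fv -big_split /= big_seq [RHS]big_seq; apply: eq_bigr => B Bs.
rewrite -mulrDr; congr (_ * _); rewrite -PoszD; congr Posz.
have fq := feq_neq0 q Bs; have qb' : axis_at (dir R b :: q) b by rewrite axis_at_dir.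
have n0 := feq_axis (irr_neq0 (ssi Bs)) qb'.
have e : pb (axarc R b) (feq B q) = t ^+ mlt (feq B q) * pb (axarc R b) (feq B (dir R b :: q)).
  by rewrite -{1}(push_axarc R b) (pb_strict (dir R b) (axarc R b) fq) pb_exc_dir.
by rewrite e ordM ?expf_neq0 ?fpsX_neq0 // ordX ?fpsX_neq0 // ord_fpsX muln1.
Qed.

(** On the strict transform of the axis the order drops by the exponent of the divisor and the
    intersection by the multiplicity. The corrections in [tau] record that the other component
    through the point is replaced by the exceptional one. *)
Lemma ex_dir q b : axis_at q b -> ex q b = tau q + ex (dir R b :: q) b.
Proof.
move=> qb; rewrite /ex (fl_dir qb) /tau /iq.
have -> : ia (dir R b :: q) (~~ b) = ~~ dic q by have := ia_exc (dir R b) q; rewrite eb_dir.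
have io : (ia q true)%:Z + (ia q false)%:Z = (ia q b)%:Z + (ia q (~~ b))%:Z by case: b {qb}; ring.
rewrite io {io}; suff -> : oo q b = (mexp (lw q))%:Z - (ia q b)%:Z + oo (dir R b :: q) b.
  by case: (dic q) => /=; ring.
rewrite /oo ia_dir; have qn := nz_strict_form q w0.
have qb' : axis_at (dir R b :: q) b by rewrite axis_at_dir.
case: ifP => i.
  have i' : ia (dir R b :: q) b by rewrite ia_dir.
  have := ncomp_dir qn (elimT (iaP qb) i) => /(congr1 (@ord C)).
  rewrite (ordM (fpsX_neq0 _) (ncomp_neq0 i)) (ordM (expf_neq0 _ (fpsX_neq0 _)) (ncomp_neq0 i')).
  rewrite (ordX _ (fpsX_neq0 _)) ord_fpsX muln1 => e.
  have {}e : (1 + ord (pb (axarc R b) (ncomp b (lw q))))%:Z =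
    (mexp (lw q) + ord (pb (axarc R b) (ncomp b (lw (dir R b :: q)))))%:Z by rewrite e.
  by move: e; rewrite !PoszD /=; lia.
have i' : ~~ ia (dir R b :: q) b by rewrite ia_dir i.
have := tcomp_dir b qn => /(congr1 (@ord C)).
rewrite (ordM (expf_neq0 _ (fpsX_neq0 _)) (tcomp_neq0 qb' i')) (ordX _ (fpsX_neq0 _)) ord_fpsX muln1 => e.
rewrite e; lia.
Qed.

Lemma sum_Posz (I : Type) (r : seq I) (F : I -> nat) : \sum_(i <- r) (F i)%:Z = (\sum_(i <- r) F i)%N%:Z.
Proof. by rewrite (big_morph Posz PoszD (erefl 0%:Z)). Qed.

(** Counts zeros of the tangent cone, of degree [mltw] + 1, or in the dicritical case of [leadQ], of
    degree [mltw] - 1; there [mexp] is already [mltw] + 1, whence the 3. *)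
Lemma sum_oo_exc q : exists ds0 : seq (direction R), forall ds, uniq ds -> {subset ds0 <= ds} ->
  \sum_(d <- ds) (oo (d :: q) (eb d) - (dic q)%:Z) = (mexp (lw q))%:Z + 1 - (dic q)%:Z *+ 3.
Proof.
have qn := nz_strict_form q w0; case dq : (dic q).
  have [mu l0 ls] := dicb_leadQ qn dq.
  have [||n0 [ds0 [_ sm]]] := @sum_at_dir R (mltw (lw q)).-1 (leadQ (lw q)); first exact: l0.
    by rewrite prednK.
  exists ds0 => ds ud sd; rewrite /mexp -/(dic q) dq.
  have -> : (mltw (lw q) + true)%N%:Z + 1 - 1%:Z *+ 3 = (mltw (lw q)).-1%:Z.
    by rewrite -{1}(prednK mu) /=; lia.
  rewrite -(sm ds ud sd) -sum_Posz; apply: eq_bigr => d _.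
  rewrite /oo ia_exc dq /= -(addn1 (ord _)) PoszD addrK; congr Posz.
  have [_ _ h] := strict_formP d qn; have h' := h dq.
  have s0 : (-1) ^+ eb d != 0 :> fps C by rewrite expf_neq0 // oppr_eq0 oner_eq0.
  apply: etrans (congr1 (@ord C) h') _; rewrite (ordM s0 (n0 d)).
  suff -> : ord ((-1) ^+ eb d : fps C) = 0%N by [].
  apply: ord_unit; case: (eb d); rewrite ?expr1 ?expr0 ?fps_coefN fps_coef1 ?oppr_eq0 oner_neq0 //.
have t0 : tcone (lw q) != 0 by rewrite -/(dicb _) -/(dic q) dq.
have [n0 [ds0 [_ sm]]] := sum_at_dir t0 (size_tcone _).
exists ds0 => ds ud sd; rewrite /mexp -/(dic q) dq addn0.
have -> : (mltw (lw q))%:Z + 1 - 0%:Z *+ 3 = (mltw (lw q)).+1%:Z by rewrite mul0rn; lia.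
rewrite -(sm ds ud sd) -sum_Posz; apply: eq_bigr => d _.
rewrite /oo ia_exc dq /= subr0; congr Posz.
by have [_ h _] := strict_formP d qn; have [_ h' _] := h dq; exact: congr1 h'.
Qed.

Lemma sum_fl_exc q : exists ds0 : seq (direction R), forall ds, uniq ds -> {subset ds0 <= ds} ->
  \sum_(d <- ds) fl (d :: q) (eb d) = fv q.
Proof.
suff: forall s : seq (curve R), {subset s <= ss} -> exists ds0 : seq (direction R), forall ds, uniq ds -> {subset ds0 <= ds} ->
  \sum_(d <- ds) \sum_(B <- s) cf B * (ord (pb (axarc R (eb d)) (feq B (d :: q))))%:Z = \sum_(B <- s) cf B * (mlt (feq B q))%:Z.
  by move/(_ ss); apply.
elim=> [_|B s IH sub]; first by exists [::] => ds _ _; rewrite big_nil big1 // => d _; rewrite big_nil.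
have [|d1 h1] := IH; first by move=> B' h; apply: sub; rewrite inE h orbT.
have Bs : B \in ss by apply: sub; rewrite inE eqxx.
have fq := feq_neq0 q Bs; have [_ l0] := mltP fq.
have [_ [d2 [_ h2]]] := sum_at_dir l0 (size_poly _ _).
exists (d1 ++ d2) => ds ud sd; rewrite big_cons.
rewrite -(h1 ds ud) => [|d dd]; last by apply: sd; rewrite mem_cat dd.
rewrite -(h2 ds ud) => [|d dd]; last by apply: sd; rewrite mem_cat dd orbT.
rewrite -sum_Posz mulr_sumr -big_split /=; apply: eq_bigr => d _; rewrite big_cons.
have [_ _ e] := strict_eqP d fq.
congr (cf B * (ord _)%:Z + _); exact: e.
Qed.

Lemma sum_other_exc q ds : uniq ds -> Some 0 \in ds -> None \in ds ->
  \sum_(d <- ds) (ia (d :: q) (~~ eb d))%:Z = iq q.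
Proof.
move=> ud d0 dn.
have cnt (x : direction R) : x \in ds -> (\sum_(d <- ds) (d == x))%N = 1%N.
  by move=> xd; have := count_uniq_mem x ud; rewrite xd -sum1_count big_mkcond.
rewrite (eq_bigr (fun d => (d == Some 0)%:Z * (ia q true)%:Z + (d == None)%:Z * (ia q false)%:Z)).
  by rewrite big_split /= -!mulr_suml !sum_Posz !cnt // !mul1r.
move=> d _; rewrite ia_other; case: d => [c|] /=; last by rewrite mul0r mul1r add0r.
by rewrite mul0r addr0 orbF; case: eqP => _; rewrite ?mul1r ?mul0r.
Qed.

(** In the dicritical case a generic direction has excess 1; subtracting it leaves a finite sum. *)
Lemma sum_ex_exc q : exists ds0 : seq (direction R), forall ds, uniq ds -> {subset ds0 <= ds} ->
  \sum_(d <- ds) (ex (d :: q) (eb d) - (dic q)%:Z) = tau q - (dic q)%:Z *+ 2.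
Proof.
have [d1 h1] := sum_oo_exc q; have [d2 h2] := sum_fl_exc q.
exists (Some 0 :: None :: d1 ++ d2) => ds ud sd.
have s1 : {subset d1 <= ds} by move=> d dd; apply: sd; rewrite !inE mem_cat dd !orbT.
have s2 : {subset d2 <= ds} by move=> d dd; apply: sd; rewrite !inE mem_cat dd !orbT.
have e3 : \sum_(d <- ds) (ia (d :: q) (~~ eb d))%:Z = iq q.
  by apply: sum_other_exc ud _ _; apply: sd; rewrite !inE eqxx ?orbT.
have -> : \sum_(d <- ds) (ex (d :: q) (eb d) - (dic q)%:Z) = \sum_(d <- ds) (oo (d :: q) (eb d) - (dic q)%:Z)
   - \sum_(d <- ds) fl (d :: q) (eb d) - \sum_(d <- ds) (ia (d :: q) (~~ eb d))%:Z.
  by rewrite -!sumrB; apply: eq_bigr => d _; rewrite /ex; ring.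
by rewrite (h1 ds ud s1) (h2 ds ud s2) e3 /tau !mulrSr !mulr0n; ring.
Qed.

End Index.


(** * Nonnegativity, bounds and telescoping of the excesses over the tree *)

Section IndexTree.
Variable R : realType.
Local Notation C := R[i].
Local Notation fps2 := (fps2 R).
Local Notation t := (fpsX C).
Implicit Types (f g h : fps2) (c z : C) (s u v : fps C) (gam del p : parc R) (B : curve R) (d : direction R) (b : bool) (W : Defs.form R) (q : Defs.point R).
Notation exc d := (axeq R (eb d)).
Notation earc d := (axarc R (eb d)).
Variables (w : Defs.form R) (T : set (Defs.point R)) (ss : seq (curve R)) (cf : curve R -> int).
Hypothesis wco : no_common_factor w.1 w.2.
Hypothesis RT : resolves w T.
Hypothesis T0 : T [::].
Hypothesis ssu : uniq ss.
Hypothesis sss : forall B, B \in ss -> separatrix w B.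
Hypothesis cfiso : forall B q b, separatrix w B -> final T q -> passes B q -> axis_at q b ->
  pb (axarc R b) (tcomp b (strict_form w q)) = 0 -> B \in ss /\ cf B = 1.
(* The directions of [vs] are those of the points of [s] from which another component
   grows, or which are corners: their number is the valence of [s]. *)
Hypothesis cfdic : forall s : Defs.point R, T s -> dic w s -> exists vs : seq (direction R),
  [/\ uniq vs, forall d, d \in vs <-> T (d :: s) \/ corner (d :: s) &
      \sum_(B <- ss) cf B * (`[< exists d, d \notin vs /\ passes B (d :: s) >])%:Z = 2 - (size vs)%:Z].
Notation lw q := (strict_form w q).
Notation feq B q := (strict_eq (equation B) q).
Notation inv q b := (pb (axarc R b) (tcomp b (lw q)) = 0).
Local Notation EX := (ex w ss cf).
Local Notation TAU := (tau w ss cf).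
Local Notation IA := (ia w).
Local Notation DIC := (dic w).
Local Notation FL := (fl ss cf).
Local Notation OO := (oo w).
Let w0 : nzform w := nz_of_coprime wco.
Let ssi B (h : B \in ss) : irreducible (equation B) := sep_curve (sss h).

(** Leaves out the noncorner final points of dicritical components: their excesses can be negative
    and are compensated by the balance condition. *)
Definition good q b := axis_at q b /\ (T q \/ (final T q /\ (corner q \/ IA q b))).

Lemma final_child d q : T q -> ~ T (d :: q) -> final T (d :: q).
Proof. by move=> Tq nT; split. Qed.

Lemma T_tail d q : T (d :: q) -> T q.
Proof. by have [[_ Tc] _ _ _] := RT; exact: Tc. Qed.

Lemma passes_ord B q b : B \in ss -> final T q -> axis_at q b ->
  ord (pb (axarc R b) (feq B q)) = `[< passes B q >] :> nat.
Proof.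
move=> Bs fq qb; case: asboolP => pB.
  by have [g [_ _ _ h _]] := final_arc RT (sss Bs) fq pB; have [_ [_ e]] := h b qb.
by apply: ord_unit; rewrite pb_at0; apply/eqP.
Qed.

Lemma fl_final q b : final T q -> axis_at q b -> ~ (exists B, separatrix w B /\ passes B q) ->
  FL q b = 0.
Proof.
move=> fq qb nB; rewrite /fl.
rewrite big_seq big1 // => B Bs; rewrite (passes_ord Bs fq qb) asboolF ?mulr0 // => pB.
by apply: nB; exists B; split; [exact: sss|exact: pB].
Qed.

Lemma corner_avoid q : final T q -> corner q -> ~ (exists B, separatrix w B /\ passes B q).
Proof. by move=> fq cq [B [sB pB]]; have [_ _ c3 _] := RT; have [_ nc _] := c3 B q sB fq pB. Qed.

Lemma fl_iso q b : final T q -> axis_at q b -> IA q b ->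
  FL q b = (`[< exists B, separatrix w B /\ passes B q >])%:Z.
Proof.
move=> fq qb iq; case: asboolP => [[B [sB pB]]|nB]; last exact: fl_final.
have [Bs c1] := cfiso sB fq pB qb (elimT (iaP w0 qb) iq).
rewrite /fl (bigD1_seq B) //= c1 (passes_ord Bs fq qb) asboolT // mulr1.
rewrite big_seq_cond big1 ?addr0 // => B' /andP[B's ne].
rewrite (passes_ord B's fq qb) asboolF ?mulr0 // => pB'; case/eqP: ne.
by have [_ _ _ c4] := RT; exact: c4 (sss B's) sB fq pB' pB.
Qed.

Lemma corner_axis q b : corner q -> axis_at q b.
Proof. by move/cornerP. Qed.

Lemma other_corner q b : axis_at q b -> axis_at q (~~ b) -> corner q.
Proof. by move=> h h'; apply/cornerP => b'; case: b b' h h' => [] []. Qed.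

(** On an invariant component a singular final point carries exactly one more invariant curve, the
    other component or a separatrix of coefficient 1, and a regular one carries none. A good
    noninvariant axis is at a corner, where the excess is 1 - 0 - 1. *)
Lemma ex_final q b : final T q -> good q b ->
  EX q b = if IA q b then OO q b - (`[< singular (lw q) >])%:Z else 0.
Proof.
move=> fq [qb [Tq|[_ gq]]]; first by case: fq => /(_ Tq).
case: ifP => i.
  rewrite /ex fl_iso // -addrA -opprD; congr (_ - _); rewrite -PoszD; congr Posz.
  have iP := elimT (iaP w0 qb) i.
  case: (asboolP (exists B, separatrix w B /\ passes B q)) => [[B [sB pB]]|nB].
    have sq : singular (lw q) := inv_passes_singular wco RT sB fq pB qb iP.
    rewrite (asboolT sq).
    case i' : (IA q (~~ b)) => //.
    by case: (corner_avoid fq (other_corner qb (ia_axis i'))); exists B; split; [exact: sB|exact: pB].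
  rewrite add0n; case: (asboolP (singular (lw q))) => sq.
    have [ai [cq|[B [sB pB]]]] := final_singular wco RT fq sq.
      by rewrite (introT (iaP w0 (corner_axis _ cq)) (ai _ (corner_axis _ cq))).
    by case: nB; exists B; split; [exact: sB|exact: pB].
  case i' : (IA q (~~ b)) => //; case: sq.
  exact: inv_both_singular iP (elimT (iaP w0 (ia_axis i')) i').
have cq : corner q by case: gq => //; rewrite i.
have ni : ~ inv q b by move/(introT (iaP w0 qb)); rewrite i.
have [ns t0 co _] := final_dicritical wco RT fq qb ni.
rewrite /ex fl_final //; last exact: corner_avoid.
rewrite (introT (iaP w0 (corner_axis _ cq)) (co cq)) /oo i ord_unit ?pb_at0; last exact/eqP.
by [].
Qed.

Lemma ex_final_ge0 q b : final T q -> good q b -> 0 <= EX q b.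
Proof.
move=> fq gq; rewrite (ex_final fq gq); case: ifP => // i; rewrite /oo i.
case: asboolP => [sq|_]; last by rewrite subr0.
rewrite subr_ge0 lez_nat; have n0 := ncomp_neq0 w0 i; rewrite (ord_gt0 n0) pb_at0.
by case: sq => h1 h2; case: (b); rewrite /= ?h1 ?h2.
Qed.

(** In the dicritical case the sum of the excesses minus 1 is tau - 2. The directions of [vs]
    contribute their excesses minus v, and the others contribute v - 2 by balancedness, where v is
    the size of [vs]; the constants cancel. *)
Lemma tau_sum q : T q -> exists l : seq (direction R),
  [/\ TAU q = \sum_(d <- l) EX (d :: q) (eb d), forall d, d \in l -> good (d :: q) (eb d), uniq l &
      forall d, good (d :: q) (eb d) -> d \in l \/ EX (d :: q) (eb d) = 0].
Proof.
move=> Tq; have [ds0 h] := sum_ex_exc cf w0 ssi q.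
have ax d : axis_at (d :: q) (eb d) by rewrite axis_at_exc.
case dq : (DIC q) h => h.
  have [vs [uv vP vsum]] := cfdic Tq dq; exists vs.
  have nvP d : d \notin vs -> final T (d :: q) /\ ~ corner (d :: q).
    move=> /negP dv; split; last by move=> cd; apply: dv; apply/vP; right.
    by apply: final_child Tq _ => Td; apply: dv; apply/vP; left.
  split=> //.
  (* The directions outside [vs] where some curve of [ss] meets the component; they must belong to
     the list of summation. *)
  - have [r rP] : exists r : seq (direction R), forall B d, B \in ss -> d \notin vs -> passes B (d :: q) -> d \in r.
      have nthP : forall B, B \in ss -> exists r : seq (direction R), forall d, d \notin vs -> passes B (d :: q) -> d \in r.
        move=> B Bs; have [[d1 [n1 p1]]|np] := pselect (exists d, d \notin vs /\ passes B (d :: q)); last first.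
          by exists [::] => d n p; case: np; exists d.
        exists [:: d1] => d n p; have := final_unique RT T0 (sss Bs) (nvP d n).1 (nvP d1 n1).1 p p1.
        by case=> ->; rewrite inE.
      elim: (ss) nthP => [_|B s IH hs]; first by exists [::].
      have [|r1 h1] := IH; first by move=> B' hB; apply: hs; rewrite inE hB orbT.
      have [r2 h2] := hs B (mem_head _ _); exists (r1 ++ r2) => B' d.
      rewrite inE mem_cat => /orP[/eqP->|hB] n p; first by rewrite (h2 d n p) orbT.
      by rewrite (h1 B' d hB n p).
    pose ds := undup (vs ++ ds0 ++ r).
    have uds : uniq ds by exact: undup_uniq.
    have := h ds uds; rewrite (_ : true%:Z = 1) // => {}h.
    have {h} : \sum_(d <- ds) (EX (d :: q) (eb d) - 1) = TAU q - 1 *+ 2.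
      by apply: h => d dd; rewrite mem_undup !mem_cat dd orbT.
    rewrite (bigID (mem vs)) /=.
    have -> : \sum_(d <- ds | d \in vs) (EX (d :: q) (eb d) - 1) = \sum_(d <- vs) EX (d :: q) (eb d) - (size vs)%:Z.
      rewrite -big_filter (perm_big vs) /=.
        by rewrite sumrB big_const_seq count_predT iter_addr_0 -natz mulr1n || rewrite sumrB big_const_seq count_predT iter_addr_0 natz.
      apply: uniq_perm; [exact: filter_uniq|exact: uv|move=> d].
      by rewrite mem_filter mem_undup mem_cat; case: (d \in vs).
    have -> : \sum_(d <- ds | d \notin vs) (EX (d :: q) (eb d) - 1) = (size vs)%:Z - 2.
      apply: (@etrans _ _ (- \sum_(d <- ds | d \notin vs) FL (d :: q) (eb d))).
        rewrite -sumrN; apply: eq_bigr => d /nvP[fd ncd].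
        have nia : IA (d :: q) (eb d) = false by rewrite ia_exc dq.
        have ni : ~ inv (d :: q) (eb d) by move/(introT (iaP w0 (ax d))); rewrite nia.
        have [ns t0 co _] := final_dicritical wco RT fd (ax d) ni.
        rewrite /ex /oo nia ord_unit ?pb_at0; last exact/eqP.
        case i' : (IA (d :: q) (~~ eb d)); last by rewrite /= subr0 addrAC subrr add0r.
        by case: ncd; exact: other_corner (ax d) (ia_axis i').
      (* Summing first over directions counts each curve at most once, since it passes through a
         single final point; what remains is the balance sum. *)
      rewrite /fl exchange_big /=.
      have -> : (size vs)%:Z - 2 = - (2 - (size vs)%:Z) by ring.
      rewrite -vsum; congr (- _); rewrite big_seq [RHS]big_seq; apply: eq_bigr => B Bs.
      rewrite -mulr_sumr -big_filter sum_Posz; congr (_ * _%:Z).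
      pose G d : nat := `[< passes B (d :: q) >].
      have G1 d : passes B (d :: q) -> G d = 1%N by move=> p; rewrite /G (asboolT p).
      have G0 d : ~ passes B (d :: q) -> G d = 0%N by move=> p; rewrite /G (asboolF p).
      rewrite (eq_big_seq G); last first.
        by move=> d; rewrite mem_filter => /andP[n _]; exact: passes_ord Bs (nvP d n).1 (ax d).
      move: G G1 G0 => G G1 G0.
      case: (asboolP (exists d, d \notin vs /\ passes B (d :: q))) => [[d1 [n1 p1]]|np].
        have d1l : d1 \in [seq i <- ds | i \notin vs].
          by rewrite mem_filter n1 mem_undup !mem_cat (rP B d1 Bs n1 p1) !orbT.
        rewrite (bigD1_seq d1 d1l (filter_uniq _ uds)) (G1 d1 p1).
        rewrite big_seq_cond big1; [exact: addn0|move=> d /andP[]; rewrite mem_filter => /andP[n _] ne].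
        apply: G0 => p; case/eqP: ne.
        by case: (final_unique RT T0 (sss Bs) (nvP d n).1 (nvP d1 n1).1 p p1).
      rewrite big_seq big1; first exact: erefl.
      move=> d; rewrite mem_filter => /andP[n _].
      apply: G0 => p; apply: np; exists d; split; [exact: n|exact: p].
    by move=> e; rewrite -(subrK (1 *+ 2) (TAU q)) -e; ring.
  - move=> d /vP dv; split; first exact: ax.
    have [Td|nT] := pselect (T (d :: q)); first by left.
    by right; split; [exact: final_child|case: dv => // c; left].
  - move=> d [_ gd]; left; apply/vP.
    case: gd => [Td|[_ [cd|]]]; [by left|by right|by rewrite ia_exc dq].
have gd d : good (d :: q) (eb d).
  split; first exact: ax.
  have [Td|nT] := pselect (T (d :: q)); first by left.
  by right; split; [exact: final_child|right; rewrite ia_exc dq].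
have h' (ds : seq (direction R)) : uniq ds -> {subset ds0 <= ds} -> TAU q = \sum_(d <- ds) EX (d :: q) (eb d).
  move=> ud sd; have := h ds ud sd; rewrite mul0rn subr0 => <-.
  by apply: eq_bigr => d _; rewrite subr0.
exists (undup ds0); split; [|by []|exact: undup_uniq|].
  by apply: h'; [exact: undup_uniq|move=> d; rewrite mem_undup].
move=> d _; have [dd|nd] := boolP (d \in undup ds0); [by left|right].
have e1 : TAU q = \sum_(d <- undup ds0) EX (d :: q) (eb d).
  by apply: h'; [exact: undup_uniq|move=> x; rewrite mem_undup].
have := h' (d :: undup ds0); rewrite big_cons -e1 /= nd undup_uniq => /(_ isT) e.
suff e2 : TAU q = EX (d :: q) (eb d) + TAU q by apply: (addIr (TAU q)); rewrite add0r -e2.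
by apply: e => x xd; rewrite inE mem_undup xd orbT.
Qed.

Lemma good_dir q b : T q -> axis_at q b -> good (dir R b :: q) b.
Proof.
move=> Tq qb; have qb' : axis_at (dir R b :: q) b by rewrite axis_at_dir.
split=> //; have [Td|nT] := pselect (T (dir R b :: q)); first by left.
right; split; [exact: final_child|left]; apply: (other_corner qb').
by rewrite -(eb_dir R b) axis_at_exc.
Qed.

(** Induction from the final points down to the origin: tau is a sum of excesses of children, and
    the excess along an axis is tau plus the excess at the next point of that axis. *)
Lemma index_ge0 q : (T q -> 0 <= TAU q) /\ forall b, good q b -> 0 <= EX q b.
Proof.
have [M Mb] := tree_bound RT.
suff H n : forall q, (M - size q <= n)%N -> T q -> 0 <= TAU q /\ forall b, good q b -> 0 <= EX q b.
  split=> [Tq|b gq]; first by have [] := H _ q (leqnn _) Tq.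
  have [qb [Tq|[fq _]]] := gq; first by have [_] := H _ q (leqnn _) Tq; apply.
  exact: ex_final_ge0.
elim: n => [|n IH] {}q le Tq; first by have := Mb _ Tq; lia.
have IH' d b : good (d :: q) b -> 0 <= EX (d :: q) b.
  move=> gd; have [_ [Td|[fd _]]] := gd; last exact: ex_final_ge0.
  have [||_] := IH (d :: q); [by have := Mb _ Tq; rewrite /=; lia|exact: Td|exact].
have t0 : 0 <= TAU q.
  have [l [-> lg _ _]] := tau_sum Tq.
  by rewrite big_seq sumr_ge0 // => d /lg; exact: IH'.
split=> // b [qb _]; rewrite (ex_dir cf w0 ssi qb) addr_ge0 //; exact: IH' (good_dir Tq qb).
Qed.

Lemma good_T q b : T q -> axis_at q b -> good q b.
Proof. by move=> Tq qb; split=> //; left. Qed.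

(** By nonnegativity an excess is at most tau of the point just blown up, on the new component, or
    the previous excess on an older one; and tau is at most the excess along the last exceptional
    component. *)
Lemma index_mono q : (T q -> TAU q <= TAU [::]) /\ forall b, good q b -> EX q b <= TAU [::].
Proof.
elim: q => [|d q [IHt IHe]]; first by split=> // b [] ; case: b.
have aux : forall b, good (d :: q) b -> EX (d :: q) b <= TAU [::].
  move=> b gd; have Tq : T q by case: gd => _ [/T_tail|[[_ ]]].
  case e : (axis_at (d :: q) b) => [s|]; last by case: gd; rewrite e.
  have [[eb_ _]|[ed qb]] := axis_at_cons e.
    apply: le_trans (IHt Tq); have [l [te lg ul lc]] := tau_sum Tq.
    rewrite eb_ in gd *; have [dl|->] := lc d gd; last exact: (index_ge0 q).1.
    rewrite te (bigD1_seq d) //= lerDl big_seq_cond sumr_ge0 // => x /andP[/lg gx _].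
    exact: (index_ge0 _).2 _ gx.
  have qb' : axis_at q b by rewrite qb.
  apply: le_trans (IHe b (good_T Tq qb')); rewrite (ex_dir cf w0 ssi qb') ed lerDr.
  exact: (index_ge0 q).1.
split=> // Td; have ax : axis_at (d :: q) (eb d) by rewrite axis_at_exc.
apply: le_trans (aux _ (good_T Td ax)); rewrite (ex_dir cf w0 ssi ax) lerDl.
exact: (index_ge0 _).2 _ (good_dir Td ax).
Qed.

Lemma index_vanish : (forall q b, final T q -> good q b -> EX q b = 0) ->
  forall q, T q -> TAU q = 0.
Proof.
move=> ef; have [M Mb] := tree_bound RT.
suff H n : forall q, (M - size q <= n)%N -> T q -> TAU q = 0 /\ forall b, good q b -> EX q b = 0.
  by move=> q Tq; have [] := H _ q (leqnn _) Tq.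
elim: n => [|n IH] q le Tq; first by have := Mb _ Tq; lia.
have IH' d b : good (d :: q) b -> EX (d :: q) b = 0.
  move=> gd; have [_ [Td|[fd _]]] := gd; last exact: ef.
  have [||_] := IH (d :: q); [by have := Mb _ Tq; rewrite /=; lia|exact: Td|exact].
have t0 : TAU q = 0.
  have [l [-> lg _ _]] := tau_sum Tq.
  by rewrite big_seq big1 // => d /lg; exact: IH'.
split=> // b [qb _]; rewrite (ex_dir cf w0 ssi qb) t0 add0r; exact: IH' (good_dir Tq qb).
Qed.

(** Total of the h tau met on the way from the origin to q, h being the order of the exceptional
    divisor along the lift of the curve. *)
Fixpoint path_excess q gam : int :=
  if q is d :: r then (ord (pb gam (exc d)))%:Z * TAU r + path_excess r (push (bl d) gam) else 0.

Lemma path_excess_ge0 q gam : (if q is _ :: r then T r else True) -> 0 <= path_excess q gam.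
Proof.
elim: q gam => [|d q IH] gam //= Tq; rewrite addr_ge0 //.
  by rewrite mulr_ge0 // (index_ge0 q).1.
by apply: IH; case: q Tq => // x r /T_tail.
Qed.

(** The terms are nonnegative, and the coefficient of tau at the origin is a positive order. *)
Lemma path_excess_root d q gam : T q -> offaxes (d :: q) gam -> path_excess (d :: q) gam = 0 -> TAU [::] = 0.
Proof.
elim: q d gam => [|d' q IH] d gam Tq off.
  rewrite /= addr0 => /eqP; rewrite mulf_eq0 eqz_nat (ord_eq0 (offaxes_exc off)) => /orP[|/eqP //].
  by rewrite pb_at0 axeq0 eqxx.
have Tq' := T_tail Tq; rewrite [path_excess _ _]/= => /eqP; rewrite paddr_eq0.
- by move=> /andP[_ /eqP h]; apply: (IH d' (push (bl d) gam) Tq' (offaxes_push off)).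
- by rewrite mulr_ge0 // (index_ge0 _).1.
- exact: (@path_excess_ge0 (d' :: q)).
Qed.

Lemma path_excess_eq0 q gam : (forall r, T r -> TAU r = 0) -> (if q is _ :: r then T r else True) ->
  path_excess q gam = 0.
Proof.
move=> h; elim: q gam => [|d q IH] gam //= Tq; rewrite h // mulr0 add0r.
by apply: IH; case: q Tq => // x r /T_tail.
Qed.

(** For a simple zero B with arc [gam], the analogue at q of the polar number of w minus that of dF:
    the latter is the order of the differential of B plus the intersection with the rest of the
    divisor. *)
Definition dlt B q gam : int := (ordon gam (lw q))%:Z - (ordon gam (dform (feq B q)))%:Z
  - \sum_(B' <- ss | B' != B) cf B' * (ord (pb gam (feq B' q)))%:Z.
Definition ii q gam : int := (IA q true)%:Z * (ord (pb gam (axeq R true)))%:Z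
  + (IA q false)%:Z * (ord (pb gam (axeq R false)))%:Z.

Lemma ii_arith1 (i x : bool) (n0 n1 n2 : nat) : (i -> n0 = n1 + x * n2)%N ->
  i%:Z * n0%:Z = i%:Z * n1%:Z + (x && i)%:Z * n2%:Z.
Proof. by case: i x => [] [] h; rewrite ?(h isT); lia. Qed.

Lemma ii_arith2 (x a b e : bool) (h nt : nat) :
  a%:Z * h%:Z + (x && a)%:Z * nt%:Z + (b%:Z * h%:Z + (false && b)%:Z * h%:Z) + (~~ e)%:Z * h%:Z =
  (a%:Z + b%:Z) * h%:Z + ((x && a || false && b)%:Z * nt%:Z + (~~ e)%:Z * h%:Z).
Proof. by case: x a b e => [] [] [] []; lia. Qed.

Lemma ii_arith3 (a b e : bool) (h nf : nat) :
  a%:Z * h%:Z + (false && a)%:Z * h%:Z + (b%:Z * h%:Z + (true && b)%:Z * nf%:Z) + (~~ e)%:Z * h%:Z =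
  (a%:Z + b%:Z) * h%:Z + ((~~ e)%:Z * h%:Z + (false && a || true && b)%:Z * nf%:Z).
Proof. by case: a b e => [] [] []; lia. Qed.

(** Each axis of q, pulled back, is the exceptional divisor plus its strict transform, which passes
    through the new point only in its own direction. *)
Lemma ii_blow d q gam : offaxes (d :: q) gam ->
  ii q (push (bl d) gam) + (~~ DIC q)%:Z * (ord (pb gam (exc d)))%:Z
  = (iq w q) * (ord (pb gam (exc d)))%:Z + ii (d :: q) gam.
Proof.
move=> off; have e0 := offaxes_exc off.
have kn b : IA q b -> ord (pb (push (bl d) gam) (axeq R b)) =
    (ord (pb gam (exc d)) + (d == dir R b) * ord (pb gam (axeq R b)))%N.
  move=> i; rewrite pb_push; have [ed|nd] := eqVneq d (dir R b).
    have ax' : axis_at (d :: q) b by rewrite ed axis_at_dir; exact: ia_axis i.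
    have b0 := off b ax'.
    have -> : pb gam (sb (bl d) (axeq R b)) = pb gam (exc d) * pb gam (axeq R b).
      rewrite ed; case: (b); [apply: etrans (congr1 (pb gam) (sb_Y _)) _|apply: etrans (congr1 (pb gam) (sb_X _)) _].
        apply: etrans (pbM gam (X R) _) _; congr (_ * _).
        by rewrite pbD pb_cst (raddf0 (@fpsC C)) addr0.
      by apply: etrans (pbM gam (X R) _) _; exact: mulrC.
    by rewrite (ordM e0 b0) mul1n.
  rewrite mul0n addn0.
  case: d nd off e0 => [c|] nd off e0; case: b i nd => i nd.
  - have c0 : c != 0 by apply: contraNneq nd => ->.
    have u0 : pb gam (Y R + cst2 c) 0%N != 0 by rewrite pb_at0 at0D at0_Y add0r at0_cst.
    have -> : pb gam (sb (bl (Some c)) (axeq R true)) = pb gam (X R) * pb gam (Y R + cst2 c).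
      by apply: etrans (congr1 (pb gam) (sb_Y _)) _; exact: pbM.
    by rewrite (ordM e0 (neq0_coef u0)) (ord_unit u0) addn0.
  - by apply: (congr1 (fun x => ord (pb gam x))); exact: sb_X.
  - by apply: (congr1 (fun x => ord (pb gam x))); exact: sb_Y.
  - by rewrite eqxx in nd.
have key b : (IA q b)%:Z * (ord (pb (push (bl d) gam) (axeq R b)))%:Z =
    (IA q b)%:Z * (ord (pb gam (exc d)))%:Z + ((d == dir R b) && IA q b)%:Z * (ord (pb gam (axeq R b)))%:Z.
  exact: ii_arith1 (kn b).
rewrite /ii (key true) (key false) /iq; move: (ia_exc w d q) (ia_other w d q).
case: d {off e0 key kn} => [c|]; rewrite [eb _]/= [~~ _]/= => -> ->; exact: ii_arith2 || exact: ii_arith3.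
Qed.

Lemma dlt_arith (o1 o2 o3 o4 m1 m2 h : nat) (i1 i2 i3 v S : int) (dd : bool) :
  (o1 + m1 * h + o2 = o3 + m2 * h + o4)%N -> i1 + (~~ dd)%:Z * h%:Z = i3 * h%:Z + i2 ->
  o1%:Z - o3%:Z - (h%:Z * (v - m1%:Z) + S) - i1 =
  h%:Z * (m2%:Z - v + 1 - i3 - dd%:Z) + (o4%:Z - o2%:Z - S - i2).
Proof.
move=> e ih; have {}e : o1%:Z = o3%:Z + m2%:Z * h%:Z + o4%:Z - m1%:Z * h%:Z - o2%:Z.
  by rewrite -!PoszM -!PoszD -e !PoszD; ring.
have -> : i1 = i3 * h%:Z + i2 - (~~ dd)%:Z * h%:Z by rewrite -ih; ring.
have -> : (~~ dd)%:Z = 1 - dd%:Z by case: dd {ih}.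
by rewrite e; ring.
Qed.

Lemma dlt_blow B d q gam : separatrix w B -> B \in ss -> cf B = 1 -> offaxes (d :: q) gam -> nonconst gam ->
  pb gam (feq B (d :: q)) = 0 -> nzon gam (dform (feq B (d :: q))) ->
  nzon (push (bl d) gam) (lw q) -> tpb gam (lw (d :: q)) = 0 ->
  (forall B', B' \in ss -> B' != B -> pb gam (feq B' (d :: q)) != 0) ->
  dlt B q (push (bl d) gam) - ii q (push (bl d) gam) =
    (ord (pb gam (exc d)))%:Z * TAU q + (dlt B (d :: q) gam - ii (d :: q) gam).
Proof.
move=> sB Bs c1 off nc gf nf nw tg nB.
have e0 := offaxes_exc off; have fq := feq_neq0 ssi q Bs.
have pf : pb (push (bl d) gam) (feq B q) = 0.
  rewrite (pb_strict d gam fq); apply: etrans (mulr0 (pb gam (exc d) ^+ mlt (feq B q))).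
  exact: congr1 gf.
have tq : tpb (push (bl d) gam) (lw q) = 0.
  rewrite (tpb_blow d gam (nz_strict_form q w0)).
  apply: etrans (mulr0 (pb gam (exc d) ^+ mexp (lw q))); exact: congr1 tg.
have wz := wedge_tpb (push_nonconst e0) pf tq.
have [_ e] := delta_blow fq e0 nw (nzon_dform_push fq gf e0 nf) pf wz.
have ih := ii_blow off.
set h := ord (pb gam (exc d)) in e ih *.
have se : \sum_(B' <- ss | B' != B) cf B' * (ord (pb (push (bl d) gam) (feq B' q)))%:Z =
   h%:Z * (fv ss cf q - (mlt (feq B q))%:Z) + \sum_(B' <- ss | B' != B) cf B' * (ord (pb gam (feq B' (d :: q))))%:Z.
  rewrite /fv (bigD1_seq B) //= c1 mul1r addrAC subrr add0r mulr_sumr -big_split /=.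
  rewrite big_seq_cond [RHS]big_seq_cond; apply: eq_bigr => B' /andP[B's ne].
  have fq' := feq_neq0 ssi q B's.
  rewrite (pb_strict d gam fq') ordM ?expf_neq0 //; last exact: nB.
  by rewrite ordX // PoszD PoszM -/h; ring.
have e' : (ordon (push (bl d) gam) (lw q) + mlt (feq B q) * h + ordon gam (dform (feq B (d :: q))) =
  ordon (push (bl d) gam) (dform (feq B q)) + mexp (lw q) * h + ordon gam (lw (d :: q)))%N.
  exact: e.
have k := dlt_arith (fv ss cf q) (\sum_(B' <- ss | B' != B) cf B' * (ord (pb gam (feq B' (d :: q))))%:Z) e' ih.
apply: etrans (etrans _ k) _.
  exact: (congr1 (fun S : int => (ordon (push (bl d) gam) (lw q))%:Z
    - (ordon (push (bl d) gam) (dform (feq B q)))%:Z - S - ii q (push (bl d) gam)) se).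
exact: erefl.
Qed.

Lemma dlt_path B q gam : separatrix w B -> B \in ss -> cf B = 1 -> offaxes q gam -> nonconst gam ->
  pb gam (feq B q) = 0 -> nzon gam (dform (feq B q)) ->
  dlt B [::] (pushq q gam) = path_excess q gam + (dlt B q gam - ii q gam).
Proof.
move=> sB Bs c1; elim: q gam => [|d q IH] gam off nc gf nf.
  suff -> : ii [::] gam = 0 by rewrite subr0 add0r.
  have zi b : (IA [::] b)%:Z = 0 by case: b.
  by rewrite /ii (zi true) ?(zi false) !mul0r addr0.
have e0 := offaxes_exc off; have fq := feq_neq0 ssi q Bs; have offp := offaxes_push off.
have Bi := sep_curve sB; have B0 := irr_neq0 Bi.
have pf : pb (push (bl d) gam) (feq B q) = 0.
  rewrite (pb_strict d gam fq); apply: etrans (mulr0 (pb gam (exc d) ^+ mlt (feq B q))).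
  exact: congr1 gf.
have gB := (pb_strict_eq B0 off).1 gf; have ncp := push_nonconst e0.
have ncr := pushq_nonconst nc off.
have nw := nzon_w wco Bi ncr gB.
have nfr := nzon_dform_pushq B0 off gf nf.
have tg := (tpb_pushq w0 off).1 (tpb_wedge gB nfr (sep_wedge sB gB)).
have nB B' : B' \in ss -> B' != B -> pb gam (feq B' (d :: q)) != 0.
  move=> B's ne; apply/eqP => z; case/eqP: ne.
  have B'i := ssi B's; have h := (pb_strict_eq (irr_neq0 B'i) off).1 z.
  apply: esym; apply: curve_ext (sB.1) ((sss B's).1) _.
  exact: (ker_irreducible _ ncr Bi gB).1 h.
apply: etrans (IH (push (bl d) gam) offp ncp pf (nzon_dform_push fq gf e0 nf)) _.
have shuffle (a u x : int) : a + (u + x) = u + a + x by ring.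
exact: (etrans (congr1 (fun x => path_excess q (push (bl d) gam) + x)
  (dlt_blow sB Bs c1 off nc gf nf (nzon_pushq offp nw) tg nB))
  (shuffle (path_excess q (push (bl d) gam)) ((ord (pb gam (exc d)))%:Z * TAU q) (dlt B (d :: q) gam - ii (d :: q) gam))).
Qed.

Lemma dlt_final B q gam b : separatrix w B -> B \in ss -> final T q -> passes B q ->
  smooth_arc gam -> pb gam (feq B q) = 0 -> axis_at q b -> ord (pb gam (axeq R b)) = 1%N ->
  dlt B q gam - ii q gam = (ordon gam (lw q))%:Z - (IA q b)%:Z.
Proof.
move=> sB Bs fq pB sg gf qb o1.
have [sm nc _] : [/\ smooth (feq B q), ~ corner q & True].
  by have [_ _ c3 _] := RT; have [h1 h2 _] := c3 B q sB fq pB; split.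
have -> : ii q gam = (IA q b)%:Z.
  have i' : IA q (~~ b) = false.
    by apply/negbTE/negP => /ia_axis h; apply: nc; exact: other_corner qb h.
  by rewrite /ii; case: (b) o1 i' => /= -> ->; rewrite mul0r mulr1 ?addr0 ?add0r.
congr (_ - _); rewrite /dlt.
have -> : ordon gam (dform (feq B q)) = 0%N.
  apply: ord2_eq0; case: sm => h; [left|right] => e; apply: h;
  by apply: etrans e; apply: esym; exact: pb_at0.
rewrite big_seq_cond big1; first by rewrite !subr0.
move=> B' /andP[B's ne]; rewrite ord_unit ?mulr0 // pb_at0; apply/eqP => z; case/eqP: ne.
by have [_ _ _ c4] := RT; exact: c4 (sss B's) sB fq z pB.
Qed.

End IndexTree.


(** * Residues of quotients of power series *)

Section Residue.
Variable K : fieldType.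
Local Notation t := (fpsX K).
Implicit Types (f g h u k : fps K).

(* The residue at t = 0 of (f / g) dt. *)
Definition res f g : K :=
  if ord g is n.+1 then (f * (Fps (fun i => g (i + ord g)%N) : fps K)^-1) n else 0.

Lemma ord_split g : g != 0 -> g = t ^+ ord g * Fps (fun i => g (i + ord g)%N) /\ g (ord g) != 0.
Proof.
move=> g0; have [v n0] := ordP g0; split=> //; apply: fpsP => i; rewrite fps_coefXnM.
by case: ltnP => [/v|le] //; rewrite /= subnK.
Qed.

Lemma unit_coef0 u : u 0%N != 0 -> u \is a GRing.unit.
Proof. by move=> u0; rewrite fps_unitE unitfE. Qed.

Lemma coef0_Xn n u : u 0%N != 0 -> ord (t ^+ n * u) = n.
Proof.
move=> u0; rewrite ordM ?expf_neq0 ?fpsX_neq0 ?(neq0_coef u0) //.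
by rewrite ordX ?fpsX_neq0 // ord_fpsX muln1 (ord_unit u0) addn0.
Qed.

Lemma resE n f u : u 0%N != 0 -> res f (t ^+ n * u) = if n is m.+1 then (f * u^-1) m else 0.
Proof.
move=> u0; rewrite /res coef0_Xn //; case: n => // n; congr ((f * _^-1) n).
by apply: fpsP => i /=; rewrite fps_coefXnM ltnNge leq_addl /= addnK.
Qed.

Lemma resD f f' g : res (f + f') g = res f g + res f' g.
Proof. by rewrite /res; case: (ord g) => [|n]; rewrite ?addr0 // mulrDl. Qed.

Lemma res0 g : res 0 g = 0.
Proof. by rewrite /res; case: (ord g) => // n; rewrite mul0r fps_coef0. Qed.

Lemma res_unit f u : u 0%N != 0 -> res f u = 0.
Proof. by move=> u0; rewrite /res (ord_unit u0). Qed.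

Lemma res_cancel k f g : k != 0 -> g != 0 -> res (k * f) (k * g) = res f g.
Proof.
move=> /ord_split[ek k0] /ord_split[eg g0]; move: ek eg.
set v := Fps _; set u := Fps _ => ek eg.
have v0 : v 0%N != 0 by []. have u0 : u 0%N != 0 by [].
move: (ord k) (ord g) ek eg => a n -> ->.
have -> : t ^+ a * v * (t ^+ n * u) = t ^+ (a + n) * (v * u) by rewrite exprD; ring.
rewrite !resE // ?fps_coefM0 ?mulf_neq0 //.
have -> : t ^+ a * v * f * (v * u)^-1 = t ^+ a * (f * u^-1).
  rewrite invrM ?unit_coef0 //; have vv := mulVr (unit_coef0 v0).
  move: (v^-1) (u^-1) vv => v' u' vv; transitivity (t ^+ a * f * u' * (v' * v)); first by ring.
  by rewrite vv; ring.
case: n => [|n]; last by rewrite addnS fps_coefXnM ltnNge leq_addr /= addKn.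
by rewrite addn0; case: a => [|a]; rewrite // fps_coefXnM ltnSn.
Qed.

Lemma res_1X : res 1 t = 1.
Proof.
have u0 : (1 : fps K) 0%N != 0 by rewrite fps_coef1 oner_neq0.
have -> : res 1 t = res 1 (t ^+ 1 * 1) by rewrite expr1 mulr1.
by rewrite resE // invr1 mulr1 fps_coef1.
Qed.

Lemma res_dlog f g : g != 0 -> res (t * f + g) (t * g) = res f g + 1.
Proof.
move=> g0; rewrite resD res_cancel ?fpsX_neq0 //; congr (_ + _).
by rewrite -{1}[g]mulr1 [t * g]mulrC res_cancel ?fpsX_neq0 // res_1X.
Qed.

End Residue.

(** * The residue theorem on the projective line *)

Section ResidueTheorem.
Variable R : realType.
Local Notation C := R[i].
Local Notation t := (fpsX C).
Implicit Types (G H Q P : {poly C}) (a b c : C).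

Definition rc Q P c := res (at_dir 0 Q (Some c)) (at_dir 0 P (Some c)).
(** With s = 1/z the form Q/P dz becomes - q/(s p) ds, where q and p are the reversals in degrees m
    and m + 1: this is the opposite of the residue at infinity. *)
Definition rinf m Q P := res (at_dir m Q None) (t * at_dir m.+1 P None).
Definition residue_thm m Q P := exists cs0 : seq C, forall cs : seq C, uniq cs -> {subset cs0 <= cs} ->
  \sum_(c <- cs) rc Q P c = rinf m Q P.

Lemma at_someM N Q P c : at_dir N (Q * P) (Some c) = at_dir 0 Q (Some c) * at_dir 0 P (Some c).
Proof. by rewrite /= comp_polyM rmorphM. Qed.

Lemma at_some_neq0 P c : P != 0 -> at_dir 0 P (Some c) != 0.
Proof.
move=> P0; apply: (@at_dir_neq0 R (size P) P (Some c) P0); exact: leqnSn.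
Qed.

Lemma at_some_XB a c : at_dir 0 ('X - a%:P) (Some c) = t + fpsC (c - a).
Proof.
have -> : at_dir 0 ('X - a%:P) (Some c) = ptp ('X + (c - a)%:P).
  by rewrite /= comp_polyB comp_polyX comp_polyC polyCB addrA.
exact: etrans (rmorphD (@ptp R) _ _) (congr2 +%R (ptp_X R) (ptp_C _)).
Qed.

Lemma rev_XB N a Q : (size Q <= N.+1)%N ->
  at_dir N.+1 (('X - a%:P) * Q) None = (1 - fpsC a * t) * at_dir N Q None.
Proof.
move=> sQ; have -> : ('X - a%:P) * Q = - (a%:P * Q) + 'X * Q by ring.
rewrite at_dirS; last by rewrite size_polyN (leq_trans (size_polyMleq _ _)) // size_polyC; case: eqP => _ /=; rewrite ?add1n ?add0n //= (leq_trans (leq_pred _)).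
have -> : at_dir N (- (a%:P * Q)) None = - (fpsC a * at_dir N Q None).
  by apply: fpsP => i; rewrite fps_coefN fps_coefCM /=; case: ifP => _; rewrite ?coefN ?coefCM ?mulr0 ?oppr0.
by move: (at_dir N Q None) => x; ring.
Qed.

Lemma rev_C N a Q : at_dir N (a%:P * Q) None = fpsC a * at_dir N Q None.
Proof. by apply: fpsP => i; rewrite fps_coefCM /=; case: ifP => _; rewrite ?coefCM ?mulr0. Qed.

Lemma rev_1 N : at_dir N 1 None = t ^+ N.
Proof.
apply: fpsP => i; rewrite coef_expX /= coef1; case: leqP => [le|lt]; last by rewrite gtn_eqF.
by rewrite subn_eq0 [i == N]eqn_leq le.
Qed.

Lemma rev_neq0 N Q : Q != 0 -> (size Q <= N.+1)%N -> at_dir N Q None != 0.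
Proof. by move=> Q0 s; apply: at_dir_neq0. Qed.

Lemma one_sub_neq0 a : (1 - fpsC a * t : fps C) 0%N != 0.
Proof. by rewrite fps_coefB fps_coef1 fps_coefCM fps_coefX mulr0 subr0 oner_neq0. Qed.

Lemma rt_add m Q Q' P : residue_thm m Q P -> residue_thm m Q' P -> residue_thm m (Q + Q') P.
Proof.
move=> [c1 h1] [c2 h2]; exists (c1 ++ c2) => cs ud sd.
rewrite /rinf at_dirD resD -/(rinf m Q P) -/(rinf m Q' P).
rewrite -(h1 cs ud) => [|c cc]; last by apply: sd; rewrite mem_cat cc.
rewrite -(h2 cs ud) => [|c cc]; last by apply: sd; rewrite mem_cat cc orbT.
by rewrite -big_split; apply: eq_bigr => c _; rewrite /rc at_dirD resD.
Qed.

Lemma rt_cancelX m a Q P : P != 0 -> (size Q <= m.+1)%N -> (size P <= m.+2)%N ->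
  residue_thm m Q P -> residue_thm m.+1 (('X - a%:P) * Q) (('X - a%:P) * P).
Proof.
move=> P0 sQ sP [cs0 h]; exists cs0 => cs ud sd.
rewrite /rinf !rev_XB // mulrCA res_cancel; last 2 first.
- exact: neq0_coef (one_sub_neq0 a).
- by rewrite mulf_neq0 ?fpsX_neq0 ?rev_neq0.
rewrite -/(rinf m Q P) -(h cs ud sd); apply: eq_bigr => c _.
by rewrite /rc !at_someM res_cancel ?at_some_neq0 // polyXsubC_eq0.
Qed.

Lemma rt_cancelC m a Q P : a != 0 -> P != 0 -> (size P <= m.+2)%N ->
  residue_thm m Q P -> residue_thm m (a%:P * Q) (a%:P * P).
Proof.
move=> a0 P0 sP [cs0 h]; exists cs0 => cs ud sd.
rewrite /rinf !rev_C mulrCA res_cancel; last 2 first.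
- by apply: (@neq0_coef _ _ 0).
- by rewrite mulf_neq0 ?fpsX_neq0 ?rev_neq0.
rewrite -/(rinf m Q P) -(h cs ud sd); apply: eq_bigr => c _.
by rewrite /rc !at_someM res_cancel ?at_some_neq0 // polyC_eq0.
Qed.

Lemma rc_unit Q P c : ~~ root P c -> rc Q P c = 0.
Proof.
move=> rP; apply: res_unit; rewrite /= -horner_coef0 horner_comp !hornerE.
by move: rP; rewrite /root.
Qed.

Lemma rev_pow n k a : at_dir (n + k) (('X - a%:P) ^+ n) None = (1 - fpsC a * t) ^+ n * t ^+ k.
Proof.
elim: n => [|n IH]; first by rewrite expr0 mul1r rev_1.
rewrite addSn exprS rev_XB ?IH; first by rewrite exprS mulrA.
by rewrite size_exp_XsubC ltnS leq_addr.
Qed.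

(** The only finite pole has order at least two and no residue, and the form is regular at
    infinity. *)
Lemma rt_pow m a n : (n.+2 <= m.+1)%N -> residue_thm m 1 (('X - a%:P) ^+ n.+2).
Proof.
move=> nm; exists [::] => cs _ _; have [k ->] : exists k, m = (n.+1 + k)%N by exists (m - n.+1)%N; lia.
rewrite big1_seq => [|c _].
  rewrite /rinf -addSn rev_pow rev_1.
  have -> : t * ((1 - fpsC a * t) ^+ n.+2 * t ^+ k) = t ^+ k.+1 * (1 - fpsC a * t) ^+ n.+2 by rewrite [t ^+ k.+1]exprS -mulrA [t ^+ k * _]mulrC.
  have -> : t ^+ (n.+1 + k) = t ^+ k.+1 * t ^+ n :> fps C by rewrite -exprD addSnnS addnC.
  have u0 : ((1 - fpsC a * t) ^+ n.+2 : fps C) 0%N != 0.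
    elim: n.+2 => [|j IH]; first by rewrite expr0 fps_coef1 oner_neq0.
    by rewrite exprS fps_coefM0 mulf_neq0 // one_sub_neq0.
  by rewrite res_cancel; [apply: esym; exact: res_unit|rewrite expf_neq0 ?fpsX_neq0|exact: neq0_coef u0].
have [ra|nr] := boolP (root (('X - a%:P) ^+ n.+2) c); last exact: rc_unit.
move: ra; rewrite root_exp_XsubC // => /eqP ->.
have -> : rc 1 (('X - a%:P) ^+ n.+2) a = res 1 (t ^+ n.+2 * 1).
  congr res; first by rewrite /= comp_polyC ptp_C.
  rewrite mulr1; elim: n.+2 => [|j IH]; first by rewrite !expr0 /= comp_polyC ptp_C.
  by rewrite !exprS at_someM IH at_some_XB subrr (raddf0 (@fpsC C)) addr0.
have u1 : (1 : fps C) 0%N != 0 by rewrite fps_coef1 oner_neq0.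
by rewrite resE // invr1 mulr1 fps_coef1.
Qed.

Lemma rt_lin m a : residue_thm m 1 ('X - a%:P).
Proof.
exists [:: a] => cs ud sd; rewrite (bigD1_seq a) //=; last by apply: sd; rewrite inE.
rewrite big1 ?addr0 => [|c ca]; last by rewrite rc_unit // root_XsubC.
have -> : rc 1 ('X - a%:P) a = res 1 t.
  congr res; first by rewrite /= comp_polyC ptp_C.
  by rewrite at_some_XB subrr (raddf0 (@fpsC C)) addr0.
rewrite /rinf rev_1 -['X - _]mulr1 rev_XB ?size_poly1 // rev_1.
have -> : t * ((1 - fpsC a * t) * t ^+ m) = t ^+ m * (t ^+ 1 * (1 - fpsC a * t)) by rewrite expr1; ring.
rewrite -{1}[t ^+ m]mulr1 res_cancel ?expf_neq0 ?fpsX_neq0 //; last first.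
  by rewrite mulf_neq0 ?expf_neq0 ?fpsX_neq0 //; exact: neq0_coef (one_sub_neq0 a).
rewrite res_1X resE ?one_sub_neq0 // mul1r.
have := mulrV (unit_coef0 (one_sub_neq0 a)) => /(congr1 (fun x : fps C => x 0%N)).
rewrite fps_coefM0 fps_coef1 fps_coefB fps_coef1 fps_coefCM fps_coefX mulr0 subr0 mul1r => ->.
by [].
Qed.

Notation prodl r := (\prod_(z <- r) ('X - z%:P)).

(** Partial fractions: for distinct roots a and b of P, (b - a)/P = (X - a)/P - (X - b)/P, and both
    terms have one root less. The induction ends at powers of a single linear factor. *)
Lemma rt_one n : forall r : seq C, (size r <= n)%N -> forall m, (0 < size r)%N -> (size r <= m.+1)%N ->
  residue_thm m 1 (prodl r).
Proof.
elim: n => [|n IH] r rn m r0 rm; first by case: r rn r0 {rm}.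
case: r rn r0 rm => // a r rn _ rm.
have [/allP alla|] := boolP (all (pred1 a) r).
  have -> : prodl (a :: r) = ('X - a%:P) ^+ (size r).+1.
    rewrite big_cons exprS; congr (_ * _).
    elim: r alla {rn rm} => [|b r IHr] alla; first by rewrite big_nil expr0.
    rewrite big_cons exprS; congr (_ * _); last by apply: IHr => x xr; apply: alla; rewrite inE xr orbT.
    by have /eqP -> := alla b (mem_head _ _).
  case: r rm {rn alla} => [|b r] rm; first by rewrite expr1; exact: rt_lin.
  exact: rt_pow.
move=> /allPn[b br /= ba].
have pr : perm_eq r (b :: rem b r) by exact: perm_to_rem.
have sr : size r = (size (rem b r)).+1 by rewrite (perm_size pr).
have -> : prodl (a :: r) = ('X - a%:P) * (('X - b%:P) * prodl (rem b r)).
  by rewrite big_cons (perm_big _ pr) big_cons.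
set r' := rem b r in pr sr *.
case: m rm => [|m] rm; first by move: rm; rewrite /= sr.
have pl (c : C) : residue_thm m 1 (('X - c%:P) * prodl r').
  have a1 : (size (c :: r') <= n)%N by move: rn; rewrite /= sr.
  have a2 : (size (c :: r') <= m.+1)%N by move: rm; rewrite /= sr.
  by have := IH (c :: r') a1 m isT a2; rewrite big_cons.
have nz (c : C) : ('X - c%:P) * prodl r' != 0 by rewrite mulf_neq0 ?polyXsubC_eq0 // monic_neq0 // monic_prod_XsubC.
have sz (c : C) : (size (('X - c%:P) * prodl r')%R <= m.+2)%N.
  have -> : ('X - c%:P) * prodl r' = prodl (c :: r') by rewrite big_cons.
  by rewrite size_prod_XsubC; move: rm; rewrite /= sr.
have s1 : (size (1%R : {poly C}) <= m.+1)%N by rewrite size_poly1.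
have h1 := rt_cancelX a (nz b) s1 (sz b) (pl b).
have h2 := rt_cancelX b (nz a) s1 (sz a) (pl a).
have e2 : ('X - b%:P) * (('X - a%:P) * prodl r') = ('X - a%:P) * (('X - b%:P) * prodl r') by rewrite mulrCA.
rewrite e2 in h2; move: (nz b) => nzb; set P := ('X - a%:P) * (('X - b%:P) * prodl r') in h1 h2 *.
have nP : P != 0 by exact: mulf_neq0 (negbT (polyXsubC_eq0 a)) nzb.
have sP : (size P <= m.+3)%N.
  by rewrite (leq_trans (size_polyMleq _ _)) // size_XsubC add2n; exact: sz b.
have [cs1 {}h1] := h1; have [cs2 {}h2] := h2; exists (cs1 ++ cs2) => cs ud sd.
have {}h1 : \sum_(c <- cs) rc (('X - a%:P) * 1) P c = rinf m.+1 (('X - a%:P) * 1) P.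
  by apply: h1 => // c cc; apply: sd; rewrite mem_cat cc.
have {}h2 : \sum_(c <- cs) rc (('X - b%:P) * 1) P c = rinf m.+1 (('X - b%:P) * 1) P.
  by apply: h2 => // c cc; apply: sd; rewrite mem_cat cc orbT.
pose k := (b - a)%:P : {poly C}.
have kE : ('X - a%:P) * 1 = ('X - b%:P) * 1 + k * 1 by rewrite /k rmorphB /=; ring.
have k0 : b - a != 0 by rewrite subr_eq0.
have rk : \sum_(c <- cs) rc (k * 1) P c = rinf m.+1 (k * 1) P.
  move: h1; rewrite kE /rinf at_dirD resD => h1.
  apply: (addrI (\sum_(c <- cs) rc (('X - b%:P) * 1) P c)); rewrite -big_split /=.
  rewrite h2 -h1; apply: eq_bigr => c _; by rewrite /rc at_dirD resD.
have scale (x : C) f g : res (fpsC x * f) g = x * res f g.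
  by rewrite /res; case: (ord g) => [|j]; rewrite ?mulr0 // -mulrA fps_coefCM.
apply: (mulfI k0); rewrite mulr_sumr.
have -> : (b - a) * rinf m.+1 1 P = rinf m.+1 (k * 1) P by rewrite /rinf -scale -rev_C.
rewrite -rk; apply: eq_bigr => c _; rewrite /rc at_someM -scale; congr (res (_ * _) _).
by rewrite /= comp_polyC ptp_C.
Qed.

(** Writing Q = (X - a) Q1 + Q(a) cancels one factor in the first term and leaves a constant
    numerator in the second. *)
Lemma rt_prod r : forall m Q, (size Q <= m.+1)%N -> (size r <= m.+1)%N -> residue_thm m Q (prodl r).
Proof.
elim: r => [|a r IH] m Q sQ sr.
  exists [::] => cs _ _; rewrite big1 => [|c _]; last by rewrite rc_unit // big_nil root1.
  have u1 : (1 : fps C) 0%N != 0 by rewrite fps_coef1 oner_neq0.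
  rewrite big_nil /rinf rev_1 -exprS -[t ^+ _]mulr1 resE // invr1 mulr1.
  by rewrite /= ltnn.
have [Q1 QE] : exists Q1, Q = ('X - a%:P) * Q1 + (Q.[a])%:P * 1.
  have : root (Q - (Q.[a])%:P) a by rewrite /root !hornerE subrr.
  by move=> /factor_theorem[Q1 e]; exists Q1; rewrite mulrC -e mulr1 subrK.
have nz : prodl (a :: r) != 0 by rewrite monic_neq0 // monic_prod_XsubC.
have nzr : prodl r != 0 by rewrite monic_neq0 // monic_prod_XsubC.
have sp : (size (prodl (a :: r)) <= m.+2)%N by rewrite size_prod_XsubC.
rewrite QE; apply: rt_add; last first.
  have [q0|q0] := eqVneq (Q.[a]) 0.
    exists [::] => cs _ _; rewrite q0 polyC0 mul0r /rinf big1 => [|c _]; last first.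
      by rewrite /rc /= comp_polyC ptp_C (raddf0 (@fpsC C)) res0.
    by rewrite (_ : at_dir m 0 None = 0) ?res0 //; apply: fpsP => i; rewrite fps_coef0 /= coef0; case: ifP.
  have [cs0 h] := @rt_one (size (a :: r)) (a :: r) (leqnn _) m isT sr.
  have scale (x : C) f g : res (fpsC x * f) g = x * res f g.
    by rewrite /res; case: (ord g) => [|j]; rewrite ?mulr0 // -mulrA fps_coefCM.
  exists cs0 => cs ud sd; rewrite /rinf rev_C scale -/(rinf m 1 _) -(h cs ud sd) mulr_sumr.
  apply: eq_bigr => c _; rewrite /rc at_someM -scale; congr (res (_ * _) _).
  by rewrite /= comp_polyC ptp_C.
have sQ1 : (size Q1 <= m)%N.
  have [->|Q10] := eqVneq Q1 0; first by rewrite size_poly0.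
  have : (size (('X - a%:P) * Q1)%R <= m.+1)%N.
    have -> : ('X - a%:P) * Q1 = Q - (Q.[a])%:P by rewrite {1}QE mulr1 addrK.
    rewrite (leq_trans (size_polyD _ _)) // geq_max sQ size_polyN size_polyC /=.
    by case: (_ != 0).
  by rewrite mulrC size_Mmonic ?monicXsubC // size_XsubC addn2.
rewrite big_cons; case: m sr sQ sp sQ1 => [|m] sr sQ sp sQ1.
  have -> : Q1 = 0 by apply/eqP; rewrite -size_poly_eq0; lia.
  exists [::] => cs _ _; rewrite mulr0 /rinf big1 => [|c _]; last first.
    by rewrite /rc /= comp_polyC ptp_C (raddf0 (@fpsC C)) res0.
  by rewrite (_ : at_dir 0 0 None = 0) ?res0 //; apply: fpsP => i; rewrite fps_coef0 /= coef0; case: ifP.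
by apply: rt_cancelX nzr sQ1 _ (IH _ _ sQ1 _) => //; rewrite ?size_prod_XsubC.
Qed.

Lemma residue_theorem m Q P : P != 0 -> (size P <= m.+2)%N -> (size Q <= m.+1)%N -> residue_thm m Q P.
Proof.
move=> P0 sP sQ; have [r Pr] := closed_field_poly_normal P.
have l0 : lead_coef P != 0 by rewrite lead_coef_eq0.
have sr : (size r <= m.+1)%N.
  by have := sP; rewrite Pr size_scale // size_prod_XsubC.
have Pe : P = (lead_coef P)%:P * prodl r by rewrite mul_polyC -Pr.
move: (lead_coef P) l0 Pe => l l0 -> {Pr P0 sP}.
have -> : Q = l%:P * (l^-1%:P * Q) by rewrite mulrA -polyCM mulfV // mul1r.
apply: rt_cancelC l0 _ _ _.
- by rewrite monic_neq0 // monic_prod_XsubC.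
- by rewrite size_prod_XsubC.
by apply: rt_prod sr; rewrite mul_polyC (leq_trans (size_scale_leq _ _)).
Qed.

End ResidueTheorem.


(** * Camacho-Sad indices under blow-up *)

Section CamachoSad.
Variable R : realType.
Local Notation C := R[i].
Local Notation fps2 := (fps2 R).
Local Notation t := (fpsX C).
Implicit Types (f g h : fps2) (c z : C) (gam del p : parc R) (B : curve R) (d : direction R) (b : bool) (W : Defs.form R) (q : Defs.point R).
Notation exc d := (axeq R (eb d)).
Notation earc d := (axarc R (eb d)).

(* The Camacho-Sad index of W along the invariant axis b. *)
Definition cs b W : C := - res (pb (axarc R b) (trans_deriv b W)) (pb (axarc R b) (ncomp b W)).

Lemma cs_dir b W : nzform W -> pb (axarc R b) (tcomp b W) = 0 -> pb (axarc R b) (ncomp b W) != 0 ->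
  cs b (strict_form1 (dir R b) W) = cs b W - 1.
Proof.
move=> W0 iW n0; rewrite /cs.
have t0 : t ^+ mexp W != 0 by rewrite expf_neq0 // fpsX_neq0.
have e1 := trans_deriv_dir b W0; have e2 := ncomp_dir W0 iW.
have n1 : pb (axarc R b) (ncomp b (strict_form1 (dir R b) W)) != 0.
  apply: contraNneq n0 => z; rewrite z mulr0 in e2; move/eqP: e2.
  by rewrite mulf_eq0 (negPf (fpsX_neq0 C)).
rewrite -(res_cancel _ t0 n1) -e1 -e2 res_dlog // opprD; exact: erefl.
Qed.

(** With P, Q and R the germs at x = 0 of [leadP], [leadQ] and [tcone], R = t P + Q. By the residue
    theorem the finite directions give minus the residue of Q/(t R), the last one minus that of P/R,
    and together they are minus the residue of 1/t. *)
Lemma sum_cs W : nzform W -> dicb W = false -> exists ds0 : seq (direction R), forall ds, uniq ds ->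
  {subset ds0 <= ds} -> \sum_(d <- ds) cs (eb d) (strict_form1 d W) = -1.
Proof.
move=> W0 dW; have t0 : tcone W != 0 by rewrite -/(dicb W) dW.
have sQ : (size (leadQ W) <= (mltw W).+1)%N by exact: size_poly.
have sP : (size (leadP W) <= (mltw W).+1)%N by exact: size_poly.
have [cs0 h] := residue_theorem t0 (size_tcone W) sQ.
exists (None :: map Some cs0) => ds ud sd.
pose l : seq C := pmap id ds.
have ul : uniq l by rewrite /l; apply: pmap_uniq ud; move=> [c|].
have nd : None \in ds by apply: sd; rewrite inE eqxx.
have pds : perm_eq ds (None :: map Some l).
  apply: uniq_perm => //=.
    by rewrite map_inj_uniq ?ul ?andbT; [apply/negP => /mapP[]|move=> x y []].
  move=> [c|]; rewrite inE /= ?nd // mem_map; last by move=> x y [].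
  by rewrite /l mem_pmap map_id.
have csE d : cs (eb d) (strict_form1 d W) = - res (at_dir (mltw W) (if d is Some _ then leadQ W else leadP W) d)
    (at_dir (mltw W).+1 (tcone W) d).
  have [_ h1 _] := strict_formP d W0; have [_ e2 e3] := h1 dW.
  exact: (congr2 (fun x y => - res x y) e3 e2).
rewrite (perm_big _ pds) big_cons big_map.
rewrite (eq_bigr (fun c => - rc (leadQ W) (tcone W) c)); last by move=> c _; exact: csE.
rewrite sumrN h //; last first.
  by move=> c cc; rewrite /l mem_pmap map_id; apply: sd; rewrite inE /= mem_map //; move=> x y [].
have fin (x y : C) : x + y = 1 -> - x + - y = -1 by move=> <-; rewrite opprD.
rewrite (csE None) /rinf; apply: fin.
have rn := rev_neq0 t0 (size_tcone W).
have e : at_dir (mltw W).+1 (tcone W) None = t * at_dir (mltw W) (leadP W) None + at_dir (mltw W) (leadQ W) None.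
  exact: at_dirS.
set Pi := at_dir (mltw W) (leadP W) None in e *; set Qi := at_dir (mltw W) (leadQ W) None in e *.
set Ri := at_dir (mltw W).+1 (tcone W) None in e rn *.
have -> : res Pi Ri = res (t * Pi) (t * Ri) by rewrite res_cancel ?fpsX_neq0.
rewrite -resD -e; have := res_dlog 0 rn; rewrite mulr0 add0r res0 add0r; exact.
Qed.

End CamachoSad.

(** * Rational lower bounds for complex numbers *)

Section NonnegativeRationals.
Variable R : realType.
Local Notation C := R[i].
Implicit Types (x y : C) (r s : rat).

Definition ratge r x := exists2 s, r <= s & x = ratr s.

Lemma ratge_arith (F : realFieldType) (x y : F) : 0 < x -> 0 < y -> x / (x + 1) <= y ->
  - x^-1 <= - y^-1 + 1.
Proof.
move=> x0 y0 le; have x1 : 0 < x + 1 by rewrite addr_gt0.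
have : y^-1 <= 1 + x^-1; last by move=> h; lra.
rewrite -[y^-1]mul1r ler_pdivrMr //; have k : 0 <= 1 + x^-1 by rewrite addr_ge0 // invr_ge0 ltW.
apply: le_trans (ler_wpM2l k le); rewrite le_eqVlt; apply/orP; left; apply/eqP.
by field; rewrite !gt_eqF.
Qed.

Lemma sum_nonneg (I : eqType) (l : seq I) (F : I -> C) : (forall i, i \in l -> ratge 0 (F i)) ->
  ratge 0 (\sum_(i <- l) F i).
Proof.
elim: l => [|i l IH] h; first by exists 0; rewrite ?big_nil ?raddf0.
have [s s0 e] := h i (mem_head _ _).
have [|s' s'0 e'] := IH; first by move=> j jl; apply: h; rewrite inE jl orbT.
by exists (s + s'); rewrite ?addr_ge0 // big_cons e e' rmorphD.
Qed.

Lemma ratge_le r r' x : r <= r' -> ratge r' x -> ratge r x.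
Proof. by move=> le [s s0 e]; exists s => //; exact: le_trans s0. Qed.

Lemma ratge_sub1 r x : ratge r (x - 1) -> ratge (r + 1) x.
Proof.
move=> [s s0 e]; exists (s + 1); rewrite ?lerD2r // rmorphD rmorph1.
by apply/eqP; rewrite -subr_eq; apply/eqP.
Qed.

End NonnegativeRationals.

(** * The separatrix theorem, by descent on the indices *)

Section Existence.
Variable R : realType.
Local Notation C := R[i].
Local Notation fps2 := (fps2 R).
Local Notation t := (fpsX C).
Implicit Types (f g h : fps2) (c z : C) (gam del p : parc R) (B : curve R) (d : direction R) (b : bool) (W : Defs.form R) (q : Defs.point R).
Notation exc d := (axeq R (eb d)).
Variables (w : Defs.form R) (T : set (Defs.point R)).
Hypothesis wco : no_common_factor w.1 w.2.
Hypothesis RT : resolves w T.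
Hypothesis T0 : T [::].
Notation lw q := (strict_form w q).
Hypothesis noiso : forall B q b, separatrix w B -> final T q -> passes B q -> axis_at q b ->
  pb (axarc R b) (tcomp b (lw q)) = 0 -> False.
Hypothesis val1 : forall q, T q -> dic w q -> exists d, T (d :: q) \/ (final T (d :: q) /\ corner (d :: q)).
Let w0 : nzform w := nz_of_coprime wco.
Local Notation ia := (ia w).
Notation CS q b := (cs b (lw q)).

(** The states carried from a point to a child: no invariant component, one invariant component, or
    an invariant corner. Each of the last two contains an index condition that no final point can
    meet. *)
Definition st0 q := forall b, ia q b = false.
Definition st1 q := exists b, [/\ ia q b, ia q (~~ b) = false & ~ ratge 0 (CS q b)].
(** At a reduced corner nonzero indices are inverse to each other, so an index - r forces - 1/r on
    the other axis; the last clause excludes this value, and 0 as well. *)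
Definition st2 q := exists b, [/\ ia q b, ia q (~~ b) & exists2 r : rat, 0 < r &
  CS q b = - ratr r /\ ~ ratge (- r^-1) (CS q (~~ b))].

Lemma cs_step q b : ia q b -> CS (dir R b :: q) b = CS q b - 1.
Proof.
move=> i; have qb := ia_axis i.
exact: cs_dir (nz_strict_form q w0) (elimT (iaP w0 qb) i) (ncomp_neq0 w0 i).
Qed.

Lemma cs_regular q b : ia q b -> ~ singular (lw q) -> CS q b = 0.
Proof.
move=> i ns; have h := inv_at0 (elimT (iaP w0 (ia_axis i)) i).
rewrite /cs res_unit ?oppr0 // pb_at0; apply/eqP => z; apply: ns.
by case: b h z {i} => /= h z; split.
Qed.

Lemma final_st1 q : final T q -> ~ st1 q.
Proof.
move=> fq [b [i ni nr]]; have [sq|ns] := pselect (singular (lw q)); last first.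
  by apply: nr; exists 0; rewrite ?raddf0 // cs_regular.
have [ai [cq|[B [sB pB]]]] := final_singular wco RT fq sq.
  have qn : axis_at q (~~ b) by move/cornerP: cq; apply.
  by rewrite (introT (iaP w0 qn) (ai _ qn)) in ni.
exact: noiso sB fq pB (ia_axis i) (elimT (iaP w0 (ia_axis i)) i).
Qed.

Lemma reduced_lin W : reduced W -> exists g : parc R, linw W (ax g 1%N) (ay g 1%N) <> (0, 0).
Proof.
move=> rW; apply: contrapT => h; have sW := reduced_singular rW.
have nl (x y : C) : linw W x y = (0, 0).
  apply: contrapT => n; apply: h.
  have x0 : (fpsC x * t) 0%N == 0 by rewrite fps_coefCM fps_coefX mulr0.
  have y0 : (fpsC y * t) 0%N == 0 by rewrite fps_coefCM fps_coefX mulr0.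
  by exists (Arc x0 y0); rewrite /= !fps_coefCM !fps_coefX !mulr1.
have [psi [e [al [be [J nd]]]]] := reduced_jet rW.
have := jet_lin J 0 1; cbv zeta; rewrite nl /= !mulr0 !addr0 !mulr0 => -[/esym/eqP + _].
rewrite mulr1 => /eqP al0.
have := jet_lin J 1 0; cbv zeta; rewrite nl /= !mulr0 !addr0 !mulr0 => -[_ /esym/eqP].
rewrite mulr1 => /eqP be0.
by have := nd 1%N 1%N isT isT; rewrite al0 be0 !mul0r addr0 eqxx.
Qed.

(** With W = y A dx + x B dy the indices are - A/B and - B/A at the origin when defined. If A or B
    vanishes there the other does not, because the linear part is nonzero, and one index is 0. *)
Lemma cs_corner W b : reduced W -> pb (axarc R b) (tcomp b W) = 0 -> pb (axarc R (~~ b)) (tcomp (~~ b) W) = 0 ->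
  cs b W = 0 \/ cs (~~ b) W = 0 \/ cs b W * cs (~~ b) W = 1.
Proof.
move=> rW h h'; have dv (b0 : bool) : exists A, tcomp b0 W = axeq R b0 * A.
  by apply: axeq_dvd; case: (eqVneq b0 b) => [->//|ne]; have -> : b0 = ~~ b by case: b0 b ne {h h'} => [] [].
have [At e1] := dv true; have [Af e2] := dv false.
have e1' : W.1 = Y R * At := e1; have e2' : W.2 = X R * Af := e2.
have alpha : pb (axarc R true) (trans_deriv true W) = pb (axarc R true) At.
  have dA : dy W.1 = At + Y R * dy At by rewrite e1' (dyM (Y R)) dy_Y mul1r.
  apply: etrans (congr1 (pb (axarc R true)) dA) _.
  rewrite pbD (pbM (axarc R true) (Y R)) pb_Y [ay _]/= mul0r addr0; exact: erefl.
have alphaf : pb (axarc R false) (trans_deriv false W) = pb (axarc R false) Af.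
  have dA : dx W.2 = Af + X R * dx Af by rewrite e2' (dxM (X R)) dx_X mul1r.
  apply: etrans (congr1 (pb (axarc R false)) dA) _.
  rewrite pbD (pbM (axarc R false) (X R)) pb_X [ax _]/= mul0r addr0; exact: erefl.
have beta : pb (axarc R true) (ncomp true W) = t ^+ 1 * pb (axarc R true) Af.
  apply: etrans (congr1 (pb (axarc R true)) e2') _.
  rewrite (pbM (axarc R true) (X R)) pb_X expr1; exact: erefl.
have betaf : pb (axarc R false) (ncomp false W) = t ^+ 1 * pb (axarc R false) At.
  apply: etrans (congr1 (pb (axarc R false)) e1') _.
  rewrite (pbM (axarc R false) (Y R)) pb_Y expr1; exact: erefl.
have rv (x y : fps C) : y 0%N != 0 -> res x (t ^+ 1 * y) = x 0%N / y 0%N.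
  move=> y0; rewrite resE // fps_coefM0; congr (_ * _).
  have := congr1 (fun z : fps C => z 0%N) (mulVr (unit_coef0 y0)).
  by rewrite fps_coefM0 fps_coef1 => k; apply: (mulIf y0); rewrite k mulVf.
have ct : at0 Af != 0 -> cs true W = - (at0 At / at0 Af).
  by move=> n; rewrite /cs alpha beta rv ?pb_at0.
have cf : at0 At != 0 -> cs false W = - (at0 Af / at0 At).
  by move=> n; rewrite /cs alphaf betaf rv ?pb_at0.
have nz : at0 At != 0 \/ at0 Af != 0.
  have [zt|] := eqVneq (at0 At) 0; last by left.
  have [zf|] := eqVneq (at0 Af) 0; last by right.
  have c1 : at0 (dx W.1) = 0 by rewrite e1' (dxM (Y R)) dx_Y mul0r add0r at0M at0_Y mul0r.
  have c2 : at0 (dy W.1) = 0 by rewrite e1' (dyM (Y R)) dy_Y mul1r at0D at0M at0_Y mul0r addr0.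
  have c3 : at0 (dx W.2) = 0 by rewrite e2' (dxM (X R)) dx_X mul1r at0D at0M at0_X mul0r addr0.
  have c4 : at0 (dy W.2) = 0 by rewrite e2' (dyM (X R)) dy_X mul0r add0r at0M at0_X mul0r.
  have [g []] := reduced_lin rW; rewrite /linw -!at0_dx -!at0_dy c1 c2 c3 c4 !mul0r addr0.
  exact: erefl.
have [zt|nt] := eqVneq (at0 At) 0.
  have [/negP[]|nf] := nz; first by rewrite zt.
  by have := ct nf; rewrite zt mul0r oppr0; case: (b) => e; [left|right; left].
have [zf|nf] := eqVneq (at0 Af) 0.
  by have := cf nt; rewrite zf mul0r oppr0; case: (b) => e; [right; left|left].
right; right; have k : cs true W * cs false W = 1 by rewrite (ct nf) (cf nt) mulrNN; field; rewrite nt nf.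
by case: (b); [exact: k|exact: etrans (mulrC _ _) k].
Qed.

Lemma final_st2 q : final T q -> ~ st2 q.
Proof.
move=> fq [b [i i' [r r0 [e1 e2]]]]; have qb := ia_axis i; have qb' := ia_axis i'.
have h := elimT (iaP w0 qb) i; have h' := elimT (iaP w0 qb') i'.
have [_ c2 _ _] := RT; have rq := c2 q fq (inv_both_singular h h').
case: (cs_corner rq h h') => [|[|]] e.
- move: e1; rewrite e => /eqP; rewrite eq_sym oppr_eq0 fmorph_eq0 => /eqP z.
  by rewrite z ltxx in r0.
- by apply: e2; exists 0; rewrite ?raddf0 // oppr_le0 invr_ge0 ltW.
- apply: e2; exists (- r^-1) => //; rewrite rmorphN fmorphV.
  have rn : ratr r != 0 :> C by rewrite fmorph_eq0 gt_eqF.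
  have n0 : - ratr r != 0 :> C by rewrite oppr_eq0.
  by apply: (mulfI n0); rewrite -{1}e1 e mulrNN mulfV.
Qed.

(** After a dicritical blow-up an old invariant axis is followed, its index being lowered by one.
    Otherwise the indices on the new component sum to -1; if no noncorner child is admissible they
    are nonnegative rationals off the corners, and this forces a suitable index at a corner. *)
Lemma step q : T q -> st0 q \/ st1 q \/ st2 q ->
  exists d, (T (d :: q) \/ final T (d :: q)) /\ (st0 (d :: q) /\ T (d :: q) \/ st1 (d :: q) \/ st2 (d :: q)).
Proof.
move=> Tq st; have ch d : T (d :: q) \/ final T (d :: q).
  by have [Td|nT] := pselect (T (d :: q)); [left|right; split].
have ax d : axis_at (d :: q) (eb d) by rewrite axis_at_exc.
have oth b : ia (dir R b :: q) (~~ b) = ~~ dic w q by have := ia_exc w (dir R b) q; rewrite eb_dir.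
case dq : (dic w q).
  case: st => [s0|[[b [i ni nr]]|[b [i i' [r r0 [e1 e2]]]]]].
  - have [d hd] := val1 Tq dq.
    have s0' : st0 (d :: q).
      move=> b; case: (eqVneq b (eb d)) => [->|ne]; first by rewrite ia_exc dq.
      have -> : b = ~~ eb d by case: b (eb d) ne => [] [].
      by rewrite ia_other !s0 !andbF.
    (* A final corner is impossible: a noninvariant axis there makes the other one invariant. *)
    case: hd => [Td|[fd cd]]; first by exists d; split; [left|left; split].
    have qb : axis_at (d :: q) true by move/cornerP: cd; apply.
    have ni : ~ pb (axarc R true) (tcomp true (lw (d :: q))) = 0 by move/(introT (iaP w0 qb)); rewrite s0'.
    have [_ _ co _] := final_dicritical wco RT fd qb ni.
    have qb' : axis_at (d :: q) false by move/cornerP: cd; apply.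
    by have := introT (iaP w0 qb') (co cd); rewrite s0'.
  - exists (dir R b); split; first exact: ch.
    right; left; exists b; rewrite ia_dir oth dq cs_step //; split=> // /ratge_sub1 h.
    by apply: nr; apply: ratge_le h.
  - exists (dir R (~~ b)); split; first exact: ch.
    right; left; exists (~~ b); rewrite ia_dir oth dq cs_step //; split=> // /ratge_sub1 h.
    by apply: e2; apply: ratge_le h; rewrite (le_trans (y := 0)) // ?add0r // oppr_le0 invr_ge0 ltW.
have [ds0 hs] := sum_cs (nz_strict_form q w0) dq.
pose E d := CS (d :: q) (eb d).
have iE d : ia (d :: q) (eb d) by rewrite ia_exc dq.
have bad d : ia (d :: q) (~~ eb d) = false -> ~ ratge 0 (E d) ->
  exists d, (T (d :: q) \/ final T (d :: q)) /\ (st0 (d :: q) /\ T (d :: q) \/ st1 (d :: q) \/ st2 (d :: q)).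
  by move=> n e; exists d; split; [exact: ch|right; left; exists (eb d)].
apply: contrapT => no.
have good d : ia (d :: q) (~~ eb d) = false -> ratge 0 (E d).
  by move=> n; apply: contrapT => h; apply: no; exact: bad n h.
have io d : ia (d :: q) (~~ eb d) -> exists2 b, d = dir R b & ia q b.
  by rewrite ia_other => /orP[/andP[/eqP -> i]|/andP[/eqP -> i]]; [exists true|exists false].
(* [l] is the list of corners; the remaining directions contribute a nonnegative rational S. *)
have sumE l : uniq l -> (forall d, d \notin l -> ia (d :: q) (~~ eb d) = false) ->
  exists2 S : rat, 0 <= S & \sum_(d <- l) E d = -1 - ratr S.
  move=> ul hl; pose ds := l ++ [seq d <- undup ds0 | d \notin l].
  have ud : uniq ds.
    rewrite cat_uniq ul filter_uniq ?undup_uniq // andbT; apply/hasPn => d.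
    by rewrite mem_filter => /andP[].
  have sd : {subset ds0 <= ds}.
    by move=> d dd; rewrite mem_cat mem_filter mem_undup dd andbT orbN.
  have := hs ds ud sd; rewrite big_cat /= -/E => e.
  have [|S S0 eS] := @sum_nonneg R _ [seq d <- undup ds0 | d \notin l] E.
    by move=> d; rewrite mem_filter => /andP[/hl n _]; exact: good n.
  exists S => //; rewrite -eS -e addrK; exact: erefl.
case: st => [s0|[[b [i ni nr]]|[b [i i' [r r0 [e1 e2]]]]]].
- have [|S S0] := sumE [::] isT.
    by move=> d _; rewrite ia_other !s0 !andbF.
  rewrite big_nil => /eqP; rewrite -opprD eq_sym oppr_eq0 => /eqP z.
  have : ratr (1 + S) = 0 :> C by rewrite rmorphD rmorph1.
  by move=> /eqP; rewrite fmorph_eq0 paddr_eq0 // oner_eq0.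
(* One corner: the new component has index -(1 + S) there, so r = 1 + S. If the old axis, lowered by
   one, had a rational index at least - 1/r, its previous index would be a nonnegative rational. *)
- have [||S S0] := sumE [:: dir R b]; first by [].
    move=> d; rewrite inE => nd; apply/negP => /io[b' ed ib'].
    have eb' : b' = b by apply/eqP; apply: contraT => ne; rewrite -ni (_ : ~~ b = b') // ; case: b b' ne {i ni nr nd ed ib'} => [] [].
    by rewrite ed eb' eqxx in nd.
  rewrite big_seq1 => eS; apply: no; exists (dir R b); split; first exact: ch.
  right; right; exists (~~ b); rewrite negbK ia_dir oth dq; split=> //.
  exists (1 + S); first by rewrite ltr_pwDl.
  split; first by move: eS; rewrite /E eb_dir => ->; rewrite rmorphD rmorph1 opprD.
  rewrite cs_step // => h; apply: nr; apply: ratge_le (ratge_sub1 h).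
  by rewrite addrC subr_ge0 invf_le1 ?ltr_pwDl // lerDl.
have [||S S0] := sumE [:: dir R b; dir R (~~ b)].
- by rewrite /= inE andbT; case: (b).
- move=> d; rewrite !inE => nd; apply/negP => /io[b' ed _]; move: nd; rewrite {}ed.
  by case: (b) b' => [] [] /=; rewrite ?eqxx ?orbT.
rewrite big_cons big_seq1 => eS.
have E1 : E (dir R b) = CS (dir R b :: q) (~~ b).
  by rewrite /E; congr (cs _ _); rewrite eb_dir.
have E2 : E (dir R (~~ b)) = CS (dir R (~~ b) :: q) b.
  by rewrite /E; congr (cs _ _); rewrite eb_dir negbK.
(* Two corners: on the axis b the index becomes -(r + 1), and this corner is admissible unless the
   new component has there a rational index at least - 1/(r + 1). *)
have [[s1 s1r es1]|n1] := pselect (ratge (- (r + 1)^-1) (E (dir R b))); last first.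
  apply: no; exists (dir R b); split; first exact: ch.
  right; right; exists b; rewrite ia_dir oth dq; split; [exact: i|exact: isT|exists (r + 1); first by rewrite addr_gt0].
  rewrite -E1 (cs_step i) e1; split; [by rewrite rmorphD rmorph1 opprD|exact: n1].
have r1 : 0 < r + 1 by rewrite addr_gt0.
(* The sum of the indices then leaves - r' at the other corner, with r' at least 1 - 1/(r + 1) =
   r/(r + 1), as [ratge_arith] requires to contradict the state of q. *)
pose r' := 1 + S + s1.
have r'1 : r / (r + 1) <= r'.
  have -> : r / (r + 1) = 1 - (r + 1)^-1 by field; rewrite gt_eqF.
  by rewrite /r'; lra.
have r'0 : 0 < r' := lt_le_trans (divr_gt0 r0 r1) r'1.
apply: no; exists (dir R (~~ b)); split; first exact: ch.
have o2 : ia (dir R (~~ b) :: q) b = ~~ dic w q by have := oth (~~ b); rewrite negbK.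
right; right; exists b; rewrite o2 dq ia_dir; split; [exact: isT|exact: i'|].
exists r'; first exact: r'0.
rewrite -E2; split.
  have aux (x y z : C) : x + y = z -> y = z - x by move=> <-; rewrite addrAC subrr add0r.
  rewrite (aux _ _ _ eS).
  by rewrite es1 /r' !rmorphD rmorph1 !opprD.
rewrite (cs_step i') => /ratge_sub1 h; apply: e2; apply: ratge_le h.
exact: ratge_arith r0 r'0 r'1.
Qed.

(** The state passes from each point to a child and survives no final point, but the tree is
    finite. *)
Lemma separatrix_exists : False.
Proof.
have [M Mb] := tree_bound RT.
suff H n : forall q, (M - size q <= n)%N -> T q -> st0 q \/ st1 q \/ st2 q -> False.
  by apply: (H _ [::] (leqnn _) T0); left => b; case: b.
elim: n => [|n IH] q le Tq st; first by have := Mb _ Tq; lia.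
have [d [Td st']] := step Tq st.
have [Td'|fd] := Td.
  apply: (IH (d :: q) _ Td'); first by have := Mb _ Tq; rewrite /=; lia.
  by case: st' => [[s0 _]|[s1|s2]]; [left|right; left|right; right].
case: st' => [[_ Td']|[s1|s2]]; [by case: fd => /(_ Td')|exact: final_st1 fd s1|exact: final_st2 fd s2].
Qed.

End Existence.


(** * The valence of a component, counted by directions *)

Section Valence.
Variable R : realType.
Implicit Types (d : direction R) (b : bool) (q s r : Defs.point R).

Lemma axis_suffix q b s : axis_at q b = Some s -> exists d r, q = r ++ d :: s.
Proof.
elim: q b => [|d q IH] b; first by case: b.
move=> /axis_at_cons[[_ ->]|[_ /IH[d' [r ->]]]]; first by exists d, [::].
by exists d', (d :: r).
Qed.

Lemma axis_size q b s : axis_at q b = Some s -> (size s < size q)%N.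
Proof. by move=> /axis_suffix[d [r ->]]; rewrite size_cat /= addnS ltnS leq_addl. Qed.

Lemma axes_distinct q s : axis_at q true = Some s -> axis_at q false = Some s -> False.
Proof.
case: q => [//|x y] h h'; case: (axis_at_cons h) => -[e1 e2].
  by case: (axis_at_cons h') => -[e3 e4]; [rewrite -e1 in e3|have := axis_size e4; rewrite e2 ltnn].
case: (axis_at_cons h') => -[e3 e4]; first by have := axis_size e2; rewrite e4 ltnn.
by rewrite e1 in e3.
Qed.

Lemma on_componentP s q : on_component s q <-> exists b, axis_at q b = Some s.
Proof.
split=> [[l [[h _]|[h _]]]|[[] h]]; [by exists false|by exists true| |].
- by exists (Y R); right.
- by exists (X R); left.
Qed.

Variables (T : set (Defs.point R)) (s : Defs.point R).
Hypothesis BT : blowup_tree T.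
Hypothesis Ts : T s.

Lemma tree_tail r q : T (r ++ q) -> T q.
Proof. by have [_ Tc] := BT; elim: r => //= d r IH /Tc. Qed.

Let nbr := [set s' | [/\ T s', s' <> s & exists q, [/\ final T q, on_component s q & on_component s' q]]].
(** The component s' meets s at a final point lying at, or above, the direction d of s. *)
Let adj d s' := s' <> s /\ exists q b r, [/\ final T q, axis_at q b = Some s, axis_at q (~~ b) = Some s' & q = r ++ d :: s].

Lemma tree_seq : exists l : seq (Defs.point R), forall q, T q <-> q \in l.
Proof. by have [/finite_seqP[l e] _] := BT; exists l => q; rewrite e. Qed.

(** Stay on the axis b until the tree is left; the last exceptional component crossed is then the
    neighbour of s. *)
Lemma follow q b : T q -> axis_at q b = Some s ->
  exists q' r, [/\ final T q', axis_at q' b = Some s, axis_at q' (~~ b) = Some (r ++ q) & q' = (dir R b :: r) ++ q].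
Proof.
have [l lT] := tree_seq; pose M := (\max_(x <- l) size x).+1.
have Mb x : T x -> (size x < M)%N.
  by move=> /lT xl; rewrite /M ltnS (big_rem _ xl) leq_maxl.
move=> Tq qb; suff H n : forall r, (M - size (r ++ q) <= n)%N -> T (r ++ q) -> axis_at (r ++ q) b = Some s ->
    exists q' r, [/\ final T q', axis_at q' b = Some s, axis_at q' (~~ b) = Some (r ++ q) & q' = (dir R b :: r) ++ q].
  exact: (H _ [::] (leqnn _)).
elim: n => [|n IH] r le Tr rb; first by have := Mb _ Tr; lia.
have ab : axis_at (dir R b :: r ++ q) b = Some s by rewrite axis_at_dir.
have [Td|nT] := pselect (T (dir R b :: r ++ q)).
  by apply: (IH (dir R b :: r)) => //; have := Mb _ Tr; rewrite /= ; lia.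
exists (dir R b :: r ++ q), r; split=> //.
by rewrite -(eb_dir R b) axis_at_exc.
Qed.

Lemma final_tail q x r : final T q -> q = x :: r -> T r.
Proof. by move=> [_ h] e; rewrite e in h. Qed.

Lemma adj_exists d : T (d :: s) \/ corner (d :: s) -> exists s', adj d s'.
Proof.
move=> h; have ax : axis_at (d :: s) (eb d) = Some s by rewrite axis_at_exc.
have [Td|nT] := pselect (T (d :: s)).
  have [q' [r [fq a1 a2 e]]] := follow Td ax; exists (r ++ d :: s); split.
    by move=> /(congr1 size); rewrite size_cat /=; lia.
  by exists q', (eb d), (dir R (eb d) :: r).
case: h => // /cornerP /(_ (~~ eb d)); case e : (axis_at (d :: s) (~~ eb d)) => [s'|] // _.
exists s'; split; last by exists (d :: s), (eb d), [::]; split=> //; split.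
have [[eb_ _]|[_ e']] := axis_at_cons e; first by case: (eb d) eb_.
by move=> ss; have := axis_size e'; rewrite ss ltnn.
Qed.

Lemma adj_vs d s' : adj d s' -> T (d :: s) \/ corner (d :: s).
Proof.
move=> [_ [q [b [r [fq a1 a2 e]]]]]; case: r e => [|x r] e.
  right; rewrite -[d :: s]/([::] ++ d :: s) -e; apply/cornerP => b0; case: (eqVneq b0 b) => [->|nb]; first by rewrite a1.
  by have -> : b0 = ~~ b by [case: b0 b nb {a1 a2} => [] []]; rewrite a2.
by left; apply: (@tree_tail r); exact: final_tail fq e.
Qed.

Lemma adj_nbr d s' : adj d s' -> nbr s'.
Proof.
move=> [ne [q [b [r [fq a1 a2 e]]]]]; split=> //; last first.
  by exists q; split=> //; apply/on_componentP; [exists b|exists (~~ b)].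
have [x [r' e']] := axis_suffix a2; case: r' e' => [|y r'] e'; first exact: final_tail fq e'.
by apply: (@tree_tail (r' ++ [:: x])); rewrite -catA; exact: final_tail fq e'.
Qed.

Lemma nbr_adj s' : nbr s' -> exists d, adj d s'.
Proof.
move=> [Ts' ne [q [fq /on_componentP[b qb] /on_componentP[b' qb']]]].
have nb : b' = ~~ b.
  case: (eqVneq b b') => [e|]; last by case: b b' {qb qb'} => [] [].
  by case: ne; move: qb'; rewrite -e qb => -[].
have [d [r e]] := axis_suffix qb; exists d; split=> //; exists q, b, r; split=> //.
by rewrite -nb.
Qed.

Lemma adj_cases d s' : adj d s' -> (exists r, s' = r ++ d :: s) \/ axis_at (d :: s) (~~ eb d) = Some s'.
Proof.
move=> [ne [q [b [r [fq a1 a2 e]]]]]; case: r e => [|x r] e.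
  right; rewrite e in a1 a2; have [[<- //]|[_ a3]] := axis_at_cons a1.
  by have := axis_size a3; rewrite ltnn.
left; exists r; rewrite e in a1 a2; have [[_ e3]|[e3 _]] := axis_at_cons a2; first by [].
have [[_ e4]|[e4 _]] := axis_at_cons a1.
  by have := congr1 size e4; rewrite size_cat /=; lia.
by move: e4; rewrite e3; case: (b).
Qed.

(** A neighbour is either created above d, and then its name contains d, or it is an older axis
    through s, with a shorter name, whose direction is d. *)
Lemma adj_inj d d' s' : adj d s' -> adj d' s' -> d = d'.
Proof.
have sz x : axis_at (x :: s) (~~ eb x) = Some s' -> x = dir R (~~ eb x) /\ axis_at s (~~ eb x) = Some s'.
  by move=> /axis_at_cons[[e _]|//]; case: (eb x) e.
move=> /adj_cases[[r e]|e] /adj_cases[[r' e']|e'].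
- have := e; rewrite e' => h; have sr : size r' = size r.
    by have := congr1 size h; rewrite !size_cat /=; lia.
  by have /eqP := h; rewrite eqseq_cat // => /andP[_ /eqP[->]].
- by have [_ /axis_size] := sz _ e'; rewrite e size_cat /=; lia.
- by have [_ /axis_size] := sz _ e; rewrite e' size_cat /=; lia.
have [-> a1] := sz _ e; have [-> a2] := sz _ e'.
have [-> //|ne] := eqVneq (~~ eb d) (~~ eb d').
exfalso; move: a1 a2 ne; case: (~~ eb d) (~~ eb d') => -[] // a1 a2 _; [exact: axes_distinct a1 a2|exact: axes_distinct a2 a1].
Qed.

(** Above d, only the direction of the component itself stays on it. *)
Lemma axis_shape d r q b : q = r ++ d :: s -> axis_at q b = Some s ->
  b = eb d /\ r = nseq (size r) (dir R (eb d)).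
Proof.
elim: r q => [|x r IH] q -> h.
  by have [[-> _]|[_ /axis_size]] := axis_at_cons h; rewrite ?ltnn.
have [[_ e]|[-> e]] := axis_at_cons h.
  by have := congr1 size e; rewrite size_cat /=; lia.
by have [-> er] := IH _ erefl e; split=> //=; rewrite {1}er.
Qed.

(** Both final points lie on the chain described by [axis_shape], and a final point has no final
    point above it. *)
Lemma adj_fun d s' s'' : adj d s' -> adj d s'' -> s' = s''.
Proof.
move=> [_ [q [b [r [fq a1 a2 e]]]]] [_ [q' [b' [r' [fq' a1' a2' e']]]]].
have [eb1 er] := axis_shape e a1; have [eb2 er'] := axis_shape e' a1'.
suff qq : q = q' by move: a2; rewrite qq eb1 -eb2 a2' => -[].
have aux (p p' : Defs.point R) n m : final T p -> final T p' -> p = nseq n (dir R (eb d)) ++ d :: s ->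
    p' = nseq m (dir R (eb d)) ++ d :: s -> (n <= m)%N -> p = p'.
  move=> fp fp' ep ep'; rewrite leq_eqVlt => /orP[/eqP nm|nm]; first by rewrite ep ep' nm.
  case: (fp) => nT _; case: nT; move: ep'; rewrite -(subnK nm) addnS -addSn => ep'.
  apply: (@tree_tail (nseq (m - n.+1) (dir R (eb d)))).
  by apply: (final_tail fp'); rewrite ep' ep nseqD /= catA.
by case: (leqP (size r) (size r')) => h; [|apply: esym];
  [apply: (aux _ _ (size r) (size r'))|apply: (aux _ _ (size r') (size r))] => //; rewrite -?er -?er' // ltnW.
Qed.

(** [adj] is a bijection between the directions of [vs] and the neighbouring components. *)
Lemma valence_vs : exists vs : seq (direction R), [/\ uniq vs,
  forall d, d \in vs <-> T (d :: s) \/ corner (d :: s) & valence T s = size vs].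
Proof.
have [l lT] := tree_seq.
pose vs := undup [seq d <- Some 0 :: None :: map (head None) l | `[< T (d :: s) \/ corner (d :: s) >]].
have vP d : d \in vs <-> T (d :: s) \/ corner (d :: s).
  rewrite mem_undup mem_filter; split=> [/andP[/asboolP]//|h]; apply/andP; split; first exact/asboolP.
  case: h => [/lT h|/cornerP /(_ (~~ eb d))].
    by rewrite !inE; apply/orP; right; apply/orP; right; apply/mapP; exists (d :: s).
  by case: d => [c|]; rewrite /axis_at /= !inE //; case: eqP => // ->; rewrite eqxx.
have [G GP] : exists G : direction R -> Defs.point R, forall d, d \in vs -> adj d (G d).
  exists (fun d => xget s [set s' | adj d s']) => d /vP /adj_exists[s' a].
  by case: xgetP => [x _|/(_ s')].
exists vs; split=> //; first exact: undup_uniq.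
have uL : uniq (map G vs).
  rewrite map_inj_in_uniq ?undup_uniq // => d d' dv dv' e.
  by apply: (adj_inj (GP d dv)); rewrite e; exact: GP d' dv'.
have AE : nbr = [set` map G vs].
  apply/seteqP; split=> s' /=.
    move=> n; have [d a] := nbr_adj n; have dv : d \in vs by apply/vP; exact: adj_vs a.
    by apply/mapP; exists d => //; exact: adj_fun a (GP d dv).
  by move=> /mapP[d dv ->]; exact: adj_nbr (GP d dv).
rewrite /valence -/nbr AE; have fs : finite_set [set` map G vs] by exact: finite_seq.
have -> : fset_set [set` map G vs] = [fset x in map G vs]%fset.
  by apply/fsetP => x; rewrite (in_fset_set fs); apply/idP/idP; rewrite !inE.
by rewrite card_fseq undup_id // size_map.
Qed.

End Valence.


(** * Factorization into irreducibles and multiplicities *)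

Section Factorization.
Variable R : realType.
Local Notation C := R[i].
Local Notation fps2 := (fps2 R).
Local Notation t := (fpsX C).
Implicit Types (f g h u : fps2) (gam : parc R) (B : curve R) (d : direction R) (s : seq (curve R)).
Notation exc d := (axeq R (eb d)).

Lemma infinite_direction (l : seq (direction R)) : exists d, d \notin l.
Proof.
have [n hn] : exists n : nat, Some (n%:R : C) \notin l.
  apply: contrapT => h.
  have al n : Some (n%:R : C) \in l by apply: contrapT => nl; apply: h; exists n; apply/negP.
  have : (size (map (fun n : nat => Some (n%:R : C)) (iota 0 (size l).+1)) <= size l)%N.
    apply: uniq_leq_size; last by move=> d /mapP[n _ ->].
    rewrite map_inj_uniq ?iota_uniq // => x y [/eqP]; rewrite eqr_nat; exact/eqP.
  by rewrite size_map size_iota ltnn.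
by exists (Some n%:R).
Qed.

(** A smooth arc whose direction is not a zero of the initial form of f. *)
Lemma arc_avoiding f : f != 0 -> exists gam, pb gam f != 0.
Proof.
move=> f0; have [_ l0] := mltP f0; have [_ [ds0 [h _]]] := sum_at_dir l0 (size_poly _ _).
have [d nd] := infinite_direction ds0; exists (push (bl d) (axarc R (~~ eb d))).
have e0 : pb (axarc R (~~ eb d)) (exc d) = t by rewrite pb_axeq; case: (eb d).
rewrite (pb_strict d (axarc R (~~ eb d)) f0) e0 mulf_neq0 ?expf_neq0 ?fpsX_neq0 //.
have [_ nf ep] := strict_eqP d f0; apply: (@neq0_coef _ _ 0).
have n0 : pb (axarc R (eb d)) (strict_eq1 d f) != 0 by apply/eqP => z; apply: nf; apply/fdvd_axeq.
rewrite pb_at0 -(pb_at0 (axarc R (eb d))) -(ord_eq0 n0).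
by have := h d nd; rewrite -ep => ->.
Qed.

(** Induction on the order along an arc on which f does not vanish: it is additive on products and
    positive on nonunits. *)
Lemma factorization f : f != 0 -> exists s u,
  [/\ f = u * \prod_(B <- s) equation B, at0 u != 0 & forall B, B \in s -> is_curve B].
Proof.
move=> f0; have [gam gf] := arc_avoiding f0.
have [n] := ubnP (ord (pb gam f)); elim: n f f0 gf => // n IH f f0 gf; rewrite ltnS => le.
have [u0|u0] := eqVneq (at0 f) 0; last by exists [::], f; rewrite big_nil mulr1.
have nu : ~ is_unit f by move/is_unitP; rewrite u0 eqxx.
have [fi|ni] := pselect (irreducible f).
  have Bc : is_curve (curve_of f) by exists f.
  have [ei eE] := curve_eqP Bc.
  have [k kE] : fdvd (equation (curve_of f)) f by apply: irreducible_assoc => //; rewrite -/(curve_of f _); have : curve_of f (equation (curve_of f)) by rewrite {1}eE; exists 1; rewrite mulr1.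
  exists [:: curve_of f], k; rewrite big_seq1 mulrC -kE; split=> //; last by move=> B; rewrite inE => /eqP ->.
  apply/is_unitP; have [_ _ ir] := fi; case: (ir _ _ kE) => // /is_unitP.
  by rewrite (irreducible_at0 ei) eqxx.
have [g [h [fE ng nh]]] : exists g h, [/\ f = g * h, ~ is_unit g & ~ is_unit h].
  apply: contrapT => no; apply: ni; split=> // [|g h fE]; first exact/eqP.
  apply: contrapT => /not_orP[ng nh]; apply: no; exists g, h; split; [exact: fE|exact: ng|exact: nh].
have [gp hp] : pb gam g != 0 /\ pb gam h != 0.
  by move: gf; rewrite fE pbM mulf_eq0 negb_or => /andP[].
have pos x : ~ is_unit x -> pb gam x != 0 -> (0 < ord (pb gam x))%N.
  by move=> nx x0; rewrite (ord_gt0 x0) pb_at0; apply: contraT => z; case: nx; apply/is_unitP.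
have os : ord (pb gam f) = (ord (pb gam g) + ord (pb gam h))%N by rewrite fE pbM (ordM gp hp).
have nz x : pb gam x != 0 -> x != 0 by apply: contraNneq => ->; rewrite raddf0.
have pg := pos _ ng gp; have ph := pos _ nh hp.
have [|s1 [u1 [e1 v1 c1]]] := IH g (nz _ gp) gp; first by lia.
have [|s2 [u2 [e2 v2 c2]]] := IH h (nz _ hp) hp; first by lia.
exists (s1 ++ s2), (u1 * u2); split.
- by rewrite fE big_cat /= mulrACA -e1 -e2.
- by rewrite at0M mulf_neq0.
- by move=> B; rewrite mem_cat => /orP[/c1|/c2].
Qed.

Lemma multiplicityP f g k : fdvd (f ^+ k) g -> ~ fdvd (f ^+ k.+1) g -> multiplicity f g = k.
Proof.
move=> h1 h2; rewrite /multiplicity; case: xgetP => [j _ [j1 j2]|/(_ k)[]//].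
have le a b : (a <= b)%N -> fdvd (f ^+ b) g -> fdvd (f ^+ a) g.
  move=> ab; apply: fdvd_trans; exists (f ^+ (b - a)); by rewrite -exprD subnKC.
have [jk|kj|//] := ltngtP j k; first by case: j2; exact: le h1.
by case: h2; exact: le j1.
Qed.

Lemma ord_prod gam s u : at0 u != 0 -> (forall B, B \in s -> pb gam (equation B) != 0) ->
  pb gam (u * \prod_(B <- s) equation B) != 0 /\
  ord (pb gam (u * \prod_(B <- s) equation B)) = (\sum_(B <- s) ord (pb gam (equation B)))%N.
Proof.
move=> u0; have pu : pb gam u 0%N != 0 by rewrite pb_at0.
elim: s => [_|B s IH h].
  by rewrite !big_nil mulr1; split; [exact: neq0_coef pu|exact: ord_unit].
have [|n0 e] := IH; first by move=> B' B's; apply: h; rewrite inE B's orbT.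
have B0 := h B (mem_head _ _); rewrite !big_cons mulrCA pbM.
by split; [exact: mulf_neq0|rewrite (ordM B0 n0) e].
Qed.

Lemma curve_vanish B B' gam : is_curve B -> is_curve B' -> nonconst gam -> pb gam (equation B) = 0 ->
  pb gam (equation B') = 0 -> B' = B.
Proof.
move=> Bc B'c nc gB gB'; have [ei _] := curve_eqP Bc.
apply: esym; apply: curve_ext Bc B'c _; exact: (ker_irreducible _ nc ei gB).1 gB'.
Qed.

Lemma prod_split B s u : exists s', perm_eq s (nseq (count_mem B s) B ++ s') /\ B \notin s' /\
  u * \prod_(B <- s) equation B = equation B ^+ count_mem B s * (u * \prod_(B <- s') equation B).
Proof.
exists (filter (predC1 B) s); have p : perm_eq s (nseq (count_mem B s) B ++ filter (predC1 B) s).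
  have <- : [seq x <- s | pred1 B x] = nseq (count_mem B s) B.
    by elim: s => //= x s ->; case: eqP => [->|].
  by rewrite perm_sym; apply/permPl; exact: perm_filterC.
split; first exact: p.
split; first by rewrite mem_filter /= eqxx.
rewrite (perm_big _ p) big_cat big_nseq /= mulrCA; congr (_ * _).
by elim: (count _ _) => [|n IH]; rewrite ?expr0 //= IH exprS.
Qed.

Lemma multiplicity_count B s u gam : is_curve B -> (forall B', B' \in s -> is_curve B') -> at0 u != 0 ->
  nonconst gam -> pb gam (equation B) = 0 ->
  multiplicity (equation B) (u * \prod_(B <- s) equation B) = count_mem B s.
Proof.
move=> Bc sc u0 nc gB; have [s' [p [ns e]]] := prod_split B s u; rewrite e.
have B0 : equation B != 0 := irr_neq0 (curve_eqP Bc).1.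
have [|r0 _] := @ord_prod gam s' u u0.
  move=> B' B's; apply/eqP => z; move: ns.
  have B'c : is_curve B' by apply: sc; rewrite (perm_mem p) mem_cat B's orbT.
  by rewrite -(curve_vanish Bc B'c nc gB z) B's.
apply: multiplicityP; first by exists (u * \prod_(B <- s') equation B).
move=> [k]; rewrite exprSr -mulrA => /(mulfI (expf_neq0 _ B0)) k1.
by move: r0; rewrite k1 pbM gB mul0r eqxx.
Qed.

(* For a curve with no known arc only positivity of the multiplicity is available. *)
Lemma multiplicity_gt0 B f : is_curve B -> f != 0 -> fdvd (equation B) f -> (0 < multiplicity (equation B) f)%N.
Proof.
move=> Bc f0 dv; have [ei _] := curve_eqP Bc; have [gam gf] := arc_avoiding f0.
have bound k : fdvd (equation B ^+ k) f -> (k <= ord (pb gam f))%N.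
  move=> [h e]; move: gf; rewrite e pbM pbX mulf_eq0 negb_or => /andP[g1 g2].
  case: k g1 {e} => // k g1; have gB : pb gam (equation B) != 0 by apply: contraNneq g1 => ->; rewrite expr0n.
  rewrite (ordM g1 g2) (ordX _ gB) (leq_trans _ (leq_addr _ _)) // leq_pmulr // (ord_gt0 gB) pb_at0.
  by rewrite (irreducible_at0 ei).
have [k [k1 k2]] : exists k, fdvd (equation B ^+ k) f /\ ~ fdvd (equation B ^+ k.+1) f.
  apply: contrapT => no; have all k : fdvd (equation B ^+ k) f.
    elim: k => [|k IH]; first by exists f; rewrite expr0 mul1r.
    by apply: contrapT => n; apply: no; exists k.
  by have := bound _ (all (ord (pb gam f)).+1); rewrite ltnn.
by rewrite (multiplicityP k1 k2); case: k k2 {k1}; rewrite // expr1.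
Qed.

Lemma multiplicity_eq0 B f : is_curve B -> ~ fdvd (equation B) f -> multiplicity (equation B) f = 0%N.
Proof. by move=> Bc n; apply: multiplicityP; [exists f; rewrite expr0 mul1r|rewrite expr1]. Qed.

End Factorization.

(** * Polar numbers of the differential of a meromorphic function *)

Section PolarMeromorphic.
Variable R : realType.
Local Notation C := R[i].
Local Notation fps2 := (fps2 R).
Implicit Types (gam : parc R) (B : curve R).
Variables (F : fps2 * fps2) (s1 s2 : seq (curve R)) (u1 u2 : fps2).
Hypothesis e1 : F.1 = u1 * \prod_(B <- s1) equation B.
Hypothesis e2 : F.2 = u2 * \prod_(B <- s2) equation B.
Hypothesis v1 : at0 u1 != 0.
Hypothesis v2 : at0 u2 != 0.
Hypothesis c1 : forall B, B \in s1 -> is_curve B.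
Hypothesis c2 : forall B, B \in s2 -> is_curve B.
Hypothesis F0 : meromorphic F.
Let ss := undup (s1 ++ s2).

Lemma dvd_mem B : B \in s1 -> fdvd (equation B) F.1.
Proof.
move=> Bs; rewrite e1 (big_rem _ Bs) /= mulrCA.
by exists (u1 * \prod_(y <- rem B s1) equation y).
Qed.

Lemma dvd_mem2 B : B \in s2 -> fdvd (equation B) F.2.
Proof.
move=> Bs; rewrite e2 (big_rem _ Bs) /= mulrCA.
by exists (u2 * \prod_(y <- rem B s2) equation y).
Qed.

Lemma not_both B : is_curve B -> fdvd (equation B) F.1 -> fdvd (equation B) F.2 -> False.
Proof. by move=> /curve_eqP[[_ nu _] _] h1 h2; apply: nu; have [_ _] := F0; apply. Qed.

Lemma ss_curve B : B \in ss -> is_curve B.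
Proof. by rewrite mem_undup mem_cat => /orP[/c1|/c2]. Qed.

Lemma divisor_mem B : B \in ss -> divisor F B <> 0.
Proof.
move=> Bs; have Bc := ss_curve Bs; have [/eqP n1 /eqP n2 _] := F0.
move: Bs; rewrite mem_undup mem_cat /divisor => /orP[Bs|Bs].
  have d1 := dvd_mem Bs; have := multiplicity_gt0 Bc n1 d1.
  by rewrite (multiplicity_eq0 Bc (not_both Bc d1)); lia.
have d2 := dvd_mem2 Bs; have := multiplicity_gt0 Bc n2 d2.
by rewrite (multiplicity_eq0 Bc (fun d1 => not_both Bc d1 d2)); lia.
Qed.

Lemma divisor_count B gam : is_curve B -> nonconst gam -> pb gam (equation B) = 0 ->
  divisor F B = (count_mem B s1)%:Z - (count_mem B s2)%:Z.
Proof.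
move=> Bc nc gB; rewrite /divisor e1 e2.
by rewrite (multiplicity_count Bc c1 v1 nc gB) (multiplicity_count Bc c2 v2 nc gB).
Qed.

Lemma sum_count (I : choiceType) (l r : seq I) (P : pred I) (g : I -> nat) : {subset l <= r} ->
  (\sum_(x <- l | P x) g x = \sum_(x <- undup r | P x) count_mem x l * g x)%N.
Proof.
elim: l => [_|y l IH sub]; first by rewrite big_nil big1.
rewrite big_cons IH; last by move=> x xl; apply: sub; rewrite inE xl orbT.
have yr : y \in undup r by rewrite mem_undup; apply: sub; rewrite mem_head.
have -> : (\sum_(x <- undup r | P x) count_mem x (y :: l) * g x =
   \sum_(x <- undup r | P x) (y == x) * g x + \sum_(x <- undup r | P x) count_mem x l * g x)%N.
  by rewrite -big_split; apply: eq_bigr => x _; rewrite /= mulnDl.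
have -> : (\sum_(x <- undup r | P x) (y == x) * g x = if P y then g y else 0)%N.
  rewrite big_mkcond (bigD1_seq y) ?undup_uniq //= big1 => [|x /negPf xy].
    by rewrite eqxx mul1n addn0.
  by rewrite eq_sym xy mul0n; case: (P x).
by case: (P y).
Qed.

(** F1 = f h vanishes along the arc, so the only surviving term is the one in which f is
    differentiated. *)
Lemma pb_dquot gam (D : fps2 -> fps2) (f h F1 F2 : fps2) : (forall x y, D (x * y) = D x * y + x * D y) ->
  F1 = f * h -> pb gam f = 0 ->
  pb gam (F2 * D F1 - F1 * D F2) = (pb gam F2 * pb gam h) * pb gam (D f).
Proof.
move=> DM e gB; have F1z : pb gam F1 = 0 by rewrite e pbM gB mul0r.
have eP : pb gam (D F1) = pb gam h * pb gam (D f).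
  rewrite e DM pbD (pbM gam (D f)) (pbM gam f) gB mul0r addr0; exact: mulrC.
have k1 : pb gam (F2 * D F1) = pb gam F2 * pb gam h * pb gam (D f).
  by apply: etrans (pbM gam F2 (D F1)) _; rewrite eP; exact: mulrA.
have k2 : pb gam (F1 * D F2) = 0.
  by apply: etrans (pbM gam F1 (D F2)) _; rewrite F1z; exact: mul0r.
apply: etrans (pbB gam (F2 * D F1) (F1 * D F2)) _; rewrite k1 k2; exact: subr0.
Qed.

Lemma polar_sum B gam (s' : seq (curve R)) (oh o2 : nat) : is_curve B -> B \notin s2 ->
  perm_eq s1 (B :: s') -> B \notin s' ->
  oh = (\sum_(B' <- s') ord (pb gam (equation B')))%N -> o2 = (\sum_(B' <- s2) ord (pb gam (equation B')))%N ->
  (forall B', B' \in ss -> exists2 g', nonconst g' & pb g' (equation B') = 0) ->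
  \sum_(B' <- ss | B' != B) divisor F B' * (ord (pb gam (equation B')))%:Z = oh%:Z - o2%:Z.
Proof.
move=> Bc n2 p ns ohE o2E arcs.
have s1s : {subset s1 <= s1 ++ s2} by move=> x xs; rewrite mem_cat xs.
have s2s : {subset s2 <= s1 ++ s2} by move=> x xs; rewrite mem_cat xs orbT.
pose G B' := ord (pb gam (equation B')).
have -> : oh = (\sum_(B' <- s1 | B' != B) G B')%N.
  rewrite ohE (perm_big _ p) big_cons eqxx big_seq [RHS]big_seq_cond; apply: eq_bigl => x.
  by case xs : (x \in s') => //=; apply/esym/eqP => xb; move: ns; rewrite -xb xs.
have -> : o2 = (\sum_(B' <- s2 | B' != B) G B')%N.
  rewrite o2E big_seq [RHS]big_seq_cond; apply: eq_bigl => x.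
  by case xs : (x \in s2) => //=; apply/esym/eqP => xb; move: n2; rewrite -xb xs.
rewrite (sum_count _ G s1s) (sum_count _ G s2s) !(big_morph Posz PoszD (erefl 0%:Z)) -sumrB.
rewrite big_seq_cond [RHS]big_seq_cond; apply: eq_bigr => B' /andP[B's _].
have [g' nc' gB'] := arcs B' B's.
by rewrite (divisor_count (ss_curve B's) nc' gB') mulrBl !PoszM.
Qed.

Lemma polar_arith (x y z : nat) : (x + y + z)%N%:Z - (2 * x)%N%:Z = z%:Z + (y%:Z - x%:Z).
Proof. lia. Qed.

(** Writing F.1 = h f with f the equation of B, dF restricts to (h / F.2) df along B; the order of h
    / F.2 is the intersection with the rest of the divisor. *)
Lemma polar_dF B gam : is_curve B -> nonconst gam -> prim gam -> pb gam (equation B) = 0 ->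
  nzon gam (dform (equation B)) -> divisor F B = 1 ->
  (forall B', B' \in ss -> exists2 g', nonconst g' & pb g' (equation B') = 0) ->
  polar_intersection (F.2 * dx F.1 - F.1 * dx F.2, F.2 * dy F.1 - F.1 * dy F.2) (F.2 ^+ 2) B =
  (ordon gam (dform (equation B)))%:Z
    + \sum_(B' <- ss | B' != B) divisor F B' * (ord (pb gam (equation B')))%:Z.
Proof.
move=> Bc nc pg gB nf dB arcs; have [ei _] := curve_eqP Bc.
have dc := divisor_count Bc nc gB; rewrite dB in dc.
have n2 : B \notin s2.
  apply/negP => Bs; have d2 := dvd_mem2 Bs; have : B \notin s1.
    by apply/negP => /dvd_mem d1; exact: not_both Bc d1 d2.
  by move=> /count_memPn z; rewrite z in dc; move: dc; lia.
have z2 : count_mem B s2 = 0%N by exact/count_memPn.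
have o1 : count_mem B s1 = 1%N by move: dc; rewrite z2; lia.
have [s' [p [ns e]]] := prod_split B s1 u1; rewrite o1 expr1 -e1 in e.
have [|h0 oh] := @ord_prod R gam s' u1 v1.
  move=> B' B's; apply/eqP => z; move: ns.
  have B'c : is_curve B' by apply: c1; rewrite (perm_mem p) mem_cat B's orbT.
  by rewrite -(curve_vanish Bc B'c nc gB z) B's.
have [|f20 o2] := @ord_prod R gam s2 u2 v2.
  by move=> B' B's; apply/eqP => z; move: n2; rewrite -(curve_vanish Bc (c2 B's) nc gB z) B's.
rewrite -e2 in f20 o2; set h := u1 * _ in e h0 oh.
have kx := pb_dquot F.2 (@dxM R) e gB; have ky := pb_dquot F.2 (@dyM R) e gB.
have K0 : pb gam F.2 * pb gam h != 0 by exact: mulf_neq0 f20 h0.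
pose W : Defs.form R := (F.2 * dx F.1 - F.1 * dx F.2, F.2 * dy F.1 - F.1 * dy F.2).
have nW : nzon gam W.
  have k x : x != 0 -> (pb gam F.2 * pb gam h) * x != 0 by exact: mulf_neq0 K0.
  apply/orP; case/orP: nf => /k n; [left|right]; apply/eqP => z; case/eqP: n.
    exact: etrans (esym kx) z.
  exact: etrans (esym ky) z.
have oW : ordon gam W = (ord (pb gam F.2 * pb gam h)%R + ordon gam (dform (equation B)))%N.
  exact: etrans (congr2 (@ord2 _) kx ky) (ord2M K0 nf).
have p2 : pb gam (F.2 ^+ 2) != 0 by rewrite pbX expf_neq0.
apply: etrans (polarE ei gB nc pg nW p2) _.
have ps : perm_eq s1 (B :: s') by move: p; rewrite o1.
have sc := polar_sum Bc n2 ps ns oh o2 arcs.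
rewrite sc oW (ordM f20 h0) pbX (ordX _ f20).
exact: polar_arith.
Qed.

End PolarMeromorphic.


(** * The equivalence for a germ that is not reduced *)

Section Balanced.
Variable R : realType.
Local Notation C := R[i].
Local Notation fps2 := (fps2 R).
Local Notation t := (fpsX C).
Implicit Types (f g h : fps2) (gam del : parc R) (B : curve R) (d : direction R) (b : bool) (q s : Defs.point R).
Variables (w : Defs.form R) (T : set (Defs.point R)) (F : fps2 * fps2) (a : Defs.point R -> curve R -> int).
Hypothesis wco : no_common_factor w.1 w.2.
Hypothesis RT : resolves w T.
Hypothesis T0 : T [::].
Hypothesis F0 : meromorphic F.
Hypothesis asum : forall D, dicritical w T D -> \sum_(B \in Curv w T D) a D B = 2 - (valence T D)%:Z.
Hypothesis adiv : forall B, is_curve B -> divisor F B = (B \in isolated w T)%:Z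
  + \sum_(D \in dicritical w T) (B \in Curv w T D)%:Z * a D B.
Hypothesis Fsimple : simple_zeros F.
Notation lw q := (strict_form w q).
Notation feq B q := (strict_eq (equation B) q).
Notation inv q b := (pb (axarc R b) (tcomp b (lw q)) = 0).
Let w0 : nzform w := nz_of_coprime wco.
Let BT : blowup_tree T. Proof. by case: RT. Qed.

Lemma component_eqP s q (l : fps2) : component_eq s q l <-> exists2 b, axis_at q b = Some s & l = axeq R b.
Proof.
split=> [[[h ->]|[h ->]]|[[] h ->]]; [by exists false|by exists true|by right|by left].
Qed.

Lemma invariant_axeq (W : Defs.form R) b : Defs.invariant W (axeq R b) <-> pb (axarc R b) (tcomp b W) = 0.
Proof.
apply: iff_trans (fdvd_axeq b _) _.
have -> : W.1 * dy (axeq R b) - W.2 * dx (axeq R b) = (if b then W.1 else - W.2).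
  by case: b; rewrite /axeq ?dx_X ?dx_Y ?dy_X ?dy_Y mulr0 mulr1 ?subr0 ?sub0r.
case: b; first exact: iff_refl.
rewrite raddfN /=; split=> [/eqP|h]; first by rewrite oppr_eq0 => /eqP.
by apply/eqP; rewrite oppr_eq0; apply/eqP.
Qed.

(** A direction outside the finite tree gives a final point of the component, at which invariance
    can be tested. *)
Lemma dicriticalP s : dicritical w T s <-> T s /\ dic w s.
Proof.
split=> -[Ts h]; split=> //.
  apply: contraT => /negPf nd; case: h => q l fq /component_eqP[b qb ->].
  by apply/invariant_axeq; apply/(axis_inv w0 qb).
move=> hi; have [l lT] := tree_seq BT.
have [d nd] := infinite_direction (map (head None) l).
have nT : ~ T (d :: s).
  by move=> /lT dl; move/negP: nd; apply; apply/mapP; exists (d :: s).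
have ax : axis_at (d :: s) (eb d) = Some s by exact: axis_at_exc.
have := hi (d :: s) _ (final_child Ts nT) (component_axis ax).
by move=> /invariant_axeq/(axis_inv w0 ax); rewrite h.
Qed.

Lemma CurvP B d s : separatrix w B -> final T (d :: s) -> passes B (d :: s) ->
  forall D, Curv w T D B <-> D = s.
Proof.
move=> sB fq pB D; have ax : axis_at (d :: s) (eb d) = Some s by exact: axis_at_exc.
split=> [[_ [q [fq' /on_componentP[b qb] pB']]]|->].
  have e := final_unique RT T0 sB fq' fq pB' pB; rewrite e in qb.
  have [_ _ c3 _] := RT; have [_ nc _] := c3 B _ sB fq pB.
  have [[_ //]|[ed qb']] := axis_at_cons qb; case: nc.
  apply: (other_corner (b := eb d)); first by rewrite ax.
  have -> : ~~ eb d = b by rewrite ed eb_dir negbK.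
  by rewrite qb.
split; first exact: sB.
exists (d :: s); split; [exact: fq|by apply/on_componentP; exists (eb d)|exact: pB].
Qed.

Lemma sep_final B : separatrix w B -> exists d s, final T (d :: s) /\ passes B (d :: s).
Proof.
move=> sB; have [q [fq pB]] := final_exists wco RT T0 sB.1.
by have [d [s [e _]]] := final_cons T0 fq; exists d, s; rewrite -e.
Qed.

Lemma divisor_sep B d s : separatrix w B -> final T (d :: s) -> passes B (d :: s) ->
  divisor F B = if dic w s then a s B else 1.
Proof.
move=> sB fq pB; have Ts : T s by case: fq.
have cP := CurvP sB fq pB; rewrite (adiv sB.1).
case: ifP => ds.
  have -> : (B \in isolated w T) = false.
    apply/negP; rewrite inE => -[_ /(_ s)]; apply; first by apply/dicriticalP.
    by apply/cP.
  rewrite add0r (fsbigE [:: s]) //=.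
  - rewrite big_seq1_cond || rewrite big_mkcond big_seq1.
    by rewrite mem_set ?mem_set ?mul1r //; [apply/cP|apply/dicriticalP].
  - by move=> x /=; rewrite inE => /eqP ->; apply/dicriticalP.
  move=> D _; rewrite inE => /eqP nD; rewrite memNset ?mul0r // => /cP; exact: nD.
have -> : (B \in isolated w T) = true.
  by apply: mem_set; split=> // D /dicriticalP[_ dD] /cP e; rewrite e ds in dD.
rewrite fsbig1 ?addr0 // => D /dicriticalP[_ dD]; rewrite memNset ?mul0r // => /cP e.
by rewrite e ds in dD.
Qed.

Lemma divisor_nonsep B : is_curve B -> ~ separatrix w B -> divisor F B = 0.
Proof.
move=> Bc nB; rewrite (adiv Bc) memNset; last by move=> -[].
by rewrite add0r fsbig1 // => D _; rewrite memNset ?mul0r // => -[].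
Qed.

Variables (s1 s2 : seq (curve R)) (u1 u2 : fps2).
Hypothesis e1 : F.1 = u1 * \prod_(B <- s1) equation B.
Hypothesis e2 : F.2 = u2 * \prod_(B <- s2) equation B.
Hypothesis v1 : at0 u1 != 0.
Hypothesis v2 : at0 u2 != 0.
Hypothesis c1 : forall B, B \in s1 -> is_curve B.
Hypothesis c2 : forall B, B \in s2 -> is_curve B.
Notation ss := (undup (s1 ++ s2)).
Notation cf := (divisor F).
Notation EX := (ex w ss cf).
Notation TAU := (tau w ss cf).

Let sss B : B \in ss -> separatrix w B.
Proof.
move=> Bs; apply: contrapT => nB; have Bc := ss_curve c1 c2 Bs.
case: (divisor_mem e1 e2 v1 v2 c1 c2 F0 Bs); exact: divisor_nonsep Bc nB.
Qed.

Lemma sep_arc B : separatrix w B -> exists2 gam, nonconst gam & pb gam (equation B) = 0.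
Proof.
move=> sB; have [d [s [fq pB]]] := sep_final sB.
have [gam [sg gf off _ _]] := final_arc RT sB fq pB.
exists (pushq (d :: s) gam); first exact: pushq_nonconst (smooth_nonconst sg) off.
exact: (pb_strict_eq (irr_neq0 (sep_curve sB)) off).1 gf.
Qed.

Lemma mem_divisor B : separatrix w B -> divisor F B <> 0 -> B \in ss.
Proof.
move=> sB n; have [gam nc gB] := sep_arc sB; apply: contraT; rewrite mem_undup mem_cat => /norP[n1 n2].
by case: n; rewrite (divisor_count e1 e2 v1 v2 c1 c2 sB.1 nc gB) (count_memPn n1) (count_memPn n2).
Qed.

Let ssu : uniq ss := undup_uniq _.

Let cfiso B q b : separatrix w B -> final T q -> passes B q -> axis_at q b -> inv q b -> B \in ss /\ cf B = 1.
Proof.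
move=> sB fq pB qb iq; have [d [s [e Ts]]] := final_cons T0 fq; rewrite e in fq pB qb iq.
have bE : b = eb d.
  have [_ _ c3 _] := RT; have [_ nc _] := c3 B _ sB fq pB; apply/eqP; apply: contraT => ne.
  case: nc; apply: (other_corner qb); have -> : ~~ b = eb d by case: b (eb d) ne {qb iq} => [] [].
  by rewrite axis_at_exc.
have ds : dic w s = false by apply/(axis_inv w0 (axis_at_exc d s)); rewrite -bE.
have c : cf B = 1 by rewrite (divisor_sep sB fq pB) ds.
by split=> //; apply: mem_divisor => //; rewrite c.
Qed.

(** The balance condition in terms of directions: [valence_vs] counts the valence, and a curve of
    [Curv] meets s at a final noncorner point, whose direction is outside [vs]. *)
Let cfdic s : T s -> dic w s -> exists vs : seq (direction R),
  [/\ uniq vs, forall d, d \in vs <-> T (d :: s) \/ corner (d :: s) &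
      \sum_(B <- ss) cf B * (`[< exists d, d \notin vs /\ passes B (d :: s) >])%:Z = 2 - (size vs)%:Z].
Proof.
move=> Ts ds; have [vs [uv vP vE]] := valence_vs BT Ts; exists vs; split; [exact: uv|exact: vP|].
have Ds : dicritical w T s by apply/dicriticalP.
have key B : B \in ss -> cf B * (`[< exists d, d \notin vs /\ passes B (d :: s) >])%:Z =
    if B \in Curv w T s then a s B else 0.
  move=> Bs; have sB := sss Bs; have [d [s0 [fq pB]]] := sep_final sB.
  have cP := CurvP sB fq pB s.
  case: ifP => [|/negP nC].
    rewrite inE => /cP e; rewrite -e in fq pB; rewrite (divisor_sep sB fq pB) ds asboolT ?mulr1 //.
    exists d; split; last exact: pB.
    apply/negP => /vP[Td|cd]; first by case: fq => /(_ Td).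
    by have [_ _ c3 _] := RT; have [_ nc _] := c3 B _ sB fq pB.
  rewrite asboolF ?mulr0 // => -[d1 [n1 p1]]; apply: nC; rewrite inE.
  have f1 : final T (d1 :: s) by split=> // Td; move/negP: n1; apply; apply/vP; left.
  by apply/(CurvP sB f1 p1).
rewrite -vE -(asum Ds) (fsbigE [seq B <- ss | B \in Curv w T s]).
- rewrite big_filter_cond (eq_big_seq _ key) -big_mkcond.
  by apply: eq_bigl => B; rewrite andbb.
- exact: filter_uniq.
- by move=> B /=; rewrite mem_filter => /andP[]; rewrite inE.
move=> B CB; rewrite mem_filter mem_set // andTb => /negP nB.
have [sB _] := CB; have [d [s0 [fq pB]]] := sep_final sB.
have e := (CurvP sB fq pB s).1 CB; rewrite -e in fq pB.
by have := divisor_sep sB fq pB; rewrite ds => <-; apply: contrapT => n; apply: nB; exact: mem_divisor.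
Qed.

Lemma zerosP B : zeros F B <-> B \in [seq B <- ss | 0 < cf B].
Proof.
rewrite mem_filter; split=> [[Bc c]|/andP[c Bs]]; last by split; [exact: (ss_curve c1 c2 Bs)|exact: c].
rewrite c /=; have sB : separatrix w B by apply: contrapT => /(divisor_nonsep Bc) z; rewrite z in c.
by apply: mem_divisor => // z; rewrite z in c.
Qed.

Notation term B := (polar_intersection w 1 B
     - polar_intersection (F.2 * dx F.1 - F.1 * dx F.2, F.2 * dy F.1 - F.1 * dy F.2) (F.2 ^+ 2) B).

Lemma excess_sum : polar_excess w F (zeros F) = \sum_(B <- [seq B <- ss | 0 < cf B]) term B.
Proof.
rewrite /polar_excess (fsbigE [seq B <- ss | 0 < cf B]).
- rewrite big_seq_cond [RHS]big_seq; apply: eq_bigl => B.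
  by case h : (B \in _) => //=; rewrite mem_set //; apply/zerosP.
- exact/filter_uniq/undup_uniq.
- by move=> B h; apply/zerosP.
by move=> B zB /negP; case; apply/zerosP.
Qed.

Lemma final_prop B q : separatrix w B -> final T q -> passes B q -> forall gam, smooth_arc gam ->
  pb gam (feq B q) = 0 -> offaxes q gam /\ nzon gam (dform (feq B q)) /\
  forall b, axis_at q b -> ord (pb gam (axeq R b)) = 1%N.
Proof.
move=> sB fq pB gam sg gf; have [_ _ c3 _] := RT; have [sm _ tr] := c3 B q sB fq pB.
have key b : axis_at q b -> ord (pb gam (axeq R b)) = 1%N.
  case ab : (axis_at q b) => [s|]; [move=> _|by []].
  by have [] := transverse_arc pB sg gf (tr s _ (component_axis ab)).
split; [|split; [|exact: key]].
  move=> b /key h; apply/eqP => e; move: h; rewrite e /ord.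
  by case: xgetP => // n _ [_]; rewrite fps_coef0.
by case: sm => h; apply/orP; [left|right]; apply: (@neq0_coef _ _ 0); apply/eqP => e;
  apply: h; rewrite -e; apply: esym; exact: pb_at0.
Qed.

(** At the origin [dlt] is the difference of the polar numbers; [dlt_path] transports it to the
    final point of B, where [dlt_final] evaluates it. *)
Lemma term_eq B q gam b : zeros F B -> separatrix w B -> final T q -> passes B q -> smooth_arc gam ->
  pb gam (feq B q) = 0 -> axis_at q b ->
  term B = path_excess w ss cf q gam + ((ordon gam (lw q))%:Z - (ia w q b)%:Z).
Proof.
move=> zB sB fq pB sg gf qb; have Bs : B \in ss by move/zerosP: zB; rewrite mem_filter => /andP[].
have cB := Fsimple zB; have [off [nf o1]] := final_prop sB fq pB sg gf.
have Bi := sep_curve sB; have gB := (pb_strict_eq (irr_neq0 Bi) off).1 gf.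
have nc := smooth_nonconst sg; have ncr := pushq_nonconst nc off.
have pr := pushq_prim off (smooth_prim sg).
rewrite -(dlt_final cf RT sss sB Bs fq pB sg gf qb (o1 b qb)).
rewrite -(dlt_path wco ssu sss sB Bs cB off nc gf nf).
have nfr := nzon_dform_pushq (irr_neq0 Bi) off gf nf.
have one : pb (pushq q gam) (1 : fps2) = 1 := rmorph1 (pb (pushq q gam)).
have one0 : pb (pushq q gam) (1 : fps2) != 0 by rewrite one oner_neq0.
rewrite (polarE Bi gB ncr pr (nzon_w wco Bi ncr gB) one0).
rewrite (polar_dF e1 e2 v1 v2 c1 c2 F0 sB.1 ncr pr gB nfr cB); last by move=> B' /sss; exact: sep_arc.
rewrite one ord_one subr0 /dlt opprD addrA; exact: erefl.
Qed.

Lemma fin_ge B q gam b : separatrix w B -> final T q -> passes B q -> smooth_arc gam ->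
  pb gam (feq B q) = 0 -> axis_at q b -> 0 <= (ordon gam (lw q))%:Z - (ia w q b)%:Z :> int.
Proof.
move=> sB fq pB sg gf qb; case i : (ia w q b); last by rewrite subr0.
have sq := inv_passes_singular wco RT sB fq pB qb (elimT (iaP w0 qb) i).
have [off _] := final_prop sB fq pB sg gf; have Bi := sep_curve sB.
have gB := (pb_strict_eq (irr_neq0 Bi) off).1 gf.
have ncr := pushq_nonconst (smooth_nonconst sg) off.
by have := ordon_gt0 sq (nzon_pushq off (nzon_w wco Bi ncr gB)); lia.
Qed.

Lemma tail_T q : final T q -> if q is _ :: r then T r else True.
Proof. by move=> fq; have [d [s [-> Ts]]] := final_cons T0 fq. Qed.

Lemma zero_data B : zeros F B -> exists q gam b, [/\ separatrix w B, final T q, passes B q &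
  [/\ smooth_arc gam, pb gam (feq B q) = 0 & axis_at q b]].
Proof.
move=> zB; have Bs : B \in ss by move/zerosP: zB; rewrite mem_filter => /andP[].
have sB := sss Bs; have [d [s [fq pB]]] := sep_final sB.
have [gam [sg gf _ _ _]] := final_arc RT sB fq pB.
exists (d :: s), gam, (eb d); split=> //; split=> //; by rewrite axis_at_exc.
Qed.

Lemma term_ge0 B : zeros F B -> 0 <= term B :> int.
Proof.
move=> zB; have [q [gam [b [sB fq pB [sg gf qb]]]]] := zero_data zB.
rewrite (term_eq zB sB fq pB sg gf qb) addr_ge0 //; last exact: fin_ge sB fq pB sg gf qb.
exact: (path_excess_ge0 wco RT T0 ssu sss cfiso cfdic) (tail_T fq).
Qed.

(** Otherwise all coefficients are at most 0. Then there is no isolated separatrix, whose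
    coefficient would be 1, and no dicritical component of valence 0, whose coefficients would sum
    to 2: the hypotheses of [separatrix_exists] hold. *)
Lemma zeros_nonempty : exists B, zeros F B.
Proof.
apply: contrapT => nz.
have nzB B : is_curve B -> cf B <= 0.
  by move=> Bc; rewrite leNgt; apply/negP => c; apply: nz; exists B.
apply: (separatrix_exists wco RT T0).
  move=> B q b sB fq pB qb iq; have [Bs c] := cfiso sB fq pB qb iq.
  by have := nzB B sB.1; rewrite c.
move=> s Ts ds; have [vs [_ vP vsum]] := cfdic Ts ds.
case: vs vP vsum => [|d vs] vP vsum; last first.
  exists d; have /vP := mem_head d vs; have [Td|nT] := pselect (T (d :: s)); first by left.
  by case=> // cd; right; split=> //; exact: final_child.
have : \sum_(B <- ss) cf B * (`[< exists d, d \notin [::] /\ passes B (d :: s) >])%:Z <= 0.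
  rewrite big_seq; apply: sumr_le0 => B Bs; rewrite mulr_le0_ge0 //.
  by apply: nzB; exact: (sss Bs).1.
by rewrite vsum.
Qed.

(** The terms are nonnegative, so all vanish. A single zero gives tau = 0 at the origin, hence w has
    order one along both branches of every final singular point, which excludes saddle-nodes. *)
Lemma excess_zero_generic : polar_excess w F (zeros F) = 0 ->
  forall q, final T q -> singular (lw q) -> ~ saddle_node (lw q).
Proof.
rewrite excess_sum => s0 q fq sq sn.
have tz B : zeros F B -> term B = 0 :> int.
  move=> zB; apply/eqP; move/eqP: s0; rewrite big_seq psumr_eq0; last by move=> x /zerosP/term_ge0.
  have Bl := (zerosP B).1 zB; by move=> /allP /(_ B Bl); rewrite Bl.
have t0 : TAU [::] = 0.
  have [B zB] := zeros_nonempty; have [q1 [gam [b [sB fq1 pB [sg gf qb]]]]] := zero_data zB.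
  have := tz B zB; rewrite (term_eq zB sB fq1 pB sg gf qb) => /eqP; rewrite paddr_eq0; last 2 first.
  - exact: (path_excess_ge0 wco RT T0 ssu sss cfiso cfdic) (tail_T fq1).
  - exact: fin_ge sB fq1 pB sg gf qb.
  move=> /andP[/eqP pe _]; have [off _] := final_prop sB fq1 pB sg gf.
  have [d [r [e Tr]]] := final_cons T0 fq1; rewrite e in pe off.
  exact: (path_excess_root wco RT T0 ssu sss cfiso cfdic Tr off pe).
have [ai _] := final_singular wco RT fq sq.
have [g1 [g2 [tg1 tg2 ind _]]] := reduced_branches (or_intror sn).
(* A branch inside the divisor is controlled by [index_mono]; a branch that is a separatrix is
   isolated, hence a zero of F whose term vanishes. *)
have main (g : parc R) : smooth_arc g -> tpb g (lw q) = 0 -> nzon g (lw q) /\ (ordon g (lw q) <= 1)%N.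
  move=> sg tg; case: (arc_cases wco (smooth_nonconst sg) tg) => [[b qb [gb iq]]|[B [sB pB off gf]]].
    have i : ia w q b := introT (iaP w0 qb) iq.
    pose p := if b then Arc (ax0 g) (ax0 g) else Arc (ay0 g) (ay0 g).
    have ge : rep (axarc R b) p = g.
      rewrite /p; move: gb; case: (b); rewrite /= ?pb_X ?pb_Y => z; apply: parcP;
      by [exact: cmp_t|exact: etrans (raddf0 (cmp _)) (esym z)].
    have gt0 : ax p 1%N != 0.
      rewrite /p; move: gb sg; case: (b); rewrite /smooth_arc /= ?pb_X ?pb_Y => ->; rewrite fps_coef0 eqxx; by case.
    have op : ord (ax p) = 1%N by apply: ord_eq gt0; apply: vge1; apply/eqP; exact: ax0.
    have [n1 o1] := ordon_rep (nzon_axis w0 qb) (neq0_coef gt0).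
    rewrite ge in n1 o1; split; first exact: n1.
    have gd : good w T q b.
      by split=> //; right; split=> //; right.
    have := (index_mono wco RT T0 ssu sss cfiso cfdic q).2 b gd.
    rewrite t0 (ex_final wco RT ssu sss cfiso fq gd) i (asboolT sq) /oo i -(ordon_axis w0 i).
    by rewrite o1 op muln1; lia.
  have Bi := sep_curve sB; have gB := (pb_strict_eq (irr_neq0 Bi) off).1 gf.
  have ncr := pushq_nonconst (smooth_nonconst sg) off.
  split; first exact: nzon_pushq off (nzon_w wco Bi ncr gB).
  have [b qb] := final_axis T0 fq.
  have [Bs c] := cfiso sB fq pB qb (ai b qb).
  have zB : zeros F B by split; [exact: sB.1|rewrite c].
  have := tz B zB; rewrite (term_eq zB sB fq pB sg gf qb).
  have := path_excess_ge0 wco RT T0 ssu sss cfiso cfdic g (tail_T fq).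
  rewrite (introT (iaP w0 qb) (ai b qb)).
  by move: (path_excess _ _ _ _ _) (ordon _ _) => x y; lia.
have [sg1 sg2] : smooth_arc g1 /\ smooth_arc g2.
  by split; rewrite /smooth_arc; apply/orP; apply: contraNT ind; rewrite negb_or !negbK => /andP[/eqP -> /eqP ->];
     rewrite ?mul0r ?mulr0 subrr.
have [n1 o1] := main g1 sg1 tg1; have [n2 o2] := main g2 sg2 tg2.
by case: (saddle_node_ordon sn tg1 tg2 ind n1 n2); lia.
Qed.

(** A nondegenerate singularity has order one along every smooth arc, so the excesses at final
    points vanish, then tau everywhere, and finally each term. *)
Lemma generic_excess_zero : (forall q, final T q -> singular (lw q) -> ~ saddle_node (lw q)) ->
  polar_excess w F (zeros F) = 0.
Proof.
move=> ns; have nd q : final T q -> singular (lw q) -> Defs.nondegenerate (lw q).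
  by move=> fq sq; have [_ c2' _ _] := RT; case: (c2' q fq sq) => // /(ns q fq sq).
have sax b : smooth_arc (axarc R b).
  by rewrite /smooth_arc; case: b => /=; [left|right]; exact: oner_neq0.
have ex0 q b : final T q -> good w T q b -> EX q b = 0.
  move=> fq gq; rewrite (ex_final wco RT ssu sss cfiso fq gq); case: ifP => // i.
  rewrite /oo i; have qb := ia_axis i; have iq := elimT (iaP w0 qb) i.
  case: asboolP => sq.
    by rewrite -(ordon_axis w0 i) (nondegenerate_ordon (nd q fq sq) (sax b) (nzon_axis w0 qb)).
  rewrite ord_unit // pb_at0; apply/eqP => z; apply: sq; have h := inv_at0 iq.
  by case: b h z {gq i qb iq} => /= h z; split.
have t0 := index_vanish wco RT T0 ssu sss cfdic ex0.
rewrite excess_sum big1_seq // => B /= /zerosP zB.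
have [q [gam [b [sB fq pB [sg gf qb]]]]] := zero_data zB.
rewrite (term_eq zB sB fq pB sg gf qb) (path_excess_eq0 RT _ t0 (tail_T fq)) add0r.
have [off _] := final_prop sB fq pB sg gf; have Bi := sep_curve sB.
have gB := (pb_strict_eq (irr_neq0 Bi) off).1 gf.
have ncr := pushq_nonconst (smooth_nonconst sg) off.
have nw := nzon_pushq off (nzon_w wco Bi ncr gB).
case i : (ia w q b).
  have sq := inv_passes_singular wco RT sB fq pB qb (elimT (iaP w0 qb) i).
  by rewrite (nondegenerate_ordon (nd q fq sq) sg nw).
have [|nsq _ _ _] := final_dicritical wco RT fq qb; first by move/(introT (iaP w0 qb)); rewrite i.
rewrite /ordon ord2_eq0 // !pb_at0; apply: contrapT => h; apply: nsq.
by split; apply: contrapT => n; apply: h; [left|right].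
Qed.

End Balanced.


(** * Smooth arcs and smooth curves *)

Section Irreducible.
Variable R : realType.
Local Notation C := R[i].
Local Notation fps2 := (fps2 R).
Local Notation t := (fpsX C).
Implicit Types (f g h : fps2) (gam del : parc R) (B : curve R) (d : direction R) (b : bool) (q s : Defs.point R).

(** If the first coordinate has order one, normalizing it to t turns the arc into a graph with
    equation Y - v(X); otherwise the coordinates are exchanged. *)
Lemma smooth_kernel gam : smooth_arc gam -> exists f, [/\ at0 f = 0, smooth f & pb gam f = 0].
Proof.
have graph del : ax del 1%N != 0 -> exists f, [/\ at0 f = 0, smooth f & pb del f = 0].
  move=> d1; have d0 := neq0_coef d1; have [n [p [p0 p1 e]]] := normalize d0.
  have od : ord (ax del) = 1%N by apply: ord_eq d1; apply: vge1; apply/eqP; exact: ax0.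
  have n0 : n = 0%N.
    have := congr1 (@ord C) e; rewrite /= (ord_cmp p0 d0).2 od p1 (ordX _ (fpsX_neq0 C)) ord_fpsX; lia.
  rewrite n0 expr1 in e; set v := ay (rep del p).
  have v0 : v 0%N = 0 by apply/eqP; exact: ay0.
  have z : pb (rep del p) (Y R - ofx v) = 0.
    have k : pb (rep del p) (ofx v) = v.
      pose r := Arc (ax0 (rep del p)) (ax0 (rep del p)).
      have tt : forall u : fps C, cmp (rep del p) u = u.
        move=> u; apply: fpsP => i.
        have : vge i.+1 (cmp (rep del p) u - cmp (Arc (t0 R) (t0 R)) u).
          by apply: cmp_close; rewrite e /= subrr; exact: vge_0.
        move=> /(_ i (ltnSn i))/eqP; rewrite fps_coefB subr_eq0 => /eqP ->.
        have := cmp_cX 0 1 u; rewrite /cX => h.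
        have -> : cmp (Arc (t0 R) (t0 R)) u = cmp (cX 0 1 : parc R) u.
          apply/eqP; rewrite -subr_eq0; apply/eqP; apply: vge_eq0 => j; apply: cmp_close.
          by rewrite /= expr1 (rmorph1 (@fpsC C)) mul1r subrr; exact: vge_0.
        by rewrite cmp_cX0 /= expr1n mul1r.
      exact: tt.
    by rewrite pbB pb_Y k subrr.
  exists (Y R - ofx v); split.
  - by rewrite -(pb_at0 (rep del p)) z fps_coef0.
  - right; rewrite dyB dy_Y (_ : dy (ofx v) = 0) ?subr0 ?at0_1; last exact: fps_derivC.
    by apply/eqP; exact: oner_neq0.
  by apply: (cmp_eq0 p0); rewrite -pb_rep.
move=> [/graph//|y1].
pose swp : chart R := Chart (introT eqP (at0_Y R)) (introT eqP (at0_X R)).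
have [|f [f0 sf gf]] := graph (push swp gam); first by rewrite /= pb_Y.
exists (sb swp f); split; [by rewrite sb_at0| |by rewrite -pb_push].
case: sf => h; [right|left] => z; apply: h; move: z.
  by rewrite sb_dy at0D !at0M !sb_at0 /= dy_X dy_Y at0_0 at0_1 mulr0 mulr1 addr0 || rewrite sb_dy at0D !at0M !sb_at0 /= dy_Y dy_X at0_0 at0_1 mulr0 mulr1 addr0.
by rewrite sb_dx at0D !at0M !sb_at0 /= dx_X dx_Y at0_0 at0_1 mulr0 mulr1 add0r || rewrite sb_dx at0D !at0M !sb_at0 /= dx_Y dx_X at0_0 at0_1 mulr0 mulr1 add0r.
Qed.

Lemma smooth_of_arc gam f : smooth_arc gam -> irreducible f -> pb gam f = 0 -> smooth f.
Proof.
move=> sg fi gf; have [g [g0 sg' gg]] := smooth_kernel sg.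
have [k e] := (ker_irreducible g (smooth_nonconst sg) fi gf).1 gg.
have f0 := irreducible_at0 fi.
case: sg' => h; [left|right] => z; apply: h; rewrite e.
  by rewrite dxM at0D !at0M z f0 !mul0r addr0.
by rewrite dyM at0D !at0M z f0 !mul0r addr0.
Qed.

Lemma ordon_dform_smooth gam f : smooth f -> nzon gam (dform f) /\ ordon gam (dform f) = 0%N.
Proof.
move=> sf; have h : pb gam (dx f) 0%N <> 0 \/ pb gam (dy f) 0%N <> 0 by rewrite !pb_at0.
split; last exact: ord2_eq0.
by apply/orP; case: h => /eqP h; [left|right]; exact: neq0_coef h.
Qed.

Lemma smooth_meet (g1 g2 : parc R) f : smooth f -> pb g2 f = 0 -> at0 f = 0 ->
  ax g1 1%N * ay g2 1%N - ay g1 1%N * ax g2 1%N != 0 -> pb g1 f != 0 /\ ord (pb g1 f) = 1%N.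
Proof.
move=> sf gf f0 ind; suff h : pb g1 f 1%N != 0.
  by split; [exact: neq0_coef h|apply: ord_eq h; apply: vge1; rewrite pb_at0].
have l2 : coef2 f 1 0 * ax g2 1%N + coef2 f 0 1 * ay g2 1%N = 0 by rewrite -pb_coef1 gf fps_coef0.
apply/eqP => l1; rewrite pb_coef1 in l1; move: sf ind l1 l2; rewrite /smooth at0_dx at0_dy.
move: (coef2 _ 1 0) (coef2 _ 0 1) (ax g1 1%N) (ay g1 1%N) (ax g2 1%N) (ay g2 1%N).
move=> x y a b a' b' sm ind l1 l2.
have k1 : x * (a * b' - b * a') = (x * a + y * b) * b' - (x * a' + y * b') * b by ring.
have k2 : y * (a * b' - b * a') = (x * a' + y * b') * a - (x * a + y * b) * a' by ring.
rewrite l1 l2 !mul0r subrr in k1; rewrite l1 l2 !mul0r subrr in k2.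
have x0 : x = 0 by apply: (mulIf ind); rewrite mul0r.
have y0 : y = 0 by apply: (mulIf ind); rewrite mul0r.
by case: sm => [/(_ x0)|/(_ y0)].
Qed.

End Irreducible.

(** * The equivalence for a reduced germ *)

Section ReducedGerm.
Variable R : realType.
Local Notation C := R[i].
Local Notation fps2 := (fps2 R).
Implicit Types (f g h : fps2) (gam del : parc R) (B : curve R).
Variables (w : Defs.form R) (F : fps2 * fps2) (a : Defs.point R -> curve R -> int).
Hypothesis wco : no_common_factor w.1 w.2.
Hypothesis wr : reduced w.
Hypothesis F0 : meromorphic F.
Hypothesis adiv : forall B, is_curve B -> divisor F B = (B \in isolated w set0)%:Z
  + \sum_(D \in dicritical w set0) (B \in Curv w set0 D)%:Z * a D B.
Variables (s1 s2 : seq (curve R)) (u1 u2 : fps2).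
Hypothesis e1 : F.1 = u1 * \prod_(B <- s1) equation B.
Hypothesis e2 : F.2 = u2 * \prod_(B <- s2) equation B.
Hypothesis v1 : at0 u1 != 0.
Hypothesis v2 : at0 u2 != 0.
Hypothesis c1 : forall B, B \in s1 -> is_curve B.
Hypothesis c2 : forall B, B \in s2 -> is_curve B.
Notation ss := (undup (s1 ++ s2)).

Lemma divisor_reduced B : is_curve B -> divisor F B = (B \in separatrix w)%:Z.
Proof.
move=> Bc; rewrite (adiv Bc) fsbig1 ?addr0; last by move=> D [[]].
congr (nat_of_bool _)%:Z; apply/idP/idP; rewrite !inE; first by case.
by move=> sB; split=> // D [[]].
Qed.

Notation term B := (polar_intersection w 1 B
     - polar_intersection (F.2 * dx F.1 - F.1 * dx F.2, F.2 * dy F.1 - F.1 * dy F.2) (F.2 ^+ 2) B).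

Lemma two_ones (x y : nat) : (0 < x)%N -> (0 < y)%N -> x%:Z - 1 + (y%:Z - 1) = 0 -> x = 1%N /\ y = 1%N.
Proof. lia. Qed.

(** Without components every separatrix is isolated, so the divisor of F is the sum of the two
    branches. They are smooth and transverse: each term is the order of w along the branch minus
    1. *)
Lemma reduced_excess : polar_excess w F (zeros F) = 0 <-> ~ saddle_node w.
Proof.
have sw := reduced_singular wr.
have [g1 [g2 [t1 t2 ind br]]] := reduced_branches wr.
have sm1 : smooth_arc g1.
  by rewrite /smooth_arc; apply/orP; apply: contraNT ind; rewrite negb_or !negbK => /andP[/eqP -> /eqP ->]; rewrite !mul0r subrr.
have sm2 : smooth_arc g2.
  by rewrite /smooth_arc; apply/orP; apply: contraNT ind; rewrite negb_or !negbK => /andP[/eqP -> /eqP ->]; rewrite !mulr0 subrr.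
have off gam : offaxes [::] gam by case.
have nc1 := smooth_nonconst sm1; have nc2 := smooth_nonconst sm2.
have [B1 [sB1 gB1 _ _]] := separatrix_of_arc wco nc1 (off g1) t1.
have [B2 [sB2 gB2 _ _]] := separatrix_of_arc wco nc2 (off g2) t2.
rewrite [pushq _ _]/= in gB1; rewrite [pushq _ _]/= in gB2.
have i1 := sep_curve sB1; have i2 := sep_curve sB2.
have q1 := smooth_of_arc sm1 i1 gB1; have q2 := smooth_of_arc sm2 i2 gB2.
have ind' : ax g2 1%N * ay g1 1%N - ay g2 1%N * ax g1 1%N != 0.
  by rewrite -oppr_eq0 opprB [ay g2 _ * _]mulrC [ax g2 _ * _]mulrC.
have [m12 o12] := smooth_meet q2 gB2 (irreducible_at0 i2) ind.
have [m21 o21] := smooth_meet q1 gB1 (irreducible_at0 i1) ind'.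
have ne : B1 != B2 by apply/eqP => e; move: m12; rewrite -e gB1 eqxx.
have two B : separatrix w B -> B = B1 \/ B = B2.
  move=> sB; have [z|z] := br _ (irreducible_at0 (sep_curve sB)) sB.2.
    by left; exact: curve_vanish sB1.1 sB.1 nc1 gB1 z.
  by right; exact: curve_vanish sB2.1 sB.1 nc2 gB2 z.
have dB B : separatrix w B -> divisor F B = 1 by move=> sB; rewrite (divisor_reduced sB.1) mem_set.
have mem B gam : separatrix w B -> nonconst gam -> pb gam (equation B) = 0 -> B \in ss.
  move=> sB nc gB; apply: contraT; rewrite mem_undup mem_cat => /norP[n1 n2].
  have := divisor_count e1 e2 v1 v2 c1 c2 sB.1 nc gB.
  by rewrite (dB _ sB) (count_memPn n1) (count_memPn n2).
have ssP B : B \in ss <-> B = B1 \/ B = B2.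
  split=> [Bs|[->|->]]; [|exact: mem sB1 nc1 gB1|exact: mem sB2 nc2 gB2].
  have Bc := ss_curve c1 c2 Bs; have n := divisor_mem e1 e2 v1 v2 c1 c2 F0 Bs.
  apply: two; apply: contrapT => nB; apply: n; rewrite (divisor_reduced Bc) memNset //.
have ps : perm_eq ss [:: B1; B2].
  apply: uniq_perm; [exact: undup_uniq|by rewrite /= inE ne|move=> B].
  apply/idP/idP => [/ssP h|]; rewrite !inE; first by case: h => ->; rewrite eqxx ?orbT.
  by move=> /orP[/eqP ->|/eqP ->]; apply/ssP; [left|right].
have arcs B' : B' \in ss -> exists2 g', nonconst g' & pb g' (equation B') = 0.
  by move=> /ssP[->|->]; [exists g1|exists g2].
have one gam : pb gam (1 : fps2) = 1 := rmorph1 (pb gam).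
have one0 gam : pb gam (1 : fps2) != 0 by rewrite one oner_neq0.
have tm B B' gam : separatrix w B -> smooth_arc gam -> pb gam (equation B) = 0 -> smooth (equation B) ->
    perm_eq ss [:: B; B'] -> B != B' -> separatrix w B' -> ord (pb gam (equation B')) = 1%N ->
    nzon gam w /\ term B = (ordon gam w)%:Z - 1.
  move=> sB sg gB sf pp nn sB' o1; have Bi := sep_curve sB; have nc := smooth_nonconst sg.
  have nw := nzon_w wco Bi nc gB; have [nf of0] := ordon_dform_smooth gam sf.
  split; first exact: nw.
  rewrite (polarE Bi gB nc (smooth_prim sg) nw (one0 gam)) one ord_one subr0.
  rewrite (polar_dF e1 e2 v1 v2 c1 c2 F0 sB.1 nc (smooth_prim sg) gB nf (dB _ sB) arcs) of0 add0r.
  rewrite (perm_big _ pp) !big_cons big_nil eqxx eq_sym nn /= addr0 o1 mulr1 (dB _ sB'); exact: erefl.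
have [nw1 tm1] := tm _ _ _ sB1 sm1 gB1 q1 ps ne sB2 o12.
have ps' : perm_eq ss [:: B2; B1] by rewrite (permPl ps) (perm_catC [:: B1] [:: B2]).
have ne' : B2 != B1 by rewrite eq_sym.
have [nw2 tm2] := tm _ _ _ sB2 sm2 gB2 q2 ps' ne' sB1 o21.
have -> : polar_excess w F (zeros F) = (ordon g1 w)%:Z - 1 + ((ordon g2 w)%:Z - 1).
  rewrite /polar_excess (fsbigE [:: B1; B2]).
  - have z1 : B1 \in zeros F by apply: mem_set; split; [exact: sB1.1|rewrite (dB _ sB1)].
    have z2 : B2 \in zeros F by apply: mem_set; split; [exact: sB2.1|rewrite (dB _ sB2)].
    rewrite !big_cons big_nil z1 z2 tm1 tm2; congr (_ + _); exact: addr0.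
  - by rewrite /= inE ne.
  - by move=> B /=; rewrite !inE => /orP[/eqP ->|/eqP ->]; split;
      [exact: sB1.1|rewrite (dB _ sB1)|exact: sB2.1|rewrite (dB _ sB2)].
  move=> B [Bc p]; have sB : separatrix w B.
    by apply: contrapT => nB; move: p; rewrite (divisor_reduced Bc) memNset.
  by move=> /negP[]; case: (two B sB) => ->; rewrite !inE eqxx ?orbT.
have p1 := ordon_gt0 sw nw1; have p2 := ordon_gt0 sw nw2.
split=> [e sn|ns].
  have [x1 x2] := two_ones p1 p2 e.
  by case: (saddle_node_ordon sn t1 t2 ind nw1 nw2); [rewrite x1|rewrite x2].
have nd : Defs.nondegenerate w by case: wr.
by rewrite (nondegenerate_ordon nd sm1 nw1) (nondegenerate_ordon nd sm2 nw2).
Qed.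

End ReducedGerm.

Theorem theorem1 (R : realType) (w F : fps2 R * fps2 R)
    (w_coprime : no_common_factor w.1 w.2) (w_singular : singular w)
    (F_balanced : balanced_equation w F) (F_simple : simple_zeros F) :
  generalized_curve w <-> polar_excess w F (zeros F) = 0.
Proof.
have [F0 [T mT [a [_ asum adiv]]]] := F_balanced.
have [/eqP n1 /eqP n2 _] := F0.
have [s1 [u1 [e1 v1 c1]]] := factorization n1; have [s2 [u2 [e2 v2 c2]]] := factorization n2.
(* Minimality makes the tree unique, so the condition may be read on the tree of the balanced
   equation. *)
have gen : generalized_curve w <->
    (forall q, final T q -> singular (strict_form w q) -> ~ saddle_node (strict_form w q)).
  split=> [[T' mT' h]|h]; last by exists T.
  suff -> : T = T' by [].
  have [rw|nrw] := pselect (~ singular w \/ reduced w); first by rewrite (mT.1 rw) (mT'.1 rw).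
  have [rT mn] := mT.2 nrw; have [rT' mn'] := mT'.2 nrw.
  by apply/seteqP; split; [exact: mn|exact: mn'].
apply: iff_trans gen _.
have [rw|nrw] := pselect (reduced w).
  have TE : T = set0 by apply: mT.1; right.
  rewrite TE in adiv *.
  apply: iff_trans (iff_sym (reduced_excess w_coprime rw F0 adiv e1 e2 v1 v2 c1 c2)).
  have f0 q : final (set0 : set (Defs.point R)) q <-> q = [::].
    by split=> [[_]|->]; [case: q|split].
  split=> [h|h q /f0 -> _ //]; exact: h [::] ((f0 _).2 erefl) w_singular.
have nn : ~ (~ singular w \/ reduced w) by move=> [].
have [RT _] := mT.2 nn.
(* Were the origin not blown up it would be final and singular, hence reduced. *)
have T0 : T [::].
  apply: contrapT => nT; apply: nrw; have [[_ Tc] rd _ _] := RT.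
  by apply: (rd [::] _ w_singular); split.
split; first exact: (generic_excess_zero w_coprime RT T0 F0 asum adiv F_simple e1 e2 v1 v2 c1 c2).
exact: (excess_zero_generic w_coprime RT T0 F0 asum adiv F_simple e1 e2 v1 v2 c1 c2).
Qed.
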